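(* Consider a linear electromagnetic-gravitational perturbation of the Kerr-Newman spacetime $\mathbf g_{M,a,Q}$, with associated gauge-invariant quantities $A,\mathfrak F,\mathfrak B,\mathfrak X$ (all as defined in the context). Define $$\mathfrak p=q^{1/2}\,\overline q^{\,9/2}\Big({}^{c}\nabla_3\mathfrak B+\big(2\,\mathrm{tr}\underline\chi-\tfrac52 i\,{}^{(a)}\mathrm{tr}\underline\chi\big)\mathfrak B\Big)\in\mathfrak s_1(\mathbb C),$$ $$\mathfrak q^{\mathbf F}=q\,\overline q^{\,2}\Big({}^{c}\nabla_3\mathfrak F+\big(\mathrm{tr}\underline\chi-3 i\,{}^{(a)}\mathrm{tr}\underline\chi\big)\mathfrak F\Big)\in\mathfrak s_2(\mathbb C).$$ Then $\mathfrak p$ and $\mathfrak q^{\mathbf F}$ satisfy the coupled system $$\dot\square_1\mathfrak p-i\frac{2a\cos\theta}{|q|^2}\nabla_t\mathfrak p-V_1\mathfrak p=4Q^2\frac{\overline q^{\,3}}{|q|^5}\big(\overline{\mathcal D}\cdot\mathfrak q^{\mathbf F}\big)+L_{\mathfrak p}[\mathfrak B,\mathfrak F],$$ $$\dot\square_2\mathfrak q^{\mathbf F}-i\frac{4a\cos\theta}{|q|^2}\nabla_t\mathfrak q^{\mathbf F}-V_2\mathfrak q^{\mathbf F}=-\frac12\frac{q^3}{|q|^5}\Big(\mathcal D\widehat\otimes\mathfrak p-\frac32(H-\underline H)\widehat\otimes\mathfrak p\Big)+L_{\mathfrak q^{\mathbf F}}[\mathfrak B,\mathfrak F],$$ where: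 (i) The potentials $V_1,V_2$ are real positive scalar functions, given by $$V_1=\frac{r^4-2Mr^3+(2-3\cos^2\theta)a^2r^2+Q^2r^2-2a^4\cos^2\theta}{|q|^6}+\frac{5Q^2}{|q|^4},$$ $$V_2=4\,\frac{r^4-2Mr^3+(2-3\cos^2\theta)a^2r^2+Q^2r^2-2a^4\cos^2\theta}{|q|^6}+\frac{2Q^2}{|q|^4},$$ and which satisfy $V_1=-\frac14\mathrm{tr}\chi\,\mathrm{tr}\underline\chi+5\rho_{\mathbf F}^2+O(|a|/r^4)$ and $V_2=-\mathrm{tr}\chi\,\mathrm{tr}\underline\chi+2\rho_{\mathbf F}^2+O(|a|/r^4)$. (ii) $L_{\mathfrak p}$ and $L_{\mathfrak q^{\mathbf F}}$ are linear first order operators of the form $$L_{\mathfrak p}[\mathfrak B,\mathfrak F]=q^{1/2}\overline q^{\,9/2}\Big[-Z^{\mathfrak B}_a\cdot{}^{c}\nabla\mathfrak B+2P_{\mathbf F}\overline{P_{\mathbf F}}\,Y^{\mathfrak F}_a\,(\overline{{}^{c}\mathcal D}\cdot\mathfrak F)+\big(2P_{\mathbf F}\overline{P_{\mathbf F}}\,Y_0^{\mathfrak B}-Z_0^{\mathfrak B}\big)\mathfrak B+2P_{\mathbf F}\overline{P_{\mathbf F}}\big(Y_0^{\mathfrak F}\cdot\mathfrak F+Y_0^{\mathfrak X}\,\mathfrak X\big)\Big],$$ $$L_{\mathfrak q^{\mathbf F}}[\mathfrak B,\mathfrak F]=q\,\overline q^{\,2}\Big[W_4^{\mathfrak F}\,{}^{c}\nabla_4\mathfrak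 F+\big(W_a^{\mathfrak F}-Z_a^{\mathfrak F}\big)\cdot{}^{c}\nabla\mathfrak F+W_a^{\mathfrak X}\,{}^{c}\mathcal D\widehat\otimes\mathfrak X+W_a^{\mathfrak B}\,{}^{c}\mathcal D\widehat\otimes\mathfrak B+\big(W_0^{\mathfrak F}-Z_0^{\mathfrak F}\big)\mathfrak F+W_0^{\mathfrak B}\widehat\otimes\mathfrak B+W_0^{\mathfrak X}\widehat\otimes\mathfrak X\Big],$$ where $W_4^{\mathfrak F}$ and $W_a^{\mathfrak X}$ are real functions; $Z_a^{\mathfrak B}$ and $W_a^{\mathfrak F}-Z_a^{\mathfrak F}$ are real one-forms; $W_a^{\mathfrak B}$ and $Y_a^{\mathfrak F}$ are the imaginary functions $W_a^{\mathfrak B}=\frac34 i\,{}^{(a)}\mathrm{tr}\underline\chi$ and $Y_a^{\mathfrak F}=-3i\,{}^{(a)}\mathrm{tr}\underline\chi$; and $Y_0^{\mathfrak B},Z_0^{\mathfrak B},Y_0^{\mathfrak X},W_0^{\mathfrak F}-Z_0^{\mathfrak F}$ are complex functions and $Y_0^{\mathfrak F},W_0^{\mathfrak B},W_0^{\mathfrak X}$ complex one-forms, all of which vanish for zero angular momentum ($a=0$).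
   Context: **Formalism.** $(\mathcal M,\mathbf g)$ is a 4-dimensional Lorentzian manifold with Levi-Civita connection $\mathbf D$, a null pair $(e_3,e_4)$ with $\mathbf g(e_3,e_4)=-2$, and an antisymmetric 2-tensor $\mathbf F$. A vector is horizontal if orthogonal to $e_3,e_4$; $(e_a)_{a=1,2}$ is a local orthonormal frame of horizontal vectors, $\in_{ab}$ the horizontal volume form ($\in_{12}=1$, orientation fixed); repeated horizontal indices are summed. $\nabla_a,\nabla_3,\nabla_4$, and generally $\dot{\mathbf D}_X$, are the horizontal projections of $\mathbf D_{e_a},\mathbf D_{e_3},\mathbf D_{e_4},\mathbf D_X$ acting on horizontal tensors. Connection coefficients: $\chi_{ab}=\mathbf g(\mathbf D_ae_4,e_b)$, $\underline\chi_{ab}=\mathbf g(\mathbf D_ae_3,e_b)$, $\eta_a=\frac12\mathbf g(\mathbf D_3e_4,e_a)$, $\underline\eta_a=\frac12\mathbf g(\mathbf D_4e_3,e_a)$, $\xi_a=\frac12\mathbf g(\mathbf D_4e_4,e_a)$, $\underline\xi_a=\frac12\mathbf g(\mathbf D_3e_3,e_a)$, $\zeta_a=\frac12\mathbf g(\mathbf D_ae_4,e_3)$, $\omega=\frac14\mathbf g(\mathbf D_4e_4,e_3)$, $\underline\omega=\frac14\mathbf g(\mathbf D_3e_3,e_4)$; $\mathrm{tr}\chi=\delta^{ab}\chi_{ab}$, ${}^{(a)}\mathrm{tr}\chi=\in^{ab}\chi_{ab}$, $\hat\chi$ is the symmetric traceless part of $\chi$; similarly for $\underline\chi$. Electromagnetic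 components: $(\beta_{\mathbf F})_a=\mathbf F(e_a,e_4)$, $(\underline\beta_{\mathbf F})_a=\mathbf F(e_a,e_3)$, $\rho_{\mathbf F}=\frac12\mathbf F(e_3,e_4)$, $\mathbf F(e_a,e_b)=-\in_{ab}{}^*\rho_{\mathbf F}$. Curvature: $[\mathbf D_\mu,\mathbf D_\nu]f_\gamma=\mathbf R_{\gamma\delta\mu\nu}f^\delta$, $\mathbf W$ is the Weyl tensor, $\alpha_{ab}=\mathbf W(e_4,e_a,e_4,e_b)$, $\underline\alpha_{ab}=\mathbf W(e_3,e_a,e_3,e_b)$, $\beta_a=\frac12\mathbf W(e_a,e_4,e_3,e_4)$, $\underline\beta_a=\frac12\mathbf W(e_a,e_3,e_3,e_4)$, $\rho=\frac14\mathbf W(e_4,e_3,e_4,e_3)$, $\mathbf W(e_a,e_b,e_3,e_4)=2\in_{ab}{}^*\rho$. **Complex notation.** ${}^*f_a=\in_{ab}f_b$, ${}^*u_{ab}=\in_{ac}u_{cb}$. $\mathfrak s_1(\mathbb C)$ (resp. $\mathfrak s_2(\mathbb C)$) is the set of $f+i{}^*f$ (resp. $u+i{}^*u$) with $f$ a real horizontal 1-form (resp. $u$ a real horizontal symmetric traceless 2-tensor). $X=\chi+i{}^*\chi$, so $\mathrm{tr}X=\mathrm{tr}\chi-i\,{}^{(a)}\mathrm{tr}\chi$, $\widehat X=\hat\chi+i{}^*\hat\chi$, likewise $\underline X$; $H=\eta+i{}^*\eta$, $\underline H=\underline\eta+i{}^*\underline\eta$, $\Xi=\xi+i{}^*\xi$,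 $\underline\Xi=\underline\xi+i{}^*\underline\xi$, $Z=\zeta+i{}^*\zeta$, $A=\alpha+i{}^*\alpha$, $B=\beta+i{}^*\beta$, $P=\rho+i{}^*\rho$ (and $\underline A,\underline B$ similarly), $B_{\mathbf F}=\beta_{\mathbf F}+i{}^*\beta_{\mathbf F}$, $\underline B_{\mathbf F}=\underline\beta_{\mathbf F}+i{}^*\underline\beta_{\mathbf F}$, $P_{\mathbf F}=\rho_{\mathbf F}+i{}^*\rho_{\mathbf F}$. Products are complex bilinear: $F\cdot G=F_aG_a$, $(F\widehat\otimes G)_{ab}=\frac12(F_aG_b+F_bG_a-\delta_{ab}F\cdot G)$, $(F\cdot U)_a=F_bU_{ab}$, $F\cdot\nabla\Psi=F_a\nabla_a\Psi$. $\mathcal D=\nabla+i{}^*\nabla$, $\overline{\mathcal D}=\nabla-i{}^*\nabla$ with ${}^*\nabla_a=\in_{ab}\nabla_b$; $(\mathcal D\widehat\otimes F)_{ab}=\frac12(\mathcal D_aF_b+\mathcal D_bF_a-\delta_{ab}\mathcal D\cdot F)$, $(\overline{\mathcal D}\cdot U)_a=\overline{\mathcal D}_bU_{ab}$. **Conformal derivatives.** A horizontal tensor has conformal type $s$ if it is multiplied by $\lambda^s$ under $e_4\to\lambda e_4$, $e_3\to\lambda^{-1}e_3$. On type $s$: ${}^c\nabla_3=\nabla_3-2s\underline\omega$, ${}^c\nabla_4=\nabla_4+2s\omega$, ${}^c\nabla_a=\nabla_a+s\zeta_a$, ${}^c\mathcal D=\mathcal D+sZ$, $\overline{{}^c\mathcal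 D}=\overline{\mathcal D}+s\overline Z$; results of ${}^c\nabla_3,{}^c\nabla_4,{}^c\nabla_a$ have types $s-1,s+1,s$. Types: $A,\Xi$: 2; $\mathrm{tr}X,\widehat X,B,B_{\mathbf F}$: 1; $H,\underline H,P,P_{\mathbf F}$: 0; underlined $\underline X,\underline B,\underline B_{\mathbf F}$: $-1$; $\underline A,\underline\Xi$: $-2$. **Kerr-Newman.** For $\sqrt{a^2+Q^2}<M$, in coordinates $(t,r,\theta,\varphi)$, with $\Delta=r^2-2Mr+a^2+Q^2$, $q=r+ia\cos\theta$, $|q|^2=r^2+a^2\cos^2\theta$ (powers of $q,\overline q$ are principal), $$\mathbf g_{M,a,Q}=-\tfrac{\Delta}{|q|^2}(dt-a\sin^2\theta d\varphi)^2+\tfrac{|q|^2}{\Delta}dr^2+|q|^2d\theta^2+\tfrac{\sin^2\theta}{|q|^2}(a\,dt-(r^2+a^2)d\varphi)^2.$$ Principal null frame: $e_4=\frac{r^2+a^2}{\Delta}\partial_t+\partial_r+\frac a\Delta\partial_\varphi$, $e_3=\frac{r^2+a^2}{|q|^2}\partial_t-\frac{\Delta}{|q|^2}\partial_r+\frac{a}{|q|^2}\partial_\varphi$, $e_1=\frac1{|q|}\partial_\theta$, $e_2=\frac{a\sin\theta}{|q|}\partial_t+\frac{1}{|q|\sin\theta}\partial_\varphi$. In it $\widehat X,\underline{\widehat X},\Xi,\underline\Xi,A,B,\underline B,\underline A,B_{\mathbf F},\underline B_{\mathbf F}$ vanish, and $\mathrm{tr}X=\frac2q$, $\mathrm{tr}\underline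 X=-\frac{2\Delta}{q\overline q^2}$, $H_1=\frac{ai\sin\theta\,q}{|q|^3}$, $\underline H=-Z$, $Z_1=\frac{ai\sin\theta\,\overline q}{|q|^3}$, $P_{\mathbf F}=\frac{Q}{\overline q^2}$, $P=-\frac{2M}{q^3}+\frac{2Q^2}{q^3\overline q}$, $\omega=0$. **Linear perturbations.** A linear electromagnetic-gravitational perturbation of Kerr-Newman is a solution, with a null frame, of the Einstein-Maxwell equations $\mathbf R_{\mu\nu}=2\mathbf F_{\mu\lambda}\mathbf F_\nu{}^\lambda-\frac12\mathbf g_{\mu\nu}\mathbf F^{\alpha\beta}\mathbf F_{\alpha\beta}$, $\mathbf D_{[\mu}\mathbf F_{\nu\lambda]}=0$, $\mathbf D^\mu\mathbf F_{\mu\nu}=0$, in which expressions quadratic in the quantities vanishing in Kerr-Newman ($\widehat X,\underline{\widehat X},\Xi,\underline\Xi,A,B,\underline B,\underline A,B_{\mathbf F},\underline B_{\mathbf F}$, and their derivatives) are neglected: all equalities are modulo such quadratic expressions; coefficients multiplying one of these quantities may thus be evaluated in the Kerr-Newman background. **Gauge-invariant quantities.** $A$ (type 2), $\mathfrak F=-\frac12{}^c\mathcal D\widehat\otimes B_{\mathbf F}-\frac32H\widehat\otimes B_{\mathbf F}+P_{\mathbf F}\widehat X\in\mathfrak s_2(\mathbb C)$ (type 1), $\mathfrak B=2P_{\mathbf F}B-3\overline PB_{\mathbf F}\in\mathfrak s_1(\mathbb C)$ (type 1), $\mathfrak X={}^c\nabla_4B_{\mathbf F}+\frac32\overline{\mathrm{tr}X}B_{\mathbf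 F}-2P_{\mathbf F}\Xi\in\mathfrak s_1(\mathbb C)$ (type 2). **Wave operator.** $\dot\square_k\Psi=\mathbf g^{\mu\nu}\dot{\mathbf D}_\mu\dot{\mathbf D}_\nu\Psi$ for $\Psi\in\mathfrak s_k(\mathbb C)$ (with $\dot{\mathbf D}$ extended by $\mathbf D$ on spacetime indices); $\nabla_t=\dot{\mathbf D}_{\partial_t}$.
   Formalization: Positivity of V_1, V_2 fails near the horizon close to the axis when a≠0 (e.g. M=1, a=3/5, Q=0, r=2, cosθ=19/20); it is asserted at each radius r under the exact inequality on r equivalent to positivity for all θ. *)

(* Defs.v *)
From Stdlib Require Import Reals Lra List.
From Coquelicot Require Import Coquelicot.
Open Scope R_scope.

(** * Points and smooth functions *)

Inductive coord := ct | cr | cth | cph.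

Record pt := Pt { tc : R; rc : R; thc : R; phc : R }.

Definition shift (x : pt) (mu : coord) (s : R) : pt :=
  match mu with
  | ct  => Pt (tc x + s) (rc x) (thc x) (phc x)
  | cr  => Pt (tc x) (rc x + s) (thc x) (phc x)
  | cth => Pt (tc x) (rc x) (thc x + s) (phc x)
  | cph => Pt (tc x) (rc x) (thc x) (phc x + s)
  end.

Definition near (d : R) (x y : pt) : Prop :=
  Rabs (tc y - tc x) < d /\ Rabs (rc y - rc x) < d /\
  Rabs (thc y - thc x) < d /\ Rabs (phc y - phc x) < d.

Definition open_pt (U : pt -> Prop) : Prop :=
  forall x, U x -> exists d, 0 < d /\ forall y, near d x y -> U y.

Definition partial (mu : coord) (f : pt -> R) (x : pt) : R :=
  Derive (fun s => f (shift x mu s)) 0.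

Definition partials (l : list coord) (f : pt -> R) : pt -> R :=
  fold_right partial f l.

Definition smooth_on (U : pt -> Prop) (f : pt -> R) : Prop :=
  forall (l : list coord) (x : pt), U x ->
    (forall mu, ex_derive (fun s => partials l f (shift x mu s)) 0) /\
    (forall e, 0 < e -> exists d, 0 < d /\
       forall y, near d x y -> Rabs (partials l f y - partials l f x) < e).

Definition Csmooth_on (U : pt -> Prop) (f : pt -> C) : Prop :=
  smooth_on U (fun x => Re (f x)) /\ smooth_on U (fun x => Im (f x)).

Definition Cpartial (mu : coord) (f : pt -> C) (x : pt) : C :=
  (partial mu (fun y => Re (f y)) x, partial mu (fun y => Im (f y)) x).

(** * Index types *)

(* [E3], [E4] are the null directions, [E1], [E2] the horizontal ones. *)
Inductive idx := E1 | E2 | E3 | E4.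

Inductive hor := h1 | h2.

Definition emb (a : hor) : idx := match a with h1 => E1 | h2 => E2 end.
Coercion emb : hor >-> idx.

Definition sumc (f : coord -> R) : R := f ct + f cr + f cth + f cph.
Definition sum4 (f : idx -> R) : R := f E1 + f E2 + f E3 + f E4.
Definition sumh (f : hor -> R) : R := f h1 + f h2.
Definition Csumc (f : coord -> C) : C := (f ct + f cr + f cth + f cph)%C.
Definition Csum4 (f : idx -> C) : C := (f E1 + f E2 + f E3 + f E4)%C.
Definition Csumh (f : hor -> C) : C := (f h1 + f h2)%C.

(** Frame components of the metric and of its inverse. *)
Definition mink (i j : idx) : R :=
  match i, j with
  | E1, E1 | E2, E2 => 1
  | E3, E4 | E4, E3 => -2
  | _, _ => 0
  end.

Definition mink_inv (i j : idx) : R :=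
  match i, j with
  | E1, E1 | E2, E2 => 1
  | E3, E4 | E4, E3 => - (1 / 2)
  | _, _ => 0
  end.

Definition raise (v : idx -> R) (i : idx) : R :=
  sum4 (fun j => mink_inv i j * v j).

Definition delta (a b : hor) : R :=
  match a, b with h1, h1 | h2, h2 => 1 | _, _ => 0 end.

(** The horizontal volume form. *)
Definition eps (a b : hor) : R :=
  match a, b with h1, h2 => 1 | h2, h1 => -1 | _, _ => 0 end.

Definition vec := coord -> pt -> R.
Definition hform := hor -> pt -> C.
Definition htens := hor -> hor -> pt -> C.

Record spacetime := Spacetime {
  met : coord -> coord -> pt -> R;
  fr  : idx -> vec;
  em  : coord -> coord -> pt -> R
}.

(** * Horizontal algebra *)

Definition dual1 (f : hor -> R) (a : hor) : R := sumh (fun b => eps a b * f b).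
Definition dual2 (u : hor -> hor -> R) (a b : hor) : R :=
  sumh (fun c => eps a c * u c b).

(** [f + i *f] and [u + i *u]. *)
Definition cplx1 (f : hor -> R) (a : hor) : C := (f a + Ci * dual1 f a)%C.
Definition cplx2 (u : hor -> hor -> R) (a b : hor) : C :=
  (u a b + Ci * dual2 u a b)%C.

Definition in_s1 (F : hor -> C) : Prop :=
  exists f : hor -> R, forall a, F a = cplx1 f a.

Definition in_s2 (F : hor -> hor -> C) : Prop :=
  exists u : hor -> hor -> R,
    u h1 h2 = u h2 h1 /\ u h1 h1 + u h2 h2 = 0 /\
    forall a b, F a b = cplx2 u a b.

Definition trh (u : hor -> hor -> R) : R := sumh (fun a => u a a).
Definition atrh (u : hor -> hor -> R) : R :=
  sumh (fun a => sumh (fun b => eps a b * u a b)).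
Definition hath (u : hor -> hor -> R) (a b : hor) : R :=
  1 / 2 * (u a b + u b a - delta a b * trh u).

Definition Chath (T : hor -> hor -> C) (a b : hor) : C :=
  (/ 2 * (T a b + T b a - delta a b * Csumh (fun c => T c c)))%C.

Definition otimes (F G : hor -> C) (a b : hor) : C :=
  Chath (fun c d => F c * G d)%C a b.

Definition dot12 (F : hor -> C) (U : hor -> hor -> C) (a : hor) : C :=
  Csumh (fun b => F b * U a b)%C.

(** * Geometry of a spacetime with a frame *)

Section Geometry.

Context (S : spacetime).

Definition inner (X Y : vec) (x : pt) : R :=
  sumc (fun mu => sumc (fun nu => met S mu nu x * X mu x * Y nu x)).

Definition dir (X : vec) (f : pt -> R) (x : pt) : R :=
  sumc (fun mu => X mu x * partial mu f x).

Definition Cdir (X : vec) (f : pt -> C) (x : pt) : C :=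
  Csumc (fun mu => X mu x * Cpartial mu f x)%C.

Definition bracket (X Y : vec) : vec :=
  fun mu x => dir X (Y mu) x - dir Y (X mu) x.

(** [g (D_X Y, V)] for the Levi-Civita connection [D], by the Koszul formula. *)
Definition gD (X Y V : vec) (x : pt) : R :=
  1 / 2 * (dir X (inner Y V) x + dir Y (inner X V) x - dir V (inner X Y) x
           + inner (bracket X Y) V x - inner (bracket X V) Y x
           - inner (bracket Y V) X x).

(** [gam i j k = g (D_{e_i} e_j, e_k)]; in [gamu] the last index is raised. *)
Definition gam (i j k : idx) : pt -> R := gD (fr S i) (fr S j) (fr S k).
Definition gamu (i j k : idx) (x : pt) : R := raise (fun l => gam i j l x) k.

Definition ed (i : idx) (f : pt -> R) : pt -> R := dir (fr S i) f.

(** Component along [e_m] of [D_i D_j e_k - D_j D_i e_k - D_{[e_i, e_j]} e_k]. *)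
Definition riem_up (i j k m : idx) (x : pt) : R :=
  ed i (gamu j k m) x - ed j (gamu i k m) x
  + sum4 (fun n => gamu j k n x * gamu i n m x - gamu i k n x * gamu j n m x
                   - (gamu i j n x - gamu j i n x) * gamu n k m x).

(** [R_{lkij}], with [[D_i, D_j] f_l = R_{lkij} f^k]. *)
Definition riem (l k i j : idx) (x : pt) : R :=
  sum4 (fun m => mink l m * riem_up i j k m x).

Definition ric (k j : idx) (x : pt) : R :=
  sum4 (fun l => sum4 (fun i => mink_inv l i * riem l k i j x)).

Definition scal (x : pt) : R :=
  sum4 (fun k => sum4 (fun j => mink_inv k j * ric k j x)).

Definition weyl (i j k l : idx) (x : pt) : R :=
  riem i j k l x
  - 1 / 2 * (mink i k * ric j l x - mink i l * ric j k x
             - mink j k * ric i l x + mink j l * ric i k x)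
  + scal x / 6 * (mink i k * mink j l - mink i l * mink j k).

(** ** Electromagnetic field and the Einstein-Maxwell equations *)

Definition Ff (i j : idx) (x : pt) : R :=
  sumc (fun mu => sumc (fun nu => em S mu nu x * fr S i mu x * fr S j nu x)).

(** [F_i^l]. *)
Definition Ffu (i l : idx) (x : pt) : R := raise (fun m => Ff i m x) l.

Definition DF (i j k : idx) (x : pt) : R :=
  ed i (Ff j k) x
  - sum4 (fun m => gamu i j m x * Ff m k x + gamu i k m x * Ff j m x).

Definition F2 (x : pt) : R :=
  sum4 (fun i => raise (fun j => sum4 (fun l => Ff j l x * Ffu i l x)) i).

Definition einstein_res (i j : idx) (x : pt) : R :=
  ric i j x
  - (2 * sum4 (fun l => Ff i l x * Ffu j l x) - 1 / 2 * mink i j * F2 x).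

Definition bianchi_res (i j k : idx) (x : pt) : R :=
  DF i j k x + DF j k i x + DF k i j x.

Definition maxwell_res (k : idx) (x : pt) : R :=
  sum4 (fun i => sum4 (fun j => mink_inv i j * DF i j k x)).

(** ** Connection coefficients *)

Definition chi (x : pt) (a b : hor) : R := gam a E4 b x.
Definition chib (x : pt) (a b : hor) : R := gam a E3 b x.
Definition eta (x : pt) (a : hor) : R := 1 / 2 * gam E3 E4 a x.
Definition etab (x : pt) (a : hor) : R := 1 / 2 * gam E4 E3 a x.
Definition xi (x : pt) (a : hor) : R := 1 / 2 * gam E4 E4 a x.
Definition zeta (x : pt) (a : hor) : R := 1 / 2 * gam a E4 E3 x.
Definition omega (x : pt) : R := 1 / 4 * gam E4 E4 E3 x.
Definition omegab (x : pt) : R := 1 / 4 * gam E3 E3 E4 x.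

Definition trchi (x : pt) : R := trh (chi x).
Definition atrchi (x : pt) : R := atrh (chi x).
Definition trchib (x : pt) : R := trh (chib x).
Definition atrchib (x : pt) : R := atrh (chib x).

Definition trX (x : pt) : C := (trchi x - Ci * atrchi x)%C.
Definition Xhat (x : pt) : hor -> hor -> C := cplx2 (hath (chi x)).
Definition Hf (x : pt) : hor -> C := cplx1 (eta x).
Definition Hbf (x : pt) : hor -> C := cplx1 (etab x).
Definition Xif (x : pt) : hor -> C := cplx1 (xi x).
Definition Zf (x : pt) : hor -> C := cplx1 (zeta x).

(** ** Curvature and electromagnetic components *)

Definition beta (x : pt) (a : hor) : R := 1 / 2 * weyl a E4 E3 E4 x.
Definition rho (x : pt) : R := 1 / 4 * weyl E4 E3 E4 E3 x.
(** From [W(e_1, e_2, e_3, e_4) = 2 *rho]. *)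
Definition rho_star (x : pt) : R := 1 / 2 * weyl E1 E2 E3 E4 x.

Definition Bf (x : pt) : hor -> C := cplx1 (beta x).
Definition Pf (x : pt) : C := (rho x + Ci * rho_star x)%C.

Definition betaF (x : pt) (a : hor) : R := Ff a E4 x.
Definition rhoF (x : pt) : R := 1 / 2 * Ff E3 E4 x.
(** From [F(e_1, e_2) = - *rho_F]. *)
Definition rhoF_star (x : pt) : R := - Ff E1 E2 x.

Definition BF (x : pt) : hor -> C := cplx1 (betaF x).
Definition PF (x : pt) : C := (rhoF x + Ci * rhoF_star x)%C.

(** ** Horizontal derivatives *)

Definition nabla1 (X : vec) (F : hform) : hform := fun a x =>
  (Cdir X (F a) x - Csumh (fun c => gD X (fr S a) (fr S c) x * F c x))%C.

Definition nabla2 (X : vec) (F : htens) : htens := fun a b x =>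
  (Cdir X (F a b) x
   - Csumh (fun c => gD X (fr S a) (fr S c) x * F c b x
                     + gD X (fr S b) (fr S c) x * F a c x))%C.

(** Zeroth-order part of the conformal derivative along [e_i] on type [s]. *)
Definition cweight (s : R) (i : idx) (x : pt) : R :=
  match i with
  | E1 => s * zeta x h1
  | E2 => s * zeta x h2
  | E3 => - 2 * s * omegab x
  | E4 => 2 * s * omega x
  end.

Definition cnabla1 (s : R) (i : idx) (F : hform) : hform := fun a x =>
  (nabla1 (fr S i) F a x + cweight s i x * F a x)%C.

Definition cnabla2 (s : R) (i : idx) (F : htens) : htens := fun a b x =>
  (nabla2 (fr S i) F a b x + cweight s i x * F a b x)%C.

(** [(D_a + s Z_a) F_b], with [D_a = nabla_a + i eps_{ac} nabla_c]. *)
Definition cD1 (s : R) (F : hform) (x : pt) (a b : hor) : C :=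
  (nabla1 (fr S a) F b x + Ci * Csumh (fun c => eps a c * nabla1 (fr S c) F b x)
   + s * Zf x a * F b x)%C.

Definition cDotimes (s : R) (F : hform) : htens := fun a b x =>
  Chath (cD1 s F x) a b.

Definition cDbar2 (s : R) (U : htens) (x : pt) (c a b : hor) : C :=
  (nabla2 (fr S c) U a b x
   - Ci * Csumh (fun d => eps c d * nabla2 (fr S d) U a b x)
   + s * Cconj (Zf x c) * U a b x)%C.

Definition cDbardot (s : R) (U : htens) : hform := fun a x =>
  Csumh (fun b => cDbar2 s U x b a b).

Definition Dotimes : hform -> htens := cDotimes 0.
Definition Dbardot : htens -> hform := cDbardot 0.

(** [g^{mu nu} D_mu D_nu], the second derivative being taken as
    [D_i D_j - D_{D_i e_j}]. *)
Definition box1 (F : hform) : hform := fun a x =>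
  Csum4 (fun i => Csum4 (fun j => mink_inv i j *
    (nabla1 (fr S i) (nabla1 (fr S j) F) a x
     - Csum4 (fun m => gamu i j m x * nabla1 (fr S m) F a x))))%C.

Definition box2 (F : htens) : htens := fun a b x =>
  Csum4 (fun i => Csum4 (fun j => mink_inv i j *
    (nabla2 (fr S i) (nabla2 (fr S j) F) a b x
     - Csum4 (fun m => gamu i j m x * nabla2 (fr S m) F a b x))))%C.

Definition dt : vec := fun mu _ => match mu with ct => 1 | _ => 0 end.

(** ** Gauge-invariant quantities *)

Definition frF : htens := fun a b x =>
  (- / 2 * cDotimes 1 (fun c y => BF y c) a b x
   - 3 / 2 * otimes (Hf x) (BF x) a b + PF x * Xhat x a b)%C.

Definition frB : hform := fun a x =>
  (2 * PF x * Bf x a - 3 * Cconj (Pf x) * BF x a)%C.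

Definition frX : hform := fun a x =>
  (cnabla1 1 E4 (fun c y => BF y c) a x + 3 / 2 * Cconj (trX x) * BF x a
   - 2 * PF x * Xif x a)%C.

End Geometry.

(** * Kerr-Newman *)

(** Principal argument: [2 atan (y / (|z| + x))] is the argument of [x + i y] in
    (-pi, pi) off the half-line [y = 0, x <= 0]. *)
Definition Carg (z : C) : R := 2 * atan (Im z / (Cmod z + Re z)).

Definition Cpow (z : C) (s : R) : C :=
  (Rpower (Cmod z) s * cos (s * Carg z), Rpower (Cmod z) s * sin (s * Carg z)).

Definition subextremal (M a Q : R) : Prop := sqrt (a ^ 2 + Q ^ 2) < M.

Section KerrNewman.

Context (M a Q : R).

Definition KN_Delta (x : pt) : R := rc x ^ 2 - 2 * M * rc x + a ^ 2 + Q ^ 2.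
Definition q (x : pt) : C := (rc x, a * cos (thc x)).
Definition q2 (x : pt) : R := rc x ^ 2 + a ^ 2 * cos (thc x) ^ 2.
Definition qm (x : pt) : R := Cmod (q x).

Definition exterior (x : pt) : Prop :=
  M + sqrt (M ^ 2 - a ^ 2 - Q ^ 2) < rc x /\ 0 < thc x < PI.

Definition covec (t r th ph : R) (mu : coord) : R :=
  match mu with ct => t | cr => r | cth => th | cph => ph end.

Definition KN_met (mu nu : coord) (x : pt) : R :=
  let s := sin (thc x) in
  let w0 := covec 1 0 0 (- a * s ^ 2) in
  let w1 := covec 0 1 0 0 in
  let w2 := covec 0 0 1 0 in
  let w3 := covec a 0 0 (- (rc x ^ 2 + a ^ 2)) in
  - (KN_Delta x / q2 x) * (w0 mu * w0 nu) + q2 x / KN_Delta x * (w1 mu * w1 nu)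
  + q2 x * (w2 mu * w2 nu) + s ^ 2 / q2 x * (w3 mu * w3 nu).

Definition KN_fr (i : idx) (mu : coord) (x : pt) : R :=
  let s := sin (thc x) in
  let n := rc x ^ 2 + a ^ 2 in
  match i with
  | E1 => covec 0 0 (1 / qm x) 0 mu
  | E2 => covec (a * s / qm x) 0 0 (1 / (qm x * s)) mu
  | E3 => covec (n / q2 x) (- (KN_Delta x / q2 x)) 0 (a / q2 x) mu
  | E4 => covec (n / KN_Delta x) 1 0 (a / KN_Delta x) mu
  end.

Definition KN_PF (x : pt) : C := (Q / (Cconj (q x) * Cconj (q x)))%C.

(** The 2-form with [B_F = 0], [underline B_F = 0] and [P_F = KN_PF]. *)
Definition KN_Ff (i j : idx) (x : pt) : R :=
  match i, j with
  | E3, E4 => 2 * Re (KN_PF x)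
  | E4, E3 => - 2 * Re (KN_PF x)
  | E1, E2 => - Im (KN_PF x)
  | E2, E1 => Im (KN_PF x)
  | _, _ => 0
  end.

Definition KN_coframe (i : idx) (mu : coord) (x : pt) : R :=
  raise (fun j => sumc (fun nu => KN_met mu nu x * KN_fr j nu x)) i.

Definition KN_em (mu nu : coord) (x : pt) : R :=
  sum4 (fun i => sum4 (fun j =>
    KN_Ff i j x * KN_coframe i mu x * KN_coframe j nu x)).

Definition KN : spacetime := Spacetime KN_met KN_fr KN_em.

(** ** Potentials *)

Definition Vnum (x : pt) : R :=
  let r := rc x in
  let c := cos (thc x) in
  r ^ 4 - 2 * M * r ^ 3 + (2 - 3 * c ^ 2) * a ^ 2 * r ^ 2 + Q ^ 2 * r ^ 2
  - 2 * a ^ 4 * c ^ 2.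

Definition V1 (x : pt) : R := Vnum x / qm x ^ 6 + 5 * Q ^ 2 / qm x ^ 4.
Definition V2 (x : pt) : R := 4 * (Vnum x / qm x ^ 6) + 2 * Q ^ 2 / qm x ^ 4.

(** ** The transformed quantities *)

Section Transformed.

Context (S : spacetime).

Definition wp (x : pt) : C := (Cpow (q x) (1 / 2) * Cpow (Cconj (q x)) (9 / 2))%C.
Definition wq (x : pt) : C := (q x * (Cconj (q x) * Cconj (q x)))%C.

Definition frp : hform := fun b x =>
  (wp x * (cnabla1 S 1 E3 (frB S) b x
           + (2 * trchib S x - 5 / 2 * Ci * atrchib S x) * frB S b x))%C.

Definition frqF : htens := fun b c x =>
  (wq x * (cnabla2 S 1 E3 (frF S) b c x
           + (trchib S x - 3 * Ci * atrchib S x) * frF S b c x))%C.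

(** ** The coupled system *)

(** [WZaF] and [WZ0F] are the differences [W_a^F - Z_a^F] and [W_0^F - Z_0^F],
    which occur only as such. *)
Record coeffs := Coeffs {
  W4F : pt -> R;
  WaX : pt -> R;
  ZaB : hor -> pt -> R;
  WZaF : hor -> pt -> R;
  WaB : pt -> C;
  YaF : pt -> C;
  Y0B : pt -> C;
  Z0B : pt -> C;
  Y0X : pt -> C;
  WZ0F : pt -> C;
  Y0F : hor -> pt -> C;
  W0B : hor -> pt -> C;
  W0X : hor -> pt -> C
}.

Definition Lp (k : coeffs) : hform := fun b x =>
  let PP := (2 * PF S x * Cconj (PF S x))%C in
  (wp x *
   (- Csumh (fun c => ZaB k c x * cnabla1 S 1 c (frB S) b x)
    + PP * YaF k x * cDbardot S 1 (frF S) b x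
    + (PP * Y0B k x - Z0B k x) * frB S b x
    + PP * (dot12 (fun c => Y0F k c x) (fun c d => frF S c d x) b
            + Y0X k x * frX S b x)))%C.

Definition LqF (k : coeffs) : htens := fun b c x =>
  (wq x *
   (W4F k x * cnabla2 S 1 E4 (frF S) b c x
    + Csumh (fun d => WZaF k d x * cnabla2 S 1 d (frF S) b c x)
    + WaX k x * cDotimes S 2 (frX S) b c x
    + WaB k x * cDotimes S 1 (frB S) b c x
    + WZ0F k x * frF S b c x
    + otimes (fun d => W0B k d x) (fun d => frB S d x) b c
    + otimes (fun d => W0X k d x) (fun d => frX S d x) b c))%C.

Definition eq1_lhs : hform := fun b x =>
  (box1 S frp b x
   - Ci * (2 * a * cos (thc x) / q2 x)%R * nabla1 S dt frp b x
   - V1 x * frp b x)%C.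

Definition eq1_rhs (k : coeffs) : hform := fun b x =>
  (4 * (Q * Q) * (Cconj (q x) * Cconj (q x) * Cconj (q x)) / (qm x ^ 5)%R
     * Dbardot S frqF b x
   + Lp k b x)%C.

Definition eq2_lhs : htens := fun b c x =>
  (box2 S frqF b c x
   - Ci * (4 * a * cos (thc x) / q2 x)%R * nabla2 S dt frqF b c x
   - V2 x * frqF b c x)%C.

Definition eq2_rhs (k : coeffs) : htens := fun b c x =>
  (- / 2 * ((q x * q x * q x) / (qm x ^ 5)%R)
     * (Dotimes S frp b c x
        - 3 / 2 * otimes (fun d => Hf S x d - Hbf S x d) (fun d => frp d x) b c)
   + LqF k b c x)%C.

End Transformed.

Definition smooth_coeffs (k : coeffs) : Prop :=
  smooth_on exterior (W4F k) /\ smooth_on exterior (WaX k) /\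
  (forall b, smooth_on exterior (ZaB k b) /\ smooth_on exterior (WZaF k b)) /\
  Csmooth_on exterior (WaB k) /\ Csmooth_on exterior (YaF k) /\
  Csmooth_on exterior (Y0B k) /\ Csmooth_on exterior (Z0B k) /\
  Csmooth_on exterior (Y0X k) /\ Csmooth_on exterior (WZ0F k) /\
  (forall b, Csmooth_on exterior (Y0F k b) /\ Csmooth_on exterior (W0B k b) /\
             Csmooth_on exterior (W0X k b)).

Definition vanishing_coeffs (k : coeffs) : Prop :=
  forall x, exterior x ->
  W4F k x = 0 /\ WaX k x = 0 /\ (forall b, ZaB k b x = 0 /\ WZaF k b x = 0) /\
  WaB k x = 0 /\ YaF k x = 0 /\ Y0B k x = 0 /\ Z0B k x = 0 /\ Y0X k x = 0 /\
  WZ0F k x = 0 /\ (forall b, Y0F k b x = 0 /\ W0B k b x = 0 /\ W0X k b x = 0).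

(** ** Linear perturbations *)

(** A first-order variation of the metric, of the frame and of the field. *)
Record variation := Variation {
  d_met : coord -> coord -> pt -> R;
  d_fr  : idx -> vec;
  d_em  : coord -> coord -> pt -> R
}.

Definition perturbed (v : variation) (e : R) : spacetime :=
  Spacetime
    (fun mu nu x => KN_met mu nu x + e * d_met v mu nu x)
    (fun i mu x => KN_fr i mu x + e * d_fr v i mu x)
    (fun mu nu x => KN_em mu nu x + e * d_em v mu nu x).

(** The quantities that vanish in Kerr-Newman are [O(e)] on [perturbed v e], so
    that neglecting their quadratic expressions is working modulo [O(e^2)]. *)
Definition lin_eq (f g : R -> C) : Prop :=
  exists K d, 0 < d /\
    forall e, Rabs e < d -> Cmod (f e - g e)%C <= K * e ^ 2.

(** Since [perturbed v e] is affine in [e], the frame is only required to be null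
    and orthonormal, as the field equations to hold, modulo [O(e^2)]. The constant
    matrices [mink] and [mink_inv] used above are the frame components of the metric
    and its inverse to that order. *)
Definition linear_perturbation (U : pt -> Prop) (v : variation) : Prop :=
  (forall mu nu, smooth_on U (d_met v mu nu)) /\
  (forall i mu, smooth_on U (d_fr v i mu)) /\
  (forall mu nu, smooth_on U (d_em v mu nu)) /\
  forall x, U x ->
  (forall mu nu, d_met v mu nu x = d_met v nu mu x) /\
  (forall mu nu, d_em v mu nu x = - d_em v nu mu x) /\
  (forall i j, lin_eq (fun e => let S := perturbed v e in
                                inner S (fr S i) (fr S j) x)
                      (fun _ => mink i j)) /\
  (forall i j, lin_eq (fun e => einstein_res (perturbed v e) i j x) (fun _ => 0)) /\
  (forall i j k,
     lin_eq (fun e => bianchi_res (perturbed v e) i j k x) (fun _ => 0)) /\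
  (forall k, lin_eq (fun e => maxwell_res (perturbed v e) k x) (fun _ => 0)).

End KerrNewman.

(** The potentials change sign in the exterior of a rotating black hole: they are
    negative near the horizon close to the axis. *)
Lemma V1_V2_not_positive :
  let x := Pt 0 2 (acos (19 / 20)) 0 in
  subextremal 1 (3 / 5) 0 /\ exterior 1 (3 / 5) 0 x /\
  V1 1 (3 / 5) 0 x < 0 /\ V2 1 (3 / 5) 0 x < 0.
Proof.
assert (Hc : cos (acos (19 / 20)) = 19 / 20) by (apply cos_acos; lra).
assert (Hs : sqrt (1 ^ 2 - (3 / 5) ^ 2 - 0 ^ 2) = 4 / 5).
{ replace (1 ^ 2 - (3 / 5) ^ 2 - 0 ^ 2) with ((4 / 5) ^ 2) by field.
  rewrite sqrt_pow2; lra. }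
assert (Ha : 0 < acos (19 / 20) < PI) by (apply acos_bound_lt; lra).
cbv zeta. split; [|split].
- unfold subextremal.
  replace ((3 / 5) ^ 2 + 0 ^ 2) with ((3 / 5) ^ 2) by ring.
  rewrite sqrt_pow2; lra.
- unfold exterior; simpl rc; simpl thc. rewrite Hs. lra.
- unfold V1, V2.
  set (x := Pt 0 2 (acos (19 / 20)) 0).
  assert (Hq : 0 < qm (3 / 5) x).
  { apply Cmod_gt_0. intros E. apply (f_equal fst) in E. simpl in E. lra. }
  assert (Hn : Vnum 1 (3 / 5) 0 x < 0).
  { unfold Vnum, x; simpl rc; simpl thc. rewrite Hc. lra. }
  assert (Hv : Vnum 1 (3 / 5) 0 x / qm (3 / 5) x ^ 6 < 0).
  { apply Rdiv_neg_pos; [exact Hn | now apply pow_lt]. }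
  replace (5 * 0 ^ 2 / qm (3 / 5) x ^ 4) with 0 by (unfold Rdiv; ring).
  replace (2 * 0 ^ 2 / qm (3 / 5) x ^ 4) with 0 by (unfold Rdiv; ring).
  lra.
Qed.

(* Main.v *)
(* All quantities are expanded to first order in [e]. Pairs of smooth functions, multiplied modulo
   [e^2], form a differential ring in which "linear perturbation" means an exact solution of the
   Einstein-Maxwell equations, so the tensor calculus is purely algebraic there.

   A form in [s_1(C)] or [s_2(C)] is determined by its first component in the frame. On first
   components, the Cartan, Bianchi and Maxwell equations give four scalar equations on the
   Kerr-Newman background for the first-order parts of the gauge-invariant quantities [B], [F], [X]
   (in Fraktur) and [A]: two Bianchi equations for [A], and the two equations obtained by inserting
   the definitions of [F] and [X] in the Codazzi-type equation for [hat X], [Xi] and in the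
   commutator of [e_4] with [e_1 + i e_2] on [P_F]. After rescaling by powers of [q] and [qbar]
   they involve only Chandrasekhar's operators. Since two of these commute up to weights, [A] can be
   eliminated, which leaves two second-order Teukolsky equations for [B] and [F] coupled through
   [X]. Their [e_3]-derivatives, in which the derivative of [X] is removed by the remaining
   equation, are the wave equations for the Chandrasekhar transforms [p] and [q^F]; the lower order
   coefficients are read off and vanish when [q] is real.

   The expansions of the potentials are elementary, their numerator being affine in
   [cos^2 theta]. *)
From Stdlib Require Import Reals Lra List QArith Qreals Qreduction Ring.
From Stdlib Require Import ClassicalEpsilon FunctionalExtensionality ProofIrrelevance.
From Coquelicot Require Import Coquelicot.
Require Import Defs.
Open Scope R_scope.

(** The hypotheses bound residuals by [K * e ^ 2] at each point, and such a bound cannot be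
    differentiated. So every family is represented exactly as [u0 + e u1 + e^2 h], with [h]
    polynomial in [e]; an affine function of [e] that is [O(e^2)] is zero, whence residuals that are
    negligible at each point vanish in the ring of pairs [(u0, u1)]. Conversely, two families with
    the same pair agree modulo [e^2]. Perturbed connection coefficients are never computed. Each
    equation is linear in quantities without background part, so they enter only through their
    Kerr-Newman values, and these come from the structure functions of the principal frame instead
    of derivatives of the metric. In an abstract ring a derivation does not determine a vector
    field: a dual coframe and coordinate functions are carried along to obtain the Jacobi identity,
    hence the Bianchi identities. A single complex component suffices because the complexified
    Lorentz algebra splits into two halves, and the structure equations of one half close. The wave
    equations are identities of third order in the unknowns; they become polynomial identities once
    words in the operators are put in a fixed order. *)

Module DifferentialRings.

(** * Differential rings over the complex numbers *)

Open Scope R_scope.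

(* Gaussian rationals: the computable coefficients of [ring] on a [dring]. *)
Definition QI : Type := (Q * Q)%type.
(** Each operation ends with [Qred]: unreduced numerators and denominators would grow throughout the
    normalisations done by [ring]. *)
Definition qi_add (u v : QI) : QI := (Qred (fst u + fst v), Qred (snd u + snd v)).
Definition qi_opp (u : QI) : QI := (Qred (- fst u), Qred (- snd u)).
Definition qi_sub (u v : QI) : QI := qi_add u (qi_opp v).
Definition qi_mul (u v : QI) : QI :=
  (Qred (fst u * fst v - snd u * snd v), Qred (fst u * snd v + snd u * fst v)).
Definition qi_eqb (u v : QI) : bool :=
  andb (Qeq_bool (fst u) (fst v)) (Qeq_bool (snd u) (snd v)).
Definition qiC (u : QI) : C := (Q2R (fst u), Q2R (snd u)).

Lemma Q2R_Qred q : Q2R (Qred q) = Q2R q.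
Proof. apply Qeq_eqR, Qred_correct. Qed.

Lemma qiC_add u v : qiC (qi_add u v) = (qiC u + qiC v)%C.
Proof. unfold qiC, qi_add, Cplus; cbn [fst snd]. now rewrite !Q2R_Qred, !Q2R_plus. Qed.
Lemma qiC_opp u : qiC (qi_opp u) = (- qiC u)%C.
Proof. unfold qiC, qi_opp, Copp; cbn [fst snd]. now rewrite !Q2R_Qred, !Q2R_opp. Qed.
Lemma qiC_mul u v : qiC (qi_mul u v) = (qiC u * qiC v)%C.
Proof.
unfold qiC, qi_mul, Cmult; cbn [fst snd].
now rewrite !Q2R_Qred, Q2R_minus, Q2R_plus, !Q2R_mult.
Qed.
Lemma qi_eqb_ok u v : qi_eqb u v = true -> qiC u = qiC v.
Proof.
unfold qi_eqb, qiC. intros H. apply andb_prop in H as [H1 H2].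
apply Qeq_bool_eq, Qeq_eqR in H1. apply Qeq_bool_eq, Qeq_eqR in H2. congruence.
Qed.

(* The tensor calculus is done over an arbitrary differential ring; it is applied to pairs of
   smooth functions multiplied modulo [e^2], where the hypotheses become exact equations. *)
Record dring := Dring {
  car :> Type;
  kz : car; ko : car; kadd : car -> car -> car; kmul : car -> car -> car;
  ksub : car -> car -> car; kopp : car -> car;
  kth : ring_theory kz ko kadd kmul ksub kopp (@eq car);
  cst : C -> car;
  cst0 : cst 0 = kz;
  cst1 : cst 1 = ko;
  cst_add : forall u v, cst (u + v)%C = kadd (cst u) (cst v);
  cst_mul : forall u v, cst (u * v)%C = kmul (cst u) (cst v);
  cst_opp : forall u, cst (- u)%C = kopp (cst u);
  pd : coord -> car -> car;
  pd_add : forall m u v, pd m (kadd u v) = kadd (pd m u) (pd m v);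
  pd_mul : forall m u v, pd m (kmul u v) = kadd (kmul (pd m u) v) (kmul u (pd m v));
  pd_cst : forall m z, pd m (cst z) = kz;
  pd_comm : forall m n u, pd m (pd n u) = pd n (pd m u)
}.

Arguments kz {_}. Arguments ko {_}. Arguments kadd {_}. Arguments kmul {_}.
Arguments ksub {_}. Arguments kopp {_}. Arguments cst {_}. Arguments pd {_}.

Declare Scope dr_scope.
Delimit Scope dr_scope with D.
Bind Scope dr_scope with car.
Infix "+" := kadd : dr_scope.
Infix "*" := kmul : dr_scope.
Infix "-" := ksub : dr_scope.
Notation "- x" := (kopp x) : dr_scope.

Definition kc {K : dring} (u : QI) : K := cst (qiC u).

Ltac kcst t := match t with kc ?q => constr:(q) | _ => constr:(InitialRing.NotConstant) end.

(** This lets [ring] compute with [i] and with fractions in a ring without division: [i * i = -1]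
    and [1/2 + 1/2 = 1] become computations on coefficients. *)
Lemma kc_morph (K : dring) :
  ring_morph (R := K) kz ko kadd kmul ksub kopp eq
    (0%Q, 0%Q) (1%Q, 0%Q) qi_add qi_mul qi_sub qi_opp qi_eqb kc.
Proof.
constructor; unfold kc; intros.
- unfold qiC; cbn [fst snd]. rewrite RMicromega.Q2R_0. apply cst0.
- unfold qiC; cbn [fst snd]. rewrite RMicromega.Q2R_1, RMicromega.Q2R_0. apply cst1.
- now rewrite qiC_add, cst_add.
- unfold qi_sub. rewrite qiC_add, qiC_opp, cst_add, cst_opp. now rewrite (Rsub_def (kth K)).
- now rewrite qiC_mul, cst_mul.
- now rewrite qiC_opp, cst_opp.
- now rewrite (qi_eqb_ok _ _ H).
Qed.

Notation "'#q' n" := (kc (n%Q, 0%Q)) (at level 1, n at level 1, format "#q n") : dr_scope.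
Notation "'#i'" := (kc (0%Q, 1%Q)) : dr_scope.
End DifferentialRings.

(** * Geometry of a null frame over a differential ring *)

Module FrameGeometry.
Import DifferentialRings.
Open Scope dr_scope.

(* [kfoo] is the counterpart over a differential ring of the definition [foo] of the
   statement; a final [c] ([kZc], [kPc], [kPFc]) marks a complex conjugate. *)
Definition ksumc {K : dring} (f : coord -> K) : K := f ct + f cr + f cth + f cph.
Definition ksum4 {K : dring} (f : idx -> K) : K := f E1 + f E2 + f E3 + f E4.
Definition ksumh {K : dring} (f : hor -> K) : K := f h1 + f h2.

Definition kmink {K : dring} (i j : idx) : K :=
  match i, j with
  | E1, E1 | E2, E2 => #q 1
  | E3, E4 | E4, E3 => #q (-2)
  | _, _ => #q 0
  end.
Definition kmink_inv {K : dring} (i j : idx) : K :=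
  match i, j with
  | E1, E1 | E2, E2 => #q 1
  | E3, E4 | E4, E3 => #q (-(1#2))
  | _, _ => #q 0
  end.
Definition kraise {K : dring} (v : idx -> K) (i : idx) : K :=
  ksum4 (fun j => kmink_inv i j * v j).
Definition kdelta {K : dring} (a b : hor) : K :=
  match a, b with h1, h1 | h2, h2 => #q 1 | _, _ => #q 0 end.
Definition keps {K : dring} (a b : hor) : K :=
  match a, b with h1, h2 => #q 1 | h2, h1 => #q (-1) | _, _ => #q 0 end.

Definition kdual1 {K : dring} (f : hor -> K) (a : hor) : K := ksumh (fun b => keps a b * f b).
Definition kdual2 {K : dring} (u : hor -> hor -> K) (a b : hor) : K :=
  ksumh (fun c => keps a c * u c b).
Definition kcplx1 {K : dring} (f : hor -> K) (a : hor) : K := f a + #i * kdual1 f a.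
Definition kcplx2 {K : dring} (u : hor -> hor -> K) (a b : hor) : K :=
  u a b + #i * kdual2 u a b.
Definition ktrh {K : dring} (u : hor -> hor -> K) : K := ksumh (fun a => u a a).
Definition katrh {K : dring} (u : hor -> hor -> K) : K :=
  ksumh (fun a => ksumh (fun b => keps a b * u a b)).
Definition khath {K : dring} (u : hor -> hor -> K) (a b : hor) : K :=
  #q (1#2) * (u a b + u b a - kdelta a b * ktrh u).
Definition kChath {K : dring} (T : hor -> hor -> K) (a b : hor) : K :=
  #q (1#2) * (T a b + T b a - kdelta a b * ksumh (fun c => T c c)).
Definition kotimes {K : dring} (F G : hor -> K) (a b : hor) : K :=
  kChath (fun c d => F c * G d) a b.
Definition kdot12 {K : dring} (F : hor -> K) (U : hor -> hor -> K) (a : hor) : K :=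
  ksumh (fun b => F b * U a b).

Definition kdir {K : dring} (X : coord -> K) (f : K) : K := ksumc (fun mu => X mu * pd mu f).
Definition kbracket {K : dring} (X Y : coord -> K) (mu : coord) : K :=
  kdir X (Y mu) - kdir Y (X mu).

Record kspacetime (K : dring) := Kspacetime {
  kmet : coord -> coord -> K;
  kfr : idx -> coord -> K;
  kem : coord -> coord -> K
}.
Arguments kmet {_}. Arguments kfr {_}. Arguments kem {_}.

Section KGeometry.
Context {K : dring} (S : kspacetime K).

Definition kinner (X Y : coord -> K) : K :=
  ksumc (fun mu => ksumc (fun nu => kmet S mu nu * X mu * Y nu)).
Definition kgD (X Y V : coord -> K) : K :=
  #q (1#2) * (kdir X (kinner Y V) + kdir Y (kinner X V) - kdir V (kinner X Y)
    + kinner (kbracket X Y) V - kinner (kbracket X V) Y - kinner (kbracket Y V) X).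
Definition kgam (i j k : idx) : K := kgD (kfr S i) (kfr S j) (kfr S k).
Definition kgamu (i j k : idx) : K := kraise (fun l => kgam i j l) k.
Definition ked (i : idx) (f : K) : K := kdir (kfr S i) f.

Definition kriem_up (i j k m : idx) : K :=
  ked i (kgamu j k m) - ked j (kgamu i k m)
  + ksum4 (fun n => kgamu j k n * kgamu i n m - kgamu i k n * kgamu j n m
                   - (kgamu i j n - kgamu j i n) * kgamu n k m).
Definition kriem (l k i j : idx) : K := ksum4 (fun m => kmink l m * kriem_up i j k m).
Definition kric (k j : idx) : K :=
  ksum4 (fun l => ksum4 (fun i => kmink_inv l i * kriem l k i j)).
Definition kscal : K := ksum4 (fun k => ksum4 (fun j => kmink_inv k j * kric k j)).
Definition kweyl (i j k l : idx) : K :=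
  kriem i j k l
  - #q (1#2) * (kmink i k * kric j l - kmink i l * kric j k
             - kmink j k * kric i l + kmink j l * kric i k)
  + kscal * #q (1#6) * (kmink i k * kmink j l - kmink i l * kmink j k).

Definition kFf (i j : idx) : K :=
  ksumc (fun mu => ksumc (fun nu => kem S mu nu * kfr S i mu * kfr S j nu)).
Definition kFfu (i l : idx) : K := kraise (fun m => kFf i m) l.
Definition kDF (i j k : idx) : K :=
  ked i (kFf j k)
  - ksum4 (fun m => kgamu i j m * kFf m k + kgamu i k m * kFf j m).
Definition kF2 : K :=
  ksum4 (fun i => kraise (fun j => ksum4 (fun l => kFf j l * kFfu i l)) i).
Definition keinstein (i j : idx) : K :=
  kric i j
  - (#q 2 * ksum4 (fun l => kFf i l * kFfu j l) - #q (1#2) * kmink i j * kF2).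
Definition kbianchi (i j k : idx) : K := kDF i j k + kDF j k i + kDF k i j.
Definition kmaxwell (k : idx) : K :=
  ksum4 (fun i => ksum4 (fun j => kmink_inv i j * kDF i j k)).

Definition kchi (a b : hor) : K := kgam a E4 b.
Definition kchib (a b : hor) : K := kgam a E3 b.
Definition keta (a : hor) : K := #q (1#2) * kgam E3 E4 a.
Definition ketab (a : hor) : K := #q (1#2) * kgam E4 E3 a.
Definition kxi (a : hor) : K := #q (1#2) * kgam E4 E4 a.
Definition kzeta (a : hor) : K := #q (1#2) * kgam a E4 E3.
Definition komega : K := #q (1#4) * kgam E4 E4 E3.
Definition komegab : K := #q (1#4) * kgam E3 E3 E4.
Definition ktrchi : K := ktrh kchi.
Definition katrchi : K := katrh kchi.
Definition ktrchib : K := ktrh kchib.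
Definition katrchib : K := katrh kchib.
Definition kXhat : hor -> hor -> K := kcplx2 (khath kchi).
Definition kH : hor -> K := kcplx1 keta.
Definition kHb : hor -> K := kcplx1 ketab.
Definition kXi : hor -> K := kcplx1 kxi.
Definition kZ : hor -> K := kcplx1 kzeta.
Definition kZc (a : hor) : K := kzeta a - #i * kdual1 kzeta a.
Definition kbeta (a : hor) : K := #q (1#2) * kweyl a E4 E3 E4.
Definition krho : K := #q (1#4) * kweyl E4 E3 E4 E3.
Definition krho_star : K := #q (1#2) * kweyl E1 E2 E3 E4.
Definition kB : hor -> K := kcplx1 kbeta.
Definition kPc : K := krho - #i * krho_star.
Definition kbetaF (a : hor) : K := kFf a E4.
Definition krhoF : K := #q (1#2) * kFf E3 E4.
Definition krhoF_star : K := - kFf E1 E2.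
Definition kBF : hor -> K := kcplx1 kbetaF.
Definition kPF : K := krhoF + #i * krhoF_star.
Definition kPFc : K := krhoF - #i * krhoF_star.

Definition knabla1 (X : coord -> K) (F : hor -> K) (a : hor) : K :=
  kdir X (F a) - ksumh (fun c => kgD X (kfr S a) (kfr S c) * F c).
Definition knabla2 (X : coord -> K) (F : hor -> hor -> K) (a b : hor) : K :=
  kdir X (F a b)
  - ksumh (fun c => kgD X (kfr S a) (kfr S c) * F c b
                    + kgD X (kfr S b) (kfr S c) * F a c).
Definition kcweight (s : QI) (i : idx) : K :=
  match i with
  | E1 => kc s * kzeta h1
  | E2 => kc s * kzeta h2
  | E3 => #q (-2) * kc s * komegab
  | E4 => #q 2 * kc s * komega
  end.
Definition kcnabla1 (s : QI) (i : idx) (F : hor -> K) (a : hor) : K :=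
  knabla1 (kfr S i) F a + kcweight s i * F a.
Definition kcnabla2 (s : QI) (i : idx) (F : hor -> hor -> K) (a b : hor) : K :=
  knabla2 (kfr S i) F a b + kcweight s i * F a b.
Definition kcD1 (s : QI) (F : hor -> K) (a b : hor) : K :=
  knabla1 (kfr S a) F b + #i * ksumh (fun c => keps a c * knabla1 (kfr S c) F b)
  + kc s * kZ a * F b.
Definition kcDotimes (s : QI) (F : hor -> K) (a b : hor) : K := kChath (kcD1 s F) a b.
Definition kcDbar2 (s : QI) (U : hor -> hor -> K) (c a b : hor) : K :=
  knabla2 (kfr S c) U a b
  - #i * ksumh (fun d => keps c d * knabla2 (kfr S d) U a b)
  + kc s * kZc c * U a b.
Definition kcDbardot (s : QI) (U : hor -> hor -> K) (a : hor) : K :=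
  ksumh (fun b => kcDbar2 s U b a b).
Definition kbox1 (F : hor -> K) (a : hor) : K :=
  ksum4 (fun i => ksum4 (fun j => kmink_inv i j *
    (knabla1 (kfr S i) (knabla1 (kfr S j) F) a
     - ksum4 (fun m => kgamu i j m * knabla1 (kfr S m) F a)))).
Definition kbox2 (F : hor -> hor -> K) (a b : hor) : K :=
  ksum4 (fun i => ksum4 (fun j => kmink_inv i j *
    (knabla2 (kfr S i) (knabla2 (kfr S j) F) a b
     - ksum4 (fun m => kgamu i j m * knabla2 (kfr S m) F a b)))).

Definition kfrF (a b : hor) : K :=
  - #q (1#2) * kcDotimes (1%Q, 0%Q) kBF a b
  - #q (3#2) * kotimes kH kBF a b + kPF * kXhat a b.
Definition kfrB (a : hor) : K := #q 2 * kPF * kB a - #q 3 * kPc * kBF a.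
Definition kfrX (a : hor) : K :=
  kcnabla1 (1%Q, 0%Q) E4 kBF a + #q (3#2) * (ktrchi + #i * katrchi) * kBF a
  - #q 2 * kPF * kXi a.
End KGeometry.

Section Deriv.
Context {K : dring}.
Add Ring Kring : (kth K) (morphism (kc_morph K), constants [kcst]).

Definition derivation (d : K -> K) : Prop :=
  (forall u v, d (u + v) = d u + d v) /\ (forall u v, d (u * v) = d u * v + u * d v) /\
  (forall z, d (cst z) = #q 0).

(** The ring structure has its own zero [kz]; all vanishing statements use the constant [#q 0], so
    that rewriting meets one form only. *)
Lemma kz_q0 : kz = #q 0 :> K. Proof. ring. Qed.

Lemma pd_derivation m : derivation (pd m).
Proof.
repeat split; intros; [apply pd_add | apply pd_mul |]. rewrite pd_cst. apply kz_q0.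
Qed.
Lemma kdir_derivation X : derivation (kdir X).
Proof.
unfold kdir, ksumc; repeat split; intros; rewrite ?pd_add, ?pd_mul, ?pd_cst; ring.
Qed.
Lemma ked_derivation S i : derivation (ked S i).
Proof. apply kdir_derivation. Qed.

Section D.
Context (d : K -> K) (dd : derivation d).
Lemma der_add u v : d (u + v) = d u + d v. Proof. apply dd. Qed.
Lemma der_mul u v : d (u * v) = d u * v + u * d v. Proof. apply dd. Qed.
Lemma der_cst z : d (cst z) = #q 0. Proof. apply dd. Qed.
Lemma der_kc z : d (kc z) = #q 0. Proof. apply der_cst. Qed.
Lemma der_opp u : d (- u) = - d u.
Proof. replace (- u) with (#q (-1) * u) by ring. rewrite der_mul, der_kc. ring. Qed.
Lemma der_sub u v : d (u - v) = d u - d v.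
Proof. replace (u - v) with (u + - v) by ring. rewrite der_add, der_opp. ring. Qed.
End D.
End Deriv.
End FrameGeometry.

(** * Torsion, metric compatibility and the Jacobi identity of a frame *)

Module Koszul.
Import DifferentialRings FrameGeometry.
Open Scope dr_scope.

Definition kcoord_delta {K : dring} (m n : coord) : K :=
  match m, n with
  | ct, ct | cr, cr | cth, cth | cph, cph => #q 1
  | _, _ => #q 0
  end.

Section Frame.
Context {K : dring} (S : kspacetime K).
Add Ring Kring1 : (kth K) (morphism (kc_morph K), constants [kcst]).

(** Two facts that are automatic on a manifold are data over a ring: the frame spans, through the
    inverse matrix [cf], and a vector field is recovered from its action on the coordinate functions
    [xco]. *)
Context (met_sym : forall mu nu, kmet S mu nu = kmet S nu mu)
  (inner_fr : forall i j, kinner S (kfr S i) (kfr S j) = kmink i j)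
  (cf : coord -> idx -> K)
  (cf_fr : forall mu nu, ksum4 (fun j => cf mu j * kfr S j nu) = kcoord_delta mu nu)
  (xco : coord -> K)
  (pd_xco : forall mu nu, pd nu (xco mu) = kcoord_delta mu nu).

Let e := ked S.
Let br (i j k : idx) : K := kinner S (kbracket (kfr S i) (kfr S j)) (kfr S k).
Let G := kgam S.
Let cc (i j n : idx) : K := kgamu S i j n - kgamu S j i n.

Lemma kbracket_anti (X Y : coord -> K) mu : kbracket X Y mu = - kbracket Y X mu.
Proof. unfold kbracket. ring. Qed.

Lemma br_anti i j k : br i j k = - br j i k.
Proof.
unfold br, kinner, ksumc. rewrite !(kbracket_anti (kfr S i) (kfr S j)). ring.
Qed.

(** The frame components of the metric are constants, so the three derivative terms of the Koszul
    formula drop out. *)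
Lemma kgam_koszul i j k : G i j k = #q (1#2) * (br i j k - br i k j - br j k i).
Proof.
unfold G, kgam, kgD. rewrite !inner_fr.
assert (Z : forall X a b, kdir X (kmink (K := K) a b) = #q 0).
{ intros X a b. unfold kmink. destruct a, b; apply (der_kc _ (kdir_derivation X)). }
rewrite !Z. unfold br. ring.
Qed.

Lemma kgam_anti i j k : G i j k = - G i k j.
Proof.
rewrite !kgam_koszul, (br_anti k j i). ring.
Qed.

Lemma kgam_torsion i j k : G i j k - G j i k = br i j k.
Proof. rewrite !kgam_koszul, (br_anti j i k). ring. Qed.

(** The coframe gives some expansion of [X]; taking inner products with the frame then identifies
    its coefficients, since [mink_inv] inverts [mink]. *)
Lemma frame_complete (X : coord -> K) nu :
  X nu = ksum4 (fun k => kraise (fun l => kinner S X (kfr S l)) k * kfr S k nu).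
Proof.
set (a := fun j => ksumc (fun mu => X mu * cf mu j)).
assert (HX : forall mu, X mu = ksum4 (fun j => a j * kfr S j mu)).
{ intros mu.
  transitivity (ksumc (fun la => X la * kcoord_delta la mu)).
  - destruct mu; unfold ksumc, kcoord_delta; ring.
  - unfold ksumc. rewrite <- !cf_fr. unfold a, ksum4, ksumc. ring. }
assert (Hi : forall l, kinner S X (kfr S l) = ksum4 (fun j => a j * kmink j l)).
{ intros l. transitivity (ksum4 (fun j => a j * kinner S (kfr S j) (kfr S l))).
  - unfold kinner, ksumc. rewrite !HX. unfold ksum4. ring.
  - unfold ksum4. now rewrite !inner_fr. }
rewrite (HX nu). unfold kraise, ksum4. rewrite !Hi.
unfold ksum4, kmink, kmink_inv. ring.
Qed.

Lemma cc_br i j n : cc i j n = kraise (fun l => br i j l) n.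
Proof.
unfold cc, kgamu, kraise, ksum4.
rewrite <- !kgam_torsion. unfold G. ring.
Qed.

(** Mixed partials commute, so the commutator is the derivative along the bracket, and the bracket
    is expanded in the frame. *)
Lemma frame_comm i j f : e i (e j f) = e j (e i f) + ksum4 (fun n => cc i j n * e n f).
Proof.
assert (H : e i (e j f) - e j (e i f)
            = ksumc (fun mu => kbracket (kfr S i) (kfr S j) mu * pd mu f)).
{ unfold e, ked, kbracket, kdir, ksumc.
  rewrite !pd_add, !pd_mul.
  rewrite (pd_comm K cr ct), (pd_comm K cth ct), (pd_comm K cph ct), (pd_comm K cth cr),
  (pd_comm K cph cr), (pd_comm K cph cth). ring. }
replace (e i (e j f)) with (e j (e i f) + (e i (e j f) - e j (e i f))) by ring.
rewrite H. f_equal.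
unfold ksumc. rewrite !(frame_complete (kbracket (kfr S i) (kfr S j))).
unfold ksum4 at 5. rewrite !cc_br. unfold e, ked, kdir, br, ksum4, ksumc. ring.
Qed.

(** Pairing a vanishing combination with each frame vector lowers the index of [v], and [mink] is
    invertible. *)
Lemma frame_independent (v : idx -> K) :
  (forall mu, ksum4 (fun n => v n * kfr S n mu) = #q 0) -> forall n, v n = #q 0.
Proof.
intros H n.
assert (Hk : forall k, ksum4 (fun j => v j * kmink j k) = #q 0).
{ intros k. transitivity (ksum4 (fun j => v j * kinner S (kfr S j) (kfr S k))).
  - unfold ksum4. now rewrite !inner_fr.
  - transitivity (ksumc (fun mu => ksumc (fun nu => kmet S mu nu *
      ksum4 (fun j => v j * kfr S j mu) * kfr S k nu))).
    + unfold kinner, ksum4, ksumc. ring.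
    + unfold ksumc. rewrite !H. ring. }
assert (E : v n = ksum4 (fun k => kmink_inv n k * ksum4 (fun j => v j * kmink j k))).
{ unfold ksum4, kmink, kmink_inv. destruct n; ring. }
rewrite E. unfold ksum4 at 1. rewrite !Hk. ring.
Qed.

Lemma ked_xco n mu : e n (xco mu) = kfr S n mu.
Proof.
unfold e, ked, kdir, ksumc. rewrite !pd_xco. destruct mu; unfold kcoord_delta; ring.
Qed.

(** The Jacobi identity for the three derivations, applied to each coordinate function, is a
    vanishing combination of frame vectors whose coefficients are these expressions. *)
Lemma frame_jacobi i j k n :
  e k (cc i j n) + ksum4 (fun m => cc i j m * cc k m n)
  + (e i (cc j k n) + ksum4 (fun m => cc j k m * cc i m n))
  + (e j (cc k i n) + ksum4 (fun m => cc k i m * cc j m n)) = #q 0.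
Proof.
revert n.
set (J := fun n => e k (cc i j n) + ksum4 (fun m => cc i j m * cc k m n)
  + (e i (cc j k n) + ksum4 (fun m => cc j k m * cc i m n))
  + (e j (cc k i n) + ksum4 (fun m => cc k i m * cc j m n))).
apply (frame_independent J). intros mu.
assert (X : forall a b c f, e c (e a (e b f)) = e c (e b (e a f))
   + ksum4 (fun n => e c (cc a b n) * e n f + cc a b n * e n (e c f)
       + cc a b n * ksum4 (fun m => cc c n m * e m f))).
{ intros a b c f. rewrite (frame_comm a b f).
  unfold ksum4 at 1.
  rewrite !(der_add _ (ked_derivation S c)), !(der_mul _ (ked_derivation S c)).
  fold e. rewrite (frame_comm c E1 f), (frame_comm c E2 f), (frame_comm c E3 f), (frame_comm c E4 f).
  unfold ksum4. ring. }
assert (Y : forall a b c f, e a (e b (e c f)) = e b (e a (e c f))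
   + ksum4 (fun n => cc a b n * e n (e c f))).
{ intros. apply frame_comm. }
set (f := xco mu).
assert (H1 := X i j k f). assert (H2 := X j k i f). assert (H3 := X k i j f).
assert (H4 := Y i j k f). assert (H5 := Y j k i f). assert (H6 := Y k i j f).
transitivity (ksum4 (fun n => J n * e n f)).
{ unfold ksum4, f. rewrite !ked_xco. reflexivity. }
(* The six differences cancel identically as third-order words. The first three contain inner
   commutators, expanded by [X]; the last three are outer commutators, expanded by [Y]. *)
transitivity (
   (e k (e i (e j f)) - e k (e j (e i f))) + (e i (e j (e k f)) - e i (e k (e j f)))
   + (e j (e k (e i f)) - e j (e i (e k f)))
   - (e i (e j (e k f)) - e j (e i (e k f))) - (e j (e k (e i f)) - e k (e j (e i f)))
   - (e k (e i (e j f)) - e i (e k (e j f)))); [| ring].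
assert (M : forall u v w : K, u = v + w -> u - v = w) by (intros u v w ->; ring).
rewrite (M _ _ _ H1), (M _ _ _ H2), (M _ _ _ H3), (M _ _ _ H4), (M _ _ _ H5), (M _ _ _ H6).
unfold J, ksum4. ring.
Qed.

End Frame.
End Koszul.

(** * Algebraic symmetries of the curvature *)

Module CurvatureSymmetries.
Import DifferentialRings FrameGeometry Koszul.
Open Scope dr_scope.

Definition kcc {K : dring} (S : kspacetime K) (i j n : idx) : K := kgamu S i j n - kgamu S j i n.

(** All that curvature identities need from the frame. From here on the coordinate components of
    metric and frame are not opened again in deriving them. *)
Record framed {K : dring} (S : kspacetime K) : Prop := Framed {
  gam_anti : forall i j k, kgam S i j k = - kgam S i k j;
  ked_comm : forall i j f,
    ked S i (ked S j f) = ked S j (ked S i f) + ksum4 (fun n => kcc S i j n * ked S n f);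
  kcc_jacobi : forall i j k n,
    ked S k (kcc S i j n) + ksum4 (fun m => kcc S i j m * kcc S k m n)
    + (ked S i (kcc S j k n) + ksum4 (fun m => kcc S j k m * kcc S i m n))
    + (ked S j (kcc S k i n) + ksum4 (fun m => kcc S k i m * kcc S j m n)) = #q 0
}.

Lemma framed_intro {K : dring} (S : kspacetime K) :
  (forall mu nu, kmet S mu nu = kmet S nu mu) ->
  (forall i j, kinner S (kfr S i) (kfr S j) = kmink i j) ->
  forall cf : coord -> idx -> K,
  (forall mu nu, ksum4 (fun j => cf mu j * kfr S j nu) = kcoord_delta mu nu) ->
  forall xco : coord -> K,
  (forall mu nu, pd nu (xco mu) = kcoord_delta mu nu) -> framed S.
Proof.
intros H1 H2 cf H3 xco H4. constructor.
- intros. apply kgam_anti; assumption.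
- intros. eapply frame_comm; eassumption.
- intros. eapply frame_jacobi; eassumption.
Qed.

Section Curvature.
Context {K : dring} (S : kspacetime K) (HS : framed S).
Add Ring Kring2 : (kth K) (morphism (kc_morph K), constants [kcst]).

Local Notation e := (ked S).
Local Notation G := (kgam S).
Local Notation cc := (kcc S).

(** Lowering the index commutes with the frame derivatives because [kmink] is constant; it turns the
    raised coefficients into [G], on which antisymmetry is available. *)
Lemma riem_low l k i j :
  kriem S l k i j = e i (G j k l) - e j (G i k l)
   + ksum4 (fun n => kgamu S j k n * G i n l - kgamu S i k n * G j n l - cc i j n * G n k l).
Proof.
assert (L : forall a b l, ksum4 (fun m => kmink l m * kgamu S a b m) = G a b l).
{ intros a b c. unfold kgamu, kraise, ksum4, kmink, kmink_inv. destruct c; ring. }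
assert (E : forall a b c l, e a (G b c l) = ksum4 (fun m => kmink l m * e a (kgamu S b c m))).
{ intros. rewrite <- L. unfold ksum4.
  rewrite !(der_add _ (ked_derivation S a)), !(der_mul _ (ked_derivation S a)).
  assert (Z : forall x y, e a (kmink (K := K) x y) = #q 0).
  { intros x y. unfold kmink. destruct x, y; apply (der_kc _ (ked_derivation S a)). }
  rewrite !Z. ring. }
rewrite !E. unfold ksum4.
rewrite <- (L i E1 l), <- (L i E2 l), <- (L i E3 l), <- (L i E4 l),
  <- (L j E1 l), <- (L j E2 l), <- (L j E3 l), <- (L j E4 l),
  <- (L E1 k l), <- (L E2 k l), <- (L E3 k l), <- (L E4 k l).
unfold kriem, kriem_up, ksum4, kcc. ring.
Qed.

Lemma riem_anti_ij l k i j : kriem S l k i j = - kriem S l k j i.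
Proof. rewrite !riem_low. unfold ksum4, kcc. ring. Qed.

Lemma riem_anti_lk l k i j : kriem S l k i j = - kriem S k l i j.
Proof.
rewrite !riem_low.
rewrite (gam_anti S HS j k l), (gam_anti S HS i k l : G i k l = _).
rewrite !(der_opp _ (ked_derivation S i)), !(der_opp _ (ked_derivation S j)).
assert (X : forall a b c, G a b c = - G a c b) by apply HS.
unfold ksum4.
rewrite (X E1 k l), (X E2 k l), (X E3 k l), (X E4 k l).
unfold kgamu, kraise, ksum4, kmink_inv.
rewrite (X i E1 l), (X i E2 l), (X i E3 l), (X i E4 l),
 (X j E1 l), (X j E2 l), (X j E3 l), (X j E4 l),
 (X i E1 k), (X i E2 k), (X i E3 k), (X i E4 k),
 (X j E1 k), (X j E2 k), (X j E3 k), (X j E4 k).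
ring.
Qed.

(** First Bianchi identity: as [kcc] is the antisymmetrised connection, the cyclic sum of curvatures
    is the Jacobi expression of the structure functions. *)
Lemma riem_cyc l k i j : kriem S l k i j + kriem S l i j k + kriem S l j k i = #q 0.
Proof.
assert (U : forall m, kriem_up S i j k m + kriem_up S j k i m + kriem_up S k i j m = #q 0).
{ intros m. rewrite <- (kcc_jacobi S HS i j k m).
  unfold kcc.
  rewrite !(der_sub _ (ked_derivation S i)), !(der_sub _ (ked_derivation S j)),
    !(der_sub _ (ked_derivation S k)).
  unfold kriem_up, ksum4. ring. }
transitivity (ksum4 (fun m => kmink l m *
  (kriem_up S i j k m + kriem_up S j k i m + kriem_up S k i j m))).
- unfold kriem, ksum4. ring.
- unfold ksum4. rewrite !U. ring.
Qed.

(** The classical octahedron argument: a signed half-sum of four cyclic identities, rewritten by the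
    two antisymmetries, leaves exactly these two components. *)
Lemma riem_pair l k i j : kriem S l k i j = kriem S i j l k.
Proof.
assert (H1 := riem_cyc l k i j). assert (H2 := riem_cyc k i j l).
assert (H3 := riem_cyc i j l k). assert (H4 := riem_cyc j l k i).
rewrite (riem_anti_lk k l) in H2. rewrite (riem_anti_lk j i) in H4.
rewrite (riem_anti_lk i l), (riem_anti_ij l i) in H3.
rewrite (riem_anti_lk i k) in H3.
rewrite (riem_anti_lk j l) in H4. rewrite (riem_anti_lk j k), (riem_anti_ij k j) in H4.
transitivity (kriem S i j l k + #q(1#2) * ((kriem S l k i j + kriem S l i j k + kriem S l j k i)
 - (kriem S k i j l + kriem S k j l i + - kriem S l k i j)
 - (kriem S i j l k + - - kriem S l i j k + - kriem S k i j l)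
 + (- kriem S l j k i + - - kriem S k j l i + - kriem S i j l k))); [ring|].
rewrite H1, H2, H3, H4. ring.
Qed.
End Curvature.
End CurvatureSymmetries.

(** * Complex structure equations and the second Bianchi identity *)

Module CartanEquations.
Import DifferentialRings FrameGeometry Koszul CurvatureSymmetries.
Open Scope dr_scope.

Section Cartan.
Context {K : dring} (S : kspacetime K) (HS : framed S).
Add Ring Kring3 : (kth K) (morphism (kc_morph K), constants [kcst]).

Local Notation e := (ked S).
Local Notation G := (kgam S).
Local Notation cc := (kcc S).
Local Notation Riem := (kriem S).
Local Notation half := (#q (1#2)).

(* On first components of [s_1(C)] of type 1 the conformal derivative is [e_i + kGa i];
   [kom] and [kom2] are the connection forms of [e_4] and [e_3] along [e_1 + i e_2] and
   [e_1 - i e_2]; [kTh] and [kUps] are the curvatures of [kom] and [kGa]. *)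
Definition kW (i : idx) : K := G i E1 E2.
Definition kz2 (i : idx) : K := G i E4 E3.
Definition kGa (i : idx) : K := #i * kW i + half * kz2 i.
Definition kom (i : idx) : K := G i E4 E1 + #i * G i E4 E2.
Definition kom2 (i : idx) : K := G i E3 E1 - #i * G i E3 E2.
Definition kTh (i j : idx) : K := - (Riem E4 E1 i j + #i * Riem E4 E2 i j).
Definition kUps (i j : idx) : K := #i * Riem E2 E1 i j + half * Riem E3 E4 i j.

Lemma gam_refl i j : G i j j = #q 0.
Proof.
transitivity (half * (G i j j + G i j j)); [ring|].
rewrite (gam_anti S HS i j j) at 1. ring.
Qed.

Lemma e_add i (u v : K) : e i (u + v) = e i u + e i v.
Proof. apply (der_add _ (ked_derivation S i)). Qed.
Lemma e_sub i (u v : K) : e i (u - v) = e i u - e i v.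
Proof. apply (der_sub _ (ked_derivation S i)). Qed.
Lemma e_opp i (u : K) : e i (- u) = - e i u.
Proof. apply (der_opp _ (ked_derivation S i)). Qed.
Lemma e_mul i (u v : K) : e i (u * v) = e i u * v + u * e i v.
Proof. apply (der_mul _ (ked_derivation S i)). Qed.
Lemma e_kc i c : e i (kc c) = #q 0.
Proof. apply (der_kc _ (ked_derivation S i)). Qed.

Lemma gam_canon : (forall i, G i E1 E1 = #q 0) /\ (forall i, G i E2 E2 = #q 0)
  /\ (forall i, G i E3 E3 = #q 0) /\ (forall i, G i E4 E4 = #q 0)
  /\ (forall i, G i E2 E1 = - G i E1 E2) /\ (forall i, G i E1 E3 = - G i E3 E1)
  /\ (forall i, G i E1 E4 = - G i E4 E1) /\ (forall i, G i E2 E3 = - G i E3 E2)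
  /\ (forall i, G i E2 E4 = - G i E4 E2) /\ (forall i, G i E3 E4 = - G i E4 E3).
Proof. repeat split; intros; apply gam_refl || apply HS. Qed.

Ltac canon :=
  let H1 := fresh in let H2 := fresh in let H3 := fresh in let H4 := fresh in
  let H5 := fresh in let H6 := fresh in let H7 := fresh in let H8 := fresh in
  let H9 := fresh in let H10 := fresh in
  destruct gam_canon as (H1 & H2 & H3 & H4 & H5 & H6 & H7 & H8 & H9 & H10);
  rewrite ?H1, ?H2, ?H3, ?H4, ?H5, ?H6, ?H7, ?H8, ?H9, ?H10;
  clear H1 H2 H3 H4 H5 H6 H7 H8 H9 H10.

(** First structure equation of one half of the complexified Lorentz algebra. It involves only [kom]
    and [kGa], not the conjugate forms; together with [cartan2] the system closes on [kom], [kGa],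
    [kom2]. *)
Lemma cartan1 i j :
  kTh i j = e i (kom j) - e j (kom i) - ksum4 (fun n => cc i j n * kom n)
            + kGa i * kom j - kGa j * kom i.
Proof.
unfold kTh. rewrite !(riem_low S), (gam_anti S HS _ E1 E4), (gam_anti S HS _ E2 E4).
unfold kom, kGa, kW, kz2. rewrite !e_add, !e_mul, !e_kc. unfold ksum4.
unfold kgamu at 1 2 3 4 5 6 7 8 9 10 11 12 13 14 15 16.
unfold kraise, ksum4, kmink_inv. canon. rewrite !e_opp. ring.
Qed.

Lemma cartan2 i j :
  kUps i j = e i (kGa j) - e j (kGa i) - ksum4 (fun n => cc i j n * kGa n)
             + half * (kom i * kom2 j - kom j * kom2 i).
Proof.
unfold kUps. rewrite !(riem_low S).
unfold kom, kom2, kGa, kW, kz2. rewrite !e_add, !e_mul, !e_kc. unfold ksum4.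
unfold kgamu at 1 2 3 4 5 6 7 8 9 10 11 12 13 14 15 16.
unfold kraise, ksum4, kmink_inv. canon. ring.
Qed.

(** Covariant exterior derivative of the first structure equation. Second derivatives of [kom]
    disappear through the commutators of the frame. *)
Lemma bianchi_cartan i j k :
  (e i (kTh j k) - ksum4 (fun n => cc i j n * kTh n k) + kGa i * kTh j k - kUps i j * kom k)
  + (e j (kTh k i) - ksum4 (fun n => cc j k n * kTh n i) + kGa j * kTh k i - kUps j k * kom i)
  + (e k (kTh i j) - ksum4 (fun n => cc k i n * kTh n j) + kGa k * kTh i j - kUps k i * kom j)
  = #q 0.
Proof.
assert (J := fun n => kcc_jacobi S HS i j k n).
unfold ksum4 in *. rewrite !cartan1, !cartan2. unfold ksum4.
repeat (rewrite e_add || rewrite e_sub || rewrite e_mul || rewrite e_kc).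
rewrite (ked_comm S HS i j (kom k)), (ked_comm S HS j k (kom i)), (ked_comm S HS k i (kom j)).
unfold ksum4.
(* What remains after the commutators are the derivatives of the structure functions, contracted
   with [kom]: the Jacobi expressions, one for each value of the last index. *)
transitivity (#q 0 - (
  (e k (cc i j E1) + (cc i j E1 * cc k E1 E1 + cc i j E2 * cc k E2 E1 + cc i j E3 * cc k E3 E1 + cc i j E4 * cc k E4 E1)
  + (e i (cc j k E1) + (cc j k E1 * cc i E1 E1 + cc j k E2 * cc i E2 E1 + cc j k E3 * cc i E3 E1 + cc j k E4 * cc i E4 E1))
  + (e j (cc k i E1) + (cc k i E1 * cc j E1 E1 + cc k i E2 * cc j E2 E1 + cc k i E3 * cc j E3 E1 + cc k i E4 * cc j E4 E1))) * kom E1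
  + (e k (cc i j E2) + (cc i j E1 * cc k E1 E2 + cc i j E2 * cc k E2 E2 + cc i j E3 * cc k E3 E2 + cc i j E4 * cc k E4 E2)
  + (e i (cc j k E2) + (cc j k E1 * cc i E1 E2 + cc j k E2 * cc i E2 E2 + cc j k E3 * cc i E3 E2 + cc j k E4 * cc i E4 E2))
  + (e j (cc k i E2) + (cc k i E1 * cc j E1 E2 + cc k i E2 * cc j E2 E2 + cc k i E3 * cc j E3 E2 + cc k i E4 * cc j E4 E2))) * kom E2
  + (e k (cc i j E3) + (cc i j E1 * cc k E1 E3 + cc i j E2 * cc k E2 E3 + cc i j E3 * cc k E3 E3 + cc i j E4 * cc k E4 E3)
  + (e i (cc j k E3) + (cc j k E1 * cc i E1 E3 + cc j k E2 * cc i E2 E3 + cc j k E3 * cc i E3 E3 + cc j k E4 * cc i E4 E3))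
  + (e j (cc k i E3) + (cc k i E1 * cc j E1 E3 + cc k i E2 * cc j E2 E3 + cc k i E3 * cc j E3 E3 + cc k i E4 * cc j E4 E3))) * kom E3
  + (e k (cc i j E4) + (cc i j E1 * cc k E1 E4 + cc i j E2 * cc k E2 E4 + cc i j E3 * cc k E3 E4 + cc i j E4 * cc k E4 E4)
  + (e i (cc j k E4) + (cc j k E1 * cc i E1 E4 + cc j k E2 * cc i E2 E4 + cc j k E3 * cc i E3 E4 + cc j k E4 * cc i E4 E4))
  + (e j (cc k i E4) + (cc k i E1 * cc j E1 E4 + cc k i E2 * cc j E2 E4 + cc k i E3 * cc j E3 E4 + cc k i E4 * cc j E4 E4))) * kom E4)).
2: { rewrite !J. ring. }
assert (X : forall a b n, cc a b n = - cc b a n) by (intros; unfold kcc; ring).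
rewrite !(X E1 i), !(X E2 i), !(X E3 i), !(X E4 i), !(X E1 j), !(X E2 j), !(X E3 j),
  !(X E4 j), !(X E1 k), !(X E2 k), !(X E3 k), !(X E4 k).
ring.
Qed.
End Cartan.
End CartanEquations.

(** * Einstein-Maxwell equations modulo quadratic terms *)

Module FieldEquations.
Import DifferentialRings FrameGeometry Koszul CurvatureSymmetries CartanEquations.
Open Scope dr_scope.

Record einstein_maxwell {K : dring} (S : kspacetime K) : Prop := {
  em_framed : framed S;
  em_einstein : forall i j, keinstein S i j = #q 0;
  em_bianchi : forall i j k, kbianchi S i j k = #q 0;
  em_maxwell : forall k, kmaxwell S k = #q 0;
  em_anti : forall i j, kFf S i j = - kFf S j i
}.

(* The quantities vanishing in Kerr-Newman are multiples of a parameter of square zero. *)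
Definition small {K : dring} (eps u : K) : Prop := exists v, u = eps * v.

(** The last two fields concern curvature combinations that are neither computed nor wanted: in the
    Bianchi equations below they cancel or carry a second small factor, so smallness is enough. *)
Record type_D {K : dring} (S : kspacetime K) (eps : K) : Prop := {
  eps_sq : eps * eps = #q 0;
  eps_pd : forall m, pd m eps = #q 0;
  D_xi : forall a : hor, small eps (kgam S E4 E4 a);
  D_xib : forall a : hor, small eps (kgam S E3 E3 a);
  D_chi1 : small eps (kgam S E1 E4 E1 - kgam S E2 E4 E2);
  D_chi2 : small eps (kgam S E1 E4 E2 + kgam S E2 E4 E1);
  D_chib1 : small eps (kgam S E1 E3 E1 - kgam S E2 E3 E2);
  D_chib2 : small eps (kgam S E1 E3 E2 + kgam S E2 E3 E1);
  D_F4 : forall a : hor, small eps (kFf S a E4);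
  D_F3 : forall a : hor, small eps (kFf S a E3);
  D_ups4 : small eps (kUps S E4 E1 - #i * kUps S E4 E2);
  D_ups3 : small eps (kUps S E3 E1 + #i * kUps S E3 E2)
}.

Section LinearEquations.
Context {K : dring} (S : kspacetime K) (EM : einstein_maxwell S) (eps : K) (TD : type_D S eps).
Add Ring Kring4 : (kth K) (morphism (kc_morph K), constants [kcst]).

Local Notation e := (ked S).
Local Notation G := (kgam S).
Local Notation Riem := (kriem S).
Local Notation half := (#q (1#2)).
Local Notation om := (kom S).
Local Notation W := (kW S).
Local Notation z := (kz2 S).
Local Notation Ga := (kGa S).
Local Notation Th := (kTh S).
Local Notation Ups := (kUps S).
Local Notation F := (kFf S).

Let HS := em_framed S EM.

(* First components ([tr X], [H_1], [hat X_11], [Xi_1], [(B_F)_1], [A_11], ...) and conjugates. *)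
Definition kX : K := G E1 E4 E1 + G E2 E4 E2 - #i * (G E1 E4 E2 - G E2 E4 E1).
Definition kXc : K := G E1 E4 E1 + G E2 E4 E2 + #i * (G E1 E4 E2 - G E2 E4 E1).
Definition kXb : K := G E1 E3 E1 + G E2 E3 E2 - #i * (G E1 E3 E2 - G E2 E3 E1).
Definition kXbc : K := G E1 E3 E1 + G E2 E3 E2 + #i * (G E1 E3 E2 - G E2 E3 E1).
Definition keta1 : K := half * (G E3 E4 E1 + #i * G E3 E4 E2).
Definition keta1c : K := half * (G E3 E4 E1 - #i * G E3 E4 E2).
Definition ketab1 : K := half * (G E4 E3 E1 + #i * G E4 E3 E2).
Definition ketab1c : K := half * (G E4 E3 E1 - #i * G E4 E3 E2).
Definition ksX : K := half * (om E1 + #i * om E2).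
Definition kXi1 : K := half * om E4.
Definition kphi : K := F E1 E4 + #i * F E2 E4.
Definition kR : K := kric S E1 E4 + #i * kric S E2 E4.
Definition kal : K := Th E4 E1 + #i * Th E4 E2.

Ltac canon :=
  let H1 := fresh in let H2 := fresh in let H3 := fresh in let H4 := fresh in
  let H5 := fresh in let H6 := fresh in let H7 := fresh in let H8 := fresh in
  let H9 := fresh in let H10 := fresh in
  destruct (gam_canon S HS) as (H1 & H2 & H3 & H4 & H5 & H6 & H7 & H8 & H9 & H10);
  rewrite ?H1, ?H2, ?H3, ?H4, ?H5, ?H6, ?H7, ?H8, ?H9, ?H10;
  clear H1 H2 H3 H4 H5 H6 H7 H8 H9 H10.

Lemma riem_refl_lk l i j : Riem l l i j = #q 0.
Proof.
transitivity (half * (Riem l l i j + Riem l l i j)); [ring|].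
rewrite (riem_anti_lk S HS l l i j) at 1. ring.
Qed.
Lemma riem_refl_ij l k i : Riem l k i i = #q 0.
Proof.
transitivity (half * (Riem l k i i + Riem l k i i)); [ring|].
rewrite (riem_anti_ij S l k i i) at 1. ring.
Qed.

(** In each pair the larger index goes first, and the larger pair goes first. [ring] then treats
    symmetric components as one atom. *)
Ltac rcanon :=
  rewrite ?riem_refl_lk, ?riem_refl_ij;
  rewrite ?(riem_anti_lk S HS E1 E2), ?(riem_anti_lk S HS E1 E3), ?(riem_anti_lk S HS E1 E4),
    ?(riem_anti_lk S HS E2 E3), ?(riem_anti_lk S HS E2 E4), ?(riem_anti_lk S HS E3 E4);
  rewrite ?(fun l k => riem_anti_ij S l k E1 E2), ?(fun l k => riem_anti_ij S l k E1 E3),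
    ?(fun l k => riem_anti_ij S l k E1 E4), ?(fun l k => riem_anti_ij S l k E2 E3),
    ?(fun l k => riem_anti_ij S l k E2 E4), ?(fun l k => riem_anti_ij S l k E3 E4);
  rewrite ?(riem_pair S HS E2 E1 E3 E1), ?(riem_pair S HS E2 E1 E3 E2),
    ?(riem_pair S HS E2 E1 E4 E1), ?(riem_pair S HS E2 E1 E4 E2), ?(riem_pair S HS E2 E1 E4 E3),
    ?(riem_pair S HS E3 E1 E3 E2), ?(riem_pair S HS E3 E1 E4 E1), ?(riem_pair S HS E3 E1 E4 E2),
    ?(riem_pair S HS E3 E1 E4 E3), ?(riem_pair S HS E3 E2 E4 E1), ?(riem_pair S HS E3 E2 E4 E2),
    ?(riem_pair S HS E3 E2 E4 E3), ?(riem_pair S HS E4 E1 E4 E2), ?(riem_pair S HS E4 E1 E4 E3),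
    ?(riem_pair S HS E4 E2 E4 E3).

(** The Weyl and Ricci parts enter the pair [(e_3, e_4)] with equal signs and the pair [(e_1, e_2)],
    in [Th12], with opposite ones; together the two lemmas separate them. *)
Lemma Th34 : Th E3 E4 = #q 2 * kB S h1 + kR.
Proof.
unfold kB, kcplx1, kdual1, kbeta, kweyl, kR, kTh, kmink, ksumh, keps, emb.
rcanon. ring.
Qed.

(** The symmetry of the Ricci tensor is read off from Einstein's equation, whose right-hand side is
    visibly symmetric. *)
Lemma ric_sym_4 : kric S E4 E1 + #i * kric S E4 E2 = kR.
Proof.
assert (E := em_einstein S EM). unfold keinstein in E.
assert (E' : forall i j, kric S i j = #q 2 * ksum4 (fun l => F i l * kFfu S j l)
   - half * kmink i j * kF2 S).
{ intros i j. transitivity (kric S i j - #q 0); [ring|]. rewrite <- (E i j). ring. }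
unfold kR. rewrite !E'. unfold ksum4, kFfu, kraise, ksum4, kmink_inv, kmink.
rewrite (em_anti S EM E4 E1), (em_anti S EM E4 E2), (em_anti S EM E4 E3), (em_anti S EM E2 E1).
ring.
Qed.

Lemma Th12 : Th E1 E2 = half * #i * (#q 2 * kB S h1 - kR).
Proof.
transitivity (half * #i * (#q 2 * kB S h1 - kR) + #i * (kR - (kric S E4 E1 + #i * kric S E4 E2))).
2: { rewrite ric_sym_4. ring. }
unfold kB, kcplx1, kdual1, kbeta, kweyl, kR, kTh, kmink, ksumh, keps, emb.
unfold kric, ksum4, kmink_inv. rcanon. ring.
Qed.

Lemma sub_move (u v w : K) : u - v = w -> u = v + w.
Proof. intros <-. ring. Qed.
Lemma add_move (u v w : K) : u + v = w -> v = w - u.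
Proof. intros <-. ring. Qed.

(** Every small quantity becomes [eps] times a fresh witness, and the small sums and differences are
    solved for one component; [ring [E0]] then discards all quadratic products. *)
Ltac smalls :=
  let a1 := fresh "a" in let a2 := fresh "a" in let a3 := fresh "a" in let a4 := fresh "a" in
  let c1 := fresh "c" in let c2 := fresh "c" in let c3 := fresh "c" in let c4 := fresh "c" in
  let f1 := fresh "f" in let f2 := fresh "f" in let f3 := fresh "f" in let f4 := fresh "f" in
  destruct (D_xi S eps TD h1) as [a1 ?Ha]; destruct (D_xi S eps TD h2) as [a2 ?Ha];
  destruct (D_xib S eps TD h1) as [a3 ?Ha]; destruct (D_xib S eps TD h2) as [a4 ?Ha];
  destruct (D_chi1 S eps TD) as [c1 ?Hc]; destruct (D_chi2 S eps TD) as [c2 ?Hc];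
  destruct (D_chib1 S eps TD) as [c3 ?Hc]; destruct (D_chib2 S eps TD) as [c4 ?Hc];
  destruct (D_F4 S eps TD h1) as [f1 ?Hf]; destruct (D_F4 S eps TD h2) as [f2 ?Hf];
  destruct (D_F3 S eps TD h1) as [f3 ?Hf]; destruct (D_F3 S eps TD h2) as [f4 ?Hf];
  cbn [emb] in *;
  repeat match goal with
  | H : ksub _ _ = kmul eps _ |- _ => apply sub_move in H
  | H : kadd _ _ = kmul eps _ |- _ => apply add_move in H
  end.

Ltac rwsmall :=
  repeat match goal with
  | H : kgam S _ _ _ = _ |- _ => rewrite H; clear H
  | H : kFf S _ _ = _ |- _ => rewrite H; clear H
  end.

Lemma ric_T i j : kric S i j = #q 2 * ksum4 (fun l => F i l * kFfu S j l)
   - half * kmink i j * kF2 S.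
Proof.
transitivity (kric S i j - #q 0); [ring|].
rewrite <- (em_einstein S EM i j). unfold keinstein. ring.
Qed.

Lemma F_canon : (F E1 E1 = #q 0) /\ (F E2 E2 = #q 0) /\ (F E3 E3 = #q 0) /\ (F E4 E4 = #q 0)
  /\ F E2 E1 = - F E1 E2 /\ F E3 E1 = - F E1 E3 /\ F E4 E1 = - F E1 E4
  /\ F E3 E2 = - F E2 E3 /\ F E4 E2 = - F E2 E4 /\ F E4 E3 = - F E3 E4.
Proof.
assert (Z : forall i, F i i = #q 0).
{ intros i. transitivity (half * (F i i + F i i)); [ring|].
  rewrite (em_anti S EM i i) at 1. ring. }
repeat split; try apply Z; apply (em_anti S EM).
Qed.

Ltac fcanon :=
  let H1 := fresh in let H2 := fresh in let H3 := fresh in let H4 := fresh in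
  let H5 := fresh in let H6 := fresh in let H7 := fresh in let H8 := fresh in
  let H9 := fresh in let H10 := fresh in
  destruct F_canon as (H1 & H2 & H3 & H4 & H5 & H6 & H7 & H8 & H9 & H10);
  rewrite ?H1, ?H2, ?H3, ?H4, ?H5, ?H6, ?H7, ?H8, ?H9, ?H10;
  clear H1 H2 H3 H4 H5 H6 H7 H8 H9 H10.

Ltac Tunfold :=
  rewrite !ric_T; unfold kF2, ksum4, kFfu, kraise, ksum4, kmink_inv, kmink; fcanon.

Lemma kR_phi : kR = #q 2 * kPFc S * kphi.
Proof.
smalls. unfold kR, kPFc, krhoF, krhoF_star, kphi. Tunfold. ring.
Qed.

Lemma ric44 : kric S E4 E4 = #q 0.
Proof.
assert (E0 := eps_sq S eps TD).
smalls. Tunfold. rwsmall. ring [E0].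
Qed.

Lemma ric34 : kric S E3 E4 = #q 2 * kPF S * kPFc S.
Proof.
assert (E0 := eps_sq S eps TD).
smalls. unfold kPF, kPFc, krhoF, krhoF_star. Tunfold. rwsmall. ring [E0].
Qed.

(** The electromagnetic stress tensor is traceless in dimension four. *)
Lemma kscal0 : kscal S = #q 0.
Proof. unfold kscal, ksum4. Tunfold. ring. Qed.

(** This combination is a pure trace, a Ricci component quadratic in [beta_F]. Hence [kal] alone
    describes the curvature [Th] along [e_4]; similarly for [e_3] in [Th3d]. *)
Lemma Th4db : Th E4 E1 - #i * Th E4 E2 = #q 0.
Proof.
transitivity (- kric S E4 E4).
- unfold kTh, kric, ksum4, kmink_inv. rcanon. ring.
- rewrite ric44. ring.
Qed.

Lemma Th3d : Th E3 E1 + #i * Th E3 E2 = #q 0.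
Proof.
transitivity (kric S E1 E1 - kric S E2 E2 + #i * (kric S E1 E2 + kric S E2 E1)).
- unfold kTh, kric, ksum4, kmink_inv. rcanon. ring.
- assert (E0 := eps_sq S eps TD). smalls. Tunfold. rwsmall. ring [E0].
Qed.

Lemma Ups4d : Ups E4 E1 + #i * Ups E4 E2 = - (#q 2 * kB S h1).
Proof.
transitivity (#i * Th E1 E2 - half * Th E3 E4).
- unfold kUps, kTh. rcanon. ring.
- rewrite Th12, Th34. ring.
Qed.

Lemma Pc_Ups : kPc S = half * (Ups E3 E4 - kric S E3 E4).
Proof.
unfold kPc, krho, krho_star, kweyl, kUps. rewrite kscal0.
replace (kric S E4 E3) with (kric S E3 E4).
- unfold kmink. rcanon. ring.
- Tunfold. ring.
Qed.

(** Structure equations for the pairs [(e_4, e_1)] and [(e_4, e_2)], combined. The remaining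
    combination of [kom] is the trace of chi, so only its products with shear and [Xi] survive. *)
Lemma ricci_shear :
  kal = #q 2 * e E4 ksX + #q 2 * (#q 2 * #i * W E4 + half * z E4) * ksX
   + (kX + kXc) * ksX - #q 2 * (e E1 kXi1 + #i * e E2 kXi1)
   - #q 2 * (#i * (W E1 + #i * W E2) + (z E1 + #i * z E2) + keta1 + ketab1) * kXi1.
Proof.
assert (E0 := eps_sq S eps TD).
unfold kal, ksX, kXi1. rewrite !(cartan1 S HS).
repeat (rewrite e_add || rewrite e_mul || rewrite e_kc).
(* The derivatives are abstracted first: [kom] must be expanded into small witnesses outside the
   derivatives but not inside them. *)
assert (A1 : exists v, e E1 (om E4) = v) by eauto.
assert (A2 : exists v, e E2 (om E4) = v) by eauto.
assert (A3 : exists v, e E4 (om E1) = v) by eauto.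
assert (A4 : exists v, e E4 (om E2) = v) by eauto.
destruct A1 as [v1 A1], A2 as [v2 A2], A3 as [v3 A3], A4 as [v4 A4].
rewrite A1, A2, A3, A4. clear A1 A2 A3 A4.
unfold ksum4, kcc, kgamu, kraise, ksum4, kmink_inv, kGa, kom, kW, kz2, keta1, ketab1, kX, kXc.
canon. smalls. rwsmall. ring [E0].
Qed.

Ltac atoms :=
  repeat match goal with
  | |- context [ked S ?i (kFf S ?a ?b)] => let v := fresh "v" in
      generalize (ked S i (kFf S a b)); intros v
  end.

(** The divergence equation for [F] along [e_4] and the closedness equation on [(e_4, e_1, e_2)],
    the latter multiplied by [i], form one equation for [P_F]. *)
Lemma maxwell_4 :
  e E4 (kPF S) + kXc * kPF S
  = e E1 kphi - #i * e E2 kphi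
    + (#i * (W E1 - #i * W E2) + half * (z E1 - #i * z E2) + ketab1c) * kphi.
Proof.
assert (E0 := eps_sq S eps TD).
assert (M := em_maxwell S EM E4). assert (B := em_bianchi S EM E4 E1 E2).
match goal with |- ?l = ?r =>
  transitivity (r - kmaxwell S E4 - #i * kbianchi S E4 E1 E2); [|rewrite M, B; ring] end.
clear M B.
unfold kmaxwell, kbianchi, kDF, kPF, krhoF, krhoF_star, kphi.
unfold ksum4, kmink_inv. fcanon.
repeat (rewrite e_add || rewrite e_mul || rewrite e_opp || rewrite e_kc).
atoms.
unfold kgamu, kraise, ksum4, kmink_inv, kW, kz2, ketab1c, kXc.
canon. smalls. rwsmall. ring [E0].
Qed.

(** The same combination of divergence and closedness equations in the direction [e_1 + i e_2]. *)
Lemma maxwell_d :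
  e E1 (kPF S) + #i * e E2 (kPF S) + #q 2 * keta1 * kPF S
  = e E3 kphi + (#i * W E3 + half * z E3 + half * kXb) * kphi.
Proof.
assert (E0 := eps_sq S eps TD).
assert (M1 := em_maxwell S EM E1). assert (B1 := em_bianchi S EM E1 E3 E4).
assert (M2 := em_maxwell S EM E2). assert (B2 := em_bianchi S EM E2 E3 E4).
match goal with |- ?l = ?r =>
  transitivity (r + (half * kbianchi S E1 E3 E4 - kmaxwell S E1)
    + #i * (half * kbianchi S E2 E3 E4 - kmaxwell S E2)); [|rewrite M1, B1, M2, B2; ring] end.
clear M1 B1 M2 B2.
unfold kmaxwell, kbianchi, kDF, kPF, krhoF, krhoF_star, kphi.
unfold ksum4, kmink_inv. fcanon.
repeat (rewrite e_add || rewrite e_mul || rewrite e_opp || rewrite e_kc).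
atoms.
unfold kgamu, kraise, ksum4, kmink_inv, kW, kz2, keta1, kXb.
canon. smalls. rwsmall. ring [E0].
Qed.

Ltac gen_om :=
  repeat match goal with
  | |- context [ked S ?i (kom S ?b)] => let v := fresh "v" in
      generalize (ked S i (kom S b)); intros v
  end.

(* The commutator of [e_4] and [e_1 + i e_2] applied to a scalar [P]: the
   derivatives of [tr X] and [H] are eliminated by the Cartan equations. *)
Lemma integrability (P : K) :
  let M4 := e E4 P + kXc * P in
  let Md := e E1 P + #i * e E2 P + #q 2 * keta1 * P in
  P * (#q 4 * kB S h1
    + #q 2 * (e E1 ksX - #i * e E2 ksX + (#q 2 * #i * (W E1 - #i * W E2) + half * (z E1 - #i * z E2)) * ksX)
    - #q 2 * (e E3 kXi1 + (#i * W E3 + z E3) * kXi1)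
    + (kXb - kXbc) * kXi1 + #q 2 * (keta1c - ketab1c) * ksX)
  + ksX * (e E1 P - #i * e E2 P) - kXi1 * e E3 P
  + e E4 Md + kXc * Md + (#i * W E4 + half * kX) * Md
  - (e E1 M4 + #i * e E2 M4) - #q 2 * keta1 * M4
  - (ketab1 + half * (z E1 + #i * z E2)) * M4 = #q 0.
Proof.
intros M4 Md.
assert (E0 := eps_sq S eps TD).
(* In this combination of [Th34] and [Th12] the Ricci term cancels, so the Weyl component is
   expressed by connection coefficients alone. *)
assert (HB : #q 4 * kB S h1 = Th E3 E4 - #q 2 * #i * Th E1 E2).
{ rewrite (Th34), (Th12). ring. }
rewrite HB. rewrite !(cartan1 S HS). clear HB.
assert (T : keta1 = half * om E3).
{ unfold keta1, kom. ring. }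
assert (T' : kXc = om E1 - #i * om E2).
{ unfold kXc, kom. ring. }
unfold M4, Md. rewrite T, T'. clear T T'. unfold ksX, kXi1.
repeat (rewrite e_add || rewrite e_sub || rewrite e_mul || rewrite e_kc).
rewrite (ked_comm S HS E4 E1 P), (ked_comm S HS E4 E2 P).
unfold ksum4.
gen_om.
generalize (e E1 (e E4 P)) (e E2 (e E4 P)) (e E1 P) (e E2 P) (e E3 P) (e E4 P).
intros.
unfold ksum4, kcc, kgamu, kraise, ksum4, kmink_inv, kGa, kom, kW, kz2, keta1c, ketab1, ketab1c, kX, kXc, kXb, kXbc.
canon. smalls. rwsmall. ring [E0].
Qed.

Lemma Th_anti i j : Th i j = - Th j i.
Proof. unfold kTh. rewrite (riem_anti_ij S E4 E1 i j), (riem_anti_ij S E4 E2 i j). ring. Qed.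
Lemma Ups_anti i j : Ups i j = - Ups j i.
Proof. unfold kUps. rewrite (riem_anti_ij S E2 E1 i j), (riem_anti_ij S E3 E4 i j). ring. Qed.
Lemma Th_diag i : Th i i = #q 0.
Proof. unfold kTh. rewrite !(riem_refl_ij). ring. Qed.

Lemma Th_components :
  Th E4 E1 = half * kal /\ Th E4 E2 = - half * #i * kal /\
  Th E3 E1 = half * (Th E3 E1 - #i * Th E3 E2) /\
  Th E3 E2 = half * #i * (Th E3 E1 - #i * Th E3 E2).
Proof.
assert (H1 := Th4db). assert (H2 := Th3d). unfold kal.
repeat split.
- transitivity (half * (Th E4 E1 + #i * Th E4 E2) + half * (Th E4 E1 - #i * Th E4 E2)); [ring|].
  rewrite H1. ring.
- transitivity (- half * #i * (Th E4 E1 + #i * Th E4 E2) + half * #i * (Th E4 E1 - #i * Th E4 E2)); [ring|].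
  rewrite H1. ring.
- transitivity (half * (Th E3 E1 + #i * Th E3 E2) + half * (Th E3 E1 - #i * Th E3 E2)); [ring|].
  rewrite H2. ring.
- transitivity (- half * #i * (Th E3 E1 + #i * Th E3 E2) + half * #i * (Th E3 E1 - #i * Th E3 E2)); [ring|].
  rewrite H2. ring.
Qed.

(** [kom] along horizontal directions is chi: its shear is [ksX], and its trace part is the
    conjugate of [tr X]. *)
Lemma kom_E1 : om E1 = ksX + half * kXc.
Proof. unfold ksX, kXc, kom. ring. Qed.
Lemma kom_E2 : om E2 = - #i * ksX + half * #i * kXc.
Proof. unfold ksX, kXc, kom. ring. Qed.
Lemma kXi_small : exists v, kXi1 = eps * v.
Proof.
unfold kXi1, kom. destruct (D_xi S eps TD h1) as [v1 H1], (D_xi S eps TD h2) as [v2 H2].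
cbn [emb] in *. exists (half * (v1 + #i * v2)).
destruct (gam_canon S HS) as (_ & _ & _ & _ & _ & _). rewrite H1, H2. ring.
Qed.
Lemma ksX_small : exists v, ksX = eps * v.
Proof.
unfold ksX, kom. destruct (D_chi1 S eps TD) as [v1 H1], (D_chi2 S eps TD) as [v2 H2].
apply sub_move in H1. apply add_move in H2.
exists (half * (v1 + #i * v2)). rewrite H1, H2. ring.
Qed.

(** Second Bianchi identity on the triple [(e_4, e_1, e_2)]: transport of beta along [e_4] against
    the divergence of alpha. The background Weyl curvature survives only as the coefficient of
    [Xi]. *)
Lemma bianchi_1 :
  #q 2 * (e E4 (kB S h1) + (Ga E4 + #q 2 * kXc) * kB S h1)
  - (e E4 kR + (Ga E4 + kX) * kR)
  + (e E1 kal - #i * e E2 kal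
     + (#q 2 * #i * (W E1 - #i * W E2) + (z E1 - #i * z E2) + ketab1c) * kal)
  - kXi1 * (Th E3 E1 - #i * Th E3 E2 - #q 4 * #i * Ups E1 E2) = #q 0.
Proof.
assert (E0 := eps_sq S eps TD).
assert (B := bianchi_cartan S HS E4 E1 E2).
destruct Th_components as (T1 & T2 & T3 & T4).
assert (U := Ups4d).
destruct (D_ups4 S eps TD) as [u Hu].
(* [Ups4d] gives one complex combination of the two components and [D_ups4] the other, up to the
   irrelevant small [u]; both components are solved for. *)
assert (U1 : Ups E4 E1 = - kB S h1 + half * (eps * u)) by (rewrite <- Hu;
  transitivity (half * (Ups E4 E1 + #i * Ups E4 E2) + half * (Ups E4 E1 - #i * Ups E4 E2)); [ring|];
  rewrite U; ring).
assert (U2 : Ups E4 E2 = #i * kB S h1 + half * #i * (eps * u)) by (rewrite <- Hu;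
  transitivity (- half * #i * (Ups E4 E1 + #i * Ups E4 E2) + half * #i * (Ups E4 E1 - #i * Ups E4 E2)); [ring|];
  rewrite U; ring).
unfold ksum4 in B.
rewrite !Th_diag, (Th_anti E2 E4), (Th_anti E1 E4), (Th_anti E2 E1), (Ups_anti E2 E4) in B.
set (t3 := Th E3 E1 - #i * Th E3 E2) in *.
rewrite T1, T2, T3, T4, (Th34), (Th12), U1, U2 in B.
(* In the cyclic sum beta enters through [Th E1 E2] with coefficient [i]; the factor [-2 i]
   normalises it to 2. *)
transitivity (#q (-2) * #i * #q 0 : K); [rewrite <- B|ring].
clear B T1 T2 T3 T4 U U1 U2 Hu.
repeat (rewrite e_add || rewrite e_sub || rewrite e_opp || rewrite e_mul || rewrite e_kc).
rewrite kom_E1, kom_E2.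
assert (OX : om E4 = #q 2 * kXi1) by (unfold kXi1; ring). rewrite OX.
generalize (e E4 (kB S h1)) (e E4 kR) (e E1 kal) (e E2 kal). generalize (kB S h1) kR kal.
intros.
destruct kXi_small as [x Hx], ksX_small as [y Hy].
rewrite Hy.
assert (Hx' : kXi1 = half * (G E4 E4 E1 + #i * G E4 E4 E2)) by (unfold kXi1, kom; ring).
rewrite Hx'.
unfold kcc, kgamu, kraise, ksum4, kmink_inv, kGa, kW, kz2, ketab1c, kX, kXc.
canon. smalls. rwsmall. ring [E0].
Qed.

(** Second Bianchi identity on [(e_3, e_4, e_1)] plus [i] times the one on [(e_3, e_4, e_2)]. In
    this sum the derivative of the background curvature [t3] drops out, leaving transport of alpha
    along [e_3]. *)
Lemma bianchi_2 :
  e E3 kal + (#q 2 * #i * W E3 + z E3 + half * kXb) * kal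
  + #q 2 * (e E1 (kB S h1) + #i * e E2 (kB S h1)
            + (Ga E1 + #i * Ga E2 + #q 4 * keta1) * kB S h1)
  + (e E1 kR + #i * e E2 kR + (Ga E1 + #i * Ga E2 + #q 2 * ketab1) * kR)
  - ksX * (Th E3 E1 - #i * Th E3 E2 + #q 2 * Ups E3 E4) = #q 0.
Proof.
assert (E0 := eps_sq S eps TD).
assert (B1 := bianchi_cartan S HS E3 E4 E1). assert (B2 := bianchi_cartan S HS E3 E4 E2).
destruct Th_components as (T1 & T2 & T3 & T4).
assert (U := Ups4d).
destruct (D_ups4 S eps TD) as [u Hu]. destruct (D_ups3 S eps TD) as [w Hw].
assert (U1 : Ups E4 E1 = - kB S h1 + half * (eps * u)) by (rewrite <- Hu;
  transitivity (half * (Ups E4 E1 + #i * Ups E4 E2) + half * (Ups E4 E1 - #i * Ups E4 E2)); [ring|];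
  rewrite U; ring).
assert (U2 : Ups E4 E2 = #i * kB S h1 + half * #i * (eps * u)) by (rewrite <- Hu;
  transitivity (- half * #i * (Ups E4 E1 + #i * Ups E4 E2) + half * #i * (Ups E4 E1 - #i * Ups E4 E2)); [ring|];
  rewrite U; ring).
assert (U3 : Ups E3 E2 = - #i * (eps * w) + #i * Ups E3 E1) by (rewrite <- Hw; ring).
unfold ksum4 in B1, B2.
rewrite !Th_diag, ?(Th_anti E1 E3), ?(Th_anti E1 E4), ?(Th_anti E2 E3), ?(Th_anti E2 E4), ?(Th_anti E2 E1), ?(Th_anti E4 E3), !(Ups_anti E1 E3) in B1.
rewrite !Th_diag, ?(Th_anti E1 E3), ?(Th_anti E1 E4), ?(Th_anti E2 E3), ?(Th_anti E2 E4), ?(Th_anti E2 E1), ?(Th_anti E4 E3), !(Ups_anti E2 E3) in B2.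
set (t3 := Th E3 E1 - #i * Th E3 E2) in *.
rewrite ?T1, ?T2, ?T3, ?T4, ?(Th34), ?(Th12), ?U1 in B1.
rewrite ?T1, ?T2, ?T3, ?T4, ?(Th34), ?(Th12), ?U2, ?U3 in B2.
match type of B1 with ?l1 = _ => match type of B2 with ?l2 = _ =>
  transitivity (l1 + #i * l2); [|rewrite B1, B2; ring] end end.
clear B1 B2 T1 T2 T3 T4 U U1 U2 U3 Hu Hw.
repeat (rewrite e_add || rewrite e_sub || rewrite e_opp || rewrite e_mul || rewrite e_kc).
rewrite kom_E1, kom_E2.
assert (OX : om E4 = #q 2 * kXi1) by (unfold kXi1; ring).
assert (OH : om E3 = #q 2 * keta1) by (unfold keta1, kom; ring). rewrite OX, OH.
generalize (e E1 (kB S h1)) (e E2 (kB S h1)) (e E1 kR) (e E2 kR) (e E3 kal) (e E4 t3).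
generalize (kB S h1) kR kal t3 (Ups E3 E4) (Ups E3 E1). intros.
destruct ksX_small as [y Hy].
assert (Hy' : ksX = half * (G E1 E4 E1 - G E2 E4 E2 + #i * (G E1 E4 E2 + G E2 E4 E1)))
  by (unfold ksX, kom; ring).
assert (Hx' : kXi1 = half * (G E4 E4 E1 + #i * G E4 E4 E2)) by (unfold kXi1, kom; ring).
rewrite Hx', Hy'.
unfold kcc, kgamu, kraise, ksum4, kmink_inv, kGa, kW, kz2, keta1, ketab1, kX, kXc, kXb.
canon. smalls. rwsmall. ring [E0].
Qed.
End LinearEquations.
End FieldEquations.

(** * The operator calculus of the Kerr-Newman background *)

Module Operators.
Import DifferentialRings FrameGeometry.
Open Scope dr_scope.

(* The background with [q], [qbar], [Delta], [a sin theta], [cot theta], [1 / |q|] as independent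
   symbols; [Dp], [Dm] and [Lp], [Lm] are Chandrasekhar's radial and angular operators
   [d_r +- ((r^2 + a^2) d_t + a d_phi) / Delta], [d_theta +- i (a sin d_t + d_phi / sin)]. *)
Record kncalc (K : dring) := Kncalc {
  kq : K; kiq : K; kqb : K; kiqb : K; kDl : K; kiDl : K;
  ktau : K; kct : K; kim : K; kM : K; kQ : K;
  Dp : K -> K; Dm : K -> K; Lp : K -> K; Lm : K -> K; Tt : K -> K;
  q_iq : kq * kiq = #q 1;
  qb_iqb : kqb * kiqb = #q 1;
  Dl_iDl : kDl * kiDl = #q 1;
  im_im : kim * kim = kiq * kiqb;
  tau_ct : ktau * kct = - #q (1#2) * #i * (kq - kqb);
  Q_Q : kQ * kQ = kDl - kq * kqb + kM * (kq + kqb) - ktau * ktau;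
  Dp_der : derivation Dp;
  Dm_der : derivation Dm;
  Lp_der : derivation Lp;
  Lm_der : derivation Lm;
  Tt_der : derivation Tt;
  Dp_q : Dp kq = #q 1;
  Dm_q : Dm kq = #q 1;
  Lp_q : Lp kq = - #i * ktau;
  Lm_q : Lm kq = - #i * ktau;
  Tt_q : Tt kq = #q 0;
  Dp_qb : Dp kqb = #q 1;
  Dm_qb : Dm kqb = #q 1;
  Lp_qb : Lp kqb = #i * ktau;
  Lm_qb : Lm kqb = #i * ktau;
  Tt_qb : Tt kqb = #q 0;
  Dp_Dl : Dp kDl = (kq + kqb - #q 2 * kM);
  Dm_Dl : Dm kDl = (kq + kqb - #q 2 * kM);
  Lp_Dl : Lp kDl = #q 0;
  Lm_Dl : Lm kDl = #q 0;
  Tt_Dl : Tt kDl = #q 0;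
  Dp_tau : Dp ktau = #q 0;
  Dm_tau : Dm ktau = #q 0;
  Lp_tau : Lp ktau = (- #q (1#2) * #i * (kq - kqb));
  Lm_tau : Lm ktau = (- #q (1#2) * #i * (kq - kqb));
  Tt_tau : Tt ktau = #q 0;
  Dp_ct : Dp kct = #q 0;
  Dm_ct : Dm kct = #q 0;
  Lp_ct : Lp kct = - (#q 1 + kct * kct);
  Lm_ct : Lm kct = - (#q 1 + kct * kct);
  Tt_ct : Tt kct = #q 0;
  Dp_im : Dp kim = - #q (1#2) * kim * (kiq + kiqb);
  Dm_im : Dm kim = - #q (1#2) * kim * (kiq + kiqb);
  Lp_im : Lp kim = #q (1#2) * #i * ktau * kim * (kiq - kiqb);
  Lm_im : Lm kim = #q (1#2) * #i * ktau * kim * (kiq - kiqb);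
  Tt_im : Tt kim = #q 0;
  Dp_M : Dp kM = #q 0;
  Dm_M : Dm kM = #q 0;
  Lp_M : Lp kM = #q 0;
  Lm_M : Lm kM = #q 0;
  Tt_M : Tt kM = #q 0;
  Dp_Q : Dp kQ = #q 0;
  Dm_Q : Dm kQ = #q 0;
  Lp_Q : Lp kQ = #q 0;
  Lm_Q : Lm kQ = #q 0;
  Tt_Q : Tt kQ = #q 0;
  Dp_Lp : forall u, Dp (Lp u) = Lp (Dp u);
  Dp_Lm : forall u, Dp (Lm u) = Lm (Dp u);
  Dm_Lp : forall u, Dm (Lp u) = Lp (Dm u);
  Dm_Lm : forall u, Dm (Lm u) = Lm (Dm u);
  Tt_word : forall u, Tt u = kiq * kiqb * (#q (1#2) * kDl * (Dp u - Dm u)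
      + #q (1#2) * #i * ktau * (Lp u - Lm u));
  Dp_Dm : forall u, Dp (Dm u) = Dm (Dp u) - #q 2 * (kq + kqb) * kiDl * Tt u
      + (kq + kqb - #q 2 * kM) * kiDl * (Dp u - Dm u);
  Lp_Lm : forall u, Lp (Lm u) = Lm (Lp u) + kct * (Lp u - Lm u) - #q 2 * (kq - kqb) * Tt u
}.
Arguments kq {_}.
Arguments kqb {_}.
Arguments kiq {_}.
Arguments kiqb {_}.
Arguments kDl {_}.
Arguments kiDl {_}.
Arguments ktau {_}.
Arguments kct {_}.
Arguments kim {_}.
Arguments kM {_}.
Arguments kQ {_}.
Arguments Dp {_}.
Arguments Dm {_}.
Arguments Lp {_}.
Arguments Lm {_}.
Arguments Tt {_}.

Section KN.
Context {K : dring} (N : kncalc K).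
Add Ring KringN : (kth K) (morphism (kc_morph K), constants [kcst]).

Local Notation kq := (kq N).
Local Notation kqb := (kqb N).
Local Notation kiq := (kiq N).
Local Notation kiqb := (kiqb N).
Local Notation kDl := (kDl N).
Local Notation kiDl := (kiDl N).
Local Notation ktau := (ktau N).
Local Notation kct := (kct N).
Local Notation kim := (kim N).
Local Notation kM := (kM N).
Local Notation kQ := (kQ N).
Local Notation Dp := (Dp N).
Local Notation Dm := (Dm N).
Local Notation Lp := (Lp N).
Local Notation Lm := (Lm N).
Local Notation Tt := (Tt N).
Lemma Dm_add (u v : K) : Dm (u + v) = Dm u + Dm v.
Proof. apply (der_add _ (Dm_der _ N)). Qed.
Lemma Dm_opp (u : K) : Dm (- u) = - Dm u.
Proof. apply (der_opp _ (Dm_der _ N)). Qed.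
Lemma Dm_mul (u v : K) : Dm (u * v) = Dm u * v + u * Dm v.
Proof. apply (der_mul _ (Dm_der _ N)). Qed.
Lemma Dm_kc c : Dm (kc c) = #q 0.
Proof. apply (der_kc _ (Dm_der _ N)). Qed.
Lemma Lp_add (u v : K) : Lp (u + v) = Lp u + Lp v.
Proof. apply (der_add _ (Lp_der _ N)). Qed.
Lemma Lp_sub (u v : K) : Lp (u - v) = Lp u - Lp v.
Proof. apply (der_sub _ (Lp_der _ N)). Qed.
Lemma Lp_mul (u v : K) : Lp (u * v) = Lp u * v + u * Lp v.
Proof. apply (der_mul _ (Lp_der _ N)). Qed.
Lemma Lp_kc c : Lp (kc c) = #q 0.
Proof. apply (der_kc _ (Lp_der _ N)). Qed.
Lemma Lm_add (u v : K) : Lm (u + v) = Lm u + Lm v.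
Proof. apply (der_add _ (Lm_der _ N)). Qed.
Lemma Lm_opp (u : K) : Lm (- u) = - Lm u.
Proof. apply (der_opp _ (Lm_der _ N)). Qed.
Lemma Lm_mul (u v : K) : Lm (u * v) = Lm u * v + u * Lm v.
Proof. apply (der_mul _ (Lm_der _ N)). Qed.

(** Inverses are independent symbols tied by [u * v = 1]; differentiating this relation replaces the
    quotient rule. *)
Lemma der_inv (d : K -> K) (dd : derivation d) u v : u * v = #q 1 -> d v = - (v * v * d u).
Proof.
intros H. assert (E : d (u * v) = #q 0) by (rewrite H; apply (der_kc _ dd)).
rewrite (der_mul _ dd) in E.
transitivity (v * (d u * v + u * d v) - v * v * d u + (#q 1 - u * v) * d v); [ring|].
rewrite E, H. ring.
Qed.

Lemma Dp_iq : Dp kiq = - (kiq * kiq * (#q 1)).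
Proof. rewrite (der_inv _ (Dp_der _ N) _ _ (q_iq _ N)). now rewrite (Dp_q _ N). Qed.
Lemma Dp_iqb : Dp kiqb = - (kiqb * kiqb * (#q 1)).
Proof. rewrite (der_inv _ (Dp_der _ N) _ _ (qb_iqb _ N)). now rewrite (Dp_qb _ N). Qed.
Lemma Dp_iDl : Dp kiDl = - (kiDl * kiDl * ((kq + kqb - #q 2 * kM))).
Proof. rewrite (der_inv _ (Dp_der _ N) _ _ (Dl_iDl _ N)). now rewrite (Dp_Dl _ N). Qed.
Lemma Dm_iq : Dm kiq = - (kiq * kiq * (#q 1)).
Proof. rewrite (der_inv _ (Dm_der _ N) _ _ (q_iq _ N)). now rewrite (Dm_q _ N). Qed.
Lemma Dm_iqb : Dm kiqb = - (kiqb * kiqb * (#q 1)).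
Proof. rewrite (der_inv _ (Dm_der _ N) _ _ (qb_iqb _ N)). now rewrite (Dm_qb _ N). Qed.
Lemma Dm_iDl : Dm kiDl = - (kiDl * kiDl * ((kq + kqb - #q 2 * kM))).
Proof. rewrite (der_inv _ (Dm_der _ N) _ _ (Dl_iDl _ N)). now rewrite (Dm_Dl _ N). Qed.
Lemma Lp_iq : Lp kiq = - (kiq * kiq * (- #i * ktau)).
Proof. rewrite (der_inv _ (Lp_der _ N) _ _ (q_iq _ N)). now rewrite (Lp_q _ N). Qed.
Lemma Lp_iqb : Lp kiqb = - (kiqb * kiqb * (#i * ktau)).
Proof. rewrite (der_inv _ (Lp_der _ N) _ _ (qb_iqb _ N)). now rewrite (Lp_qb _ N). Qed.
Lemma Lp_iDl : Lp kiDl = - (kiDl * kiDl * (#q 0)).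
Proof. rewrite (der_inv _ (Lp_der _ N) _ _ (Dl_iDl _ N)). now rewrite (Lp_Dl _ N). Qed.
Lemma Lm_iq : Lm kiq = - (kiq * kiq * (- #i * ktau)).
Proof. rewrite (der_inv _ (Lm_der _ N) _ _ (q_iq _ N)). now rewrite (Lm_q _ N). Qed.
Lemma Lm_iqb : Lm kiqb = - (kiqb * kiqb * (#i * ktau)).
Proof. rewrite (der_inv _ (Lm_der _ N) _ _ (qb_iqb _ N)). now rewrite (Lm_qb _ N). Qed.
Lemma Lm_iDl : Lm kiDl = - (kiDl * kiDl * (#q 0)).
Proof. rewrite (der_inv _ (Lm_der _ N) _ _ (Dl_iDl _ N)). now rewrite (Lm_Dl _ N). Qed.
Lemma Tt_iq : Tt kiq = - (kiq * kiq * (#q 0)).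
Proof. rewrite (der_inv _ (Tt_der _ N) _ _ (q_iq _ N)). now rewrite (Tt_q _ N). Qed.
Lemma Tt_iqb : Tt kiqb = - (kiqb * kiqb * (#q 0)).
Proof. rewrite (der_inv _ (Tt_der _ N) _ _ (qb_iqb _ N)). now rewrite (Tt_qb _ N). Qed.
Lemma Tt_iDl : Tt kiDl = - (kiDl * kiDl * (#q 0)).
Proof. rewrite (der_inv _ (Tt_der _ N) _ _ (Dl_iDl _ N)). now rewrite (Tt_Dl _ N). Qed.
End KN.
End Operators.

(** * Normal forms of words in the operators *)

Module NormalForms.
Import DifferentialRings FrameGeometry Operators.
Open Scope dr_scope.

(* Normalisation by reflection: the expansions needed for the wave equations are too large
   for rewriting. *)
Inductive kop := oDp | oDm | oLp | oLm | oTt.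
Inductive katom := aq | aiq | aqb | aiqb | aDl | aiDl | atau | act | aim | aM | aQ.
Inductive kex :=
  | Ec (c : QI) | Ea (a : katom) | Eu (n : nat)
  | Eadd (x y : kex) | Esub (x y : kex) | Emul (x y : kex) | Eopp (x : kex)
  | Eop (o : kop) (x : kex).

Definition qi (n : Q) : QI := (n, 0%Q).
(** Zeros and ones created by differentiation are removed at once; third-order expansions would
    otherwise fill up with trivial terms. *)
Definition sadd (x y : kex) : kex :=
  match x, y with
  | Ec c, _ => if qi_eqb c (0%Q, 0%Q) then y else Eadd x y
  | _, Ec c => if qi_eqb c (0%Q, 0%Q) then x else Eadd x y
  | _, _ => Eadd x y
  end.
Definition sopp (x : kex) : kex :=
  match x with Ec c => Ec (qi_opp c) | Eopp y => y | _ => Eopp x end.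
Definition smul (x y : kex) : kex :=
  match x, y with
  | Ec c, Ec d => Ec (qi_mul c d)
  | Ec c, _ => if qi_eqb c (0%Q, 0%Q) then Ec (0%Q, 0%Q)
               else if qi_eqb c (1%Q, 0%Q) then y else Emul x y
  | _, Ec c => if qi_eqb c (0%Q, 0%Q) then Ec (0%Q, 0%Q)
               else if qi_eqb c (1%Q, 0%Q) then x else Emul x y
  | _, _ => Emul x y
  end.

(** [Eac] is [a cos theta]; [EdDl] is the radial derivative [2 r - 2 M] of [Delta]. *)
Definition Eac : kex := Emul (Ec (0%Q, (-(1#2))%Q)) (Esub (Ea aq) (Ea aqb)).
Definition EdDl : kex := Esub (Eadd (Ea aq) (Ea aqb)) (Emul (Ec (qi 2)) (Ea aM)).
Definition Esq (a : katom) : kex := Emul (Ea a) (Ea a).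

Definition atom_diff (o : kop) (a : katom) : kex :=
  match o, a with
  | oTt, _ => Ec (qi 0)
  | _, aM | _, aQ => Ec (qi 0)
  | (oDp | oDm), (aq | aqb) => Ec (qi 1)
  | (oDp | oDm), aiq => Eopp (Esq aiq)
  | (oDp | oDm), aiqb => Eopp (Esq aiqb)
  | (oDp | oDm), aDl => EdDl
  | (oDp | oDm), aiDl => Eopp (Emul (Esq aiDl) EdDl)
  | (oDp | oDm), aim => Emul (Ec (qi (-(1#2)))) (Emul (Ea aim) (Eadd (Ea aiq) (Ea aiqb)))
  | (oDp | oDm), (atau | act) => Ec (qi 0)
  | (oLp | oLm), aq => Emul (Ec (0%Q, (-(1))%Q)) (Ea atau)
  | (oLp | oLm), aqb => Emul (Ec (0%Q, 1%Q)) (Ea atau)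
  | (oLp | oLm), aiq => Emul (Ec (0%Q, 1%Q)) (Emul (Ea atau) (Esq aiq))
  | (oLp | oLm), aiqb => Emul (Ec (0%Q, (-(1))%Q)) (Emul (Ea atau) (Esq aiqb))
  | (oLp | oLm), (aDl | aiDl) => Ec (qi 0)
  | (oLp | oLm), atau => Eac
  | (oLp | oLm), act => Eopp (Eadd (Ec (qi 1)) (Esq act))
  | (oLp | oLm), aim =>
      Emul (Ec (0%Q, (1#2)%Q)) (Emul (Ea atau) (Emul (Ea aim) (Esub (Ea aiq) (Ea aiqb))))
  end.

Section Normal.
Context (R : kex).

(* The unknown number 2 is subject to the equation [Dm u2 = R]. *)
Fixpoint ediff (fuel : nat) (o : kop) (e : kex) : kex :=
  match fuel with
  | O => Eop o e
  | Datatypes.S n =>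
    let d := ediff n in
    match e with
    | Ec _ => Ec (qi 0)
    | Ea a => atom_diff o a
    | Eadd x y => sadd (d o x) (d o y)
    | Esub x y => sadd (d o x) (sopp (d o y))
    | Eopp x => sopp (d o x)
    | Emul x y => sadd (smul (d o x) y) (smul x (d o y))
    | Eu u =>
      match o, u with
      | oDm, 2%nat => R
      | oTt, _ => eT n e
      | _, _ => Eop o e
      end
    | Eop o' w =>
      match o, o' with
      | oTt, _ => eT n e
      | (oDp | oDm), (oLp | oLm) => d o' (d o w)
      | oDp, oDm =>
          sadd (d oDm (d oDp w))
            (sadd (sopp (smul (Ec (qi 2)) (smul (Emul (Eadd (Ea aq) (Ea aqb)) (Ea aiDl)) (d oTt w))))
              (smul (Emul EdDl (Ea aiDl)) (sadd (d oDp w) (sopp (d oDm w)))))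
      | oLp, oLm =>
          sadd (d oLm (d oLp w))
            (sadd (smul (Ea act) (sadd (d oLp w) (sopp (d oLm w))))
              (sopp (smul (Ec (qi 2)) (smul (Esub (Ea aq) (Ea aqb)) (d oTt w)))))
      | _, _ => Eop o e
      end
    end
  end
with eT (fuel : nat) (e : kex) : kex :=
  match fuel with
  | O => Eop oTt e
  | Datatypes.S n =>
    smul (Emul (Ea aiq) (Ea aiqb))
      (sadd (smul (Emul (Ec (qi (1#2))) (Ea aDl)) (sadd (ediff n oDp e) (sopp (ediff n oDm e))))
        (smul (Emul (Ec (0%Q, (1#2)%Q)) (Ea atau)) (sadd (ediff n oLp e) (sopp (ediff n oLm e)))))
  end.

Fixpoint enf (fuel : nat) (e : kex) : kex :=
  match e with
  | Eadd x y => sadd (enf fuel x) (enf fuel y)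
  | Esub x y => sadd (enf fuel x) (sopp (enf fuel y))
  | Emul x y => smul (enf fuel x) (enf fuel y)
  | Eopp x => sopp (enf fuel x)
  | Eop o x => ediff fuel o (enf fuel x)
  | _ => e
  end.
End Normal.

Section Eval.
Context {K : dring} (N : kncalc K) (un : nat -> K).
Add Ring KringG2 : (kth K) (morphism (kc_morph K), constants [kcst]).

Definition eva (a : katom) : K :=
  match a with
  | aq => kq N | aiq => kiq N | aqb => kqb N | aiqb => kiqb N | aDl => kDl N | aiDl => kiDl N
  | atau => ktau N | act => kct N | aim => kim N | aM => kM N | aQ => kQ N
  end.
Definition evo (o : kop) : K -> K :=
  match o with oDp => Dp N | oDm => Dm N | oLp => Lp N | oLm => Lm N | oTt => Tt N end.
Fixpoint ev (e : kex) : K :=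
  match e with
  | Ec c => kc c | Ea a => eva a | Eu n => un n
  | Eadd x y => ev x + ev y | Esub x y => ev x - ev y | Emul x y => ev x * ev y
  | Eopp x => - ev x | Eop o x => evo o (ev x)
  end.

Lemma evo_der o : derivation (evo o).
Proof. destruct o; apply N. Qed.

Lemma kc_eqb c d : qi_eqb c d = true -> kc c = kc d :> K.
Proof. intros H. unfold kc. now rewrite (qi_eqb_ok _ _ H). Qed.

Ltac gkc := repeat match goal with |- context [kc ?c] => is_var c; generalize (kc (K := K) c); intros ? end.

Lemma sadd_ok x y : ev (sadd x y) = ev x + ev y.
Proof.
destruct x, y; cbn [sadd ev]; try (gkc; ring);
repeat match goal with |- context [qi_eqb ?c ?d] => destruct (qi_eqb c d) eqn:?H end;
cbn [ev]; repeat match goal with H : qi_eqb _ _ = true |- _ => rewrite (kc_eqb _ _ H); clear H end; gkc; ring.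
Qed.
Lemma sopp_ok x : ev (sopp x) = - ev x.
Proof.
destruct x; cbn [sopp ev]; try (gkc; ring). apply (morph_opp (kc_morph K)).
Qed.
Lemma smul_ok x y : ev (smul x y) = ev x * ev y.
Proof.
destruct x, y; cbn [smul ev]; try (gkc; ring); try apply (morph_mul (kc_morph K));
repeat match goal with |- context [if qi_eqb ?c ?d then _ else _] => destruct (qi_eqb c d) eqn:?H end;
cbn [ev]; repeat match goal with H : qi_eqb _ _ = true |- _ => rewrite (kc_eqb _ _ H); clear H end; gkc; ring.
Qed.

Lemma atom_diff_ok o a : ev (atom_diff o a) = evo o (eva a).
Proof.
destruct o, a; cbn [atom_diff evo eva ev Eac EdDl Esq qi];
rewrite ?(Dp_q _ N), ?(Dp_qb _ N), ?(Dp_iq N), ?(Dp_iqb N), ?(Dp_Dl _ N), ?(Dp_iDl N),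
  ?(Dp_tau _ N), ?(Dp_ct _ N), ?(Dp_im _ N), ?(Dp_M _ N), ?(Dp_Q _ N),
  ?(Dm_q _ N), ?(Dm_qb _ N), ?(Dm_iq N), ?(Dm_iqb N), ?(Dm_Dl _ N), ?(Dm_iDl N),
  ?(Dm_tau _ N), ?(Dm_ct _ N), ?(Dm_im _ N), ?(Dm_M _ N), ?(Dm_Q _ N),
  ?(Lp_q _ N), ?(Lp_qb _ N), ?(Lp_iq N), ?(Lp_iqb N), ?(Lp_Dl _ N), ?(Lp_iDl N),
  ?(Lp_tau _ N), ?(Lp_ct _ N), ?(Lp_im _ N), ?(Lp_M _ N), ?(Lp_Q _ N),
  ?(Lm_q _ N), ?(Lm_qb _ N), ?(Lm_iq N), ?(Lm_iqb N), ?(Lm_Dl _ N), ?(Lm_iDl N),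
  ?(Lm_tau _ N), ?(Lm_ct _ N), ?(Lm_im _ N), ?(Lm_M _ N), ?(Lm_Q _ N),
  ?(Tt_q _ N), ?(Tt_qb _ N), ?(Tt_iq N), ?(Tt_iqb N), ?(Tt_Dl _ N), ?(Tt_iDl N),
  ?(Tt_tau _ N), ?(Tt_ct _ N), ?(Tt_im _ N), ?(Tt_M _ N), ?(Tt_Q _ N);
unfold eva; try ring.
Qed.

Context (R : kex) (HR : Dm N (un 2) = ev R).

(** Correct for any fuel: where no rule applies, or fuel is exhausted, the operator simply stays in
    place. The value 100 used later is a matter of strength, not of soundness. *)
Lemma ediff_ok n : (forall o e, ev (ediff R n o e) = evo o (ev e)) /\
  (forall e, ev (eT R n e) = Tt N (ev e)).
Proof.
induction n as [|n [IH IHT]]; [split; reflexivity|].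
split.
- intros o e. destruct e; cbn [ediff].
  + cbn [ev]. symmetry. apply (der_kc _ (evo_der o)).
  + apply atom_diff_ok.
  + destruct o; try reflexivity; [|apply IHT].
    destruct n0 as [|[|[|]]]; try reflexivity. symmetry. exact HR.
  + rewrite sadd_ok, !IH. cbn [ev]. now rewrite (der_add _ (evo_der o)).
  + rewrite sadd_ok, sopp_ok, !IH. cbn [ev]. rewrite (der_sub _ (evo_der o)). ring.
  + rewrite sadd_ok, !smul_ok, !IH. cbn [ev]. now rewrite (der_mul _ (evo_der o)).
  + rewrite sopp_ok, !IH. cbn [ev]. now rewrite (der_opp _ (evo_der o)).
  + destruct o, o0; try reflexivity; try (apply IHT);
    rewrite ?sadd_ok, ?sopp_ok, ?smul_ok, ?IH; rewrite ?sadd_ok, ?sopp_ok, ?smul_ok, ?IH;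
    cbn [ev evo eva EdDl qi];
    rewrite ?(Dp_Lp _ N), ?(Dp_Lm _ N), ?(Dm_Lp _ N), ?(Dm_Lm _ N); try reflexivity;
    rewrite ?(Dp_Dm _ N), ?(Lp_Lm _ N); ring.
- intros e. cbn [eT]. rewrite smul_ok, sadd_ok, !smul_ok, !sadd_ok, !sopp_ok, !IH.
  cbn [ev evo eva qi]. rewrite (Tt_word _ N (ev e)).
  assert (Hi : (kc (0%Q, (1 # 2)%Q) : K) = #q (1#2) * #i) by ring. rewrite Hi. ring.
Qed.

Lemma enf_ok n e : ev (enf R n e) = ev e.
Proof.
induction e; cbn [enf ev]; rewrite ?sadd_ok, ?sopp_ok, ?smul_ok, ?IHe, ?IHe1, ?IHe2;
 try reflexivity; try ring.
rewrite (proj1 (ediff_ok n)), IHe. reflexivity.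
Qed.
End Eval.

Ltac kreify N u0 u1 u2 u3 u4 t :=
  let rec go t :=
    lazymatch t with
    | kc ?c => constr:(Ec c)
    | kadd ?x ?y => let a := go x in let b := go y in constr:(Eadd a b)
    | ksub ?x ?y => let a := go x in let b := go y in constr:(Esub a b)
    | kmul ?x ?y => let a := go x in let b := go y in constr:(Emul a b)
    | kopp ?x => let a := go x in constr:(Eopp a)
    | Operators.Dp N ?x => let a := go x in constr:(Eop oDp a)
    | Operators.Dm N ?x => let a := go x in constr:(Eop oDm a)
    | Operators.Lp N ?x => let a := go x in constr:(Eop oLp a)
    | Operators.Lm N ?x => let a := go x in constr:(Eop oLm a)
    | Operators.Tt N ?x => let a := go x in constr:(Eop oTt a)
    | Operators.kq N => constr:(Ea aq) | Operators.kiq N => constr:(Ea aiq)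
    | Operators.kqb N => constr:(Ea aqb) | Operators.kiqb N => constr:(Ea aiqb)
    | Operators.kDl N => constr:(Ea aDl) | Operators.kiDl N => constr:(Ea aiDl)
    | Operators.ktau N => constr:(Ea atau) | Operators.kct N => constr:(Ea act)
    | Operators.kim N => constr:(Ea aim) | Operators.kM N => constr:(Ea aM) | Operators.kQ N => constr:(Ea aQ)
    | u0 => constr:(Eu 0%nat) | u1 => constr:(Eu 1%nat) | u2 => constr:(Eu 2%nat)
    | u3 => constr:(Eu 3%nat) | u4 => constr:(Eu 4%nat)
    | _ => fail 100
    end in go t.

Definition un5 {K : dring} (u0 u1 u2 u3 u4 : K) (n : nat) : K :=
  match n with 0%nat => u0 | 1%nat => u1 | 2%nat => u2 | 3%nat => u3 | _ => u4 end.

Lemma enf_eq {K : dring} (N : kncalc K) un R (HR : Dm N (un 2%nat) = ev N un R) fuel a b a' b' :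
  enf R fuel a = a' -> enf R fuel b = b' -> ev N un a' = ev N un b' -> ev N un a = ev N un b.
Proof. intros <- <-. now rewrite !(enf_ok N un R HR). Qed.

(** In the words produced, [Lm] stands outside [Lp], then come [Dm] and [Dp], and [Tt] is
    eliminated. Such words are atoms for [ring], so the goal becomes a polynomial identity. *)
Ltac knorm5 N u0 u1 u2 u3 u4 HR :=
  match type of HR with _ = ?rr =>
  match goal with |- ?l = ?r =>
    let R := kreify N u0 u1 u2 u3 u4 rr in
    let a := kreify N u0 u1 u2 u3 u4 l in
    let b := kreify N u0 u1 u2 u3 u4 r in
    change (ev N (un5 u0 u1 u2 u3 u4) a = ev N (un5 u0 u1 u2 u3 u4) b);
    let a' := eval vm_compute in (enf R 100 a) in
    let b' := eval vm_compute in (enf R 100 b) in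
    apply (enf_eq N (un5 u0 u1 u2 u3 u4) R HR 100 a b a' b');
    [vm_compute; reflexivity | vm_compute; reflexivity | cbn [ev eva evo un5]]
  end end.
Ltac knorm N u0 u1 u2 HR := knorm5 N u0 u1 u2 u0 u0 HR.
End NormalForms.

(** * Elimination of [A] and the wave equations *)

Module Decoupling.
Import DifferentialRings FrameGeometry Operators NormalForms.
Open Scope dr_scope.

Section Decoupling.
Context {K : dring} (N : kncalc K).
Add Ring KringN : (kth K) (morphism (kc_morph K), constants [kcst]).
Local Notation half := (#q (1#2)).
Local Notation q := (Operators.kq N).
Local Notation iq := (Operators.kiq N).
Local Notation qb := (Operators.kqb N).
Local Notation iqb := (Operators.kiqb N).
Local Notation Dl := (Operators.kDl N).
Local Notation iDl := (Operators.kiDl N).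
Local Notation tau := (Operators.ktau N).
Local Notation ct := (Operators.kct N).
Local Notation im := (Operators.kim N).
Local Notation M := (Operators.kM N).
Local Notation Q := (Operators.kQ N).
Local Notation Dp := (Operators.Dp N).
Local Notation Dm := (Operators.Dm N).
Local Notation Lp := (Operators.Lp N).
Local Notation Lm := (Operators.Lm N).
Local Notation Tt := (Operators.Tt N).

Ltac knring :=
  let R1 := fresh in let R2 := fresh in let R3 := fresh in let R4 := fresh in
  let R5 := fresh in let R6 := fresh in
  assert (R1 := q_iq K N); assert (R2 := qb_iqb K N); assert (R3 := Dl_iDl K N);
  assert (R4 := im_im K N); assert (R5 := tau_ct K N); assert (R6 := Q_Q K N);
  ring [R1 R2 R3 R4 R5 R6].

Definition dDl : K := q + qb - #q 2 * M.
(** Chandrasekhar's operators of weight two, the radial one multiplied by [Delta]. *)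
Definition Dm2 (u : K) : K := Dl * Dm u + #q 2 * dDl * u.
Definition Lm2 (u : K) : K := Lm u + #q 2 * ct * u.
(** Times [4 / qb^3], this is the coefficient [6 Pbar - 4 Q^2 / |q|^4] of [Xi] in the first Bianchi
    equation; [mass_p] times [2 / qb^3] is the coefficient [6 Pbar + 4 Q^2 / |q|^4] of the shear in
    the second. *)
Definition mass_m : K := - #q 3 * M + #q 3 * Q * Q * iq - Q * Q * qb * iq * iq.
Definition mass_p : K := #q 2 * (- #q 3 * M + #q 3 * Q * Q * iq + Q * Q * qb * iq * iq).
Definition DBt (u : K) : K := half * qb * qb * iq * (Dp u + (#q 8 * iqb - iq) * u).
Definition LBt (u : K) : K :=
  half * qb * qb * iq * (Lp u + (- ct + #q 8 * #i * tau * iqb + #i * tau * iq) * u).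

(** The weights separate: [Dl] and [dDl] depend on [r] only and [ct] on theta only, and [Dm]
    commutes with [Lm]. *)
Lemma Dm2_Lm2 u : Dm2 (Lm2 u) = Lm2 (Dm2 u).
Proof.
unfold Dm2, Lm2, dDl. knorm N u u u (eq_refl (Dm u)). ring.
Qed.

(** Rescaled first components of [B], [F], [X] (in Fraktur) and of [A]. [E1] and [E2] are the
    Bianchi equations, [E3] the shear equation, [E4] the integrability condition of Maxwell's
    equations. *)
Context (Bt Ft X3 Y2 : K)
  (E1 : Lm2 Y2 = DBt Bt + mass_m * X3)
  (E2 : Dm2 Y2 = - LBt Bt + mass_p * Ft)
  (E3 : Y2 = - (qb * qb * iq * (Dp Ft + #q 6 * iqb * Ft
     + half * (Lp X3 + (- ct + #q 6 * #i * tau * iqb) * X3))))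
  (E4 : Bt = - Lm2 Ft + half * Dm2 X3).

(** [E4] solved for its derivative of [X]. This is the rewriting rule for the unknown number 2 in
    the normal forms of both wave equations. *)
Lemma Dm_X3 : Dm X3 = iDl * (#q 2 * (Bt + Lm Ft + #q 2 * ct * Ft) - #q 2 * dDl * X3).
Proof.
rewrite E4 at 1. unfold Dm2, Lm2. knring.
Qed.

(* [Y2], the rescaled [A], is eliminated by commuting [Dm2] and [Lm2]. *)
Lemma teukolsky_B :
  Dm2 (DBt Bt) + mass_m * #q 2 * (Bt + Lm2 Ft) + Dl * Dm mass_m * X3
  + Lm2 (LBt Bt) - mass_p * Lm2 Ft - Lm mass_p * Ft = #q 0.
Proof.
assert (H : Dm2 (Lm2 Y2) = Lm2 (Dm2 Y2)) by apply Dm2_Lm2.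
rewrite E1, E2 in H.
transitivity (Dm2 (DBt Bt + mass_m * X3) - Lm2 (- LBt Bt + mass_p * Ft)); [|rewrite H; ring].
generalize (DBt Bt) (LBt Bt) mass_m mass_p; intros.
unfold Dm2, Lm2.
rewrite !(Dm_add N), !(Dm_mul N), !(Lm_add N), !(Lm_opp N), !(Lm_mul N), Dm_X3.
unfold dDl. knring.
Qed.

(** [E3], freed of its factor, is differentiated by [Dm2]: then [E2] replaces [Dm2 Y2], and [E4]
    replaces the derivative of [X3], which is possible because [Dm] commutes with [Lp]. *)
Lemma teukolsky_F :
  Dm2 (Dp Ft + #q 6 * iqb * Ft) + (Lp (Bt + Lm2 Ft) + (- ct + #q 6 * #i * tau * iqb) * (Bt + Lm2 Ft))
  + #q 3 * #i * tau * Dl * Dm iqb * X3 + q * iqb * iqb * (- LBt Bt + mass_p * Ft)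
  + Dl * Dm (q * iqb * iqb) * Y2 = #q 0.
Proof.
assert (R1 := q_iq K N). assert (R2 := qb_iqb K N).
assert (H : q * iqb * iqb * Y2 = - (Dp Ft + #q 6 * iqb * Ft
     + half * (Lp X3 + (- ct + #q 6 * #i * tau * iqb) * X3))).
{ rewrite E3. ring [R1 R2]. }
assert (H2 : Dm2 X3 = #q 2 * (Bt + Lm2 Ft)) by (rewrite E4; ring).
assert (H3 : Lp (Dm2 X3) = #q 2 * Lp (Bt + Lm2 Ft)).
{ rewrite H2, (Lp_mul N), (Lp_kc N). ring. }
assert (H4 : Dm2 (q * iqb * iqb * Y2) = q * iqb * iqb * Dm2 Y2 + Dl * Dm (q * iqb * iqb) * Y2).
{ unfold Dm2. rewrite (Dm_mul N _ Y2). ring. }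
rewrite H, E2 in H4.
set (S3 := Dp Ft + #q 6 * iqb * Ft + half * (Lp X3 + (- ct + #q 6 * #i * tau * iqb) * X3)) in *.
assert (H5 : Dm2 S3 = Dm2 (Dp Ft + #q 6 * iqb * Ft)
  + (Lp (Bt + Lm2 Ft) + (- ct + #q 6 * #i * tau * iqb) * (Bt + Lm2 Ft))
  + #q 3 * #i * tau * Dl * Dm iqb * X3).
{ transitivity (Dm2 (Dp Ft + #q 6 * iqb * Ft) + half * Lp (Dm2 X3)
   + half * (- ct + #q 6 * #i * tau * iqb) * Dm2 X3 + #q 3 * #i * tau * Dl * Dm iqb * X3).
  - unfold S3, Dm2, dDl.
    repeat (rewrite (Dm_add N) || rewrite (Dm_mul N) || rewrite (Lp_add N) || rewrite (Lp_mul N)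
      || rewrite (Dm_opp N) || rewrite (Lp_sub N) || rewrite (Dm_kc N) || rewrite (Lp_kc N)).
    rewrite (Dm_ct _ N), (Dm_tau _ N), (Lp_Dl _ N), (Lp_q _ N), (Lp_qb _ N), (Lp_M _ N).
    rewrite (Dm_Lp _ N). ring.
  - rewrite H3, H2. ring. }
assert (H6 : Dm2 (- S3) = - Dm2 S3) by (unfold Dm2; rewrite (Dm_opp N); ring).
rewrite H6, H5 in H4.
match type of H4 with ?l = ?r => transitivity (r - l); [ring|rewrite H4; ring] end.
Qed.

(** Background values of [tr X], of the underlined trace and its conjugate, of [H_1], the underlined
    [H_1] and their conjugates; [nom] is [g(D_2 e_1, e_2)] and [nz3] is [g(D_3 e_4, e_3)]. *)
Definition nX : K := #q 2 * iq.
Definition nXb : K := - #q 2 * Dl * iq * iqb * iqb.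
Definition nXbc : K := - #q 2 * Dl * iqb * iq * iq.
Definition nH : K := #i * tau * im * iqb.
Definition nHb : K := - #i * tau * im * iq.
Definition nHc : K := - #i * tau * im * iq.
Definition nHbc : K := #i * tau * im * iqb.
Definition nom : K := im * (ct - half * #i * tau * (q - qb) * iq * iqb).
Definition nz3 : K := - #q 2 * (dDl * iq * iqb - Dl * iq * iqb * (iq + iqb)).

(* Horizontal derivatives of [p^k g], conformal type 0, divided by [p^k]. *)
Definition n4 (k : QI) (g : K) : K := Dp g.
Definition n3 (k : QI) (g : K) : K := - Dl * iq * iqb * (Dm g + kc k * (iq - iqb) * g).
Definition nd (k : QI) (g : K) : K := im * (Lp g - kc k * ct * g - kc k * #i * tau * iq * g).
Definition ne (k : QI) (g : K) : K := im * (Lm g + kc k * ct * g - kc k * #i * tau * iqb * g).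
Definition nbox (k : QI) (g : K) : K :=
  half * (nd k (ne k g) + ne k (nd k g)) - half * (n3 k (n4 k g) + n4 k (n3 k g))
  + half * nom * (nd k g + ne k g)
  - half * (iq + iqb) * n3 k g + half * Dl * iq * iqb * (iq + iqb) * n4 k g
  + half * ((nH + nHb) * ne k g + (nHc + nHbc) * nd k g)
  - #q (1#4) * nz3 * n4 k g.
Definition ndt (k : QI) (g : K) : K :=
  half * n3 k g + half * Dl * iq * iqb * n4 k g + half * #i * tau * im * (nd k g - ne k g).
(** Here [u] is [a cos theta]. Writing the mass and charge terms through [Dl] makes the numerator a
    polynomial in [r], [u], [tau] and [Dl]. *)
Definition nVnum : K :=
  let r := half * (q + qb) in let u := - half * #i * (q - qb) in
  r * r * Dl + (tau * tau - #q 2 * u * u) * r * r - #q 2 * (tau * tau + u * u) * u * u.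
Definition nV1 : K :=
  nVnum * iq * iq * iq * iqb * iqb * iqb + #q 5 * Q * Q * iq * iq * iqb * iqb.
Definition nV2 : K :=
  #q 4 * nVnum * iq * iq * iq * iqb * iqb * iqb + #q 2 * Q * Q * iq * iq * iqb * iqb.
Definition nPP : K := #q 2 * Q * Q * iq * iq * iqb * iqb.
(** Zeroth-order coefficients for which the wave equations balance. In every bracket of [nzB] and
    [nwF] the numerical coefficients add up to zero, so both vanish when [iq = iqb]. *)
Definition nzB : K :=
  Dl * iq * iqb * (
    half * Dl * (iq * iqb * iqb * iqb * iqb - #q 25 * iq * iq * iqb * iqb * iqb
       + #q 23 * iq * iq * iq * iqb * iqb + iq * iq * iq * iq * iqb)
    + tau * tau * (#q 4 * iq * iqb * iqb * iqb * iqb + #q 12 * iq * iq * iqb * iqb * iqb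
       - #q 15 * iq * iq * iq * iqb * iqb - iq * iq * iq * iq * iqb)
    + half * M * (- #q 23 * iq * iqb * iqb * iqb - #q 2 * iq * iq * iqb * iqb
       + #q 25 * iq * iq * iq * iqb)
    + #q (1#4) * (- iqb * iqb * iqb + #q 49 * iq * iqb * iqb - #q 43 * iq * iq * iqb
       - #q 5 * iq * iq * iq)).
Definition nwF : K :=
  Dl * iq * iqb * (
    #q 2 * Dl * (iq * iqb * iqb * iqb * iqb - #q 3 * iq * iq * iqb * iqb * iqb
       + #q 3 * iq * iq * iq * iqb * iqb - iq * iq * iq * iq * iqb)
    + #q 4 * tau * tau * (#q 2 * iq * iqb * iqb * iqb * iqb - iq * iq * iqb * iqb * iqb
       - iq * iq * iq * iq * iqb)
    - #q 4 * M * (iq * iqb * iqb * iqb - #q 2 * iq * iq * iqb * iqb + iq * iq * iq * iqb)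
    + #q 4 * (iqb * iqb * iqb - iq * iqb * iqb + iq * iq * iqb - iq * iq * iq)).

(** With [p = q / |q|], the first components of the Fraktur quantities [B], [F], [X] are [p nb],
    [p^2 nf], [p nx], and those of the transformed ones are [p nP] and [p^2 nQ]. *)
Definition nb : K := qb * qb * iq * Bt.
Definition nf : K := qb * qb * qb * iq * Ft.
Definition nx : K := qb * qb * qb * X3.
Definition nP : K :=
  - (im * qb * qb * qb * qb * qb * qb * iq)
  * (Dl * Dm Bt + (dDl + Dl * (#q (9#2) * iqb - #q (3#2) * iq)) * Bt).
Definition nQ : K :=
  - (qb * qb * qb * qb * iq) * (Dl * Dm Ft + (dDl + Dl * (#q 4 * iqb - #q 2 * iq)) * Ft).

(* The transformed quantities are [e_3]-derivatives, so the wave equations are the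
   [Dm]-derivatives of the Teukolsky equations, up to multiples of these. *)
Lemma wave_2 :
  nbox (2%Q, 0%Q) nQ - #q 2 * (q - qb) * iq * iqb * ndt (2%Q, 0%Q) nQ - nV2 * nQ
  = - half * q * q * q * im * iq * iqb * iq * iqb
    * (iq * (Lp nP - ct * nP - #i * tau * iq * nP) - #q (3#2) * #i * tau * iq * (iqb + iq) * nP)
  + q * qb * qb * (
      half * (nXb - nXbc) * (nXb - nXbc) * Dp nf
      + half * (#q 4 * nXb * nH) * (im * (Lm nf + (#q 2 * ct - #q 3 * #i * tau * iqb) * nf))
      + half * (#q 4 * nXbc * nHc) * (im * (Lp nf - (#q 2 * ct + #i * tau * iq) * nf))
      + #q (1#4) * (nXb - nXbc) * (nXb - nXbc) * (iq * (Lp nx + (- ct + #i * tau * iq) * nx))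
      + #q (3#8) * (nXbc - nXb) * (iq * (Lp nb - ct * nb))
      + nwF * nf
      + (#q (1#8) * nXb * iqb + #q (3#2) * nXbc * iqb - #q (7#8) * nXbc * iq) * #i * tau * iq * nb
      + #q (1#4) * ((- #q 3 * nXb * nXb + #q 5 * nXbc * nXbc - nXb * nXbc) * iqb
           - nXbc * nXbc * iq) * #i * tau * iq * nx).
Proof.
(* [E3] removes the last occurrence of [Y2], so that [TE] contains [Bt], [Ft] and [X3] only. *)
assert (T := teukolsky_F). rewrite E3 in T.
assert (X := Dm_X3). unfold dDl in X.
match type of T with ?l = _ => set (TE := l) in T end.
assert (DT : Dm TE = #q 0) by (rewrite T; apply (Dm_kc N)).
(* The added terms are zero. The operator applied to [TE] has the shape of the one defining [nQ],
   with weights adapted to the scaling of [TE]; this produces the wave operator on [nQ]. *)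
match goal with |- ?l = ?r =>
  transitivity (r + - (qb * qb * qb * qb * iq) * iq * iqb *
     (Dl * Dm TE + (dDl + Dl * (#q 2 * iqb - iq)) * TE)); [|rewrite DT, T; ring] end.
clear DT T. unfold TE. clear TE.
unfold nbox, ndt, n3, n4, nd, ne, nP, nQ, nb, nf, nx.
unfold DBt, LBt, Dm2, Lm2, mass_p, nX, nXb, nXbc, nH, nHc, nHb, nHbc, nom, nz3, nV2, nVnum, nwF, dDl.
knorm N Bt Ft X3 X.
knring.
Qed.

Lemma wave_1 :
  nbox (1%Q, 0%Q) nP - (q - qb) * iq * iqb * ndt (1%Q, 0%Q) nP - nV1 * nP
  = #q 4 * Q * Q * qb * qb * qb * im * iq * iqb * iq * iqb
      * (#q 2 * iqb * (Lm nQ + (#q 2 * ct - #q 2 * #i * tau * iqb) * nQ))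
  + q * qb * qb * qb * qb * qb * im * (
      half * (nXb * nH) * (im * (Lm nb + (ct - #q 2 * #i * tau * iqb) * nb))
      + half * (nXbc * nHc) * (im * (Lp nb - ct * nb))
      - #q (3#2) * (nXbc - nXb) * nPP
        * (#q 2 * iqb * (Lm nf + (#q 2 * ct - #q 3 * #i * tau * iqb) * nf))
      + nzB * nb
      + nPP * (- #q 6 * nXb * iq + #q 4 * nXbc * iq + #q 2 * nXb * iqb) * #i * tau * iqb * nf
      + nPP * #q (1#4) * (- #q 10 * nXb * nXb - #q 7 * nXbc * nXbc + #q 17 * nXb * nXbc) * nx).
Proof.
assert (T := teukolsky_B).
assert (X := Dm_X3). unfold dDl in X.
match type of T with ?l = _ => set (TE := l) in T end.
assert (DT : Dm TE = #q 0) by (rewrite T; apply (Dm_kc N)).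
match goal with |- ?l = ?r =>
  transitivity (r + - #q 2 * im * qb * qb * qb * iq *
     (Dl * Dm TE + (dDl + Dl * (#q (5#2) * iqb - half * iq)) * TE)); [|rewrite DT, T; ring] end.
clear DT T. unfold TE. clear TE.
unfold nbox, ndt, n3, n4, nd, ne, nP, nQ, nb, nf, nx.
unfold DBt, LBt, Dm2, Lm2, mass_p, mass_m, nX, nXb, nXbc, nH, nHc, nHb, nHbc, nom, nz3,
  nV1, nVnum, nzB, nPP, dDl.
knorm N Bt Ft X3 X.
knring.
Qed.
End Decoupling.
End Decoupling.

(** * The background symbols in Boyer-Lindquist coordinates *)

Module Coordinates.
Import DifferentialRings FrameGeometry Koszul CurvatureSymmetries Operators NormalForms.
Open Scope dr_scope.

(* [xis], [xim], [xiDl] are the inverses of [sin theta], [|q|], [Delta]. *)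
Record kncoord (K : dring) := Kncoord {
  xr : K; xc : K; xs : K; xis : K; xim : K; xDl : K; xiDl : K; xM : K; xa : K; xQ : K;
  xcc : xc * xc = #q 1 - xs * xs;
  xs_xis : xs * xis = #q 1;
  xDl_xiDl : xDl * xiDl = #q 1;
  xim_sq : xim * xim * (xr * xr + xa * xa * xc * xc) = #q 1;
  xDl_def : xDl = xr * xr - #q 2 * xM * xr + xa * xa + xQ * xQ;
  pd_xr : forall m, pd m xr = match m with cr => #q 1 | _ => #q 0 end;
  pd_xc : forall m, pd m xc = match m with cth => - xs | _ => #q 0 end;
  pd_xs : forall m, pd m xs = match m with cth => xc | _ => #q 0 end;
  pd_xM : forall m, pd m xM = #q 0;
  pd_xa : forall m, pd m xa = #q 0;
  pd_xQ : forall m, pd m xQ = #q 0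
}.
Arguments xr {_}. Arguments xc {_}. Arguments xs {_}. Arguments xis {_}. Arguments xim {_}.
Arguments xDl {_}. Arguments xiDl {_}. Arguments xM {_}. Arguments xa {_}. Arguments xQ {_}.

Section Coordinates.
Context {K : dring} (X : kncoord K).
Add Ring KringJ : (kth K) (morphism (kc_morph K), constants [kcst]).
Local Notation half := (#q (1#2)).
Local Notation r := (xr X). Local Notation c := (xc X). Local Notation s := (xs X).
Local Notation is := (xis X). Local Notation im := (xim X). Local Notation Dl := (xDl X).
Local Notation iDl := (xiDl X). Local Notation M := (xM X). Local Notation a := (xa X).
Local Notation Q := (xQ X).

(** [ring] uses its hypotheses as rewriting rules on a monomial; here the relation between [1 / |q|]
    and [q] is oriented accordingly, as is that for [Delta] in [xQ_rule]. *)
Lemma xim_rule : im * im * r * r = #q 1 - im * im * a * a * c * c.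
Proof. rewrite <- (xim_sq _ X). ring. Qed.
Lemma xQ_rule : Q * Q = Dl - r * r + #q 2 * M * r - a * a.
Proof. rewrite (xDl_def _ X). ring. Qed.

Ltac xring :=
  let R1 := fresh in let R2 := fresh in let R3 := fresh in let R4 := fresh in let R5 := fresh in
  assert (R1 := xcc _ X); assert (R2 := xs_xis _ X); assert (R3 := xDl_xiDl _ X);
  assert (R4 := xim_rule); assert (R5 := xQ_rule); ring [R1 R2 R3 R4 R5].

Lemma pd_kc m z : pd m (kc z) = #q 0 :> K.
Proof. apply (der_kc _ (pd_derivation m)). Qed.
Lemma pd_sub m (u v : K) : pd m (u - v) = pd m u - pd m v.
Proof. apply (der_sub _ (pd_derivation m)). Qed.
Lemma pd_opp m (u : K) : pd m (- u) = - pd m u.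
Proof. apply (der_opp _ (pd_derivation m)). Qed.

Lemma pd_xis m : pd m is = match m with cth => - is * is * c | _ => #q 0 end.
Proof.
rewrite (der_inv (pd m) (pd_derivation m) _ _ (xs_xis _ X)), (pd_xs _ X). destruct m; ring.
Qed.
Lemma pd_xDl m : pd m Dl = match m with cr => #q 2 * (r - M) | _ => #q 0 end.
Proof.
rewrite (xDl_def _ X), !pd_add, pd_sub, !pd_mul, pd_kc, (pd_xr _ X), (pd_xM _ X), (pd_xa _ X), (pd_xQ _ X).
destruct m; ring.
Qed.
Lemma pd_xiDl m : pd m iDl = match m with cr => - iDl * iDl * #q 2 * (r - M) | _ => #q 0 end.
Proof.
rewrite (der_inv (pd m) (pd_derivation m) _ _ (xDl_xiDl _ X)), pd_xDl. destruct m; ring.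
Qed.
(** No square root is differentiated: the derivative of [1 / |q|] follows from the relation
    [im^2 |q|^2 = 1], multiplied by [im / 2]. *)
Lemma pd_xim m : pd m im = match m with
  | cr => - im * im * im * r | cth => im * im * im * a * a * c * s | _ => #q 0 end.
Proof.
assert (E : pd m (im * im * (r * r + a * a * c * c)) = #q 0) by (rewrite (xim_sq _ X); apply pd_kc).
repeat rewrite ?pd_mul, ?pd_add, ?(pd_xr _ X), ?(pd_xc _ X), ?(pd_xa _ X) in E.
assert (R := xim_rule).
match type of E with ?l = _ =>
  transitivity (half * im * (l - im * im * (match m with
     cr => #q 2 * r | cth => - #q 2 * a * a * c * s | _ => #q 0 end))) end.
- destruct m; ring [R].
- rewrite E. destruct m; ring.
Qed.

Definition xq : K := r + #i * a * c.
Definition xqb : K := r - #i * a * c.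
Definition xiq : K := xqb * im * im.
Definition xiqb : K := xq * im * im.
Definition xrad (f : K) : K := (r * r + a * a) * pd ct f + a * pd cph f.
Definition xang (f : K) : K := a * s * pd ct f + is * pd cph f.
Definition xDp (f : K) : K := pd cr f + iDl * xrad f.
Definition xDm (f : K) : K := pd cr f - iDl * xrad f.
Definition xLp (f : K) : K := pd cth f + #i * xang f.
Definition xLm (f : K) : K := pd cth f - #i * xang f.

Ltac xpd := repeat rewrite ?pd_add, ?pd_sub, ?pd_mul, ?pd_opp, ?pd_kc, ?(pd_xr _ X), ?(pd_xc _ X),
  ?(pd_xs _ X), ?(pd_xM _ X), ?(pd_xa _ X), ?(pd_xQ _ X), ?pd_xis, ?pd_xDl, ?pd_xiDl, ?pd_xim.
Ltac xunf := unfold xDp, xDm, xLp, xLm, xrad, xang, xiq, xiqb, xq, xqb.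
Ltac xcomm := rewrite ?(pd_comm K cr ct), ?(pd_comm K cth ct), ?(pd_comm K cph ct), ?(pd_comm K cth cr),
  ?(pd_comm K cph cr), ?(pd_comm K cph cth).

Lemma pd_ct_derivation : derivation (pd (d := K) ct). Proof. apply pd_derivation. Qed.
Lemma xDp_derivation : derivation xDp.
Proof. repeat split; intros; xunf; rewrite ?pd_add, ?pd_mul, ?pd_cst; ring. Qed.
Lemma xDm_derivation : derivation xDm.
Proof. repeat split; intros; xunf; rewrite ?pd_add, ?pd_mul, ?pd_cst; ring. Qed.
Lemma xLp_derivation : derivation xLp.
Proof. repeat split; intros; xunf; rewrite ?pd_add, ?pd_mul, ?pd_cst; ring. Qed.
Lemma xLm_derivation : derivation xLm.
Proof. repeat split; intros; xunf; rewrite ?pd_add, ?pd_mul, ?pd_cst; ring. Qed.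

(** Ended by [Defined]: later steps compute the symbols and operators out of it. *)
Definition kn_calc : kncalc K.
Proof.
refine (Kncalc K xq xiq xqb xiqb Dl iDl (a * s) (c * is) im M Q xDp xDm xLp xLm (pd ct)
  _ _ _ _ _ _ xDp_derivation xDm_derivation xLp_derivation xLm_derivation pd_ct_derivation
  _ _ _ _ _ _ _ _ _ _ _ _ _ _ _ _ _ _ _ _ _ _ _ _ _ _ _ _ _ _ _ _ _ _ _ _ _ _ _ _
  _ _ _ _ _ _ _); intros; xunf; xpd; try xring;
  xcomm; try xring.
Defined.
End Coordinates.
End Coordinates.

(** * Connection of the principal null frame *)

Module PrincipalFrame.
Import DifferentialRings FrameGeometry Koszul CurvatureSymmetries Operators NormalForms Coordinates.
Open Scope dr_scope.

Definition xcovec {K : dring} (t r th ph : K) (mu : coord) : K :=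
  match mu with ct => t | cr => r | cth => th | cph => ph end.
Definition xfr {K : dring} (X : kncoord K) (i : idx) (mu : coord) : K :=
  let n := xr X * xr X + xa X * xa X in
  let m2 := xim X * xim X in
  match i with
  | E1 => xcovec (#q 0) (#q 0) (xim X) (#q 0) mu
  | E2 => xcovec (xa X * xs X * xim X) (#q 0) (#q 0) (xim X * xis X) mu
  | E3 => xcovec (n * m2) (- (xDl X * m2)) (#q 0) (xa X * m2) mu
  | E4 => xcovec (n * xiDl X) (#q 1) (#q 0) (xa X * xiDl X) mu
  end.

(** Inverse matrix of the frame: row [mu] expands the coordinate vector field in the principal
    frame. Row [ct] will serve for the derivative along [partial_t]. *)
Definition xcf {K : dring} (X : kncoord K) (mu : coord) (i : idx) : K :=
  let n := xr X * xr X + xa X * xa X in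
  let m2 := xim X * xim X in
  let m := xim X * (xr X * xr X + xa X * xa X * xc X * xc X) in
  match mu, i with
  | ct, E4 => #q (1#2) * xDl X * m2 | ct, E3 => #q (1#2) | ct, E2 => - xa X * xs X * xim X
  | cr, E4 => #q (1#2)
  | cr, E3 => - #q (1#2) * xiDl X * (xr X * xr X + xa X * xa X * xc X * xc X)
  | cth, E1 => m
  | cph, E2 => xs X * n * xim X
  | cph, E4 => - #q (1#2) * xa X * xs X * xs X * xDl X * m2
  | cph, E3 => - #q (1#2) * xa X * xs X * xs X
  | _, _ => #q 0
  end.

Section Background.
Context {K : dring} (X : kncoord K) (S : kspacetime K)
  (Hfr : forall i mu, kfr S i mu = xfr X i mu)
  (Hin : forall i j, kinner S (kfr S i) (kfr S j) = kmink i j).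
Add Ring KringL : (kth K) (morphism (kc_morph K), constants [kcst]).
Local Notation N := (kn_calc X).
Local Notation half := (#q (1#2)).
Local Notation q := (kq N). Local Notation iq := (kiq N). Local Notation qb := (kqb N).
Local Notation iqb := (kiqb N). Local Notation Dl := (kDl N).
Local Notation tau := (ktau N). Local Notation ct := (kct N). Local Notation im := (kim N).
Local Notation M := (kM N).

Lemma xcf_fr mu nu : ksum4 (fun j => xcf X mu j * kfr S j nu) = kcoord_delta mu nu.
Proof.
assert (R1 := xcc _ X); assert (R2 := xs_xis _ X); assert (R3 := xDl_xiDl _ X);
assert (R4 := xim_rule X).
unfold ksum4. rewrite !Hfr. unfold xcf, xfr, xcovec, kcoord_delta.
destruct mu, nu; ring [R1 R2 R3 R4].
Qed.

Lemma ked_E4 f : ked S E4 f = Dp N f.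
Proof. unfold ked, kdir, ksumc. rewrite !Hfr. unfold xfr, xcovec. cbn [Dp kn_calc]. unfold xDp, xrad. ring. Qed.
Lemma iq_iqb_im : iq * iqb = im * im.
Proof. symmetry. apply (im_im _ N). Qed.
Lemma ked_E3 f : ked S E3 f = - (Dl * iq * iqb * Dm N f).
Proof.
transitivity (- (Dl * (iq * iqb) * Dm N f)); [rewrite iq_iqb_im|ring].
assert (R3 := xDl_xiDl _ X).
unfold ked, kdir, ksumc. rewrite !Hfr. unfold xfr, xcovec. cbn [Dm kn_calc kDl kim]. unfold xDm, xrad. ring [R3].
Qed.
Lemma ked_E1 f : ked S E1 f = half * im * (Lp N f + Lm N f).
Proof. unfold ked, kdir, ksumc. rewrite !Hfr. unfold xfr, xcovec. cbn [Lp Lm kn_calc kim]. unfold xLp, xLm, xang. ring. Qed.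
Lemma ked_E2 f : ked S E2 f = - half * #i * im * (Lp N f - Lm N f).
Proof. unfold ked, kdir, ksumc. rewrite !Hfr. unfold xfr, xcovec. cbn [Lp Lm kn_calc kim]. unfold xLp, xLm, xang. ring. Qed.

Definition w0 : K := im * (ct - half * #i * tau * (q - qb) * iq * iqb).
Definition z0 : K := - #q 2 * ((q + qb - #q 2 * M) * iq * iqb - Dl * iq * iqb * (iq + iqb)).
(** Structure functions of the frame, the only table from which all background connection
    coefficients and curvatures are computed. *)
Definition cc0 (i j n : idx) : K :=
  match i, j, n with
  | E4, E1, E1 | E4, E2, E2 => - half * (iq + iqb)
  | E1, E4, E1 | E2, E4, E2 => half * (iq + iqb)
  | E3, E1, E1 | E3, E2, E2 => half * Dl * iq * iqb * (iq + iqb)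
  | E1, E3, E1 | E2, E3, E2 => - half * Dl * iq * iqb * (iq + iqb)
  | E3, E1, E3 => #i * tau * im * (iqb - iq)
  | E1, E3, E3 => - #i * tau * im * (iqb - iq)
  | E3, E4, E2 => #q 2 * tau * im * (iq + iqb)
  | E4, E3, E2 => - #q 2 * tau * im * (iq + iqb)
  | E3, E4, E4 => - half * z0
  | E4, E3, E4 => half * z0
  | E1, E2, E2 => - w0 | E2, E1, E2 => w0
  | E1, E2, E3 => half * #i * (iq - iqb) | E2, E1, E3 => - half * #i * (iq - iqb)
  | E1, E2, E4 => half * #i * Dl * iq * iqb * (iq - iqb)
  | E2, E1, E4 => - half * #i * Dl * iq * iqb * (iq - iqb)
  | _, _, _ => #q 0
  end.

Ltac knring :=
  let R1 := fresh in let R2 := fresh in let R3 := fresh in let R4 := fresh in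
  let R5 := fresh in let R6 := fresh in
  assert (R1 := q_iq K N); assert (R2 := qb_iqb K N); assert (R3 := Dl_iDl K N);
  assert (R4 := im_im K N); assert (R5 := tau_ct K N); assert (R6 := Q_Q K N);
  ring [R1 R2 R3 R4 R5 R6].

(** Each frame derivative is a combination of Chandrasekhar's operators, so the table is checked by
    their commutation rules instead of by differentiating coordinate components. *)
Lemma comm0 i j f : ked S i (ked S j f) - ked S j (ked S i f) = ksum4 (fun n => cc0 i j n * ked S n f).
Proof.
assert (B : forall i j, ked S i (ked S j f) - ked S j (ked S i f) = ksum4 (fun n => cc0 i j n * ked S n f) ->
   ked S j (ked S i f) - ked S i (ked S j f) = ksum4 (fun n => cc0 j i n * ked S n f)).
{ intros i' j' H. transitivity (- (ked S i' (ked S j' f) - ked S j' (ked S i' f))); [ring|].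
  rewrite H. unfold ksum4, cc0. destruct i', j'; ring. }
assert (Z : forall i, ked S i (ked S i f) - ked S i (ked S i f) = ksum4 (fun n => cc0 i i n * ked S n f)).
{ intros i'. unfold ksum4, cc0. destruct i'; ring. }
(* The normaliser asks for an equation on its third unknown; none is needed here, and zero is
   supplied. *)
assert (HX : Dm N (#q 0) = #q 0) by apply (Dm_kc N).
destruct i, j; try apply Z;
  match goal with |- context [cc0 E2 E1] => apply B | |- context [cc0 E3 E1] => idtac
   | |- context [cc0 E1 E3] => apply B | |- context [cc0 E1 E4] => apply B
   | |- context [cc0 E2 E3] => apply B | |- context [cc0 E2 E4] => apply B
   | |- context [cc0 E4 E3] => apply B | _ => idtac end;
  unfold ksum4, cc0, w0, z0;
  rewrite !ked_E1, !ked_E2, ?ked_E3, ?ked_E4, ?ked_E1, ?ked_E2;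
  (knorm (kn_calc X) f f (#q 0 : K) HX); knring.
Qed.

Context (xco : coord -> K) (pd_xco : forall mu nu, pd nu (xco mu) = kcoord_delta mu nu).

(** Commutators applied to the coordinate functions give the components of the bracket. *)
Lemma br0 i j k : kinner S (kbracket (kfr S i) (kfr S j)) (kfr S k) = ksum4 (fun n => cc0 i j n * kmink n k).
Proof.
assert (E : forall n mu, ked S n (xco mu) = kfr S n mu).
{ intros. unfold ked, kdir, ksumc. rewrite !pd_xco. destruct mu; unfold kcoord_delta; ring. }
assert (B : forall mu, kbracket (kfr S i) (kfr S j) mu = ksum4 (fun n => cc0 i j n * kfr S n mu)).
{ intros mu. assert (H := comm0 i j (xco mu)). rewrite !E in H. unfold ksum4 in *. rewrite !E in H.
  exact H. }
transitivity (ksum4 (fun n => cc0 i j n * kinner S (kfr S n) (kfr S k))).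
- unfold kinner, ksumc. rewrite !B. unfold ksum4. ring.
- unfold ksum4. now rewrite !Hin.
Qed.

Definition b0 (i j k : idx) : K := ksum4 (fun n => cc0 i j n * kmink n k).
Definition g0 (i j k : idx) : K := half * (b0 i j k - b0 i k j - b0 j k i).
Lemma gam0 i j k : kgam S i j k = g0 i j k.
Proof. rewrite (kgam_koszul S Hin). rewrite !br0. reflexivity. Qed.
End Background.
End PrincipalFrame.

(** * Background and first-order parts *)

Module DualNumbers.
Import DifferentialRings FrameGeometry Koszul CurvatureSymmetries CartanEquations FieldEquations.
Open Scope dr_scope.

(* Rings of dual numbers: [u = bg u + eps * lam u], [eps * eps = 0]. *)
Record dual (K : dring) := Dual {
  bg : K -> K; lam : K -> K; eps : K;
  bg_add : forall u v, bg (u + v) = bg u + bg v;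
  bg_mul : forall u v, bg (u * v) = bg u * bg v;
  bg_cst : forall z, bg (cst z) = cst z;
  bg_pd : forall m u, bg (pd m u) = pd m (bg u);
  bg_bg : forall u, bg (bg u) = bg u;
  lam_add : forall u v, lam (u + v) = lam u + lam v;
  lam_mul : forall u v, lam (u * v) = lam u * bg v + bg u * lam v;
  lam_cst : forall z, lam (cst z) = #q 0;
  lam_pd : forall m u, lam (pd m u) = pd m (lam u);
  lam_bg : forall u, lam (bg u) = #q 0;
  dec : forall u, u = bg u + eps * lam u;
  bg_epsv : bg eps = #q 0;
  epseps : eps * eps = #q 0;
  pd_eps : forall m, pd m eps = #q 0
}.
Arguments bg {_}. Arguments lam {_}. Arguments eps {_}.

Section Dual.
Context {K : dring} (T : dual K).
Add Ring KringM : (kth K) (morphism (kc_morph K), constants [kcst]).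
Local Notation bg := (DualNumbers.bg T).
Local Notation lam := (DualNumbers.lam T).
Local Notation eps := (DualNumbers.eps T).

Lemma bg_kc c : bg (kc c) = kc c. Proof. apply bg_cst. Qed.
Lemma lam_kc c : lam (kc c) = #q 0. Proof. apply lam_cst. Qed.
Lemma bg_opp u : bg (- u) = - bg u.
Proof. replace (- u) with (#q (-1) * u) by ring. rewrite bg_mul, bg_kc. ring. Qed.
Lemma bg_sub u v : bg (u - v) = bg u - bg v.
Proof. replace (u - v) with (u + - v) by ring. rewrite bg_add, bg_opp. ring. Qed.
Lemma lam_opp u : lam (- u) = - lam u.
Proof. replace (- u) with (#q (-1) * u) by ring. rewrite lam_mul, bg_kc, lam_kc. ring. Qed.
Lemma lam_sub u v : lam (u - v) = lam u - lam v.
Proof. replace (u - v) with (u + - v) by ring. rewrite lam_add, lam_opp. ring. Qed.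
Lemma small_bg u : bg u = #q 0 -> small eps u.
Proof. intros H. exists (lam u). rewrite (dec _ T u) at 1. rewrite H. ring. Qed.
Lemma bg_small u v : u = eps * v -> bg u = #q 0.
Proof. intros ->. rewrite bg_mul, (bg_epsv _ T). ring. Qed.
Lemma dual_ext u v : bg u = bg v -> lam u = lam v -> u = v.
Proof. intros H1 H2. now rewrite (dec _ T u), (dec _ T v), H1, H2. Qed.

Definition bgS (S : kspacetime K) : kspacetime K :=
  Kspacetime K (fun m n => bg (kmet S m n)) (fun i m => bg (kfr S i m)) (fun m n => bg (kem S m n)).

Context (S : kspacetime K).
Local Notation S0 := (bgS S).

Lemma bg_kmink i j : bg (kmink i j) = kmink i j.
Proof. unfold kmink. destruct i, j; apply bg_kc. Qed.
Lemma bg_kmink_inv i j : bg (kmink_inv i j) = kmink_inv i j.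
Proof. unfold kmink_inv. destruct i, j; apply bg_kc. Qed.
Lemma bg_dir V u : bg (kdir V u) = kdir (fun m => bg (V m)) (bg u).
Proof. unfold kdir, ksumc. now rewrite !bg_add, !bg_mul, !bg_pd. Qed.
Lemma bg_inner V W : bg (kinner S V W) = kinner S0 (fun m => bg (V m)) (fun m => bg (W m)).
Proof. unfold kinner, ksumc. now rewrite !bg_add, !bg_mul. Qed.
Lemma bg_bracket V W m : bg (kbracket V W m) = kbracket (fun m => bg (V m)) (fun m => bg (W m)) m.
Proof. unfold kbracket. now rewrite bg_sub, !bg_dir. Qed.
Lemma kinner_ext (V V' W W' : coord -> K) : (forall m, V m = V' m) -> (forall m, W m = W' m) ->
  kinner S0 V W = kinner S0 V' W'.
Proof. intros H1 H2. unfold kinner, ksumc. now rewrite !H1, !H2. Qed.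
Lemma bg_gD U V W : bg (kgD S U V W) = kgD S0 (fun m => bg (U m)) (fun m => bg (V m)) (fun m => bg (W m)).
Proof.
unfold kgD. rewrite bg_mul, bg_kc, !bg_sub, !bg_add, ?bg_sub, ?bg_add, !bg_dir, !bg_inner.
rewrite ?(kinner_ext _ _ _ _ (bg_bracket _ _) (fun m => eq_refl)). reflexivity.
Qed.
Lemma bg_gam i j k : bg (kgam S i j k) = kgam S0 i j k.
Proof. apply bg_gD. Qed.
Lemma bg_gamu i j k : bg (kgamu S i j k) = kgamu S0 i j k.
Proof. unfold kgamu, kraise, ksum4. now rewrite !bg_add, !bg_mul, !bg_kmink_inv, !bg_gam. Qed.
Lemma bg_ked i u : bg (ked S i u) = ked S0 i (bg u).
Proof. apply bg_dir. Qed.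
Lemma bg_riem l k i j : bg (kriem S l k i j) = kriem S0 l k i j.
Proof.
unfold kriem, kriem_up, ksum4.
repeat rewrite ?bg_add, ?bg_sub, ?bg_mul, ?bg_kmink, ?bg_ked, ?bg_gamu. reflexivity.
Qed.
Lemma bg_F i j : bg (kFf S i j) = kFf S0 i j.
Proof. unfold kFf, ksumc. repeat rewrite ?bg_add, ?bg_mul. reflexivity. Qed.
Lemma bg_inner_fr : (forall i j, kinner S (kfr S i) (kfr S j) = kmink i j) ->
  forall i j, kinner S0 (kfr S0 i) (kfr S0 j) = kmink i j.
Proof. intros H i j. rewrite <- bg_kmink, <- H, bg_inner. reflexivity. Qed.

(** The variation of the vector field multiplies a derivative of [bg u], which is zero: first-order
    quantities are differentiated along the background frame. *)
Lemma lam_dir_small V u : bg u = #q 0 -> lam (kdir V u) = kdir (fun m => bg (V m)) (lam u).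
Proof.
intros H. unfold kdir, ksumc. rewrite !lam_add, !lam_mul, !bg_pd, !lam_pd, H.
rewrite (fun m => der_kc _ (pd_derivation m)), !(fun m => der_kc _ (pd_derivation m)). ring.
Qed.
Lemma lam_ked_small i u : bg u = #q 0 -> lam (ked S i u) = ked S0 i (lam u).
Proof. apply lam_dir_small. Qed.
End Dual.
End DualNumbers.

(** * Ricci coefficients and curvature of Kerr-Newman *)

Module BackgroundValues.
Import DifferentialRings FrameGeometry Koszul CurvatureSymmetries CartanEquations FieldEquations Operators NormalForms Coordinates PrincipalFrame DualNumbers.
Open Scope dr_scope.

Section BackgroundValues.
Context {K : dring} (X : kncoord K) (S0 : kspacetime K)
  (Hfr : forall i mu, kfr S0 i mu = xfr X i mu)
  (Hin : forall i j, kinner S0 (kfr S0 i) (kfr S0 j) = kmink i j)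
  (met_sym : forall mu nu, kmet S0 mu nu = kmet S0 nu mu)
  (xco : coord -> K) (pd_xco : forall mu nu, pd nu (xco mu) = kcoord_delta mu nu).
Add Ring KringP : (kth K) (morphism (kc_morph K), constants [kcst]).
Local Notation N := (kn_calc X).
Local Notation half := (#q (1#2)).
Local Notation q := (kq N). Local Notation iq := (kiq N).
Local Notation iqb := (kiqb N). Local Notation Dl := (kDl N).
Local Notation tau := (ktau N). Local Notation im := (kim N).
Local Notation M := (kM N). Local Notation Q := (kQ N).

Ltac knring :=
  let R1 := fresh in let R2 := fresh in let R3 := fresh in let R4 := fresh in
  let R5 := fresh in let R6 := fresh in
  assert (R1 := q_iq K N); assert (R2 := qb_iqb K N); assert (R3 := Dl_iDl K N);
  assert (R4 := im_im K N); assert (R5 := tau_ct K N); assert (R6 := Q_Q K N);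
  ring [R1 R2 R3 R4 R5 R6].
Ltac g0val := unfold kGa, kW, kz2, kom, kom2, kX, kXc, kXb, kXbc, keta1, keta1c, ketab1, ketab1c;
  rewrite ?(gam0 X S0 Hfr Hin xco pd_xco); unfold g0, b0, ksum4, kmink, cc0, z0, w0; knring.

Lemma framed0 : framed S0.
Proof.
apply (framed_intro S0 met_sym Hin (xcf X)) with (xco := xco); [|exact pd_xco].
exact (xcf_fr X S0 Hfr).
Qed.

Lemma W4_0 : #i * kW S0 E4 = half * (iqb - iq). Proof. g0val. Qed.
Lemma W3_0 : #i * kW S0 E3 = half * Dl * iq * iqb * (iqb - iq). Proof. g0val. Qed.
Lemma W1_0 : kW S0 E1 = #q 0. Proof. g0val. Qed.
Lemma W2_0 : kW S0 E2 = w0 X. Proof. g0val. Qed.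
Lemma z4_0 : kz2 S0 E4 = #q 0. Proof. g0val. Qed.
Lemma z3_0 : kz2 S0 E3 = z0 X. Proof. g0val. Qed.
Lemma z1_0 : kz2 S0 E1 = #i * tau * im * (iq - iqb). Proof. g0val. Qed.
Lemma z2_0 : kz2 S0 E2 = tau * im * (iq + iqb). Proof. g0val. Qed.
Lemma X_0 : kX S0 = #q 2 * iq. Proof. g0val. Qed.
Lemma Xc_0 : kXc S0 = #q 2 * iqb. Proof. g0val. Qed.
Lemma Xb_0 : kXb S0 = - #q 2 * Dl * iq * iqb * iqb. Proof. g0val. Qed.
Lemma Xbc_0 : kXbc S0 = - #q 2 * Dl * iqb * iq * iq. Proof. g0val. Qed.
Lemma eta_0 : keta1 S0 = #i * tau * im * iqb. Proof. g0val. Qed.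
Lemma etac_0 : keta1c S0 = - #i * tau * im * iq. Proof. g0val. Qed.
Lemma etab_0 : ketab1 S0 = - #i * tau * im * iq. Proof. g0val. Qed.
Lemma etabc_0 : ketab1c S0 = #i * tau * im * iqb. Proof. g0val. Qed.
Lemma om1_0 : kom S0 E1 = iqb. Proof. g0val. Qed.
Lemma om2_0 : kom S0 E2 = #i * iqb. Proof. g0val. Qed.
Lemma om3_0 : kom S0 E3 = #q 2 * #i * tau * im * iqb. Proof. g0val. Qed.
Lemma om4_0 : kom S0 E4 = #q 0. Proof. g0val. Qed.
Lemma omb1_0 : kom2 S0 E1 = - Dl * iq * iqb * iqb. Proof. g0val. Qed.
Lemma omb2_0 : kom2 S0 E2 = #i * Dl * iq * iqb * iqb. Proof. g0val. Qed.
Lemma omb3_0 : kom2 S0 E3 = #q 0. Proof. g0val. Qed.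
Lemma omb4_0 : kom2 S0 E4 = #q 2 * #i * tau * im * iqb. Proof. g0val. Qed.
Lemma Ga_0 i : kGa S0 i = match i with
  | E1 => half * #i * tau * im * (iq - iqb)
  | E2 => #i * w0 X + half * tau * im * (iq + iqb)
  | E3 => half * Dl * iq * iqb * (iqb - iq) + half * z0 X
  | E4 => half * (iqb - iq) end.
Proof. destruct i; cbv beta iota; g0val. Qed.
Lemma cc_0 i j n : kcc S0 i j n = cc0 X i j n.
Proof.
unfold kcc, kgamu, kraise, ksum4. rewrite !(gam0 X S0 Hfr Hin xco pd_xco).
unfold g0, b0, ksum4, kmink, kmink_inv. destruct n, i, j; unfold cc0; ring.
Qed.
Lemma small_0 :
  (forall a : hor, kgam S0 E4 E4 a = #q 0) /\ (forall a : hor, kgam S0 E3 E3 a = #q 0) /\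
  kgam S0 E1 E4 E1 - kgam S0 E2 E4 E2 = #q 0 /\ kgam S0 E1 E4 E2 + kgam S0 E2 E4 E1 = #q 0 /\
  kgam S0 E1 E3 E1 - kgam S0 E2 E3 E2 = #q 0 /\ kgam S0 E1 E3 E2 + kgam S0 E2 E3 E1 = #q 0.
Proof. repeat split; try intros []; unfold emb; g0val. Qed.

Lemma HZ : Dm N (#q 0) = #q 0. Proof. apply (Dm_kc N). Qed.

(** The conjugate of the background [P]. *)
Definition P0c : K := - #q 2 * M * iqb * iqb * iqb + #q 2 * Q * Q * iqb * iqb * iqb * iq.

(** Curvature from the structure equations: only the table [cc0], the connection coefficients and
    their first derivatives occur. *)
Ltac curv :=
  rewrite ?(cartan1 S0 framed0), ?(cartan2 S0 framed0);
  unfold ksum4; rewrite !cc_0, ?Ga_0, ?om1_0, ?om2_0, ?om3_0, ?om4_0, ?omb1_0, ?omb2_0, ?omb3_0, ?omb4_0;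
  unfold cc0, w0, z0, P0c;
  rewrite ?(ked_E1 X S0 Hfr), ?(ked_E2 X S0 Hfr), ?(ked_E3 X S0 Hfr), ?(ked_E4 X S0 Hfr);
  knorm (kn_calc X) (#q 0 : K) (#q 0 : K) (#q 0 : K) HZ; knring.

Lemma Ups4_0 : kUps S0 E4 E1 - #i * kUps S0 E4 E2 = #q 0. Proof. curv. Qed.
Lemma Ups3_0 : kUps S0 E3 E1 + #i * kUps S0 E3 E2 = #q 0. Proof. curv. Qed.
Lemma Th3_0 : kTh S0 E3 E1 - #i * kTh S0 E3 E2 = #q 2 * P0c. Proof. curv. Qed.
Lemma Ups34_0 : kUps S0 E3 E4 = #q 2 * P0c + #q 2 * Q * Q * iq * iq * iqb * iqb. Proof. curv. Qed.
Lemma Ups12_0 : kUps S0 E1 E2 = #i * (P0c - Q * Q * iq * iq * iqb * iqb). Proof. curv. Qed.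
Lemma Th34_0 : kTh S0 E3 E4 = #q 0. Proof. curv. Qed.
Lemma Th41_0 : kTh S0 E4 E1 = #q 0. Proof. curv. Qed.
Lemma Th42_0 : kTh S0 E4 E2 = #q 0. Proof. curv. Qed.
End BackgroundValues.
End BackgroundValues.

(** * Reduction to the first component *)

Module AntiSelfDual.
Import DifferentialRings FrameGeometry Koszul CurvatureSymmetries CartanEquations FieldEquations DualNumbers.
Open Scope dr_scope.

(* The complex forms of [s_1(C)] and [s_2(C)], determined by their first component. *)
Definition asd1 {K : dring} (F : hor -> K) : Prop := F h2 = - #i * F h1.
Definition asd2 {K : dring} (U : hor -> hor -> K) : Prop :=
  U h1 h2 = - #i * U h1 h1 /\ U h2 h1 = - #i * U h1 h1 /\ U h2 h2 = - U h1 h1.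

Section AntiSelfDual.
Context {K : dring} (S : kspacetime K).
Add Ring KringV : (kth K) (morphism (kc_morph K), constants [kcst]).
Context (Hin : forall i j, kinner S (kfr S i) (kfr S j) = kmink i j).
Local Notation half := (#q (1#2)).

(** The rotation coefficient of the horizontal frame. On first components the horizontal connection
    is multiplication by [i kw], or [2 i kw] for rank two. *)
Definition kw (V : coord -> K) : K := kgD S V (kfr S E1) (kfr S E2).

Lemma kgD_anti V i j : kgD S V (kfr S i) (kfr S j) = - kgD S V (kfr S j) (kfr S i).
Proof.
assert (Z : forall (Y : coord -> K) x y, kdir Y (kmink (K := K) x y) = #q 0).
{ intros Y x y. unfold kmink. destruct x, y; apply (der_kc _ (kdir_derivation Y)). }
unfold kgD. rewrite !Hin, !Z.
assert (B : forall P Q R : coord -> K, kinner S (kbracket P Q) R = - kinner S (kbracket Q P) R).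
{ intros. unfold kinner, ksumc. rewrite !(kbracket_anti P Q). ring. }
rewrite (B (kfr S j) (kfr S i) V). ring.
Qed.
Lemma kgD_refl V i : kgD S V (kfr S i) (kfr S i) = #q 0.
Proof.
transitivity (half * (kgD S V (kfr S i) (kfr S i) + kgD S V (kfr S i) (kfr S i))); [ring|].
rewrite (kgD_anti V i i) at 1. ring.
Qed.

Lemma nabla1_h1 V (F : hor -> K) : asd1 F -> knabla1 S V F h1 = kdir V (F h1) + #i * kw V * F h1.
Proof.
unfold asd1, knabla1, kw, ksumh, emb. intros ->. rewrite !kgD_refl. ring.
Qed.
Lemma nabla1_asd V (F : hor -> K) : asd1 F -> asd1 (knabla1 S V F).
Proof.
intros H. unfold asd1. rewrite (nabla1_h1 V F H). unfold asd1, knabla1, kw, ksumh, emb in *.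
rewrite H, !kgD_refl, (kgD_anti V E2 E1).
rewrite !(der_mul _ (kdir_derivation V)), !(der_opp _ (kdir_derivation V)), !(der_kc _ (kdir_derivation V)). ring.
Qed.
Lemma nabla2_h1 V (U : hor -> hor -> K) : asd2 U ->
  knabla2 S V U h1 h1 = kdir V (U h1 h1) + #q 2 * #i * kw V * U h1 h1.
Proof.
unfold asd2, knabla2, kw, ksumh, emb. intros (e1 & e2 & e3); rewrite ?e1, ?e2, ?e3. rewrite !kgD_refl. ring.
Qed.
Lemma nabla2_asd V (U : hor -> hor -> K) : asd2 U -> asd2 (knabla2 S V U).
Proof.
intros H. unfold asd2. rewrite (nabla2_h1 V U H). unfold asd2, knabla2, kw, ksumh, emb in *.
destruct H as (H1 & H2 & H3).
rewrite H1, H2, H3, !kgD_refl, !(kgD_anti V E2 E1).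
repeat rewrite ?(der_mul _ (kdir_derivation V)), ?(der_opp _ (kdir_derivation V)), ?(der_kc _ (kdir_derivation V)).
repeat split; ring.
Qed.

Lemma asd1_scal c (F G : hor -> K) : asd1 F -> (forall a, G a = c * F a) -> asd1 G.
Proof. unfold asd1. intros H E. rewrite !E, H. ring. Qed.
Lemma asd2_scal c (F G : hor -> hor -> K) : asd2 F -> (forall a b, G a b = c * F a b) -> asd2 G.
Proof. unfold asd2. intros (H1 & H2 & H3) E. rewrite !E, H1, H2, H3. repeat split; ring. Qed.
Lemma asd1_add (F G H : hor -> K) : asd1 F -> asd1 G -> (forall a, H a = F a + G a) -> asd1 H.
Proof. unfold asd1. intros H1 H2 E. rewrite !E, H1, H2. ring. Qed.
Lemma asd2_add (F G H : hor -> hor -> K) : asd2 F -> asd2 G -> (forall a b, H a b = F a b + G a b) -> asd2 H.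
Proof.
unfold asd2. intros (H1 & H2 & H3) (H4 & H5 & H6) E. rewrite !E, H1, H2, H3, H4, H5, H6.
repeat split; ring.
Qed.
Lemma kcplx1_asd (f : hor -> K) : asd1 (kcplx1 f).
Proof. unfold asd1, kcplx1, kdual1, ksumh, keps. ring. Qed.
Lemma kXhat_asd : asd2 (kXhat S).
Proof.
unfold asd2, kXhat, kcplx2, kdual2, khath, ktrh, ksumh, keps, kdelta. repeat split; ring.
Qed.
Lemma kotimes_asd (F G : hor -> K) : asd1 F -> asd1 G -> asd2 (kotimes F G).
Proof.
unfold asd1, asd2, kotimes, kChath, ksumh, kdelta. intros -> ->. repeat split; ring.
Qed.
Lemma kotimes_h1 (F G : hor -> K) : asd1 F -> asd1 G -> kotimes F G h1 h1 = F h1 * G h1.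
Proof.
unfold asd1, asd2, kotimes, kChath, ksumh, kdelta. intros -> ->. ring.
Qed.
Lemma kdot12_asd (F : hor -> K) (U : hor -> hor -> K) : asd2 U -> asd1 (kdot12 F U).
Proof. unfold asd1, asd2, kdot12, ksumh. intros (e1 & e2 & e3); rewrite ?e1, ?e2, ?e3. ring. Qed.
Lemma kdot12_h1 (F : hor -> K) (U : hor -> hor -> K) : asd2 U -> kdot12 F U h1 = (F h1 - #i * F h2) * U h1 h1.
Proof. unfold asd2, kdot12, ksumh. intros (e1 & e2 & e3); rewrite ?e1, ?e2, ?e3. ring. Qed.

(** The four conformal weights of [kcweight] are one expression, [s / 2] times [g(D_i e_4, e_3)], so
    a single formula covers every direction. *)
Lemma kcnabla1_h1 s i F : asd1 F ->
  kcnabla1 S s i F h1 = ked S i (F h1) + (#i * kW S i + half * kc s * kz2 S i) * F h1.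
Proof.
intros H. unfold kcnabla1. rewrite (nabla1_h1 _ _ H). unfold kw, kcweight, kzeta, komega, komegab, kW, kz2.
fold (kgam S i E1 E2). fold (ked S i (F h1)).
assert (E : kgam S E3 E3 E4 = - kgam S E3 E4 E3) by apply kgD_anti.
generalize (kc (K := K) s). intros. destruct i; unfold emb; rewrite ?E; ring.
Qed.
Lemma kcnabla1_asd s i F : asd1 F -> asd1 (kcnabla1 S s i F).
Proof.
intros H. apply (asd1_add (knabla1 S (kfr S i) F) (fun a => kcweight S s i * F a)).
- now apply nabla1_asd.
- now apply (asd1_scal (kcweight S s i) F).
- reflexivity.
Qed.
Lemma kcnabla2_h1 s i U : asd2 U ->
  kcnabla2 S s i U h1 h1 = ked S i (U h1 h1) + (#q 2 * #i * kW S i + half * kc s * kz2 S i) * U h1 h1.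
Proof.
intros H. unfold kcnabla2. rewrite (nabla2_h1 _ _ H). unfold kw, kcweight, kzeta, komega, komegab, kW, kz2.
fold (kgam S i E1 E2). fold (ked S i (U h1 h1)).
assert (E : kgam S E3 E3 E4 = - kgam S E3 E4 E3) by apply kgD_anti.
generalize (kc (K := K) s). intros. destruct i; unfold emb; rewrite ?E; ring.
Qed.
Lemma kcnabla2_asd s i F : asd2 F -> asd2 (kcnabla2 S s i F).
Proof.
intros H. apply (asd2_add (knabla2 S (kfr S i) F) (fun a b => kcweight S s i * F a b)).
- now apply nabla2_asd.
- now apply (asd2_scal (kcweight S s i) F).
- reflexivity.
Qed.

Lemma kcD1_asd s F : asd1 F -> asd2 (kcD1 S s F).
Proof.
intros H. assert (N1 := nabla1_asd (kfr S E1) F H). assert (N2 := nabla1_asd (kfr S E2) F H).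
unfold asd2, asd1, kcD1, ksumh, keps, kZ, kcplx1, kdual1, ksumh, keps in *.
unfold emb. rewrite N1, N2, H. generalize (kc (K := K) s). intros. repeat split; ring.
Qed.
Lemma kChath_asd (U : hor -> hor -> K) : asd2 U -> asd2 (kChath U) /\ kChath U h1 h1 = U h1 h1.
Proof. unfold asd2, kChath, ksumh, kdelta. intros (e1 & e2 & e3); rewrite ?e1, ?e2, ?e3. repeat split; ring. Qed.
Lemma kcDotimes_asd s F : asd1 F -> asd2 (kcDotimes S s F).
Proof. intros H. apply kChath_asd, (kcD1_asd s F H). Qed.
Lemma kcDotimes_h1 s F : asd1 F ->
  kcDotimes S s F h1 h1 = ked S E1 (F h1) + #i * ked S E2 (F h1)
   + (#i * (kW S E1 + #i * kW S E2) + half * kc s * (kz2 S E1 + #i * kz2 S E2)) * F h1.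
Proof.
intros H. unfold kcDotimes. rewrite (proj2 (kChath_asd _ (kcD1_asd s F H))).
unfold kcD1, ksumh, keps, kZ, kcplx1, kdual1, ksumh, keps, kzeta, emb.
rewrite !(nabla1_h1 _ _ H). unfold kw, kW, kz2. fold (kgam S E1 E1 E2) (kgam S E2 E1 E2).
fold (ked S E1 (F h1)) (ked S E2 (F h1)). generalize (kc (K := K) s). intros. ring.
Qed.
Lemma kcDbardot_h1 s U : asd2 U ->
  kcDbardot S s U h1 = #q 2 * (ked S E1 (U h1 h1) - #i * ked S E2 (U h1 h1)
   + (#q 2 * #i * (kW S E1 - #i * kW S E2) + half * kc s * (kz2 S E1 - #i * kz2 S E2)) * U h1 h1).
Proof.
intros H. assert (N1 := nabla2_asd (kfr S E1) U H). assert (N2 := nabla2_asd (kfr S E2) U H).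
assert (M1 := nabla2_h1 (kfr S E1) U H). assert (M2 := nabla2_h1 (kfr S E2) U H).
destruct N1 as (A1 & A2 & A3), N2 as (B1 & B2 & B3). destruct H as (H1 & H2 & H3).
unfold kcDbardot, kcDbar2, ksumh, keps, kZc, kdual1, ksumh, keps, kzeta. unfold emb in *.
rewrite A1, B1, H1, M1, M2. unfold kw, kW, kz2. fold (kgam S E1 E1 E2) (kgam S E2 E1 E2).
fold (ked S E1 (U h1 h1)) (ked S E2 (U h1 h1)). generalize (kc (K := K) s). intros. ring.
Qed.
Lemma kcDbardot_asd s U : asd2 U -> asd1 (kcDbardot S s U).
Proof.
intros H. assert (N1 := nabla2_asd (kfr S E1) U H). assert (N2 := nabla2_asd (kfr S E2) U H).
destruct N1 as (A1 & A2 & A3), N2 as (B1 & B2 & B3). destruct H as (H1 & H2 & H3).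
unfold asd1, kcDbardot, kcDbar2, ksumh, keps, kZc, kdual1, ksumh, keps, kzeta. unfold emb in *.
rewrite A1, A2, A3, B1, B2, B3, H1, H2, H3. generalize (kc (K := K) s). intros. ring.
Qed.

(* Scalar form of the wave operators on the first component, [k] being the rank. *)
Definition nab (k : QI) (i : idx) (g : K) : K := ked S i g + kc k * #i * kW S i * g.
Definition sbox (k : QI) (g : K) : K :=
  ksum4 (fun i => ksum4 (fun j => kmink_inv i j *
    (nab k i (nab k j g) - ksum4 (fun m => kgamu S i j m * nab k m g)))).
Lemma kbox1_h1 F : asd1 F -> kbox1 S F h1 = sbox (1%Q, 0%Q) (F h1).
Proof.
intros H. unfold kbox1, sbox, ksum4.
rewrite !(fun i j => nabla1_h1 (kfr S i) _ (nabla1_asd (kfr S j) F H)).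
rewrite !(fun i => nabla1_h1 (kfr S i) _ H).
unfold nab, ked, kw, kW, kgam.
replace (kc (1%Q, 0%Q)) with (#q 1 : K) by reflexivity.
assert (E : forall u v : K, #q 1 * #i * u * v = #i * u * v) by (intros; ring).
rewrite !E. reflexivity.
Qed.
Lemma kbox2_h1 U : asd2 U -> kbox2 S U h1 h1 = sbox (2%Q, 0%Q) (U h1 h1).
Proof.
intros H. unfold kbox2, sbox, ksum4.
rewrite !(fun i j => nabla2_h1 (kfr S i) _ (nabla2_asd (kfr S j) U H)).
rewrite !(fun i => nabla2_h1 (kfr S i) _ H). reflexivity.
Qed.
Lemma kbox1_asd F : asd1 F -> asd1 (kbox1 S F).
Proof.
intros H. unfold asd1, kbox1, ksum4.
assert (N : forall i, asd1 (knabla1 S (kfr S i) F)) by (intros; now apply nabla1_asd).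
assert (NN : forall i j, asd1 (knabla1 S (kfr S i) (knabla1 S (kfr S j) F))) by (intros; now apply nabla1_asd, nabla1_asd).
unfold asd1 in *. rewrite !N, !NN. ring.
Qed.
Lemma kbox2_asd U : asd2 U -> asd2 (kbox2 S U).
Proof.
intros H.
assert (N := fun i => nabla2_asd (kfr S i) U H).
assert (NN := fun i j => nabla2_asd (kfr S i) _ (nabla2_asd (kfr S j) U H)).
unfold asd2 in *. unfold kbox2, ksum4.
repeat split.
- rewrite !(fun i => proj1 (N i)), !(fun i j => proj1 (NN i j)). ring.
- rewrite !(fun i => proj1 (proj2 (N i))), !(fun i j => proj1 (proj2 (NN i j))). ring.
- rewrite !(fun i => proj2 (proj2 (N i))), !(fun i j => proj2 (proj2 (NN i j))). ring.
Qed.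
End AntiSelfDual.
End AntiSelfDual.

(** * Linearisation of the horizontal operators *)

Module FirstOrder.
Import DifferentialRings FrameGeometry Koszul CurvatureSymmetries CartanEquations FieldEquations DualNumbers AntiSelfDual.
Open Scope dr_scope.

Section Transport.
Context {K : dring} (T : dual K) (S : kspacetime K).
Add Ring KringW : (kth K) (morphism (kc_morph K), constants [kcst]).
Local Notation bg := (DualNumbers.bg T).
Local Notation lam := (DualNumbers.lam T).
Local Notation S0 := (bgS T S).

Definition small1 (F : hor -> K) : Prop := forall a, bg (F a) = #q 0.
Definition small2 (U : hor -> hor -> K) : Prop := forall a b, bg (U a b) = #q 0.
Definition lam1 (F : hor -> K) (a : hor) : K := lam (F a).
Definition lam2 (U : hor -> hor -> K) (a b : hor) : K := lam (U a b).
Definition bgv (V : coord -> K) (m : coord) : K := bg (V m).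

Lemma lam_mul_small c u : bg u = #q 0 -> lam (c * u) = bg c * lam u.
Proof. intros H. rewrite lam_mul, H. ring. Qed.
Lemma bg_mul_small c u : bg u = #q 0 -> bg (c * u) = #q 0.
Proof. intros H. rewrite bg_mul, H. ring. Qed.
Lemma kdir0 (V : coord -> K) : kdir V (#q 0) = #q 0.
Proof. apply (der_kc _ (kdir_derivation V)). Qed.

Lemma bg_nabla1 V F : small1 F -> small1 (knabla1 S V F).
Proof.
intros H a. unfold knabla1, ksumh. repeat rewrite ?bg_sub, ?bg_add, ?bg_mul, ?bg_dir, ?H, ?kdir0. ring.
Qed.
Lemma lam_nabla1 V F a : small1 F -> lam (knabla1 S V F a) = knabla1 S0 (bgv V) (lam1 F) a.
Proof.
intros H. unfold knabla1, ksumh.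
rewrite !lam_sub, !lam_add, (lam_dir_small T V _ (H a)), !lam_mul, !H, !bg_gD.
unfold lam1, bgv. cbn [kfr bgS]. ring.
Qed.
Lemma bg_nabla2 V U : small2 U -> small2 (knabla2 S V U).
Proof.
intros H a b. unfold knabla2, ksumh. repeat rewrite ?bg_sub, ?bg_add, ?bg_mul, ?bg_dir, ?H, ?kdir0. ring.
Qed.
Lemma lam_nabla2 V U a b : small2 U -> lam (knabla2 S V U a b) = knabla2 S0 (bgv V) (lam2 U) a b.
Proof.
intros H. unfold knabla2, ksumh.
rewrite !lam_sub, !lam_add, (lam_dir_small T V _ (H a b)), !lam_mul, !H, !bg_gD.
unfold lam2, bgv. cbn [kfr bgS]. ring.
Qed.
Lemma bg_cweight s i : bg (kcweight S s i) = kcweight S0 s i.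
Proof.
unfold kcweight, kzeta, komega, komegab. destruct i; rewrite ?bg_mul, ?bg_kc, ?bg_gam; reflexivity.
Qed.
Lemma bg_cnabla1 s i F : small1 F -> small1 (kcnabla1 S s i F).
Proof.
intros H a. unfold kcnabla1. rewrite bg_add, (bg_nabla1 _ _ H), (bg_mul_small _ _ (H a)). ring.
Qed.
Lemma lam_cnabla1 s i F a : small1 F -> lam (kcnabla1 S s i F a) = kcnabla1 S0 s i (lam1 F) a.
Proof.
intros H. unfold kcnabla1. rewrite lam_add, (lam_nabla1 _ _ _ H), (lam_mul_small _ _ (H a)), bg_cweight.
reflexivity.
Qed.
Lemma bg_cnabla2 s i F : small2 F -> small2 (kcnabla2 S s i F).
Proof.
intros H a b. unfold kcnabla2. rewrite bg_add, (bg_nabla2 _ _ H), (bg_mul_small _ _ (H a b)). ring.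
Qed.
Lemma lam_cnabla2 s i F a b : small2 F -> lam (kcnabla2 S s i F a b) = kcnabla2 S0 s i (lam2 F) a b.
Proof.
intros H. unfold kcnabla2. rewrite lam_add, (lam_nabla2 _ _ _ _ H), (lam_mul_small _ _ (H a b)), bg_cweight.
reflexivity.
Qed.
Lemma bg_zeta a : bg (kzeta S a) = kzeta S0 a.
Proof. unfold kzeta. now rewrite bg_mul, bg_kc, bg_gam. Qed.
Lemma bg_eps_ab a b : bg (keps a b) = keps a b.
Proof. unfold keps. destruct a, b; apply bg_kc. Qed.
Lemma bg_delta a b : bg (kdelta a b) = kdelta a b.
Proof. unfold kdelta. destruct a, b; apply bg_kc. Qed.
Lemma bg_Z a : bg (kZ S a) = kZ S0 a.
Proof.
unfold kZ, kcplx1, kdual1, ksumh. repeat rewrite ?bg_add, ?bg_mul, ?bg_kc, ?bg_eps_ab, ?bg_zeta. reflexivity.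
Qed.
Lemma bg_Zc a : bg (kZc S a) = kZc S0 a.
Proof.
unfold kZc, kdual1, ksumh. repeat rewrite ?bg_sub, ?bg_add, ?bg_mul, ?bg_kc, ?bg_eps_ab, ?bg_zeta. reflexivity.
Qed.

Lemma bg_cD1 s F : small1 F -> small2 (kcD1 S s F).
Proof.
intros H a b. unfold kcD1, ksumh.
repeat rewrite ?bg_add, ?bg_mul, ?(fun V => bg_nabla1 V _ H), ?H. ring.
Qed.
Lemma lam_cD1 s F a b : small1 F -> lam (kcD1 S s F a b) = kcD1 S0 s (lam1 F) a b.
Proof.
intros H. unfold kcD1, ksumh.
assert (N := fun V => bg_nabla1 V _ H).
rewrite !lam_add, !lam_mul, !lam_add, !lam_mul, !bg_add, !bg_mul, !bg_kc, !bg_eps_ab, !bg_Z, !N, !H,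
  !(lam_nabla1 _ _ _ H), !lam_kc. unfold lam1, bgv. cbn [kfr bgS]. generalize (kc (K := K) s). intros. ring.
Qed.
Lemma bg_Chath U : small2 U -> small2 (kChath U).
Proof. intros H a b. unfold kChath, ksumh. repeat rewrite ?bg_mul, ?bg_sub, ?bg_add, ?H. ring. Qed.
Lemma lam_Chath U a b : small2 U -> lam (kChath U a b) = kChath (lam2 U) a b.
Proof.
intros H. unfold kChath, ksumh.
rewrite !lam_mul, !bg_sub, !lam_sub, !lam_mul, !bg_mul, !lam_add, !bg_add, !bg_kc, !lam_kc, !bg_delta, !H.
unfold lam2. ring.
Qed.
Lemma kChath_ext (U V : hor -> hor -> K) a b : (forall a b, U a b = V a b) -> kChath U a b = kChath V a b.
Proof. intros H. unfold kChath, ksumh. now rewrite !H. Qed.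
Lemma bg_cDotimes s F : small1 F -> small2 (kcDotimes S s F).
Proof. intros H. apply bg_Chath. now apply bg_cD1. Qed.
Lemma lam_cDotimes s F a b : small1 F -> lam (kcDotimes S s F a b) = kcDotimes S0 s (lam1 F) a b.
Proof.
intros H. unfold kcDotimes. rewrite (lam_Chath _ _ _ (bg_cD1 s F H)). apply kChath_ext.
intros. now apply lam_cD1.
Qed.
Lemma bg_cDbardot s U : small2 U -> small1 (kcDbardot S s U).
Proof.
intros H a. unfold kcDbardot, kcDbar2, ksumh.
repeat rewrite ?bg_add, ?bg_sub, ?bg_mul, ?(fun V => bg_nabla2 V _ H), ?H. ring.
Qed.
Lemma lam_cDbardot s U a : small2 U -> lam (kcDbardot S s U a) = kcDbardot S0 s (lam2 U) a.
Proof.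
intros H. unfold kcDbardot, kcDbar2, ksumh.
assert (N := fun V => bg_nabla2 V _ H).
repeat rewrite ?lam_add, ?lam_sub, ?lam_mul, ?bg_add, ?bg_mul, ?bg_kc, ?bg_eps_ab, ?bg_Zc, ?N, ?H,
  ?(fun V a b => lam_nabla2 V _ a b H), ?lam_kc. unfold lam2, bgv. cbn [kfr bgS].
generalize (kc (K := K) s). intros. ring.
Qed.
Lemma knabla1_ext V (F G : hor -> K) a : (forall c, F c = G c) -> knabla1 S0 V F a = knabla1 S0 V G a.
Proof. intros H. unfold knabla1, ksumh. now rewrite !H. Qed.
Lemma knabla2_ext V (F G : hor -> hor -> K) a b : (forall c d, F c d = G c d) -> knabla2 S0 V F a b = knabla2 S0 V G a b.
Proof. intros H. unfold knabla2, ksumh. now rewrite !H. Qed.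
Lemma bg_box1 F : small1 F -> small1 (kbox1 S F).
Proof.
intros H a. unfold kbox1, ksum4.
assert (N := fun V => bg_nabla1 V _ H). assert (NN := fun V W => bg_nabla1 V _ (N W)).
repeat rewrite ?bg_add, ?bg_sub, ?bg_mul, ?N, ?NN. ring.
Qed.
Lemma lam_box1 F a : small1 F -> lam (kbox1 S F a) = kbox1 S0 (lam1 F) a.
Proof.
intros H. unfold kbox1, ksum4.
assert (N := fun V => bg_nabla1 V _ H). assert (NN := fun V W => bg_nabla1 V _ (N W)).
assert (L : forall V W, lam (knabla1 S V (knabla1 S W F) a) = knabla1 S0 (bgv V) (knabla1 S0 (bgv W) (lam1 F)) a).
{ intros. rewrite (lam_nabla1 _ _ _ (N W)). apply knabla1_ext. intros c. apply lam_nabla1, H. }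
rewrite !lam_add.
(* One identity with arbitrary vector fields and coefficients serves all sixteen terms of the wave
   operator. *)
assert (E : forall i j V W n1 n2 n3 n4 F1 F2 F3 F4,
  lam (kmink_inv i j * (knabla1 S V (knabla1 S W F) a -
     (n1 * knabla1 S F1 F a + n2 * knabla1 S F2 F a + n3 * knabla1 S F3 F a + n4 * knabla1 S F4 F a)))
  = kmink_inv i j * (knabla1 S0 (bgv V) (knabla1 S0 (bgv W) (lam1 F)) a -
     (bg n1 * knabla1 S0 (bgv F1) (lam1 F) a + bg n2 * knabla1 S0 (bgv F2) (lam1 F) a
      + bg n3 * knabla1 S0 (bgv F3) (lam1 F) a + bg n4 * knabla1 S0 (bgv F4) (lam1 F) a))).
{ intros i j V W n1 n2 n3 n4 F1 F2 F3 F4.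
  rewrite lam_mul, bg_kmink_inv, bg_sub, !bg_add, !bg_mul, NN, !N, lam_sub, L, !lam_add,
    !(fun c V => lam_mul_small c _ (N V a)), !(lam_nabla1 _ _ _ H). ring. }
rewrite !E, !bg_gamu. reflexivity.
Qed.
Lemma bg_box2 F : small2 F -> small2 (kbox2 S F).
Proof.
intros H a b. unfold kbox2, ksum4.
assert (N := fun V => bg_nabla2 V _ H). assert (NN := fun V W => bg_nabla2 V _ (N W)).
repeat rewrite ?bg_add, ?bg_sub, ?bg_mul, ?N, ?NN. ring.
Qed.
Lemma lam_box2 F a b : small2 F -> lam (kbox2 S F a b) = kbox2 S0 (lam2 F) a b.
Proof.
intros H. unfold kbox2, ksum4.
assert (N := fun V => bg_nabla2 V _ H). assert (NN := fun V W => bg_nabla2 V _ (N W)).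
assert (L : forall V W, lam (knabla2 S V (knabla2 S W F) a b) = knabla2 S0 (bgv V) (knabla2 S0 (bgv W) (lam2 F)) a b).
{ intros. rewrite (lam_nabla2 _ _ _ _ (N W)). apply knabla2_ext. intros c d. apply lam_nabla2, H. }
rewrite !lam_add.
assert (E : forall i j V W n1 n2 n3 n4 F1 F2 F3 F4,
  lam (kmink_inv i j * (knabla2 S V (knabla2 S W F) a b -
     (n1 * knabla2 S F1 F a b + n2 * knabla2 S F2 F a b + n3 * knabla2 S F3 F a b + n4 * knabla2 S F4 F a b)))
  = kmink_inv i j * (knabla2 S0 (bgv V) (knabla2 S0 (bgv W) (lam2 F)) a b -
     (bg n1 * knabla2 S0 (bgv F1) (lam2 F) a b + bg n2 * knabla2 S0 (bgv F2) (lam2 F) a b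
      + bg n3 * knabla2 S0 (bgv F3) (lam2 F) a b + bg n4 * knabla2 S0 (bgv F4) (lam2 F) a b))).
{ intros i j V W n1 n2 n3 n4 F1 F2 F3 F4.
  rewrite lam_mul, bg_kmink_inv, bg_sub, !bg_add, !bg_mul, NN, !N, lam_sub, L, !lam_add,
    !(fun c V => lam_mul_small c _ (N V a b)), !(lam_nabla2 _ _ _ _ H). ring. }
rewrite !E, !bg_gamu. reflexivity.
Qed.
End Transport.
End FirstOrder.

(** * The linearised system over the ring of dual numbers *)

Module Linearisation.
Import DifferentialRings FrameGeometry Koszul CurvatureSymmetries CartanEquations FieldEquations Operators NormalForms Decoupling Coordinates PrincipalFrame DualNumbers BackgroundValues AntiSelfDual FirstOrder.
Open Scope dr_scope.

Record kn_perturbation {K : dring} (T : dual K) (X : kncoord K) (S : kspacetime K) : Prop := {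
  p_em : einstein_maxwell S;
  p_inner : forall i j, kinner S (kfr S i) (kfr S j) = kmink i j;
  p_sym : forall mu nu, kmet S mu nu = kmet S nu mu;
  p_fr : forall i mu, bg T (kfr S i mu) = xfr X i mu;
  p_F4 : forall a : hor, kFf (bgS T S) a E4 = #q 0;
  p_F3 : forall a : hor, kFf (bgS T S) a E3 = #q 0;
  p_PF : kPF (bgS T S) = kQ (kn_calc X) * kiqb (kn_calc X) * kiqb (kn_calc X);
  p_PFc : kPFc (bgS T S) = kQ (kn_calc X) * kiq (kn_calc X) * kiq (kn_calc X);
  p_co : exists xco : coord -> K, forall mu nu, pd nu (xco mu) = kcoord_delta mu nu
}.

Section Tensorial.
Context {K : dring} (S : kspacetime K).
Add Ring KringY0 : (kth K) (morphism (kc_morph K), constants [kcst]).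

(** Tensoriality in the direction of differentiation; with [kgD_add] it expands the derivative along
    [partial_t] in the frame. *)
Lemma kgD_scal c (V Y W : coord -> K) :
  kgD S (fun m => c * V m) Y W = c * kgD S V Y W.
Proof.
assert (I1 : forall A B : coord -> K, kinner S (fun m => c * A m) B = c * kinner S A B)
  by (intros; unfold kinner, ksumc; ring).
assert (I2 : forall A B : coord -> K, kinner S B (fun m => c * A m) = c * kinner S B A)
  by (intros; unfold kinner, ksumc; ring).
assert (B1 : forall A B R : coord -> K, kinner S (kbracket (fun m => c * A m) B) R
   = c * kinner S (kbracket A B) R - kdir B c * kinner S A R).
{ intros. unfold kinner, ksumc, kbracket, kdir, ksumc. rewrite !pd_mul. ring. }
unfold kgD. rewrite !I1, !I2, !B1.
rewrite !(der_mul _ (kdir_derivation Y)), !(der_mul _ (kdir_derivation W)).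
assert (D : forall f : K, kdir (fun m => c * V m) f = c * kdir V f) by (intros; unfold kdir, ksumc; ring).
rewrite D. ring.
Qed.
Lemma kgD_add (V V' Y W : coord -> K) :
  kgD S (fun m => V m + V' m) Y W = kgD S V Y W + kgD S V' Y W.
Proof.
assert (I1 : forall A A' B : coord -> K, kinner S (fun m => A m + A' m) B = kinner S A B + kinner S A' B)
  by (intros; unfold kinner, ksumc; ring).
assert (I2 : forall A A' B : coord -> K, kinner S B (fun m => A m + A' m) = kinner S B A + kinner S B A')
  by (intros; unfold kinner, ksumc; ring).
assert (B1 : forall A A' B R : coord -> K, kinner S (kbracket (fun m => A m + A' m) B) R
   = kinner S (kbracket A B) R + kinner S (kbracket A' B) R).
{ intros. unfold kinner, ksumc, kbracket, kdir, ksumc. rewrite !pd_add. ring. }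
unfold kgD. rewrite !I1, !I2, !B1.
rewrite !(der_add _ (kdir_derivation Y)), !(der_add _ (kdir_derivation W)).
assert (D : forall f : K, kdir (fun m => V m + V' m) f = kdir V f + kdir V' f) by (intros; unfold kdir, ksumc; ring).
rewrite D. ring.
Qed.
Lemma kgD_ext (V V' Y W : coord -> K) : (forall m, V m = V' m) -> kgD S V Y W = kgD S V' Y W.
Proof.
intros H. unfold kgD, kinner, kbracket, kdir, ksumc. now rewrite !H.
Qed.
End Tensorial.

Definition kdt {K : dring} (m : coord) : K := match m with ct => #q 1 | _ => #q 0 end.

(** Besides the coefficients of the statement, the last seven fields hold the weights, the time
    coefficient, the potentials and the coupling factors. All are arbitrary at this stage. *)
Record kcoeffs (K : dring) := Kcoeffs {
  c4F : K; caX : K; cZB : hor -> K; cWZF : hor -> K; caB : K; cYF : K;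
  cY0B : K; cZ0B : K; cY0X : K; cWZ0 : K; cY0F : hor -> K; cW0B : hor -> K; cW0X : hor -> K;
  cwp : K; cwq : K; ct1 : K; cV1 : K; cV2 : K; cr1 : K; cr2 : K }.
Arguments c4F {_}. Arguments caX {_}. Arguments cZB {_}. Arguments cWZF {_}. Arguments caB {_}.
Arguments cYF {_}. Arguments cY0B {_}. Arguments cZ0B {_}. Arguments cY0X {_}. Arguments cWZ0 {_}.
Arguments cY0F {_}. Arguments cW0B {_}. Arguments cW0X {_}. Arguments cwp {_}. Arguments cwq {_}.
Arguments ct1 {_}. Arguments cV1 {_}. Arguments cV2 {_}. Arguments cr1 {_}. Arguments cr2 {_}.

Definition qone : QI := (1%Q, 0%Q).
Definition qtwo : QI := (2%Q, 0%Q).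
Definition qzero : QI := (0%Q, 0%Q).

Section Equations.
Context {K : dring} (S : kspacetime K) (k : kcoeffs K).
Definition kfrp (b : hor) : K :=
  cwp k * (kcnabla1 S qone E3 (kfrB S) b
    + (#q 2 * ktrchib S - #q (5#2) * #i * katrchib S) * kfrB S b).
Definition kfrqF (b c : hor) : K :=
  cwq k * (kcnabla2 S qone E3 (kfrF S) b c
    + (ktrchib S - #q 3 * #i * katrchib S) * kfrF S b c).
Definition kLp (b : hor) : K :=
  let PP := #q 2 * kPF S * kPFc S in
  cwp k * (- ksumh (fun c => cZB k c * kcnabla1 S qone c (kfrB S) b)
    + PP * cYF k * kcDbardot S qone (kfrF S) b
    + (PP * cY0B k - cZ0B k) * kfrB S b
    + PP * (kdot12 (cY0F k) (kfrF S) b + cY0X k * kfrX S b)).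
Definition kLqF (b c : hor) : K :=
  cwq k * (c4F k * kcnabla2 S qone E4 (kfrF S) b c
    + ksumh (fun d => cWZF k d * kcnabla2 S qone d (kfrF S) b c)
    + caX k * kcDotimes S qtwo (kfrX S) b c
    + caB k * kcDotimes S qone (kfrB S) b c
    + cWZ0 k * kfrF S b c
    + kotimes (cW0B k) (kfrB S) b c + kotimes (cW0X k) (kfrX S) b c).
Definition klhs1 (b : hor) : K :=
  kbox1 S kfrp b - #i * ct1 k * knabla1 S kdt kfrp b - cV1 k * kfrp b.
Definition krhs1 (b : hor) : K := cr1 k * kcDbardot S qzero kfrqF b + kLp b.
Definition klhs2 (b c : hor) : K :=
  kbox2 S kfrqF b c - #i * (#q 2 * ct1 k) * knabla2 S kdt kfrqF b c - cV2 k * kfrqF b c.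
Definition krhs2 (b c : hor) : K :=
  cr2 k * (kcDotimes S qzero kfrp b c
     - #q (3#2) * kotimes (fun d => kH S d - kHb S d) kfrp b c) + kLqF b c.
End Equations.

Section Linearised.
Context {K : dring} (T : dual K) (X : kncoord K) (S : kspacetime K) (KP : kn_perturbation T X S).
Add Ring KringR : (kth K) (morphism (kc_morph K), constants [kcst]).
Local Notation N := (kn_calc X).
Local Notation half := (#q (1#2)).
Local Notation q := (kq N). Local Notation iq := (kiq N). Local Notation qb := (kqb N).
Local Notation iqb := (kiqb N). Local Notation Dl := (kDl N).
Local Notation tau := (ktau N). Local Notation ct := (kct N). Local Notation im := (kim N). Local Notation Q := (kQ N).
Local Notation bg := (DualNumbers.bg T).
Local Notation lam := (DualNumbers.lam T).
Local Notation eps := (DualNumbers.eps T).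
Local Notation S0 := (bgS T S).
Local Notation Dp := (Dp N). Local Notation Dm := (Dm N).
Local Notation Lp := (Lp N). Local Notation Lm := (Lm N).

Let EM := p_em T X S KP.

Lemma fr0 i mu : kfr S0 i mu = xfr X i mu.
Proof. apply (p_fr T X S KP). Qed.
Lemma in0 i j : kinner S0 (kfr S0 i) (kfr S0 j) = kmink i j.
Proof. apply bg_inner_fr, KP. Qed.
Lemma sym0 mu nu : kmet S0 mu nu = kmet S0 nu mu.
Proof. cbn. now rewrite (p_sym T X S KP). Qed.

Lemma bg_value (f g : K) : (forall xco : coord -> K, (forall mu nu, pd nu (xco mu) = kcoord_delta mu nu) -> f = g) -> f = g.
Proof. intros H. destruct (p_co T X S KP) as [xco Hx]. exact (H xco Hx). Qed.

Ltac bgp := repeat rewrite ?bg_add, ?bg_sub, ?bg_opp, ?bg_mul, ?bg_kc, ?bg_gam, ?bg_riem, ?bg_ked, ?bg_F.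
Ltac bgv L := apply bg_value; intros xco Hx; exact (L K X S0 fr0 in0 xco Hx).
Ltac bgv' L := apply bg_value; intros xco Hx; exact (L K X S0 fr0 in0 sym0 xco Hx).

Lemma bgTh i j : bg (kTh S i j) = kTh S0 i j.
Proof. unfold kTh. bgp. reflexivity. Qed.
Lemma bgUps i j : bg (kUps S i j) = kUps S0 i j.
Proof. unfold kUps. bgp. reflexivity. Qed.
Lemma bgW i : bg (kW S i) = kW S0 i.
Proof. unfold kW. bgp. reflexivity. Qed.
Lemma bgz i : bg (kz2 S i) = kz2 S0 i.
Proof. unfold kz2. bgp. reflexivity. Qed.
Lemma bgGa i : bg (kGa S i) = kGa S0 i.
Proof. unfold kGa, kW, kz2. bgp. reflexivity. Qed.
Lemma bgX : bg (kX S) = #q 2 * iq.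
Proof. transitivity (kX S0); [unfold kX; bgp; reflexivity|]. bgv @X_0. Qed.
Lemma bgXc : bg (kXc S) = #q 2 * iqb.
Proof. transitivity (kXc S0); [unfold kXc; bgp; reflexivity|]. bgv @Xc_0. Qed.
Lemma bgXb : bg (kXb S) = - #q 2 * Dl * iq * iqb * iqb.
Proof. transitivity (kXb S0); [unfold kXb; bgp; reflexivity|]. bgv @Xb_0. Qed.
Lemma bgXbc : bg (kXbc S) = - #q 2 * Dl * iqb * iq * iq.
Proof. transitivity (kXbc S0); [unfold kXbc; bgp; reflexivity|]. bgv @Xbc_0. Qed.
Lemma bgeta : bg (keta1 S) = #i * tau * im * iqb.
Proof. transitivity (keta1 S0); [unfold keta1; bgp; reflexivity|]. bgv @eta_0. Qed.
Lemma bgetac : bg (keta1c S) = - #i * tau * im * iq.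
Proof. transitivity (keta1c S0); [unfold keta1c; bgp; reflexivity|]. bgv @etac_0. Qed.
Lemma bgetab : bg (ketab1 S) = - #i * tau * im * iq.
Proof. transitivity (ketab1 S0); [unfold ketab1; bgp; reflexivity|]. bgv @etab_0. Qed.
Lemma bgetabc : bg (ketab1c S) = #i * tau * im * iqb.
Proof. transitivity (ketab1c S0); [unfold ketab1c; bgp; reflexivity|]. bgv @etabc_0. Qed.
Lemma bgPF : bg (kPF S) = Q * iqb * iqb.
Proof. transitivity (kPF S0); [unfold kPF, krhoF, krhoF_star; bgp; reflexivity|]. apply KP. Qed.
Lemma bgPFc : bg (kPFc S) = Q * iq * iq.
Proof. transitivity (kPFc S0); [unfold kPFc, krhoF, krhoF_star; bgp; reflexivity|]. apply KP. Qed.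
Lemma W4_ : kW S0 E4 = - half * #i * (iqb - iq).
Proof. transitivity (- #i * (#i * kW S0 E4)); [ring|].
assert (H : #i * kW S0 E4 = half * (iqb - iq)) by bgv @W4_0. rewrite H. ring. Qed.
Lemma W3_ : kW S0 E3 = - half * #i * Dl * iq * iqb * (iqb - iq).
Proof. transitivity (- #i * (#i * kW S0 E3)); [ring|].
assert (H : #i * kW S0 E3 = half * Dl * iq * iqb * (iqb - iq)) by bgv @W3_0. rewrite H. ring. Qed.
Lemma W1_ : kW S0 E1 = #q 0. Proof. bgv @W1_0. Qed.
Lemma W2_ : kW S0 E2 = w0 X. Proof. bgv @W2_0. Qed.
Lemma z4_ : kz2 S0 E4 = #q 0. Proof. bgv @z4_0. Qed.
Lemma z3_ : kz2 S0 E3 = z0 X. Proof. bgv @z3_0. Qed.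
Lemma z1_ : kz2 S0 E1 = #i * tau * im * (iq - iqb). Proof. bgv @z1_0. Qed.
Lemma z2_ : kz2 S0 E2 = tau * im * (iq + iqb). Proof. bgv @z2_0. Qed.
Lemma Ga_ i : kGa S0 i = #i * kW S0 i + half * kz2 S0 i. Proof. reflexivity. Qed.

(** Over dual numbers an element is a multiple of [eps] as soon as its background part vanishes, so
    the tables of background values suffice. *)
Lemma TD : type_D S eps.
Proof.
assert (H : forall P : Prop, (forall xco : coord -> K, (forall mu nu, pd nu (xco mu) = kcoord_delta mu nu) -> P) -> P).
{ intros P HP. destruct (p_co T X S KP) as [xco Hx]. exact (HP xco Hx). }
apply H. intros xco Hx.
destruct (small_0 X S0 fr0 in0 xco Hx) as (H1 & H2 & H3 & H4 & H5 & H6).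
constructor; try apply T; intros; apply small_bg; bgp; auto.
- apply (p_F4 T X S KP).
- apply (p_F3 T X S KP).
- rewrite !bgUps. exact (Ups4_0 X S0 fr0 in0 sym0 xco Hx).
- rewrite !bgUps. exact (Ups3_0 X S0 fr0 in0 sym0 xco Hx).
Qed.

Lemma bgphi : bg (kphi S) = #q 0.
Proof.
unfold kphi. bgp. assert (H1 := p_F4 T X S KP h1). assert (H2 := p_F4 T X S KP h2). cbn [emb] in *.
rewrite H1, H2. ring.
Qed.
Lemma bgsX : bg (ksX S) = #q 0.
Proof. destruct (ksX_small S eps TD) as [v H]. exact (bg_small T _ _ H). Qed.
Lemma bgXi : bg (kXi1 S) = #q 0.
Proof. destruct (kXi_small S EM eps TD) as [v H]. exact (bg_small T _ _ H). Qed.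
Lemma bgR : bg (kR S) = #q 0.
Proof. rewrite (kR_phi S EM eps TD). bgp. rewrite bgphi. ring. Qed.
Lemma bgB : bg (kB S h1) = #q 0.
Proof.
assert (H := Th34 S EM). apply (f_equal (fun u => half * bg u)) in H. revert H.
bgp. rewrite bgTh, bgR.
assert (H0 : kTh S0 E3 E4 = #q 0) by bgv' @Th34_0. rewrite H0. intros H.
transitivity (half * (#q 2 * bg (kB S h1) + #q 0)); [ring|]. rewrite <- H. ring.
Qed.
Lemma bgal : bg (kal S) = #q 0.
Proof.
unfold kal. bgp. rewrite !bgTh.
assert (H1 : kTh S0 E4 E1 = #q 0) by bgv' @Th41_0.
assert (H2 : kTh S0 E4 E2 = #q 0) by bgv' @Th42_0. rewrite H1, H2. ring.
Qed.

Lemma ked_scal i c u : ked S0 i (kc c * u) = kc c * ked S0 i u.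
Proof. rewrite e_mul, e_kc. generalize (kc (K := K) c). intros. ring. Qed.

Definition phi := lam (kphi S).
Definition sig := lam (ksX S).
Definition xi := lam (kXi1 S).
Definition bet := lam (kB S h1).
Definition alp := lam (kal S).

Lemma ked0 i : ked S0 i (#q 0) = #q 0.
Proof. apply (der_kc _ (ked_derivation S0 i)). Qed.

Ltac push1 := repeat rewrite ?lam_add, ?lam_sub, ?lam_opp, ?lam_mul, ?lam_kc,
  ?bg_add, ?bg_sub, ?bg_opp, ?bg_mul, ?bg_kc, ?bg_ked, ?bgphi, ?bgsX, ?bgXi, ?bgB, ?bgal, ?ked0,
  ?bgX, ?bgXc, ?bgXb, ?bgXbc, ?bgeta, ?bgetac, ?bgetab, ?bgetabc, ?bgW, ?bgz, ?bgGa, ?bgPF, ?bgPFc, ?bgTh, ?bgUps.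

Lemma lam_phi i : lam (ked S i (kphi S)) = ked S0 i phi.
Proof. apply lam_ked_small, bgphi. Qed.
Lemma lam_sX i : lam (ked S i (ksX S)) = ked S0 i sig.
Proof. apply lam_ked_small, bgsX. Qed.
Lemma lam_Xi i : lam (ked S i (kXi1 S)) = ked S0 i xi.
Proof. apply lam_ked_small, bgXi. Qed.
Lemma lam_B i : lam (ked S i (kB S h1)) = ked S0 i bet.
Proof. apply lam_ked_small, bgB. Qed.
Lemma lam_al i : lam (ked S i (kal S)) = ked S0 i alp.
Proof. apply lam_ked_small, bgal. Qed.

(** [lam] applied to an exact identity: [kal], the shear and [Xi] have no background part, hence
    only background values of their coefficients survive. *)
Lemma lin_shear :
  alp = #q 2 * ked S0 E4 sig + #q 2 * (#q 2 * #i * kW S0 E4 + half * kz2 S0 E4) * sig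
   + (#q 2 * iq + #q 2 * iqb) * sig - #q 2 * (ked S0 E1 xi + #i * ked S0 E2 xi)
   - #q 2 * (#i * (kW S0 E1 + #i * kW S0 E2) + (kz2 S0 E1 + #i * kz2 S0 E2)
       + #i * tau * im * iqb - #i * tau * im * iq) * xi.
Proof.
assert (H := ricci_shear S EM eps TD). apply (f_equal lam) in H. fold alp in H.
rewrite H. clear H. push1. rewrite ?lam_sX, ?lam_Xi. fold sig xi. ring.
Qed.

Lemma lin_bianchi_1 :
  #q 2 * (ked S0 E4 bet + (kGa S0 E4 + #q 4 * iqb) * bet)
  - #q 2 * (ked S0 E4 (Q * iq * iq * phi) + (kGa S0 E4 + #q 2 * iq) * (Q * iq * iq * phi))
  + (ked S0 E1 alp - #i * ked S0 E2 alp
     + (#q 2 * #i * (kW S0 E1 - #i * kW S0 E2) + (kz2 S0 E1 - #i * kz2 S0 E2) + #i * tau * im * iqb) * alp)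
  - xi * (#q 6 * P0c X - #q 4 * Q * Q * iq * iq * iqb * iqb) = #q 0.
Proof.
assert (H := bianchi_1 S EM eps TD). rewrite (kR_phi S EM eps TD) in H.
apply (f_equal lam) in H. rewrite lam_kc in H. rewrite <- H. clear H.
assert (H3 : kTh S0 E3 E1 - #i * kTh S0 E3 E2 = #q 2 * P0c X) by bgv' @Th3_0.
assert (H4 : kUps S0 E1 E2 = #i * (P0c X - Q * Q * iq * iq * iqb * iqb)) by bgv' @Ups12_0.
assert (HR : lam (ked S E4 (#q 2 * kPFc S * kphi S)) = ked S0 E4 (#q 2 * Q * iq * iq * phi)).
{ rewrite lam_ked_small by (push1; ring). f_equal. push1. fold phi. ring. }
push1. rewrite HR, ?lam_B, ?lam_al. fold phi bet alp xi.
assert (H3' : kTh S0 E3 E1 = #q 2 * P0c X + #i * kTh S0 E3 E2) by (rewrite <- H3; ring).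
rewrite H3', H4.
replace (ked S0 E4 (#q 2 * Q * iq * iq * phi)) with (#q 2 * ked S0 E4 (Q * iq * iq * phi)).
- ring.
- replace (#q 2 * Q * iq * iq * phi) with (#q 2 * (Q * iq * iq * phi)) by ring.
  rewrite ked_scal. ring.
Qed.

Lemma lin_bianchi_2 :
  ked S0 E3 alp + (#q 2 * #i * kW S0 E3 + kz2 S0 E3 - Dl * iq * iqb * iqb) * alp
  + #q 2 * (ked S0 E1 bet + #i * ked S0 E2 bet
            + (kGa S0 E1 + #i * kGa S0 E2 + #q 4 * #i * tau * im * iqb) * bet)
  + #q 2 * (ked S0 E1 (Q * iq * iq * phi) + #i * ked S0 E2 (Q * iq * iq * phi)
     + (kGa S0 E1 + #i * kGa S0 E2 - #q 2 * #i * tau * im * iq) * (Q * iq * iq * phi))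
  - sig * (#q 6 * P0c X + #q 4 * Q * Q * iq * iq * iqb * iqb) = #q 0.
Proof.
assert (H := bianchi_2 S EM eps TD). rewrite (kR_phi S EM eps TD) in H.
apply (f_equal lam) in H. rewrite lam_kc in H. rewrite <- H. clear H.
assert (H3 : kTh S0 E3 E1 - #i * kTh S0 E3 E2 = #q 2 * P0c X) by bgv' @Th3_0.
assert (H4 : kUps S0 E3 E4 = #q 2 * P0c X + #q 2 * Q * Q * iq * iq * iqb * iqb) by bgv' @Ups34_0.
assert (HR : forall i, lam (ked S i (#q 2 * kPFc S * kphi S)) = #q 2 * ked S0 i (Q * iq * iq * phi)).
{ intros i. rewrite lam_ked_small by (push1; ring).
  transitivity (ked S0 i (#q 2 * (Q * iq * iq * phi))).
  - f_equal. push1. fold phi. ring.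
  - rewrite ked_scal. ring. }
push1. rewrite !HR, ?lam_B, ?lam_al. fold phi bet alp sig.
assert (H3' : kTh S0 E3 E1 = #q 2 * P0c X + #i * kTh S0 E3 E2) by (rewrite <- H3; ring).
rewrite H3', H4. ring.
Qed.

(** First-order parts of the right-hand sides of Maxwell's equations for [P_F], along [e_4] for [m4]
    and along [e_1 + i e_2] for [md]. *)
Definition m4 : K := ked S0 E1 phi - #i * ked S0 E2 phi
    + (#i * (kW S0 E1 - #i * kW S0 E2) + half * (kz2 S0 E1 - #i * kz2 S0 E2) + #i * tau * im * iqb) * phi.
Definition md : K := ked S0 E3 phi + (#i * kW S0 E3 + half * kz2 S0 E3 - Dl * iq * iqb * iqb) * phi.

Lemma lin_maxwell :
  Q * iqb * iqb * (#q 4 * bet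
    + #q 2 * (ked S0 E1 sig - #i * ked S0 E2 sig
       + (#q 2 * #i * (kW S0 E1 - #i * kW S0 E2) + half * (kz2 S0 E1 - #i * kz2 S0 E2)) * sig)
    - #q 2 * (ked S0 E3 xi + (#i * kW S0 E3 + kz2 S0 E3) * xi)
    + #q 2 * Dl * iq * iqb * (iq - iqb) * xi
    - #q 2 * #i * tau * im * (iq + iqb) * sig)
  + sig * (ked S0 E1 (Q * iqb * iqb) - #i * ked S0 E2 (Q * iqb * iqb)) - xi * ked S0 E3 (Q * iqb * iqb)
  + ked S0 E4 md + #q 2 * iqb * md + (#i * kW S0 E4 + iq) * md
  - (ked S0 E1 m4 + #i * ked S0 E2 m4) - #q 2 * #i * tau * im * iqb * m4
  - (- #i * tau * im * iq + half * (kz2 S0 E1 + #i * kz2 S0 E2)) * m4 = #q 0.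
Proof.
assert (H := integrability S EM eps TD (kPF S)). cbv zeta in H.
rewrite (maxwell_4 S EM eps TD), (maxwell_d S EM eps TD) in H.
(* By Maxwell's equations the arguments of [e_4] and of [e_1 + i e_2] have no background part. Once
   opaque, they are differentiated along the background frame, and no derivative of the perturbed
   [P_F] along these directions is needed there. *)
match type of H with context [ked S E4 ?u] =>
  assert (Bd : bg u = #q 0) by (push1; ring);
  assert (Ld : lam u = md) by (push1; rewrite ?lam_phi; fold phi; unfold md; ring);
  set (Md := u) in H, Bd, Ld end.
match type of H with context [ked S E1 ?u + #i * ked S E2 ?u] =>
  assert (B4 : bg u = #q 0) by (push1; ring);
  assert (L4 : lam u = m4) by (push1; rewrite ?lam_phi; fold phi; unfold m4; ring);
  set (M4 := u) in H, B4, L4 end.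
clearbody Md M4.
apply (f_equal lam) in H. rewrite lam_kc in H. rewrite <- H. clear H.
push1. rewrite ?Bd, ?B4, ?Ld, ?L4, !(lam_ked_small T S _ _ Bd), !(lam_ked_small T S _ _ B4), ?lam_sX, ?lam_Xi.
rewrite ?Ld, ?L4. fold phi bet alp sig xi. ring.
Qed.
Ltac kedN := rewrite ?(ked_E1 X S0 (fr0)), ?(ked_E2 X S0 (fr0)),
  ?(ked_E3 X S0 (fr0)), ?(ked_E4 X S0 (fr0)).
Ltac gN := rewrite ?Ga_, ?(W4_), ?(W3_), ?(W1_), ?(W2_),
  ?(z4_), ?(z3_), ?(z1_), ?(z2_); unfold w0, z0, P0c.
Ltac knring :=
  let R1 := fresh in let R2 := fresh in let R3 := fresh in let R4 := fresh in
  let R5 := fresh in let R6 := fresh in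
  assert (R1 := q_iq K N); assert (R2 := qb_iqb K N); assert (R3 := Dl_iDl K N);
  assert (R4 := im_im K N); assert (R5 := tau_ct K N); assert (R6 := Q_Q K N);
  ring [R1 R2 R3 R4 R5 R6].

(* First-order parts of [B_1], [F_11], [X_1] (in Fraktur) and of [- P_F A_11 / 2]. The powers of
   [q] and [qbar] turn the linearised equations into the system of [Section Decoupling]. *)
Definition b1 : K := #q 2 * Q * iqb * iqb * bet - #q 3 * P0c X * phi.
Definition f1 : K :=
  - half * (ked S0 E1 phi + #i * ked S0 E2 phi + (kGa S0 E1 + #i * kGa S0 E2) * phi)
  - #q (3#2) * (#i * tau * im * iqb) * phi + Q * iqb * iqb * sig.
Definition x1 : K := ked S0 E4 phi + kGa S0 E4 * phi + #q 3 * iqb * phi - #q 2 * Q * iqb * iqb * xi.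
Definition y1 : K := - half * Q * iqb * iqb * alp.

Definition Bt : K := im * q * iqb * b1.
Definition Ft : K := iqb * iqb * f1.
Definition X3 : K := im * iqb * iqb * x1.
Definition Y2 : K := iq * y1.

Ltac unf := unfold Bt, Ft, X3, Y2, b1, f1, x1, y1, Decoupling.DBt, Decoupling.LBt, Decoupling.Dm2, Decoupling.Lm2, Decoupling.mass_m, Decoupling.mass_p, Decoupling.dDl; kedN; gN.

(** A void rule for the third unknown of the normaliser. *)
Lemma triv2 (u : K) : Dm u = Dm u. Proof. reflexivity. Qed.

(** The shear equation is solved for [alp], so substituting it leaves an identity in the other
    quantities. *)
Lemma scaled_3 :
  Y2 = - (qb * qb * iq * (Dp Ft + #q 6 * iqb * Ft
     + half * (Lp X3 + (- ct + #q 6 * #i * tau * iqb) * X3))).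
Proof.
unf. rewrite (lin_shear). kedN; gN. kedN.
knorm5 (kn_calc X) (phi) (sig) (bet) (xi) (alp) (triv2 bet). knring.
Qed.

(** This is [lin_maxwell] up to a factor: after the definitions of [B], [F], [X] are inserted,
    [phi], shear and [Xi] occur only through the invariant combinations. *)
Lemma scaled_4 : Bt = - Decoupling.Lm2 N Ft + half * Decoupling.Dm2 N X3.
Proof.
assert (H := lin_maxwell).
match type of H with ?l = _ =>
  transitivity (- Decoupling.Lm2 N Ft + half * Decoupling.Dm2 N X3 + half * im * q * iqb * l); [|rewrite H; ring] end.
unfold m4, md. unf.
knorm5 (kn_calc X) (phi) (sig) (bet) (xi) (alp) (triv2 bet). knring.
Qed.

Lemma scaled_1 : Decoupling.Lm2 N Y2 = Decoupling.DBt N Bt + Decoupling.mass_m N * X3.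
Proof.
assert (H := lin_bianchi_1).
match type of H with ?l = _ =>
  transitivity (Decoupling.DBt N Bt + Decoupling.mass_m N * X3 - half * Q * im * iqb * l); [|rewrite H; ring] end.
unf.
knorm5 (kn_calc X) (phi) (sig) (bet) (xi) (alp) (triv2 bet). knring.
Qed.

Lemma scaled_2 : Decoupling.Dm2 N Y2 = - Decoupling.LBt N Bt + Decoupling.mass_p N * Ft.
Proof.
assert (H := lin_bianchi_2).
match type of H with ?l = _ =>
  transitivity (- Decoupling.LBt N Bt + Decoupling.mass_p N * Ft + half * Q * iqb * l); [|rewrite H; ring] end.
unf.
knorm5 (kn_calc X) (phi) (sig) (bet) (xi) (alp) (triv2 bet). knring.
Qed.

Lemma b1_Bt : b1 = im * qb * qb * Bt.
Proof. unfold Bt. knring. Qed.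
Lemma f1_Ft : f1 = qb * qb * Ft.
Proof. unfold Ft. knring. Qed.
Lemma x1_X3 : x1 = q * im * qb * qb * qb * X3.
Proof. unfold X3. knring. Qed.

Lemma asd1_small (F : hor -> K) : asd1 F -> bg (F h1) = #q 0 -> small1 T F.
Proof. intros A H []; [exact H|]. rewrite A, bg_mul, H. ring. Qed.
Lemma asd2_small (U : hor -> hor -> K) : asd2 U -> bg (U h1 h1) = #q 0 -> small2 T U.
Proof.
intros (A & B & C) H [] []; rewrite ?A, ?B, ?C, ?bg_mul, ?bg_opp, ?H; ring.
Qed.
Lemma lam_asd1 F : asd1 F -> asd1 (lam1 T F).
Proof. unfold asd1, lam1. intros ->. rewrite lam_mul, lam_opp, bg_opp, lam_kc, bg_kc. ring. Qed.
Lemma lam_asd2 U : asd2 U -> asd2 (lam2 T U).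
Proof.
unfold asd2, lam2. intros (-> & -> & ->).
rewrite !lam_mul, !lam_opp, !bg_opp, lam_kc, bg_kc. repeat split; ring.
Qed.

Let Hin := p_inner T X S KP.

Lemma BF_phi : kBF S h1 = kphi S.
Proof. unfold kBF, kcplx1, kdual1, kbetaF, kphi, ksumh, keps, emb. ring. Qed.
Lemma Xhat_sX : kXhat S h1 h1 = ksX S.
Proof. unfold kXhat, kcplx2, kdual2, khath, ktrh, kchi, ksX, kom, ksumh, keps, kdelta, emb. ring. Qed.
Lemma Xi_Xi1 : kXi S h1 = kXi1 S.
Proof. unfold kXi, kcplx1, kdual1, kxi, kXi1, kom, ksumh, keps, emb.
destruct (gam_canon S (em_framed S (p_em T X S KP))) as (_&_&_&_&_&_). ring. Qed.
Lemma H_eta : kH S h1 = keta1 S.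
Proof. unfold kH, kcplx1, kdual1, keta, keta1, ksumh, keps, emb. ring. Qed.
Lemma Hb_etab : kHb S h1 = ketab1 S.
Proof. unfold kHb, kcplx1, kdual1, ketab, ketab1, ksumh, keps, emb. ring. Qed.

Lemma BF_asd : asd1 (kBF S). Proof. apply kcplx1_asd. Qed.
Lemma H_asd : asd1 (kH S). Proof. apply kcplx1_asd. Qed.
Lemma Hb_asd : asd1 (kHb S). Proof. apply kcplx1_asd. Qed.

Lemma frB_asd : asd1 (kfrB S).
Proof.
apply (asd1_add (fun a => #q 2 * kPF S * kB S a) (fun a => - #q 3 * kPc S * kBF S a)).
- apply (asd1_scal (#q 2 * kPF S) (kB S)); [apply kcplx1_asd|reflexivity].
- apply (asd1_scal (- #q 3 * kPc S) (kBF S)); [apply kcplx1_asd|reflexivity].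
- intros a. unfold kfrB. ring.
Qed.
Lemma frX_asd : asd1 (kfrX S).
Proof.
apply (asd1_add (fun a => kcnabla1 S qone E4 (kBF S) a + #q (3#2) * (ktrchi S + #i * katrchi S) * kBF S a)
  (fun a => - #q 2 * kPF S * kXi S a)).
- apply (asd1_add (kcnabla1 S qone E4 (kBF S)) (fun a => #q (3#2) * (ktrchi S + #i * katrchi S) * kBF S a)).
  + apply kcnabla1_asd; [exact Hin|apply kcplx1_asd].
  + apply (asd1_scal (#q (3#2) * (ktrchi S + #i * katrchi S)) (kBF S)); [apply kcplx1_asd|reflexivity].
  + reflexivity.
- apply (asd1_scal (- #q 2 * kPF S) (kXi S)); [apply kcplx1_asd|reflexivity].
- intros a. unfold kfrX. fold qone. ring.
Qed.
Lemma frF_asd : asd2 (kfrF S).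
Proof.
apply (asd2_add (fun a b => - #q (1#2) * kcDotimes S qone (kBF S) a b + - #q (3#2) * kotimes (kH S) (kBF S) a b)
  (fun a b => kPF S * kXhat S a b)).
- apply (asd2_add (fun a b => - #q (1#2) * kcDotimes S qone (kBF S) a b) (fun a b => - #q (3#2) * kotimes (kH S) (kBF S) a b)).
  + apply (asd2_scal (- #q (1#2)) (kcDotimes S qone (kBF S))); [|reflexivity].
    apply kcDotimes_asd; [exact Hin|apply kcplx1_asd].
  + apply (asd2_scal (- #q (3#2)) (kotimes (kH S) (kBF S))); [|reflexivity].
    apply kotimes_asd; apply kcplx1_asd.
  + reflexivity.
- apply (asd2_scal (kPF S) (kXhat S)); [apply kXhat_asd|reflexivity].
- intros a b. unfold kfrF. fold qone. ring.
Qed.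

Lemma bgPc : bg (kPc S) = P0c X.
Proof.
rewrite (Pc_Ups S (p_em T X S KP)), (ric34 S (p_em T X S KP) eps (TD)).
rewrite bg_mul, bg_sub, !bg_mul, !bg_kc, (bgPF), (bgPFc), bgUps.
assert (H4 : kUps S0 E3 E4 = #q 2 * P0c X + #q 2 * Q * Q * iq * iq * iqb * iqb).
{ apply (bg_value); intros xco Hx.
  exact (Ups34_0 X S0 (fr0) in0 (sym0) xco Hx). }
rewrite H4. ring.
Qed.

Ltac smalls0 := rewrite ?(bgphi), ?(bgsX), ?(bgXi), ?(bgB).

Lemma frB_bg : bg (kfrB S h1) = #q 0.
Proof. unfold kfrB. rewrite BF_phi, bg_sub, !bg_mul. smalls0. ring. Qed.
Lemma frB_lam : lam1 T (kfrB S) h1 = b1.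
Proof.
unfold lam1, kfrB. rewrite BF_phi, lam_sub, !lam_mul, !bg_mul, !bg_kc. smalls0.
rewrite (bgPF), bgPc. unfold b1, bet, phi. ring.
Qed.
Lemma frX_bg : bg (kfrX S h1) = #q 0.
Proof.
unfold kfrX. fold qone. rewrite (kcnabla1_h1 S Hin _ _ _ BF_asd).
rewrite BF_phi, Xi_Xi1, bg_sub, !bg_add, !bg_mul, bg_ked. smalls0. rewrite ked0. ring.
Qed.
Lemma frX_lam : lam1 T (kfrX S) h1 = x1.
Proof.
unfold lam1, kfrX. fold qone. rewrite (kcnabla1_h1 S Hin _ _ _ BF_asd).
replace (ktrchi S + #i * katrchi S) with (kXc S)
  by (unfold kXc, ktrchi, katrchi, ktrh, katrh, kchi, ksumh, keps, emb; ring).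
rewrite BF_phi, Xi_Xi1, lam_sub, !lam_add, !lam_mul, !bg_mul, !bg_add, !bg_mul, !bg_kc, (lam_phi). smalls0.
rewrite (bgPF), (bgXc), bgW, bgz. unfold x1, xi. fold (phi). rewrite Ga_.
unfold qone. ring.
Qed.
Lemma frF_bg : bg (kfrF S h1 h1) = #q 0.
Proof.
unfold kfrF. fold qone. rewrite (kcDotimes_h1 S Hin _ _ BF_asd), (kotimes_h1 _ _ H_asd BF_asd).
rewrite Xhat_sX, BF_phi.
repeat rewrite ?bg_sub, ?bg_add, ?bg_mul, ?bg_ked. smalls0. rewrite !ked0. ring.
Qed.
Lemma frF_lam : lam2 T (kfrF S) h1 h1 = f1.
Proof.
unfold lam2, kfrF. fold qone. rewrite (kcDotimes_h1 S Hin _ _ BF_asd), (kotimes_h1 _ _ H_asd BF_asd).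
rewrite Xhat_sX, BF_phi, H_eta.
repeat rewrite ?lam_sub, ?lam_add, ?lam_opp, ?lam_mul, ?bg_add, ?bg_opp, ?bg_mul, ?bg_kc, ?lam_kc, ?bg_ked, ?(lam_phi).
smalls0. rewrite !ked0, (bgPF), (bgeta), !bgW, !bgz. unfold f1, sig. fold (phi). rewrite !Ga_.
unfold qone. ring.
Qed.
Local Notation nXb := (Decoupling.nXb N).
Local Notation nXbc := (Decoupling.nXbc N).
Local Notation nH := (Decoupling.nH N).
Local Notation nHb := (Decoupling.nHb N).
Local Notation nHc := (Decoupling.nHc N).
Local Notation nHbc := (Decoupling.nHbc N).
Local Notation nP := (Decoupling.nP N Bt).
Local Notation nQ := (Decoupling.nQ N Ft).

(** The real one-form [z] for which [z + i *z] has first component [nXb nH], hence the real and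
    imaginary parts of that product. *)
Definition Zone (a : hor) : K :=
  match a with
  | h1 => half * (nXb * nH + nXbc * nHc)
  | h2 => - half * #i * (nXb * nH - nXbc * nHc)
  end.

(** Every coefficient multiplies a first-order quantity, so only its background part is prescribed.
    A tensor of [s_2(C)] contracts [cY0F] to [F_1 - i F_2], which allows a zero second component. *)
Record coeff_values (k : kcoeffs K) : Prop := {
  v_wp : bg (cwp k) = q * qb * qb * qb * qb * qb * im;
  v_wq : bg (cwq k) = q * qb * qb;
  v_t1 : bg (ct1 k) = - #i * (q - qb) * iq * iqb;
  v_V1 : bg (cV1 k) = Decoupling.nV1 N;
  v_V2 : bg (cV2 k) = Decoupling.nV2 N;
  v_r1 : bg (cr1 k) = #q 4 * Q * Q * qb * qb * qb * im * iq * iqb * iq * iqb;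
  v_r2 : bg (cr2 k) = - half * q * q * q * im * iq * iqb * iq * iqb;
  v_4F : bg (c4F k) = half * (nXb - nXbc) * (nXb - nXbc);
  v_aX : bg (caX k) = #q (1#4) * (nXb - nXbc) * (nXb - nXbc);
  v_ZB : forall a, bg (cZB k a) = - Zone a;
  v_ZF : forall a, bg (cWZF k a) = #q 4 * Zone a;
  v_aB : bg (caB k) = #q (3#8) * (nXbc - nXb);
  v_YF : bg (cYF k) = - #q (3#2) * (nXbc - nXb);
  v_0B : bg (cY0B k) = #q 0;
  v_Z0 : bg (cZ0B k) = - Decoupling.nzB N;
  v_0X : bg (cY0X k) = #q (1#4) * (- #q 10 * nXb * nXb - #q 7 * nXbc * nXbc + #q 17 * nXb * nXbc);
  v_W0 : bg (cWZ0 k) = Decoupling.nwF N;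
  v_Y1 : bg (cY0F k h1) = #q 6 * nXb * nHc - #q 4 * nXbc * nHc + #q 2 * nXb * nHbc;
  v_Y2 : bg (cY0F k h2) = #q 0;
  v_WB : bg (cW0B k h1) = #q (1#8) * nXb * nH + #q (3#2) * nXbc * nH + #q (7#8) * nXbc * nHb;
  v_WX : bg (cW0X k h1) = #q (1#4) * (- #q 3 * nXb * nXb * nH + #q 5 * nXbc * nXbc * nH
           - nXb * nXbc * nH + nXbc * nXbc * nHb);
  v_WBa : asd1 (cW0B k);
  v_WXa : asd1 (cW0X k)
}.
Context (k : kcoeffs K) (V : coeff_values k).

Local Notation frp := (kfrp S k).
Local Notation frq := (kfrqF S k).

Lemma frB_small : small1 T (kfrB S).
Proof. apply asd1_small; [apply (frB_asd)|apply (frB_bg)]. Qed.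
Lemma frX_small : small1 T (kfrX S).
Proof. apply asd1_small; [apply (frX_asd)|apply (frX_bg)]. Qed.
Lemma frF_small : small2 T (kfrF S).
Proof. apply asd2_small; [apply (frF_asd)|apply (frF_bg)]. Qed.

Lemma frp_asd : asd1 frp.
Proof.
apply (asd1_scal (cwp k) (fun b => kcnabla1 S qone E3 (kfrB S) b
    + (#q 2 * ktrchib S - #q (5#2) * #i * katrchib S) * kfrB S b)); [|reflexivity].
apply (asd1_add (kcnabla1 S qone E3 (kfrB S)) (fun b => (#q 2 * ktrchib S - #q (5#2) * #i * katrchib S) * kfrB S b)).
- apply kcnabla1_asd; [exact Hin|apply (frB_asd)].
- apply (asd1_scal (#q 2 * ktrchib S - #q (5#2) * #i * katrchib S) (kfrB S)); [apply (frB_asd)|reflexivity].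
- reflexivity.
Qed.
Lemma frq_asd : asd2 frq.
Proof.
apply (asd2_scal (cwq k) (fun b c => kcnabla2 S qone E3 (kfrF S) b c
    + (ktrchib S - #q 3 * #i * katrchib S) * kfrF S b c)); [|reflexivity].
apply (asd2_add (kcnabla2 S qone E3 (kfrF S)) (fun b c => (ktrchib S - #q 3 * #i * katrchib S) * kfrF S b c)).
- apply kcnabla2_asd; [exact Hin|apply (frF_asd)].
- apply (asd2_scal (ktrchib S - #q 3 * #i * katrchib S) (kfrF S)); [apply (frF_asd)|reflexivity].
- reflexivity.
Qed.
Lemma frp_small : small1 T frp.
Proof.
intros a. unfold kfrp. rewrite bg_mul, bg_add, (bg_cnabla1 T S _ _ _ frB_small), (bg_mul_small T _ _ (frB_small a)). ring.
Qed.
Lemma frq_small : small2 T frq.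
Proof.
intros a b. unfold kfrqF. rewrite bg_mul, bg_add, (bg_cnabla2 T S _ _ _ frF_small), (bg_mul_small T _ _ (frF_small a b)). ring.
Qed.

Definition pp : K := lam1 T frp h1.
Definition qq : K := lam2 T frq h1 h1.

Lemma trb1 : bg (#q 2 * ktrchib S - #q (5#2) * #i * katrchib S) = #q (9#4) * nXb - #q (1#4) * nXbc.
Proof.
replace (#q 2 * ktrchib S - #q (5#2) * #i * katrchib S) with (#q (9#4) * kXb S - #q (1#4) * kXbc S)
  by (unfold kXb, kXbc, ktrchib, katrchib, ktrh, katrh, kchib, ksumh, keps, emb; ring).
rewrite bg_sub, !bg_mul, !bg_kc, (bgXb), (bgXbc). reflexivity.
Qed.
Lemma trb2 : bg (ktrchib S - #q 3 * #i * katrchib S) = #q 2 * nXb - nXbc.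
Proof.
replace (ktrchib S - #q 3 * #i * katrchib S) with (#q 2 * kXb S - kXbc S)
  by (unfold kXb, kXbc, ktrchib, katrchib, ktrh, katrh, kchib, ksumh, keps, emb; ring).
rewrite bg_sub, !bg_mul, !bg_kc, (bgXb), (bgXbc). reflexivity.
Qed.

Lemma pp_nP : pp = q * im * nP.
Proof.
unfold pp, lam1, kfrp.
rewrite lam_mul_small by (rewrite bg_add, (bg_cnabla1 T S _ _ _ frB_small), (bg_mul_small T _ _ (frB_small h1)); ring).
rewrite lam_add, (lam_cnabla1 T S _ _ _ _ frB_small), (lam_mul_small T _ _ (frB_small h1)), trb1.
fold (lam1 T (kfrB S) h1).
rewrite (kcnabla1_h1 S0 in0 _ _ _ (lam_asd1 _ (frB_asd))), (frB_lam), (b1_Bt), (v_wp k V).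
kedN. gN. unfold qone, Decoupling.nP, Decoupling.nXb, Decoupling.nXbc, Decoupling.dDl.
knorm (kn_calc X) (Bt) (Ft) (X3) (triv2 (X3)). knring.
Qed.
Lemma qq_nQ : qq = q * im * q * im * nQ.
Proof.
unfold qq, lam2, kfrqF.
rewrite lam_mul_small by (rewrite bg_add, (bg_cnabla2 T S _ _ _ frF_small), (bg_mul_small T _ _ (frF_small h1 h1)); ring).
rewrite lam_add, (lam_cnabla2 T S _ _ _ _ _ frF_small), (lam_mul_small T _ _ (frF_small h1 h1)), trb2.
fold (lam2 T (kfrF S) h1 h1).
rewrite (kcnabla2_h1 S0 in0 _ _ _ (lam_asd2 _ (frF_asd))), (frF_lam), (f1_Ft), (v_wq k V).
kedN. gN. unfold qone, Decoupling.nQ, Decoupling.nXb, Decoupling.nXbc, Decoupling.dDl.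
knorm (kn_calc X) (Bt) (Ft) (X3) (triv2 (X3)). knring.
Qed.

Lemma gamu0 i j m : forall xco : coord -> K, (forall mu nu, pd nu (xco mu) = kcoord_delta mu nu) ->
  kgamu S0 i j m = kraise (fun l => g0 X i j l) m.
Proof.
intros xco Hx. unfold kgamu, kraise, ksum4. now rewrite !(gam0 X S0 (fr0) in0 xco Hx).
Qed.
(** The first-order part of the wave operator depends on the connection only through these four
    traces. *)
Lemma trace_gamu m : ksum4 (fun i => ksum4 (fun j => kmink_inv i j * kgamu S0 i j m)) =
  match m with
  | E1 => - Decoupling.nom N - half * (nH + nHb + nHc + nHbc)
  | E2 => half * #i * (nH + nHb - nHc - nHbc)
  | E3 => half * (iq + iqb)
  | E4 => - half * Dl * iq * iqb * (iq + iqb) + #q (1#4) * Decoupling.nz3 N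
  end.
Proof.
apply (bg_value). intros xco Hx. unfold ksum4. rewrite !(fun i j => gamu0 i j m xco Hx).
unfold kraise, ksum4, kmink_inv, g0, b0, ksum4, kmink, cc0, z0, w0, Decoupling.nom, Decoupling.nz3, Decoupling.nH, Decoupling.nHb, Decoupling.nHc, Decoupling.nHbc, Decoupling.dDl.
destruct m; knring.
Qed.
Lemma sbox_trace kk g : sbox S0 kk g = nab S0 kk E1 (nab S0 kk E1 g) + nab S0 kk E2 (nab S0 kk E2 g)
  - half * (nab S0 kk E3 (nab S0 kk E4 g) + nab S0 kk E4 (nab S0 kk E3 g))
  - ksum4 (fun m => ksum4 (fun i => ksum4 (fun j => kmink_inv i j * kgamu S0 i j m)) * nab S0 kk m g).
Proof. unfold sbox, ksum4. unfold kmink_inv. ring. Qed.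

(** Extracting the phase [q / |q|] absorbs the spin weight, which leaves the scalar operator [nbox]
    of the wave equations. *)
Lemma box1_scaled (u : K) : sbox S0 qone (q * im * u) = q * im * Decoupling.nbox N qone u.
Proof.
rewrite sbox_trace. unfold ksum4 at 1. rewrite !trace_gamu. unfold nab. kedN. gN. kedN.
unfold qone, Decoupling.nbox, Decoupling.n3, Decoupling.n4, Decoupling.nd, Decoupling.ne, Decoupling.nom, Decoupling.nz3, Decoupling.nH, Decoupling.nHb, Decoupling.nHc, Decoupling.nHbc, Decoupling.dDl.
knorm (kn_calc X) u u (X3) (triv2 (X3)). knring.
Qed.
Lemma box2_scaled (u : K) : sbox S0 qtwo (q * im * q * im * u) = q * im * q * im * Decoupling.nbox N qtwo u.
Proof.
rewrite sbox_trace. unfold ksum4 at 1. rewrite !trace_gamu. unfold nab. kedN. gN. kedN.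
unfold qtwo, Decoupling.nbox, Decoupling.n3, Decoupling.n4, Decoupling.nd, Decoupling.ne, Decoupling.nom, Decoupling.nz3, Decoupling.nH, Decoupling.nHb, Decoupling.nHc, Decoupling.nHbc, Decoupling.dDl.
knorm (kn_calc X) u u (X3) (triv2 (X3)). knring.
Qed.

Lemma kdt_frame m : bgv T kdt m = half * (xDl X * xim X * xim X) * kfr S0 E4 m + (half * kfr S0 E3 m
   + (- xa X * xs X * xim X) * kfr S0 E2 m).
Proof.
assert (H := xcf_fr X S0 (fr0) Defs.ct m). unfold ksum4, xcf in H.
transitivity (kcoord_delta Defs.ct m : K).
- unfold bgv, kdt, kcoord_delta. destruct m; apply bg_kc.
- rewrite <- H. ring.
Qed.
Lemma kw_dt : kw S0 (bgv T kdt) = half * (xDl X * xim X * xim X) * kW S0 E4 + (half * kW S0 E3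
   + (- xa X * xs X * xim X) * kW S0 E2).
Proof.
unfold kw. rewrite (kgD_ext S0 _ _ _ _ kdt_frame), kgD_add, kgD_scal, kgD_add, !kgD_scal. reflexivity.
Qed.
Lemma dir_dt (u : K) : kdir (bgv T kdt) u = half * (xDl X * xim X * xim X) * ked S0 E4 u + (half * ked S0 E3 u
   + (- xa X * xs X * xim X) * ked S0 E2 u).
Proof.
unfold ked, kdir at 1, ksumc. rewrite !kdt_frame. unfold kdir, ksumc. ring.
Qed.
Lemma atoms0 : xDl X = Dl /\ xim X = im /\ xa X * xs X = tau.
Proof. repeat split. Qed.

Lemma dt1_scaled (u : K) : kdir (bgv T kdt) (q * im * u) + #i * kw S0 (bgv T kdt) * (q * im * u)
  = q * im * Decoupling.ndt N qone u.
Proof.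
rewrite dir_dt, kw_dt. destruct atoms0 as (-> & -> & E).
transitivity (half * (Dl * im * im) * (ked S0 E4 (q * im * u) + #i * kW S0 E4 * (q * im * u))
  + half * (ked S0 E3 (q * im * u) + #i * kW S0 E3 * (q * im * u))
  - xa X * xs X * im * (ked S0 E2 (q * im * u) + #i * kW S0 E2 * (q * im * u))); [ring|].
rewrite E. kedN. gN.
unfold qone, Decoupling.ndt, Decoupling.n3, Decoupling.n4, Decoupling.nd, Decoupling.ne.
knorm (kn_calc X) u u (X3) (triv2 (X3)). knring.
Qed.
Lemma dt2_scaled (u : K) : kdir (bgv T kdt) (q * im * q * im * u) + #q 2 * #i * kw S0 (bgv T kdt) * (q * im * q * im * u)
  = q * im * q * im * Decoupling.ndt N qtwo u.
Proof.
rewrite dir_dt, kw_dt. destruct atoms0 as (-> & -> & E).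
transitivity (half * (Dl * im * im) * (ked S0 E4 (q * im * q * im * u) + #q 2 * #i * kW S0 E4 * (q * im * q * im * u))
  + half * (ked S0 E3 (q * im * q * im * u) + #q 2 * #i * kW S0 E3 * (q * im * q * im * u))
  - xa X * xs X * im * (ked S0 E2 (q * im * q * im * u) + #q 2 * #i * kW S0 E2 * (q * im * q * im * u))); [ring|].
rewrite E. kedN. gN.
unfold qtwo, Decoupling.ndt, Decoupling.n3, Decoupling.n4, Decoupling.nd, Decoupling.ne.
knorm (kn_calc X) u u (X3) (triv2 (X3)). knring.
Qed.
Local Notation nb := (Decoupling.nb N Bt).
Local Notation nf := (Decoupling.nf N Ft).
Local Notation nx := (Decoupling.nx N X3).

Let sB := frB_small.
Let sF := frF_small.
Let sX := frX_small.
Let sp := frp_small.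
Let sq := frq_small.
Let aB := lam_asd1 _ (frB_asd).
Let aF := lam_asd2 _ (frF_asd).
Let aX := lam_asd1 _ (frX_asd).
Let ap := lam_asd1 _ (frp_asd).
Let aq := lam_asd2 _ (frq_asd).

Lemma mulz (u : K) : u * #q 0 = #q 0. Proof. ring. Qed.
Lemma zmul (u : K) : #q 0 * u = #q 0. Proof. ring. Qed.
Lemma addz (u : K) : u + #q 0 = u. Proof. ring. Qed.
Lemma zadd (u : K) : #q 0 + u = u. Proof. ring. Qed.
Lemma subz (u : K) : u - #q 0 = u. Proof. ring. Qed.
Lemma zopp : - #q 0 = (#q 0 : K). Proof. ring. Qed.
Ltac zero := repeat rewrite ?mulz, ?zmul, ?addz, ?zadd, ?subz, ?zopp.
Lemma HHb : asd1 (fun d => kH S d - kHb S d).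
Proof. unfold asd1. rewrite (H_asd), (Hb_asd). ring. Qed.

Lemma lhs1_lam : lam (klhs1 S k h1) = q * im *
  (Decoupling.nbox N qone nP - (q - qb) * iq * iqb * Decoupling.ndt N qone nP - Decoupling.nV1 N * nP).
Proof.
unfold klhs1. rewrite !lam_sub, (lam_box1 T S _ _ sp), (lam_mul_small T _ _ (sp h1)).
rewrite lam_mul_small by apply (bg_nabla1 T S kdt _ sp).
rewrite (lam_nabla1 T S _ _ _ sp), (kbox1_h1 S0 in0 _ ap), (nabla1_h1 S0 in0 _ _ ap).
fold (lam1 T frp h1). fold pp. rewrite (pp_nP), (box1_scaled), (dt1_scaled).
rewrite bg_mul, bg_kc, (v_t1 k V), (v_V1 k V). ring.
Qed.
Lemma lhs2_lam : lam (klhs2 S k h1 h1) = q * im * q * im *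
  (Decoupling.nbox N qtwo nQ - #q 2 * (q - qb) * iq * iqb * Decoupling.ndt N qtwo nQ - Decoupling.nV2 N * nQ).
Proof.
unfold klhs2. rewrite !lam_sub, (lam_box2 T S _ _ _ sq), (lam_mul_small T _ _ (sq h1 h1)).
rewrite lam_mul_small by apply (bg_nabla2 T S kdt _ sq).
rewrite (lam_nabla2 T S _ _ _ _ sq), (kbox2_h1 S0 in0 _ aq), (nabla2_h1 S0 in0 _ _ aq).
fold (lam2 T frq h1 h1). fold qq. rewrite (qq_nQ), (box2_scaled), (dt2_scaled).
rewrite !bg_mul, !bg_kc, (v_t1 k V), (v_V2 k V). ring.
Qed.

Lemma rhs1_lam : lam (krhs1 S k h1) = q * im * (
  #q 4 * Q * Q * qb * qb * qb * im * iq * iqb * iq * iqb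
      * (#q 2 * iqb * (Lm nQ + (#q 2 * ct - #q 2 * #i * tau * iqb) * nQ))
  + q * qb * qb * qb * qb * qb * im * (
      half * (nXb * nH) * (im * (Lm nb + (ct - #q 2 * #i * tau * iqb) * nb))
      + half * (nXbc * nHc) * (im * (Lp nb - ct * nb))
      - #q (3#2) * (nXbc - nXb) * Decoupling.nPP N
        * (#q 2 * iqb * (Lm nf + (#q 2 * ct - #q 3 * #i * tau * iqb) * nf))
      + Decoupling.nzB N * nb
      + Decoupling.nPP N * (- #q 6 * nXb * iq + #q 4 * nXbc * iq + #q 2 * nXb * iqb) * #i * tau * iqb * nf
      + Decoupling.nPP N * #q (1#4) * (- #q 10 * nXb * nXb - #q 7 * nXbc * nXbc + #q 17 * nXb * nXbc) * nx)).
Proof.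
unfold krhs1, kLp, ksumh. cbv zeta.
assert (C1 := fun i => bg_cnabla1 T S qone i _ sB). assert (D1 := bg_cDbardot T S qone _ sF).
assert (D0 := bg_cDbardot T S qzero _ sq).
repeat rewrite ?lam_add, ?lam_opp, ?lam_mul, ?bg_add, ?bg_opp, ?bg_mul, ?bg_sub, ?bg_kc, ?C1, ?D1, ?D0, ?sB, ?sX.
rewrite (kdot12_h1 _ _ (frF_asd)), !lam_mul, !bg_mul, !bg_sub, !bg_mul, !sF.
rewrite (lam_cDbardot T S _ _ _ sq), (lam_cDbardot T S _ _ _ sF), !(lam_cnabla1 T S _ _ _ _ sB).
rewrite (kcDbardot_h1 S0 in0 _ _ aq), (kcDbardot_h1 S0 in0 _ _ aF), !(kcnabla1_h1 S0 in0 _ _ _ aB).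
fold (lam1 T (kfrB S) h1) (lam2 T (kfrF S) h1 h1) (lam1 T (kfrX S) h1) (lam2 T frq h1 h1).
fold qq. unfold emb.
rewrite (frB_lam), (frF_lam), (frX_lam), (b1_Bt), (f1_Ft), (x1_X3),
  (qq_nQ).
rewrite (v_r1 k V), (v_wp k V), !(v_ZB k V), (v_YF k V), (v_0B k V), (v_Z0 k V),
  (v_0X k V), (v_Y1 k V), (v_Y2 k V), (bgPF), (bgPFc), !bg_kc.
(* [nQ] is differentiated only as a whole, and [nzB] below only multiplies; as unknowns they keep
   the normal form small. *)
generalize nQ; intros g.
zero.
kedN. gN.
unfold qone, qzero, Zone, Decoupling.nb, Decoupling.nf, Decoupling.nx, Decoupling.nPP, Decoupling.nXb, Decoupling.nXbc, Decoupling.nH, Decoupling.nHb, Decoupling.nHc, Decoupling.nHbc.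
generalize (Decoupling.nzB N). intros zB.
knorm5 (kn_calc X) g (Bt) (X3) (Ft) zB (triv2 (X3)). knring.
Qed.
Lemma rhs2_lam : lam (krhs2 S k h1 h1) = q * im * q * im * (
  - half * q * q * q * im * iq * iqb * iq * iqb
    * (iq * (Lp nP - ct * nP - #i * tau * iq * nP) - #q (3#2) * #i * tau * iq * (iqb + iq) * nP)
  + q * qb * qb * (
      half * (nXb - nXbc) * (nXb - nXbc) * Dp nf
      + half * (#q 4 * nXb * nH) * (im * (Lm nf + (#q 2 * ct - #q 3 * #i * tau * iqb) * nf))
      + half * (#q 4 * nXbc * nHc) * (im * (Lp nf - (#q 2 * ct + #i * tau * iq) * nf))
      + #q (1#4) * (nXb - nXbc) * (nXb - nXbc) * (iq * (Lp nx + (- ct + #i * tau * iq) * nx))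
      + #q (3#8) * (nXbc - nXb) * (iq * (Lp nb - ct * nb))
      + Decoupling.nwF N * nf
      + (#q (1#8) * nXb * iqb + #q (3#2) * nXbc * iqb - #q (7#8) * nXbc * iq) * #i * tau * iq * nb
      + #q (1#4) * ((- #q 3 * nXb * nXb + #q 5 * nXbc * nXbc - nXb * nXbc) * iqb
           - nXbc * nXbc * iq) * #i * tau * iq * nx)).
Proof.
unfold krhs2, kLqF, ksumh. cbv zeta.
assert (C1 := fun i => bg_cnabla2 T S qone i _ sF). assert (D1 := bg_cDotimes T S qtwo _ sX).
assert (D2 := bg_cDotimes T S qone _ sB).
assert (D0 := bg_cDotimes T S qzero _ sp).
rewrite (kotimes_h1 _ _ (v_WBa k V) (frB_asd)), (kotimes_h1 _ _ (v_WXa k V) (frX_asd)).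
rewrite (kotimes_h1 (fun d => kH S d - kHb S d) frp HHb (frp_asd)).
repeat rewrite ?lam_add, ?lam_opp, ?lam_sub, ?lam_mul, ?bg_add, ?bg_opp, ?bg_mul, ?bg_sub, ?bg_kc, ?C1, ?D1, ?D2, ?D0, ?sB, ?sX, ?sF, ?sp.
rewrite (lam_cDotimes T S _ _ _ _ sp), (lam_cDotimes T S _ _ _ _ sB), (lam_cDotimes T S _ _ _ _ sX), !(lam_cnabla2 T S _ _ _ _ _ sF).
rewrite (kcDotimes_h1 S0 in0 _ _ ap), (kcDotimes_h1 S0 in0 _ _ aB), (kcDotimes_h1 S0 in0 _ _ aX), !(kcnabla2_h1 S0 in0 _ _ _ aF).
fold (lam1 T (kfrB S) h1) (lam2 T (kfrF S) h1 h1) (lam1 T (kfrX S) h1) (lam1 T frp h1).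
fold pp. unfold emb.
rewrite (frB_lam), (frF_lam), (frX_lam), (b1_Bt), (f1_Ft), (x1_X3),
  (pp_nP).
rewrite (H_eta), (Hb_etab), (bgeta), (bgetab).
rewrite (v_r2 k V), (v_wq k V), !(v_ZF k V), (v_4F k V), (v_aX k V), (v_aB k V),
  (v_W0 k V), (v_WB k V), (v_WX k V).
generalize nP; intros g.
zero.
kedN. gN.
unfold qone, qzero, qtwo, Zone, Decoupling.nb, Decoupling.nf, Decoupling.nx, Decoupling.nPP, Decoupling.nXb, Decoupling.nXbc, Decoupling.nH, Decoupling.nHb, Decoupling.nHc, Decoupling.nHbc.
generalize (Decoupling.nwF N). intros zB.
knorm5 (kn_calc X) g (Bt) (X3) (Ft) zB (triv2 (X3)). knring.
Qed.

(** Equality of dual numbers is checked on both parts: both backgrounds are zero, and the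
    first-order part is [wave_1] times [q / |q|]. *)
Lemma system_1_h1 : klhs1 S k h1 = krhs1 S k h1.
Proof.
apply (dual_ext T).
- unfold klhs1, krhs1, kLp, ksumh. cbv zeta. unfold emb.
  repeat rewrite ?bg_add, ?bg_sub, ?bg_opp, ?bg_mul.
  rewrite (bg_box1 T S _ sp h1), (bg_nabla1 T S kdt _ sp h1), (sp h1), (bg_cDbardot T S qzero _ sq h1),
    !(fun i => bg_cnabla1 T S qone i _ sB h1), (bg_cDbardot T S qone _ sF h1), (sB h1), (sX h1).
  rewrite (kdot12_h1 _ _ (frF_asd)), bg_mul, (sF h1 h1). ring.
- rewrite lhs1_lam, rhs1_lam. f_equal.
  exact (wave_1 N Bt Ft X3 (Y2) (scaled_1) (scaled_2) (scaled_4)).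
Qed.
Lemma system_2_h1 : klhs2 S k h1 h1 = krhs2 S k h1 h1.
Proof.
apply (dual_ext T).
- unfold klhs2, krhs2, kLqF, ksumh. cbv zeta. unfold emb.
  rewrite (kotimes_h1 _ _ (v_WBa k V) (frB_asd)), (kotimes_h1 _ _ (v_WXa k V) (frX_asd)).
  rewrite (kotimes_h1 (fun d => kH S d - kHb S d) frp HHb (frp_asd)).
  repeat rewrite ?bg_add, ?bg_sub, ?bg_opp, ?bg_mul.
  rewrite (bg_box2 T S _ sq h1 h1), (bg_nabla2 T S kdt _ sq h1 h1), (sq h1 h1), (bg_cDotimes T S qzero _ sp h1 h1),
    !(fun i => bg_cnabla2 T S qone i _ sF h1 h1), (bg_cDotimes T S qone _ sB h1 h1), (bg_cDotimes T S qtwo _ sX h1 h1),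
    (sF h1 h1), (sB h1), (sX h1), (sp h1). ring.
- rewrite lhs2_lam, rhs2_lam. f_equal.
  exact (wave_2 N Bt Ft X3 (Y2) (scaled_2) (scaled_3) (scaled_4)).
Qed.

Lemma lhs1_asd : asd1 (klhs1 S k).
Proof.
unfold asd1, klhs1. rewrite (kbox1_asd S Hin _ (frp_asd)), (nabla1_asd S Hin kdt _ (frp_asd)), (frp_asd). ring.
Qed.
Lemma lhs2_asd : asd2 (klhs2 S k).
Proof.
assert (A := frq_asd).
destruct (kbox2_asd S Hin _ A) as (A1 & A2 & A3), (nabla2_asd S Hin kdt _ A) as (B1 & B2 & B3), A as (C1 & C2 & C3).
unfold asd2, klhs2. rewrite A1, A2, A3, B1, B2, B3, C1, C2, C3. repeat split; ring.
Qed.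
Lemma rhs1_asd : asd1 (krhs1 S k).
Proof.
unfold asd1, krhs1, kLp, ksumh.
rewrite (kcDbardot_asd S Hin _ _ (frq_asd)), (kcDbardot_asd S Hin _ _ (frF_asd)),
  !(fun i => kcnabla1_asd S Hin qone i _ (frB_asd)), (frB_asd), (frX_asd),
  (kdot12_asd _ _ (frF_asd)). ring.
Qed.
Lemma rhs2_asd : asd2 (krhs2 S k).
Proof.
destruct (kcDotimes_asd S Hin qzero _ (frp_asd)) as (A1 & A2 & A3),
  (kotimes_asd (fun d => kH S d - kHb S d) frp HHb (frp_asd)) as (B1 & B2 & B3),
  (kotimes_asd _ _ (v_WBa k V) (frB_asd)) as (C1 & C2 & C3),
  (kotimes_asd _ _ (v_WXa k V) (frX_asd)) as (D1 & D2 & D3),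
  (kcDotimes_asd S Hin qone _ (frB_asd)) as (F1 & F2 & F3),
  (kcDotimes_asd S Hin qtwo _ (frX_asd)) as (G1 & G2 & G3),
  (frF_asd) as (I1 & I2 & I3).
assert (J := fun i => kcnabla2_asd S Hin qone i _ (frF_asd)).
destruct (J E4) as (J1 & J2 & J3), (J E1) as (L1 & L2 & L3), (J E2) as (M1 & M2 & M3).
unfold asd2, krhs2, kLqF, ksumh, emb.
rewrite A1, A2, A3, B1, B2, B3, C1, C2, C3, D1, D2, D3, F1, F2, F3, G1, G2, G3, I1, I2, I3, J1, J2, J3, L1, L2, L3, M1, M2, M3.
repeat split; ring.
Qed.
(** Both sides lie in the complex form class [asd1], so the second component repeats the first. *)
Theorem system_1 a : klhs1 S k a = krhs1 S k a.
Proof. destruct a; [exact system_1_h1|]. rewrite lhs1_asd, rhs1_asd, system_1_h1. reflexivity. Qed.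
Theorem system_2 a b : klhs2 S k a b = krhs2 S k a b.
Proof.
destruct lhs2_asd as (A1 & A2 & A3), rhs2_asd as (B1 & B2 & B3).
destruct a, b; rewrite ?A1, ?A2, ?A3, ?B1, ?B2, ?B3, system_2_h1; reflexivity.
Qed.
End Linearised.
End Linearisation.

(** * Smooth functions on open sets of points *)

Module SmoothFunctions.
Open Scope R_scope.

Definition nbh (x : pt) (P : pt -> Prop) : Prop :=
  exists d, 0 < d /\ forall y, near d x y -> P y.

Global Instance nbh_filter x : Filter (nbh x).
Proof.
constructor.
- exists 1. split; [lra|trivial].
- intros P Q (d & Hd & HP) (d' & Hd' & HQ). exists (Rmin d d').
  split; [now apply Rmin_pos|].
  assert (Rmin d d' <= d) by apply Rmin_l. assert (Rmin d d' <= d') by apply Rmin_r.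
  intros y (A & B & C & D). split; [apply HP|apply HQ]; repeat split; lra.
- intros P Q HPQ (d & Hd & HP). exists d. split; [exact Hd|]. auto.
Qed.

Lemma shift_0 x mu : shift x mu 0 = x.
Proof. destruct x, mu; simpl; now rewrite Rplus_0_r. Qed.
Lemma shift_add x mu s t : shift (shift x mu s) mu t = shift x mu (s + t).
Proof. destruct x, mu; simpl; f_equal; ring. Qed.
Lemma shift_comm x mu nu s t : mu <> nu -> shift (shift x mu s) nu t = shift (shift x nu t) mu s.
Proof. destruct x, mu, nu; simpl; congruence. Qed.
Lemma near_shift d x mu s : Rabs s < d -> near d x (shift x mu s).
Proof.
intros H. assert (0 <= Rabs s) by apply Rabs_pos.
assert (E : forall u, Rabs (u - u) < d) by (intros; rewrite Rminus_diag, Rabs_R0; lra).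
assert (F : forall u, Rabs (u + s - u) < d) by (intros; now replace (u + s - u) with s by ring).
destruct x, mu; unfold near; simpl; auto.
Qed.
Lemma near_trans d x y z : near (d / 2) x y -> near (d / 2) y z -> near d x z.
Proof.
intros (A & B & C & D) (A' & B' & C' & D').
assert (T : forall u v w, Rabs (v - u) < d / 2 -> Rabs (w - v) < d / 2 -> Rabs (w - u) < d).
{ intros u v w H H'. replace (w - u) with ((v - u) + (w - v)) by ring.
  apply Rle_lt_trans with (1 := Rabs_triang _ _). lra. }
repeat split; eapply T; eassumption.
Qed.

Section Smooth.
Context (U : pt -> Prop) (HU : open_pt U).

Lemma open_shift x mu : U x -> locally 0 (fun s => U (shift x mu s)).
Proof.
intros Hx. destruct (HU x Hx) as (d & Hd & H). exists (mkposreal d Hd). intros s Hs.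
apply H, near_shift. change (Rabs (s - 0) < d) in Hs. now rewrite Rminus_0_r in Hs.
Qed.

Lemma partial_ext f g mu x : (forall y, U y -> f y = g y) -> U x -> partial mu f x = partial mu g x.
Proof.
intros E Hx. apply Derive_ext_loc. generalize (open_shift x mu Hx). apply filter_imp. auto.
Qed.

Definition reg (f : pt -> R) (x : pt) : Prop :=
  (forall mu, ex_derive (fun s => f (shift x mu s)) 0) /\
  (forall e, 0 < e -> exists d, 0 < d /\ forall y, near d x y -> Rabs (f y - f x) < e).

Lemma reg_ext f g x : (forall y, U y -> f y = g y) -> U x -> reg f x -> reg g x.
Proof.
intros E Hx (H1 & H2). split.
- intros mu. apply ex_derive_ext_loc with (2 := H1 mu).
  generalize (open_shift x mu Hx). apply filter_imp. auto.
- intros e He. destruct (H2 e He) as (d & Hd & H), (HU x Hx) as (d' & Hd' & H').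
  exists (Rmin d d'). split; [now apply Rmin_pos|].
  assert (Rmin d d' <= d) by apply Rmin_l. assert (Rmin d d' <= d') by apply Rmin_r.
  intros y (A & B & C & D).
  rewrite <- E, <- E; [|exact Hx|apply H'; repeat split; lra]. apply H; repeat split; lra.
Qed.

(** Coinduction for smoothness: a class of regular functions closed under partial derivatives, up to
    equality on [U], consists of smooth functions. Iterated derivatives never have to be
    described. *)
Lemma smooth_coind (P : (pt -> R) -> Prop) :
  (forall f, P f -> (forall x, U x -> reg f x) /\
     forall mu, exists g, P g /\ forall x, U x -> partial mu f x = g x) ->
  forall f, P f -> smooth_on U f.
Proof.
intros HP f Hf l.
assert (H : exists g, P g /\ forall x, U x -> partials l f x = g x).
{ induction l as [|mu l (g & Hg & E)]; [now exists f|].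
  destruct (HP g Hg) as (_ & H). destruct (H mu) as (g' & Hg' & E'). exists g'. split; [exact Hg'|].
  intros x Hx. simpl. rewrite <- (E' x Hx). now apply partial_ext. }
destruct H as (g & Hg & E). intros x Hx.
apply (reg_ext g); [intros; symmetry; auto|exact Hx|]. now apply (HP g Hg).
Qed.

Lemma smooth_reg f x : smooth_on U f -> U x -> reg f x.
Proof. intros H Hx. exact (H nil x Hx). Qed.
Lemma smooth_partial f mu : smooth_on U f -> smooth_on U (partial mu f).
Proof.
intros H l x Hx. assert (E : partials l (partial mu f) = partials (l ++ mu :: nil) f).
{ unfold partials. now rewrite fold_right_app. }
rewrite E. now apply H.
Qed.
Lemma smooth_ext f g : (forall x, U x -> f x = g x) -> smooth_on U f -> smooth_on U g.
Proof.
intros E H. apply (smooth_coind (fun g => exists f, smooth_on U f /\ forall x, U x -> f x = g x));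
  [|now exists f]. clear f g E H.
intros g (f & H & E). split.
- intros x Hx. apply (reg_ext f); auto. now apply smooth_reg.
- intros mu. exists (partial mu f). split; [exists (partial mu f); split; auto; now apply smooth_partial|].
  intros x Hx. symmetry. now apply partial_ext.
Qed.

Definition coordf (mu : coord) (x : pt) : R :=
  match mu with ct => tc x | cr => rc x | cth => thc x | cph => phc x end.

Inductive alg : (pt -> R) -> Prop :=
| alg_smooth f : smooth_on U f -> alg f
| alg_cst c : alg (fun _ => c)
| alg_coord mu : alg (coordf mu)
| alg_add f g : alg f -> alg g -> alg (fun x => f x + g x)
| alg_mul f g : alg f -> alg g -> alg (fun x => f x * g x)
| alg_inv f : alg f -> (forall x, U x -> f x <> 0) -> alg (fun x => / f x)
| alg_sqrt f : alg f -> (forall x, U x -> 0 < f x) -> alg (fun x => sqrt (f x))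
| alg_sin f : alg f -> alg (fun x => sin (f x))
| alg_cos f : alg f -> alg (fun x => cos (f x)).

(** The class is closed under differentiation, as [smooth_coind] requires. Derivatives of inverses
    and roots are written as products of members of the class. *)
Lemma alg_derive f : alg f -> forall mu, exists g, alg g /\
  forall x, U x -> is_derive (fun s => f (shift x mu s)) 0 (g x).
Proof.
induction 1 as [f H|c|nu|f g Hf IHf Hg IHg|f g Hf IHf Hg IHg|f Hf IHf P|f Hf IHf P|f Hf IHf|f Hf IHf]; intros mu.
- exists (partial mu f). split; [apply alg_smooth; now apply smooth_partial|].
  intros x Hx. apply Derive_correct. now apply (smooth_reg f x H Hx).
- exists (fun _ => 0). split; [apply alg_cst|]. intros x _. apply @is_derive_const.
- exists (fun _ => if Nat.eqb (match mu with ct => 0 | cr => 1 | cth => 2 | cph => 3 end)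
    (match nu with ct => 0 | cr => 1 | cth => 2 | cph => 3 end) then 1 else 0).
  split; [apply alg_cst|]. intros x _. destruct mu, nu; simpl; auto_derive; trivial; ring.
- destruct (IHf mu) as (f' & Af & Df), (IHg mu) as (g' & Ag & Dg).
  exists (fun x => f' x + g' x). split; [now apply alg_add|]. intros x Hx. apply @is_derive_plus; auto.
- destruct (IHf mu) as (f' & Af & Df), (IHg mu) as (g' & Ag & Dg).
  exists (fun x => f' x * g x + f x * g' x). split; [apply alg_add; now apply alg_mul|].
  intros x Hx. assert (H := is_derive_mult _ _ 0 _ _ (Df x Hx) (Dg x Hx) Rmult_comm).
  cbv beta in H. rewrite !shift_0 in H. exact H.
- destruct (IHf mu) as (f' & Af & Df). assert (Ai := alg_inv f Hf P).
  exists (fun x => (- (1)) * f' x * (/ f x * / f x)).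
  split; [repeat (apply alg_mul || apply alg_cst || assumption)|].
  intros x Hx. assert (H := is_derive_inv _ 0 _ (Df x Hx)). cbv beta in H. rewrite shift_0 in H.
  replace (- (1) * f' x * (/ f x * / f x)) with (- f' x / f x ^ 2) by (field; auto). apply H; auto.
- destruct (IHf mu) as (f' & Af & Df). assert (As := alg_sqrt f Hf P).
  assert (Hs : forall x, U x -> 0 < sqrt (f x)) by (intros; now apply sqrt_lt_R0, P).
  assert (Ai := alg_inv _ As (fun x Hx => Rgt_not_eq _ _ (Hs x Hx))).
  exists (fun x => f' x * (/ 2 * / sqrt (f x))).
  split; [repeat (apply alg_mul || apply alg_cst || assumption)|].
  intros x Hx. assert (Ds := is_derive_comp sqrt (fun s => f (shift x mu s)) 0 (/ 2 * / sqrt (f x)) (f' x)).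
  apply Ds; [|now apply Df]. rewrite shift_0.
  replace (/ 2 * / sqrt (f x)) with (/ (2 * sqrt (f x))).
  + apply is_derive_Reals. apply derivable_pt_lim_sqrt. auto.
  + rewrite Rinv_mult. reflexivity.
- destruct (IHf mu) as (f' & Af & Df).
  exists (fun x => f' x * cos (f x)). split; [apply alg_mul; [assumption|now apply alg_cos]|].
  intros x Hx. apply (is_derive_comp sin (fun s => f (shift x mu s)) 0 (cos (f x)) (f' x)); [|now apply Df].
  rewrite shift_0. apply is_derive_Reals, derivable_pt_lim_sin.
- destruct (IHf mu) as (f' & Af & Df).
  exists (fun x => f' x * ((- (1)) * sin (f x))).
  split; [repeat (apply alg_mul || apply alg_cst || apply alg_sin || assumption)|].
  intros x Hx. apply (is_derive_comp cos (fun s => f (shift x mu s)) 0 (- (1) * sin (f x)) (f' x)); [|now apply Df].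
  rewrite shift_0. replace (- (1) * sin (f x)) with (- sin (f x)) by ring.
  apply is_derive_Reals, derivable_pt_lim_cos.
Qed.

Lemma alg_continuous f : alg f -> forall x, U x -> filterlim f (nbh x) (locally (f x)).
Proof.
induction 1 as [f H|c|nu|f g Hf IHf Hg IHg|f g Hf IHf Hg IHg|f Hf IHf P|f Hf IHf P|f Hf IHf|f Hf IHf]; intros x Hx.
- intros P (eps & HP). destruct (smooth_reg f x H Hx) as (_ & C).
  destruct (C eps (cond_pos eps)) as (d & Hd & Hy). exists d. split; [exact Hd|]. intros y Hn.
  apply HP. now apply Hy.
- apply filterlim_const.
- intros P (eps & HP). exists eps. split; [apply cond_pos|]. intros y (A & B & C & D).
  apply HP. destruct nu; assumption.
- apply (filterlim_comp_2 f g Rplus (IHf x Hx) (IHg x Hx)), (@filterlim_plus R_AbsRing R_NormedModule).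
- apply (filterlim_comp_2 f g Rmult (IHf x Hx) (IHg x Hx)), (@filterlim_mult R_AbsRing).
- apply filterlim_comp with (1 := IHf x Hx). apply continuity_pt_filterlim.
  apply (continuity_pt_inv (fun u => u)); [apply derivable_continuous_pt, derivable_pt_id|auto].
- apply filterlim_comp with (1 := IHf x Hx). apply continuity_pt_filterlim.
  apply continuity_pt_sqrt. apply Rlt_le; auto.
- apply filterlim_comp with (1 := IHf x Hx). apply continuity_pt_filterlim, continuity_sin.
- apply filterlim_comp with (1 := IHf x Hx). apply continuity_pt_filterlim, continuity_cos.
Qed.

Lemma alg_is_smooth f : alg f -> smooth_on U f.
Proof.
apply smooth_coind. clear f. intros f Hf. split.
- intros x Hx. split.
  + intros mu. destruct (alg_derive f Hf mu) as (g & _ & D). exists (g x). auto.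
  + intros e He. assert (C := alg_continuous f Hf x Hx).
    apply (C (fun z => Rabs (z - f x) < e)). exists (mkposreal e He). intros z Hz. exact Hz.
- intros mu. destruct (alg_derive f Hf mu) as (g & Ag & D). exists g. split; [exact Ag|].
  intros x Hx. apply is_derive_unique. auto.
Qed.

Lemma smooth_add f g : smooth_on U f -> smooth_on U g -> smooth_on U (fun x => f x + g x).
Proof. intros. apply alg_is_smooth, alg_add; now apply alg_smooth. Qed.
Lemma smooth_mul f g : smooth_on U f -> smooth_on U g -> smooth_on U (fun x => f x * g x).
Proof. intros. apply alg_is_smooth, alg_mul; now apply alg_smooth. Qed.
Lemma smooth_cst c : smooth_on U (fun _ => c).
Proof. apply alg_is_smooth, alg_cst. Qed.

Lemma partial_add f g mu x : smooth_on U f -> smooth_on U g -> U x ->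
  partial mu (fun y => f y + g y) x = partial mu f x + partial mu g x.
Proof. intros Hf Hg Hx. apply Derive_plus; now apply smooth_reg. Qed.
Lemma partial_mul f g mu x : smooth_on U f -> smooth_on U g -> U x ->
  partial mu (fun y => f y * g y) x = partial mu f x * g x + f x * partial mu g x.
Proof.
intros Hf Hg Hx. unfold partial. rewrite Derive_mult; [|now apply smooth_reg..]. now rewrite !shift_0.
Qed.
Lemma partial_cst c mu x : partial mu (fun _ => c) x = 0.
Proof. exact (Derive_const c 0). Qed.

(** Moves the base point without a differentiability hypothesis, because [Derive] is a total
    function given by a limit of quotients. *)
Lemma partial_shift (f : pt -> R) x mu u : partial mu f (shift x mu u) = Derive (fun z => f (shift x mu z)) u.
Proof.
unfold partial, Derive. f_equal. apply Lim_ext. intros h. rewrite !shift_add, !Rplus_0_l, Rplus_0_r. reflexivity.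
Qed.
Lemma ex_partial_shift (f : pt -> R) x mu u : ex_derive (fun s => f (shift (shift x mu u) mu s)) 0 ->
  ex_derive (fun z => f (shift x mu z)) u.
Proof.
intros H. apply (ex_derive_ext (fun z => f (shift (shift x mu u) mu (z - u)))).
{ intros z. rewrite shift_add. do 2 f_equal. ring. }
apply (ex_derive_comp (fun s => f (shift (shift x mu u) mu s)) (fun z => z - u)).
- now replace (u - u) with 0 by ring.
- auto_derive. trivial.
Qed.

(** [Schwarz] on the two-parameter slice through [x]. The case [mu = nu] is split off because only
    shifts in different coordinates interchange. *)
Lemma partial_comm f mu nu x : smooth_on U f -> U x ->
  partial mu (partial nu f) x = partial nu (partial mu f) x.
Proof.
intros Hf Hx.
destruct (Classical_Prop.classic (mu = nu)) as [->|D]; [reflexivity|].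
assert (L : locally_2d (fun u v => U (shift (shift x mu u) nu v)) 0 0).
{ destruct (HU x Hx) as (d & Hd & H). exists (mkposreal (d / 2) ltac:(lra)). simpl. intros u v Hu Hv.
  rewrite Rminus_0_r in Hu, Hv. apply H, near_trans with (shift x mu u); now apply near_shift. }
set (F u v := f (shift (shift x mu u) nu v)).
assert (A : forall g u v, Derive (fun z => g (shift (shift x mu z) nu v)) u = partial mu g (shift (shift x mu u) nu v)).
{ intros g u v. rewrite (shift_comm x mu nu _ _ D), partial_shift. apply Derive_ext. intros z.
  now rewrite (shift_comm x mu nu _ _ D). }
assert (B : forall g u v, Derive (fun z => g (shift (shift x mu u) nu z)) v = partial nu g (shift (shift x mu u) nu v)).
{ intros g u v. now rewrite partial_shift. }
assert (A' : forall g u v, smooth_on U g -> U (shift (shift x mu u) nu v) ->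
  ex_derive (fun z => g (shift (shift x mu z) nu v)) u).
{ intros g u v Hg HUv. apply (ex_derive_ext (fun z => g (shift (shift x nu v) mu z))).
  { intros z. now rewrite (shift_comm x mu nu _ _ D). }
  apply ex_partial_shift. rewrite <- (shift_comm x mu nu _ _ D). now apply smooth_reg. }
assert (B' : forall g u v, smooth_on U g -> U (shift (shift x mu u) nu v) ->
  ex_derive (fun z => g (shift (shift x mu u) nu z)) v).
{ intros g u v Hg HUv. apply ex_partial_shift. now apply smooth_reg. }
assert (Cn : forall g, smooth_on U g -> continuity_2d_pt (fun u v => g (shift (shift x mu u) nu v)) 0 0).
{ intros g Hg eps. destruct (smooth_reg g x Hg Hx) as (_ & C). destruct (C eps (cond_pos eps)) as (d & Hd & H).
  exists (mkposreal (d / 2) ltac:(lra)). simpl. intros u v Hu Hv. rewrite Rminus_0_r in Hu, Hv.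
  rewrite !shift_0. apply H, near_trans with (shift x mu u); now apply near_shift. }
assert (S := Schwarz F 0 0). unfold F in S.
transitivity (Derive (fun z => Derive (fun z0 => f (shift (shift x mu z) nu z0)) 0) 0).
{ rewrite (Derive_ext _ (fun z => partial nu f (shift (shift x mu z) nu 0))) by (intros; apply B).
  rewrite A, !shift_0. reflexivity. }
transitivity (Derive (fun z => Derive (fun z0 => f (shift (shift x mu z0) nu z)) 0) 0).
- apply S.
  + apply locally_2d_impl_strong with (2 := L). apply locally_2d_forall. intros u v Luv.
    assert (Huv := locally_2d_singleton _ _ _ Luv). repeat split.
    * now apply A'.
    * now apply B'.
    * apply (ex_derive_ext (fun z => partial nu f (shift (shift x mu z) nu v))); [intros; symmetry; apply B|].
      apply A'; [now apply smooth_partial|exact Huv].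
    * apply (ex_derive_ext (fun z => partial mu f (shift (shift x mu u) nu z))); [intros; symmetry; apply A|].
      apply B'; [now apply smooth_partial|exact Huv].
  + eapply continuity_2d_pt_ext; [|apply (Cn (partial mu (partial nu f)))].
    * intros u v. simpl. rewrite <- A. apply Derive_ext. intros; symmetry; apply B.
    * now apply smooth_partial, smooth_partial.
  + eapply continuity_2d_pt_ext; [|apply (Cn (partial nu (partial mu f)))].
    * intros u v. simpl. rewrite <- B. apply Derive_ext. intros; symmetry; apply A.
    * now apply smooth_partial, smooth_partial.
- rewrite (Derive_ext _ (fun z => partial mu f (shift (shift x mu 0) nu z))) by (intros; apply A).
  rewrite B, !shift_0. reflexivity.
Qed.
End Smooth.
End SmoothFunctions.

(** * The ring of smooth functions and its dual numbers *)

Module SmoothRing.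
Import DifferentialRings FrameGeometry DualNumbers SmoothFunctions.
Open Scope R_scope.

Section ComplexSmooth.
Context (U : pt -> Prop) (HU : open_pt U).

Lemma Csmooth_ext (f g : pt -> C) : (forall x, U x -> f x = g x) -> Csmooth_on U f -> Csmooth_on U g.
Proof. intros E (A & B). split; [apply (smooth_ext U HU) with (2 := A)|apply (smooth_ext U HU) with (2 := B)];
  intros x Hx; cbv beta; now rewrite E. Qed.
Lemma Csmooth_add (f g : pt -> C) : Csmooth_on U f -> Csmooth_on U g -> Csmooth_on U (fun x => f x + g x)%C.
Proof. intros (A & B) (A' & B'). split; [exact (smooth_add U HU _ _ A A')|exact (smooth_add U HU _ _ B B')]. Qed.
Lemma Csmooth_cst z : Csmooth_on U (fun _ => z).
Proof. split; [exact (smooth_cst U HU (Re z))|exact (smooth_cst U HU (Im z))]. Qed.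
Lemma smooth_opp f : smooth_on U f -> smooth_on U (fun x => - f x).
Proof.
intros H. apply (smooth_ext U HU) with (fun x => (- (1)) * f x); [intros; ring|].
apply (smooth_mul U HU); [apply (smooth_cst U HU)|exact H].
Qed.
Lemma Csmooth_mul (f g : pt -> C) : Csmooth_on U f -> Csmooth_on U g -> Csmooth_on U (fun x => f x * g x)%C.
Proof.
intros (A & B) (A' & B'). split.
- exact (smooth_add U HU _ _ (smooth_mul U HU _ _ A A') (smooth_opp _ (smooth_mul U HU _ _ B B'))).
- exact (smooth_add U HU _ _ (smooth_mul U HU _ _ A B') (smooth_mul U HU _ _ B A')).
Qed.
Lemma Csmooth_opp (f : pt -> C) : Csmooth_on U f -> Csmooth_on U (fun x => - f x)%C.
Proof. intros (A & B). split; [exact (smooth_opp _ A)|exact (smooth_opp _ B)]. Qed.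
Lemma Csmooth_RtoC f : smooth_on U f -> Csmooth_on U (fun x => RtoC (f x)).
Proof. intros H. split; [exact H|exact (smooth_cst U HU 0)]. Qed.
Lemma Csmooth_partial mu f : Csmooth_on U f -> Csmooth_on U (Cpartial mu f).
Proof. intros (A & B). split; now apply smooth_partial. Qed.

Lemma Cpartial_ext (f g : pt -> C) mu x : (forall y, U y -> f y = g y) -> U x -> Cpartial mu f x = Cpartial mu g x.
Proof.
intros E Hx. unfold Cpartial. f_equal; apply (partial_ext U HU); try exact Hx; intros y Hy; now rewrite E.
Qed.
Lemma Cpartial_add (f g : pt -> C) mu x : Csmooth_on U f -> Csmooth_on U g -> U x ->
  Cpartial mu (fun y => f y + g y)%C x = (Cpartial mu f x + Cpartial mu g x)%C.
Proof. intros (A & B) (A' & B') Hx. unfold Cpartial, Cplus; simpl. f_equal.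
- exact (partial_add U _ _ mu x A A' Hx).
- exact (partial_add U _ _ mu x B B' Hx). Qed.
Lemma partial_opp f mu x : partial mu (fun y => - f y) x = - partial mu f x.
Proof. exact (Derive_opp (fun s => f (shift x mu s)) 0). Qed.
Lemma Cpartial_mul (f g : pt -> C) mu x : Csmooth_on U f -> Csmooth_on U g -> U x ->
  Cpartial mu (fun y => f y * g y)%C x = (Cpartial mu f x * g x + f x * Cpartial mu g x)%C.
Proof.
intros (A & B) (A' & B') Hx.
unfold Cpartial, Cmult, Cplus; simpl. f_equal.
- assert (M1 := smooth_mul U HU _ _ A A'). assert (M2 := smooth_mul U HU _ _ B B').
  transitivity (partial mu (fun y => Re (f y) * Re (g y) + - (Im (f y) * Im (g y))) x); [reflexivity|].
  rewrite (partial_add U _ _ mu x M1 (smooth_opp _ M2) Hx), partial_opp.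
  rewrite (partial_mul U _ _ mu x A A' Hx), (partial_mul U _ _ mu x B B' Hx). unfold Re, Im. ring.
- assert (M1 := smooth_mul U HU _ _ A B'). assert (M2 := smooth_mul U HU _ _ B A').
  transitivity (partial mu (fun y => Re (f y) * Im (g y) + Im (f y) * Re (g y)) x); [reflexivity|].
  rewrite (partial_add U _ _ mu x M1 M2 Hx).
  rewrite (partial_mul U _ _ mu x A B' Hx), (partial_mul U _ _ mu x B A' Hx). unfold Re, Im. ring.
Qed.
Lemma Cpartial_cst z mu x : Cpartial mu (fun _ => z) x = 0.
Proof. unfold Cpartial. now rewrite !partial_cst. Qed.
Lemma Cpartial_RtoC f mu x : Cpartial mu (fun y => RtoC (f y)) x = RtoC (partial mu f x).
Proof. unfold Cpartial, RtoC. simpl. f_equal. apply partial_cst. Qed.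

(* Values off [U] are normalised to [0], so that equality on [U] is Leibniz equality. *)
Record smf := Smf { sev :> pt -> C; sev_smooth : Csmooth_on U sev; sev_out : forall x, ~ U x -> sev x = 0 }.

Lemma smf_ext (u v : smf) : (forall x, U x -> u x = v x) -> u = v.
Proof.
intros E. assert (F : sev u = sev v).
{ apply functional_extensionality. intros x. destruct (excluded_middle_informative (U x)); [auto|].
  now rewrite !sev_out. }
destruct u as [f A B], v as [g A' B']. simpl in F. subst g.
f_equal; apply proof_irrelevance.
Qed.

Definition restr (f : pt -> C) (x : pt) : C := if excluded_middle_informative (U x) then f x else 0.
Lemma restr_in f x : U x -> restr f x = f x.
Proof. unfold restr. now destruct (excluded_middle_informative (U x)). Qed.
Lemma restr_smooth f : Csmooth_on U f -> Csmooth_on U (restr f).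
Proof. apply Csmooth_ext. intros x Hx. now rewrite restr_in. Qed.
Lemma restr_out f x : ~ U x -> restr f x = 0.
Proof. unfold restr. now destruct (excluded_middle_informative (U x)). Qed.
Definition mk f (H : Csmooth_on U f) : smf := Smf (restr f) (restr_smooth f H) (restr_out f).
Lemma mk_in f H x : U x -> mk f H x = f x.
Proof. apply restr_in. Qed.

Definition s_add (u v : smf) := mk _ (Csmooth_add _ _ (sev_smooth u) (sev_smooth v)).
Definition s_mul (u v : smf) := mk _ (Csmooth_mul _ _ (sev_smooth u) (sev_smooth v)).
Definition s_opp (u : smf) := mk _ (Csmooth_opp _ (sev_smooth u)).
Definition s_sub (u v : smf) := s_add u (s_opp v).
Definition s_cst z := mk _ (Csmooth_cst z).
Definition s_pd mu (u : smf) := mk _ (Csmooth_partial mu _ (sev_smooth u)).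

Ltac sm := intros; apply smf_ext; intros p Hp; unfold s_sub, s_add, s_mul, s_opp, s_cst; rewrite ?mk_in by exact Hp.

Definition smooth_dring : dring.
Proof.
refine (Dring smf (s_cst 0) (s_cst 1) s_add s_mul s_sub s_opp _ s_cst eq_refl eq_refl _ _ _ s_pd _ _ _ _).
- constructor; sm; ring.
- sm. reflexivity.
- sm. reflexivity.
- sm. reflexivity.
- intros; apply smf_ext; intros x Hx. unfold s_pd at 1. rewrite mk_in by exact Hx.
  unfold s_add. rewrite !mk_in by exact Hx. unfold s_pd. rewrite !mk_in by exact Hx.
  rewrite <- (Cpartial_add u v) by (try apply sev_smooth; assumption).
  apply Cpartial_ext; [|exact Hx]. intros y Hy. now rewrite mk_in.
- intros; apply smf_ext; intros x Hx. unfold s_pd at 1. rewrite mk_in by exact Hx.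
  unfold s_add, s_mul. rewrite !mk_in by exact Hx. unfold s_pd. rewrite !mk_in by exact Hx.
  rewrite <- (Cpartial_mul u v) by (try apply sev_smooth; assumption).
  apply Cpartial_ext; [|exact Hx]. intros y Hy. now rewrite mk_in.
- intros; apply smf_ext; intros x Hx. unfold s_pd, s_cst. rewrite !mk_in by exact Hx.
  rewrite <- (Cpartial_cst z m x). apply Cpartial_ext; [|exact Hx]. intros y Hy. now rewrite mk_in.
- intros; apply smf_ext; intros x Hx. unfold s_pd. rewrite !mk_in by exact Hx.
  transitivity (Cpartial m (Cpartial n u) x); [apply Cpartial_ext; [|exact Hx]; intros y Hy; now rewrite mk_in|].
  transitivity (Cpartial n (Cpartial m u) x); [|apply Cpartial_ext; [|exact Hx]; intros y Hy; now rewrite mk_in].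
  destruct (sev_smooth u) as (A & B). unfold Cpartial. f_equal; now apply (partial_comm U).
Defined.

Section Values.
Context (u v : smooth_dring) (x : pt) (Hx : U x).
Lemma sev_add : sev (u + v)%D x = (sev u x + sev v x)%C. Proof. now apply mk_in. Qed.
Lemma sev_mul : sev (u * v)%D x = (sev u x * sev v x)%C. Proof. now apply mk_in. Qed.
Lemma sev_opp : sev (- u)%D x = (- sev u x)%C. Proof. now apply mk_in. Qed.
Lemma sev_sub : sev (u - v)%D x = (sev u x - sev v x)%C.
Proof. etransitivity; [now apply mk_in|]. unfold Cminus. f_equal. now apply mk_in. Qed.
Lemma sev_cst z : sev (cst z : smooth_dring) x = z. Proof. now apply mk_in. Qed.
Lemma sev_kc z : sev (kc z : smooth_dring) x = qiC z. Proof. apply sev_cst. Qed.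
Lemma sev_pd mu : sev (pd mu u) x = Cpartial mu (sev u) x. Proof. now apply mk_in. Qed.
End Values.
End ComplexSmooth.

Section Dualize.
Context (K : dring).
Add Ring KringD : (kth K) (morphism (kc_morph K), constants [kcst]).
Open Scope dr_scope.

Lemma kz_0 : kz = #q 0 :> K. Proof. ring. Qed.
Lemma ko_1 : ko = #q 1 :> K. Proof. ring. Qed.

(** Pairs [(u0, u1)] stand for [u0 + e u1] modulo [e^2]; constants and derivations act
    componentwise. *)
Definition dualize : dring.
Proof.
refine (Dring (K * K) (kz, kz) (ko, kz) (fun u v => (fst u + fst v, snd u + snd v))
  (fun u v => (fst u * fst v, fst u * snd v + snd u * fst v))
  (fun u v => (fst u - fst v, snd u - snd v)) (fun u => (- fst u, - snd u)) _
  (fun z => (cst z, kz)) _ _ _ _ _ (fun m u => (pd m (fst u), pd m (snd u))) _ _ _ _);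
  [|intros; simpl; f_equal..]; rewrite ?kz_0, ?ko_1.
- constructor; intros; repeat match goal with u : (_ * _)%type |- _ => destruct u end; simpl; f_equal; ring.
- now rewrite cst0, kz_0.
- now rewrite cst1, ko_1.
- apply cst_add.
- ring.
- apply cst_mul.
- ring.
- apply cst_opp.
- ring.
- apply pd_add.
- apply pd_add.
- apply pd_mul.
- rewrite pd_add, !pd_mul. ring.
- now rewrite pd_cst, kz_0.
- unfold kc. rewrite pd_cst, kz_0. reflexivity.
- apply pd_comm.
- apply pd_comm.
Defined.

Lemma kc_dual z : (kc z : dualize) = (kc z, #q 0).
Proof. unfold kc at 1. simpl. now rewrite kz_0. Qed.

Definition dual_dual : dual dualize.
Proof.
refine (Dual dualize (fun u => (fst u, #q 0)) (fun u => (snd u, #q 0)) (#q 0, #q 1)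
  _ _ _ _ _ _ _ _ _ _ _ _ _ _); intros; rewrite ?kc_dual; apply injective_projections; simpl;
  rewrite ?kz_0, ?(der_kc _ (pd_derivation _)); ring.
Defined.
End Dualize.
End SmoothRing.

(** * Transfer from families of functions to ring elements *)

Module Representations.
Import DifferentialRings FrameGeometry SmoothFunctions SmoothRing.
Open Scope R_scope.

(** A logical relation between families depending on [e] and ring elements. Geometric definitions
    use only sums, products, constants and partial derivatives, so these clauses carry each
    definition of the statement to its algebraic counterpart. *)
Record reprel (K : dring) := Reprel {
  rrel : (R -> pt -> C) -> K -> Prop;
  rrel_ext : forall F G u, (forall e x, F e x = G e x) -> rrel F u -> rrel G u;
  rrel_add : forall F G u v, rrel F u -> rrel G v -> rrel (fun e x => F e x + G e x)%C (kadd u v);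
  rrel_sub : forall F G u v, rrel F u -> rrel G v -> rrel (fun e x => F e x - G e x)%C (ksub u v);
  rrel_mul : forall F G u v, rrel F u -> rrel G v -> rrel (fun e x => F e x * G e x)%C (kmul u v);
  rrel_opp : forall F u, rrel F u -> rrel (fun e x => - F e x)%C (kopp u);
  rrel_kc : forall z c, qiC c = z -> rrel (fun _ _ => z) (kc c);
  rrel_pd : forall F u mu, rrel F u -> rrel (fun e x => Cpartial mu (F e) x) (pd mu u)
}.
Arguments rrel {_}.
Definition rrelR {K : dring} (Rl : reprel K) (f : R -> pt -> R) (u : K) : Prop :=
  rrel Rl (fun e x => RtoC (f e x)) u.

Section RepR.
Context (K : dring) (Rl : reprel K).
Local Notation repR := (rrelR Rl).

Lemma repR_add f g u v : repR f u -> repR g v -> repR (fun e x => f e x + g e x) (kadd u v).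
Proof.
intros A B. apply (rrel_ext K Rl (fun e x => RtoC (f e x) + RtoC (g e x))%C); [|exact (rrel_add K Rl _ _ _ _ A B)].
intros. now rewrite RtoC_plus.
Qed.
Lemma repR_sub f g u v : repR f u -> repR g v -> repR (fun e x => f e x - g e x) (ksub u v).
Proof.
intros A B. apply (rrel_ext K Rl (fun e x => RtoC (f e x) - RtoC (g e x))%C); [|exact (rrel_sub K Rl _ _ _ _ A B)].
intros. now rewrite RtoC_minus.
Qed.
Lemma repR_mul f g u v : repR f u -> repR g v -> repR (fun e x => f e x * g e x) (kmul u v).
Proof.
intros A B. apply (rrel_ext K Rl (fun e x => RtoC (f e x) * RtoC (g e x))%C); [|exact (rrel_mul K Rl _ _ _ _ A B)].
intros. now rewrite RtoC_mult.
Qed.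
Lemma repR_opp f u : repR f u -> repR (fun e x => - f e x) (kopp u).
Proof.
intros A. apply (rrel_ext K Rl (fun e x => - RtoC (f e x))%C); [|exact (rrel_opp K Rl _ _ A)].
intros. now rewrite RtoC_opp.
Qed.
Lemma repR_kc z c : qiC c = RtoC z -> repR (fun _ _ => z) (kc c).
Proof. intros H. exact (rrel_kc K Rl _ _ H). Qed.
Lemma repR_pd f u mu : repR f u -> repR (fun e x => partial mu (f e) x) (pd mu u).
Proof.
intros A. apply (rrel_ext K Rl (fun e x => Cpartial mu (fun y => RtoC (f e y)) x)); [|exact (rrel_pd K Rl _ _ mu A)].
intros. apply Cpartial_RtoC.
Qed.
End RepR.

Lemma qiC_real (p : Q) (z : R) : Q2R p = z -> qiC (p, 0%Q) = RtoC z.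
Proof. intros <-. unfold qiC, RtoC; cbn [fst snd]. now rewrite RMicromega.Q2R_0. Qed.
Lemma qiC_i : qiC (0%Q, 1%Q) = Ci.
Proof. unfold qiC, Ci; cbn [fst snd]. now rewrite RMicromega.Q2R_0, RMicromega.Q2R_1. Qed.
Lemma RtoC_half : (/ 2)%C = RtoC (/ 2). Proof. now rewrite RtoC_inv. Qed.
Lemma RtoC_three_halves : (3 / 2)%C = RtoC (3 / 2). Proof. now rewrite RtoC_div. Qed.
Lemma RtoC_five_halves : (5 / 2)%C = RtoC (5 / 2). Proof. now rewrite RtoC_div. Qed.

Ltac kcs := first [assumption | exact qiC_i |
  rewrite ?RtoC_half, ?RtoC_three_halves, ?RtoC_five_halves; apply qiC_real; unfold Q2R; simpl; field; lra |
  rewrite ?RtoC_half, ?RtoC_three_halves, ?RtoC_five_halves; apply qiC_real; unfold Q2R; simpl; field ].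

Create HintDb rep discriminated.
(** Follows the syntax of the analytic expression; the two sides were defined in parallel so that
    this alone relates them. *)
Ltac rp :=
  lazymatch goal with
  | |- forall _, _ => intros ?; rp
  | |- rrelR _ (fun _ _ => ?z) (kc _) => apply repR_kc; kcs
  | |- rrel _ (fun _ _ => ?z) (kc _) => apply rrel_kc; kcs
  | |- @rrelR ?K ?W (fun e x => (@?f e x + @?g e x)%R) _ => apply (repR_add K W f g); rp
  | |- @rrelR ?K ?W (fun e x => (@?f e x - @?g e x)%R) _ => apply (repR_sub K W f g); rp
  | |- @rrelR ?K ?W (fun e x => (@?f e x * @?g e x)%R) _ => apply (repR_mul K W f g); rp
  | |- @rrelR ?K ?W (fun e x => (@?f e x / @?g e x)%R) _ => apply (repR_mul K W f (fun e x => / g e x)); rp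
  | |- @rrelR ?K ?W (fun e x => (- @?f e x)%R) _ => apply (repR_opp K W f); rp
  | |- @rrelR ?K ?W (fun e x => partial ?mu (@?f e) x) _ => apply (repR_pd K W f); rp
  | |- @rrel ?K ?W (fun e x => RtoC (@?f e x)) ?u => change (rrelR W f u); cbv beta; rp
  | |- @rrel ?K ?W (fun e x => (@?f e x + @?g e x)%C) _ => apply (rrel_add K W f g); rp
  | |- @rrel ?K ?W (fun e x => (@?f e x - @?g e x)%C) _ => apply (rrel_sub K W f g); rp
  | |- @rrel ?K ?W (fun e x => (@?f e x * @?g e x)%C) _ => apply (rrel_mul K W f g); rp
  | |- @rrel ?K ?W (fun e x => (- @?f e x)%C) _ => apply (rrel_opp K W f); rp
  | |- @rrel ?K ?W (fun e x => Cpartial ?mu (@?f e) x) _ => apply (rrel_pd K W f); rp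
  | |- _ => try solve [auto 6 with rep nocore]
  end.

Section Geometry.
Context (K : dring) (Rl : reprel K).
Local Notation rep := (rrel Rl).
Local Notation repR := (rrelR Rl).
Context (S : R -> spacetime) (KS : kspacetime K).
Context (Hmet : forall mu nu, repR (fun e x => met (S e) mu nu x) (kmet KS mu nu))
  (Hfr : forall i mu, repR (fun e x => fr (S e) i mu x) (kfr KS i mu))
  (Hem : forall mu nu, repR (fun e x => em (S e) mu nu x) (kem KS mu nu)).
#[local] Hint Resolve Hmet Hfr Hem : rep.

Lemma rep_mink i j : repR (fun _ _ => mink i j) (kmink i j).
Proof. unfold mink, kmink, mink_inv, kmink_inv, delta, kdelta, eps, keps; destruct i, j; rp. Qed.
Lemma rep_mink_inv i j : repR (fun _ _ => mink_inv i j) (kmink_inv i j).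
Proof. unfold mink, kmink, mink_inv, kmink_inv, delta, kdelta, eps, keps; destruct i, j; rp. Qed.
Lemma rep_delta i j : repR (fun _ _ => delta i j) (kdelta i j).
Proof. unfold mink, kmink, mink_inv, kmink_inv, delta, kdelta, eps, keps; destruct i, j; rp. Qed.
Lemma rep_epsilon i j : repR (fun _ _ => eps i j) (keps i j).
Proof. unfold mink, kmink, mink_inv, kmink_inv, delta, kdelta, eps, keps; destruct i, j; rp. Qed.
#[local] Hint Resolve rep_mink rep_mink_inv rep_delta rep_epsilon : rep.

Lemma rep_dir V f v u : (forall mu, repR (fun e x => V e mu x) (v mu)) -> repR (fun e x => f e x) u ->
  repR (fun e x => dir (V e) (f e) x) (kdir v u).
Proof. intros A B. unfold dir, kdir, sumc, ksumc. rp. Qed.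
Lemma rep_Cdir V f v u : (forall mu, repR (fun e x => V e mu x) (v mu)) -> rep (fun e x => f e x) u ->
  rep (fun e x => Cdir (V e) (f e) x) (kdir v u).
Proof. intros A B. unfold Cdir, kdir, Csumc, ksumc. rp. Qed.
Lemma rep_inner V W v w : (forall mu, repR (fun e x => V e mu x) (v mu)) -> (forall mu, repR (fun e x => W e mu x) (w mu)) ->
  repR (fun e x => inner (S e) (V e) (W e) x) (kinner KS v w).
Proof. intros A B. unfold inner, kinner, sumc, ksumc. rp. Qed.
Lemma rep_bracket V W v w mu : (forall mu, repR (fun e x => V e mu x) (v mu)) -> (forall mu, repR (fun e x => W e mu x) (w mu)) ->
  repR (fun e x => bracket (V e) (W e) mu x) (kbracket v w mu).
Proof.
intros A B. unfold bracket, kbracket. apply repR_sub; apply (rep_dir _ (fun e => _)); rp.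
Qed.
Lemma rep_gD V W Y v w y : (forall mu, repR (fun e x => V e mu x) (v mu)) -> (forall mu, repR (fun e x => W e mu x) (w mu)) ->
  (forall mu, repR (fun e x => Y e mu x) (y mu)) ->
  repR (fun e x => gD (S e) (V e) (W e) (Y e) x) (kgD KS v w y).
Proof.
intros A B C. assert (D := fun mu => rep_bracket V W v w mu A B). assert (E := fun mu => rep_bracket V Y v y mu A C).
assert (F := fun mu => rep_bracket W Y w y mu B C).
assert (G1 := rep_inner _ _ _ _ B C). assert (G2 := rep_inner _ _ _ _ A C). assert (G3 := rep_inner _ _ _ _ A B).
assert (G4 := rep_inner _ _ _ _ D C). assert (G5 := rep_inner _ _ _ _ E B). assert (G6 := rep_inner _ _ _ _ F A).
assert (I1 := rep_dir _ _ _ _ A G1). assert (I2 := rep_dir _ _ _ _ B G2). assert (I3 := rep_dir _ _ _ _ C G3).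
unfold gD, kgD. rp.
Qed.
Lemma rep_gam i j k : repR (fun e x => gam (S e) i j k x) (kgam KS i j k).
Proof. apply rep_gD; auto with rep. Qed.
#[local] Hint Resolve rep_gam : rep.
Lemma rep_gamu i j k : repR (fun e x => gamu (S e) i j k x) (kgamu KS i j k).
Proof. unfold gamu, kgamu, raise, kraise, sum4, ksum4. rp. Qed.
#[local] Hint Resolve rep_gamu : rep.
Lemma rep_ed i f u : repR (fun e x => f e x) u -> repR (fun e x => ed (S e) i (f e) x) (ked KS i u).
Proof. intros H. apply rep_dir; auto with rep. Qed.
Lemma rep_ed_gamu n i j k : repR (fun e x => ed (S e) n (gamu (S e) i j k) x) (ked KS n (kgamu KS i j k)).
Proof. apply rep_ed, rep_gamu. Qed.
#[local] Hint Resolve rep_ed_gamu : rep.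
Lemma rep_riem_up i j k m : repR (fun e x => riem_up (S e) i j k m x) (kriem_up KS i j k m).
Proof. unfold riem_up, kriem_up, sum4, ksum4. rp. Qed.
#[local] Hint Resolve rep_riem_up : rep.
Lemma rep_riem i j k m : repR (fun e x => riem (S e) i j k m x) (kriem KS i j k m).
Proof. unfold riem, kriem, sum4, ksum4. rp. Qed.
#[local] Hint Resolve rep_riem : rep.
Lemma rep_ric i j : repR (fun e x => ric (S e) i j x) (kric KS i j).
Proof. unfold ric, kric, sum4, ksum4. rp. Qed.
#[local] Hint Resolve rep_ric : rep.
Lemma rep_scal : repR (fun e x => scal (S e) x) (kscal KS).
Proof. unfold scal, kscal, sum4, ksum4. rp. Qed.
#[local] Hint Resolve rep_scal : rep.
Lemma rep_weyl i j k m : repR (fun e x => weyl (S e) i j k m x) (kweyl KS i j k m).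
Proof. unfold weyl, kweyl. rp. Qed.
#[local] Hint Resolve rep_weyl : rep.
Lemma rep_Ff i j : repR (fun e x => Ff (S e) i j x) (kFf KS i j).
Proof. unfold Ff, kFf, sumc, ksumc. rp. Qed.
#[local] Hint Resolve rep_Ff : rep.
Lemma rep_Ffu i j : repR (fun e x => Ffu (S e) i j x) (kFfu KS i j).
Proof. unfold Ffu, kFfu, raise, kraise, sum4, ksum4. rp. Qed.
#[local] Hint Resolve rep_Ffu : rep.
Lemma rep_ed_Ff n i j : repR (fun e x => ed (S e) n (Ff (S e) i j) x) (ked KS n (kFf KS i j)).
Proof. apply rep_ed, rep_Ff. Qed.
#[local] Hint Resolve rep_ed_Ff : rep.
Lemma rep_DF i j k : repR (fun e x => DF (S e) i j k x) (kDF KS i j k).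
Proof. unfold DF, kDF, sum4, ksum4. rp. Qed.
#[local] Hint Resolve rep_DF : rep.
Lemma rep_F2 : repR (fun e x => F2 (S e) x) (kF2 KS).
Proof. unfold F2, kF2, raise, kraise, sum4, ksum4. rp. Qed.
#[local] Hint Resolve rep_F2 : rep.
Lemma rep_einstein i j : repR (fun e x => einstein_res (S e) i j x) (keinstein KS i j).
Proof. unfold einstein_res, keinstein, sum4, ksum4. rp. Qed.
Lemma rep_bianchi i j k : repR (fun e x => bianchi_res (S e) i j k x) (kbianchi KS i j k).
Proof. unfold bianchi_res, kbianchi. rp. Qed.
Lemma rep_maxwell k : repR (fun e x => maxwell_res (S e) k x) (kmaxwell KS k).
Proof. unfold maxwell_res, kmaxwell, sum4, ksum4. rp. Qed.

Lemma rep_chi a b : repR (fun e x => chi (S e) x a b) (kchi KS a b).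
Proof. unfold chi, kchi. rp. Qed.
Lemma rep_chib a b : repR (fun e x => chib (S e) x a b) (kchib KS a b).
Proof. unfold chib, kchib. rp. Qed.
Lemma rep_eta a : repR (fun e x => eta (S e) x a) (keta KS a).
Proof. unfold eta, keta. rp. Qed.
Lemma rep_etab a : repR (fun e x => etab (S e) x a) (ketab KS a).
Proof. unfold etab, ketab. rp. Qed.
Lemma rep_xi a : repR (fun e x => xi (S e) x a) (kxi KS a).
Proof. unfold xi, kxi. rp. Qed.
Lemma rep_zeta a : repR (fun e x => zeta (S e) x a) (kzeta KS a).
Proof. unfold zeta, kzeta. rp. Qed.
Lemma rep_omega : repR (fun e x => omega (S e) x) (komega KS).
Proof. unfold omega, komega. rp. Qed.
Lemma rep_omegab : repR (fun e x => omegab (S e) x) (komegab KS).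
Proof. unfold omegab, komegab. rp. Qed.
#[local] Hint Resolve rep_chi rep_chib rep_eta rep_etab rep_xi rep_zeta rep_omega rep_omegab : rep.
Lemma rep_trchi : repR (fun e x => trchi (S e) x) (ktrchi KS).
Proof. unfold trchi, ktrchi, trh, ktrh, sumh, ksumh. rp. Qed.
Lemma rep_atrchi : repR (fun e x => atrchi (S e) x) (katrchi KS).
Proof. unfold atrchi, katrchi, atrh, katrh, sumh, ksumh. rp. Qed.
Lemma rep_trchib : repR (fun e x => trchib (S e) x) (ktrchib KS).
Proof. unfold trchib, ktrchib, trh, ktrh, sumh, ksumh. rp. Qed.
Lemma rep_atrchib : repR (fun e x => atrchib (S e) x) (katrchib KS).
Proof. unfold atrchib, katrchib, atrh, katrh, sumh, ksumh. rp. Qed.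
#[local] Hint Resolve rep_trchi rep_atrchi rep_trchib rep_atrchib : rep.

Lemma rep_cplx1 f u a : (forall a, repR (fun e x => f e x a) (u a)) -> rep (fun e x => cplx1 (f e x) a) (kcplx1 u a).
Proof. intros H. unfold cplx1, kcplx1, dual1, kdual1, sumh, ksumh. rp. Qed.
Lemma rep_Xhat a b : rep (fun e x => Xhat (S e) x a b) (kXhat KS a b).
Proof.
unfold Xhat, kXhat, cplx2, kcplx2, dual2, kdual2, hath, khath, trh, ktrh, sumh, ksumh. rp.
Qed.
Lemma rep_H a : rep (fun e x => Hf (S e) x a) (kH KS a).
Proof. apply rep_cplx1; auto with rep. Qed.
Lemma rep_Hb a : rep (fun e x => Hbf (S e) x a) (kHb KS a).
Proof. apply rep_cplx1; auto with rep. Qed.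
Lemma rep_Xi a : rep (fun e x => Xif (S e) x a) (kXi KS a).
Proof. apply rep_cplx1; auto with rep. Qed.
Lemma rep_Z a : rep (fun e x => Zf (S e) x a) (kZ KS a).
Proof. apply rep_cplx1; auto with rep. Qed.
Lemma Cconj_cplx (f g : R) : Cconj (f + Ci * g)%C = (f - Ci * g)%C.
Proof. unfold Cconj, Ci, RtoC. apply injective_projections; simpl; ring. Qed.
(** The relation has no clause for conjugation. A conjugate is first rewritten as [f - i g] with
    real [f] and [g], which are represented separately. *)
Lemma rep_Zc a : rep (fun e x => Cconj (Zf (S e) x a)) (kZc KS a).
Proof.
apply (rrel_ext K Rl (fun e x => zeta (S e) x a - Ci * dual1 (zeta (S e) x) a)%C).
- intros. symmetry. apply Cconj_cplx.
- unfold kZc, dual1, kdual1, sumh, ksumh. rp.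
Qed.
Lemma rep_beta a : repR (fun e x => beta (S e) x a) (kbeta KS a).
Proof. unfold beta, kbeta. rp. Qed.
Lemma rep_rho : repR (fun e x => rho (S e) x) (krho KS).
Proof. unfold rho, krho. rp. Qed.
Lemma rep_rho_star : repR (fun e x => rho_star (S e) x) (krho_star KS).
Proof. unfold rho_star, krho_star. rp. Qed.
Lemma rep_betaF a : repR (fun e x => betaF (S e) x a) (kbetaF KS a).
Proof. unfold betaF, kbetaF. rp. Qed.
Lemma rep_rhoF : repR (fun e x => rhoF (S e) x) (krhoF KS).
Proof. unfold rhoF, krhoF. rp. Qed.
Lemma rep_rhoF_star : repR (fun e x => rhoF_star (S e) x) (krhoF_star KS).
Proof. unfold rhoF_star, krhoF_star. rp. Qed.
#[local] Hint Resolve rep_Xhat rep_H rep_Hb rep_Xi rep_Z rep_Zc rep_beta rep_rho rep_rho_star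
  rep_betaF rep_rhoF rep_rhoF_star : rep.
Lemma rep_B a : rep (fun e x => Bf (S e) x a) (kB KS a).
Proof. apply rep_cplx1; auto with rep. Qed.
Lemma rep_BF a : rep (fun e x => BF (S e) x a) (kBF KS a).
Proof. apply rep_cplx1; auto with rep. Qed.
Lemma rep_PF : rep (fun e x => PF (S e) x) (kPF KS).
Proof. unfold PF, kPF. rp. Qed.
Lemma rep_Pc : rep (fun e x => Cconj (Pf (S e) x)) (kPc KS).
Proof.
apply (rrel_ext K Rl (fun e x => rho (S e) x - Ci * rho_star (S e) x)%C).
- intros. symmetry. apply Cconj_cplx.
- unfold kPc. rp.
Qed.
Lemma rep_PFc : rep (fun e x => Cconj (PF (S e) x)) (kPFc KS).
Proof.
apply (rrel_ext K Rl (fun e x => rhoF (S e) x - Ci * rhoF_star (S e) x)%C).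
- intros. symmetry. apply Cconj_cplx.
- unfold kPFc. rp.
Qed.
Lemma rep_Xc : rep (fun e x => Cconj (trX (S e) x)) (kadd (ktrchi KS) (kmul (kc (0%Q, 1%Q)) (katrchi KS))).
Proof.
apply (rrel_ext K Rl (fun e x => trchi (S e) x + Ci * atrchi (S e) x)%C).
- intros. unfold trX, Cconj, Ci, RtoC. apply injective_projections; simpl; ring.
- rp.
Qed.
#[local] Hint Resolve rep_B rep_BF rep_PF rep_Pc rep_PFc rep_Xc : rep.

Lemma rep_nabla1 V F v u a : (forall mu, repR (fun e x => V e mu x) (v mu)) -> (forall a, rep (fun e x => F e a x) (u a)) ->
  rep (fun e x => nabla1 (S e) (V e) (F e) a x) (knabla1 KS v u a).
Proof.
intros A B. assert (E := rep_Cdir V (fun e => F e a) v (u a) A (B a)).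
assert (D := fun b c => rep_gD V _ _ v _ _ A (Hfr (emb b)) (Hfr (emb c))).
unfold nabla1, knabla1, Csumh, ksumh. rp.
Qed.
Lemma rep_nabla2 V F v u a b : (forall mu, repR (fun e x => V e mu x) (v mu)) -> (forall a b, rep (fun e x => F e a b x) (u a b)) ->
  rep (fun e x => nabla2 (S e) (V e) (F e) a b x) (knabla2 KS v u a b).
Proof.
intros A B. assert (E := rep_Cdir V (fun e => F e a b) v (u a b) A (B a b)).
assert (D := fun b c => rep_gD V _ _ v _ _ A (Hfr (emb b)) (Hfr (emb c))).
unfold nabla2, knabla2, Csumh, ksumh. rp.
Qed.
Lemma rep_cweight s c i : qiC c = RtoC s -> repR (fun e x => cweight (S e) s i x) (kcweight KS c i).
Proof. intros H. destruct i; unfold cweight, kcweight; rp. Qed.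
Lemma rep_cnabla1 s c i F u a : qiC c = RtoC s -> (forall a, rep (fun e x => F e a x) (u a)) ->
  rep (fun e x => cnabla1 (S e) s i (F e) a x) (kcnabla1 KS c i u a).
Proof.
intros H A. assert (B := rep_cweight s c i H). assert (D := rep_nabla1 _ F _ u a (Hfr i) A).
unfold cnabla1, kcnabla1. rp.
Qed.
Lemma rep_cnabla2 s c i F u a b : qiC c = RtoC s -> (forall a b, rep (fun e x => F e a b x) (u a b)) ->
  rep (fun e x => cnabla2 (S e) s i (F e) a b x) (kcnabla2 KS c i u a b).
Proof.
intros H A. assert (B := rep_cweight s c i H). assert (D := rep_nabla2 _ F _ u a b (Hfr i) A).
unfold cnabla2, kcnabla2. rp.
Qed.
Lemma rep_cD1 s c F u a b : qiC c = RtoC s -> (forall a, rep (fun e x => F e a x) (u a)) ->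
  rep (fun e x => cD1 (S e) s (F e) x a b) (kcD1 KS c u a b).
Proof.
intros H A. assert (D := fun i a => rep_nabla1 _ F _ u a (Hfr i) A).
unfold cD1, kcD1, Csumh, ksumh. rp.
Qed.
Lemma rep_Chath F u a b : (forall a b, rep (fun e x => F e x a b) (u a b)) ->
  rep (fun e x => Chath (F e x) a b) (kChath u a b).
Proof. intros H. unfold Chath, kChath, Csumh, ksumh. rp. Qed.
Lemma rep_cDotimes s c F u a b : qiC c = RtoC s -> (forall a, rep (fun e x => F e a x) (u a)) ->
  rep (fun e x => cDotimes (S e) s (F e) a b x) (kcDotimes KS c u a b).
Proof. intros H A. apply rep_Chath. intros. now apply rep_cD1. Qed.
Lemma rep_otimes F G u v a b : (forall a, rep (fun e x => F e x a) (u a)) -> (forall a, rep (fun e x => G e x a) (v a)) ->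
  rep (fun e x => otimes (F e x) (G e x) a b) (kotimes u v a b).
Proof. intros A B. unfold otimes, kotimes, Chath, kChath, Csumh, ksumh. rp. Qed.
Lemma rep_dot12 F G u v a : (forall a, rep (fun e x => F e x a) (u a)) -> (forall a b, rep (fun e x => G e x a b) (v a b)) ->
  rep (fun e x => dot12 (F e x) (G e x) a) (kdot12 u v a).
Proof. intros A B. unfold dot12, kdot12, Csumh, ksumh. rp. Qed.
Lemma rep_cDbardot s c F u a : qiC c = RtoC s -> (forall a b, rep (fun e x => F e a b x) (u a b)) ->
  rep (fun e x => cDbardot (S e) s (F e) a x) (kcDbardot KS c u a).
Proof.
intros H A. assert (D := fun i a b => rep_nabla2 _ F _ u a b (Hfr i) A).
unfold cDbardot, kcDbardot, cDbar2, kcDbar2, Csumh, ksumh. rp.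
Qed.
Lemma rep_box1 F u a : (forall a, rep (fun e x => F e a x) (u a)) ->
  rep (fun e x => box1 (S e) (F e) a x) (kbox1 KS u a).
Proof.
intros A. assert (D := fun i a => rep_nabla1 _ F _ u a (Hfr i) A).
assert (E := fun i j a => rep_nabla1 _ (fun e => nabla1 (S e) (fr (S e) j) (F e)) _ _ a (Hfr i) (D j)).
unfold box1, kbox1, Csum4, ksum4. rp.
Qed.
Lemma rep_box2 F u a b : (forall a b, rep (fun e x => F e a b x) (u a b)) ->
  rep (fun e x => box2 (S e) (F e) a b x) (kbox2 KS u a b).
Proof.
intros A. assert (D := fun i a b => rep_nabla2 _ F _ u a b (Hfr i) A).
assert (E := fun i j a b => rep_nabla2 _ (fun e => nabla2 (S e) (fr (S e) j) (F e)) _ _ a b (Hfr i) (D j)).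
unfold box2, kbox2, Csum4, ksum4. rp.
Qed.

Lemma qiC_nat0 : qiC (0%Q, 0%Q) = RtoC 0. Proof. kcs. Qed.
Lemma qiC_nat1 : qiC (1%Q, 0%Q) = RtoC 1. Proof. kcs. Qed.
Lemma qiC_nat2 : qiC (2%Q, 0%Q) = RtoC 2. Proof. kcs. Qed.

Lemma rep_frF a b : rep (fun e x => frF (S e) a b x) (kfrF KS a b).
Proof.
assert (A := rep_cDotimes 1 _ (fun e c y => BF (S e) y c) (kBF KS) a b qiC_nat1 rep_BF).
assert (B := rep_otimes _ _ _ _ a b rep_H rep_BF).
unfold frF, kfrF. rp.
Qed.
Lemma rep_frB a : rep (fun e x => frB (S e) a x) (kfrB KS a).
Proof. unfold frB, kfrB. rp. Qed.
Lemma rep_frX a : rep (fun e x => frX (S e) a x) (kfrX KS a).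
Proof.
assert (A := rep_cnabla1 1 _ E4 (fun e c y => BF (S e) y c) (kBF KS) a qiC_nat1 rep_BF).
unfold frX, kfrX. rp.
Qed.
End Geometry.
End Representations.

(** * Exact expansions to second order in the parameter *)

Module PolynomialFamilies.
Import DifferentialRings FrameGeometry DualNumbers SmoothFunctions SmoothRing Representations.
Open Scope R_scope.

Section Representation.
Context (U : pt -> Prop) (HU : open_pt U).
Local Notation SK := (smooth_dring U HU).
Local Notation DK := (dualize SK).

(* Coefficients of [e^2]: they stay bounded at each point and the class is stable under [partial]. *)
Inductive pol : (R -> pt -> C) -> Prop :=
| pol_smooth f : Csmooth_on U f -> pol (fun _ x => f x)
| pol_e : pol (fun e _ => RtoC e)
| pol_add h k : pol h -> pol k -> pol (fun e x => h e x + k e x)%C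
| pol_mul h k : pol h -> pol k -> pol (fun e x => h e x * k e x)%C.

Lemma pol_slice h : pol h -> forall e, Csmooth_on U (h e).
Proof.
induction 1 as [f H| |h k _ IH _ IK|h k _ IH _ IK]; intros e.
- exact H.
- apply (Csmooth_cst U HU).
- exact (Csmooth_add U HU _ _ (IH e) (IK e)).
- exact (Csmooth_mul U HU _ _ (IH e) (IK e)).
Qed.
Lemma pol_partial h mu : pol h ->
  exists h', pol h' /\ forall e x, U x -> Cpartial mu (h e) x = h' e x.
Proof.
induction 1 as [f H| |h k Hh (h' & Ph & IH) Hk (k' & Pk & IK)|h k Hh (h' & Ph & IH) Hk (k' & Pk & IK)].
- exists (fun _ x => Cpartial mu f x). split; [|reflexivity].
  exact (pol_smooth _ (Csmooth_partial U mu f H)).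
- exists (fun _ _ => 0). split; [exact (pol_smooth _ (Csmooth_cst U HU 0))|].
  intros. apply Cpartial_cst.
- exists (fun e x => h' e x + k' e x)%C. split; [now apply pol_add|]. intros e x Hx.
  rewrite (Cpartial_add U (h e) (k e) mu x (pol_slice h Hh e) (pol_slice k Hk e) Hx).
  now rewrite IH, IK.
- exists (fun e x => h' e x * k e x + h e x * k' e x)%C.
  split; [apply pol_add; now apply pol_mul|]. intros e x Hx.
  rewrite (Cpartial_mul U HU (h e) (k e) mu x (pol_slice h Hh e) (pol_slice k Hk e) Hx).
  now rewrite IH, IK.
Qed.
Lemma pol_bound h x : pol h -> exists B, 0 <= B /\ forall e, Rabs e < 1 -> Cmod (h e x) <= B.
Proof.
induction 1 as [f H| |h k _ (B & HB & IB) _ (B' & HB' & IB')|h k _ (B & HB & IB) _ (B' & HB' & IB')].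
- exists (Cmod (f x)). split; [apply Cmod_ge_0|]. intros; lra.
- exists 1. split; [lra|]. intros e He. rewrite Cmod_R. lra.
- exists (B + B'). split; [lra|]. intros e He. eapply Rle_trans; [apply Cmod_triangle|].
  specialize (IB e He). specialize (IB' e He). lra.
- exists (B * B'). split; [now apply Rmult_le_pos|]. intros e He. rewrite Cmod_mult.
  apply Rmult_le_compat; auto using Cmod_ge_0.
Qed.

(** An identity valid for all [e], with a remainder in [pol]: unlike a bound, it can be
    differentiated in [x]. *)
Definition rep (F : R -> pt -> C) (u : DK) : Prop :=
  exists h, pol h /\ forall e x, U x ->
    F e x = (sev U (fst u) x + e * sev U (snd u) x + e * e * h e x)%C.
Definition repR (f : R -> pt -> R) (u : DK) : Prop := rep (fun e x => RtoC (f e x)) u.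

Lemma rep_ext F G u : (forall e x, U x -> F e x = G e x) -> rep F u -> rep G u.
Proof. intros E (h & P & H). exists h. split; [exact P|]. intros e x Hx. now rewrite <- E, H. Qed.

Lemma sm_pol (u : SK) : pol (fun _ x => sev U u x).
Proof. apply pol_smooth, sev_smooth. Qed.

Ltac sv Hx := cbn [fst snd]; rewrite ?(sev_add U HU _ _ _ Hx), ?(sev_mul U HU _ _ _ Hx), ?(sev_opp U HU _ _ Hx),
  ?(sev_sub U HU _ _ _ Hx), ?(sev_cst U HU _ Hx).

Lemma rep_add F G u v : rep F u -> rep G v -> rep (fun e x => F e x + G e x)%C (kadd u v).
Proof.
intros (h & P & H) (k & Q & I). exists (fun e x => h e x + k e x)%C. split; [now apply pol_add|].
intros e x Hx. rewrite H, I by exact Hx.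
change (fst (kadd u v)) with (kadd (fst u) (fst v)). change (snd (kadd u v)) with (kadd (snd u) (snd v)).
sv Hx. ring.
Qed.
Lemma rep_mul F G u v : rep F u -> rep G v -> rep (fun e x => F e x * G e x)%C (kmul u v).
Proof.
intros (h & P & H) (k & Q & I).
exists (fun e x => sev U (fst u) x * k e x + h e x * sev U (fst v) x + sev U (snd u) x * sev U (snd v) x
  + RtoC e * (sev U (snd u) x * k e x + h e x * sev U (snd v) x) + RtoC e * (RtoC e * (h e x * k e x)))%C.
split.
- repeat first [apply pol_add | apply pol_mul]; first [exact pol_e | assumption | apply sm_pol].
- intros e x Hx. rewrite H, I by exact Hx.
  change (fst (kmul u v)) with (kmul (fst u) (fst v)).
  change (snd (kmul u v)) with (kadd (kmul (fst u) (snd v)) (kmul (snd u) (fst v))). sv Hx. ring.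
Qed.
Lemma rep_cst z : rep (fun _ _ => z) (cst z).
Proof.
exists (fun _ _ => 0). split; [exact (pol_smooth _ (Csmooth_cst U HU 0))|]. intros e x Hx.
change (fst (cst z : DK)) with (cst z : SK). change (snd (cst z : DK)) with (cst 0 : SK). sv Hx. ring.
Qed.
Lemma rep_kc z c : qiC c = z -> rep (fun _ _ => z) (kc c).
Proof. intros <-. apply rep_cst. Qed.
Lemma rep_opp F u : rep F u -> rep (fun e x => - F e x)%C (kopp u).
Proof.
intros (h & P & H). exists (fun e x => (- (1)) * h e x)%C.
split; [exact (pol_mul _ _ (pol_smooth _ (Csmooth_cst U HU (- (1)))) P)|].
intros e x Hx. rewrite H by exact Hx.
change (fst (kopp u)) with (kopp (fst u)). change (snd (kopp u)) with (kopp (snd u)). sv Hx. ring.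
Qed.
Lemma rep_sub F G u v : rep F u -> rep G v -> rep (fun e x => F e x - G e x)%C (ksub u v).
Proof.
intros A B. rewrite (Rsub_def (kth DK)). exact (rep_add _ _ _ _ A (rep_opp _ _ B)).
Qed.
Lemma rep_pd F u mu : rep F u -> rep (fun e x => Cpartial mu (F e) x) (pd mu u).
Proof.
intros (h & P & H). destruct (pol_partial h mu P) as (h' & P' & H'). exists h'. split; [exact P'|].
intros e x Hx. change (fst (pd mu u)) with (pd mu (fst u)). change (snd (pd mu u)) with (pd mu (snd u)).
rewrite !(sev_pd U HU _ _ Hx), <- H' by exact Hx.
assert (A := sev_smooth U (fst u)). assert (B := sev_smooth U (snd u)). assert (D := pol_slice h P e).
assert (E := Csmooth_cst U HU (RtoC e)). assert (E2 := Csmooth_mul U HU _ _ E E).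
rewrite (Cpartial_ext U HU _ _ mu x (H e) Hx).
rewrite (Cpartial_add U _ _ mu x (Csmooth_add U HU _ _ A (Csmooth_mul U HU _ _ E B)) (Csmooth_mul U HU _ _ E2 D) Hx).
rewrite (Cpartial_add U _ _ mu x A (Csmooth_mul U HU _ _ E B) Hx).
rewrite (Cpartial_mul U HU _ _ mu x E B Hx), (Cpartial_mul U HU _ _ mu x E2 D Hx).
rewrite !Cpartial_cst. ring.
Qed.
Lemma rep_affine f g (Hf : Csmooth_on U f) (Hg : Csmooth_on U g) :
  rep (fun e x => f x + e * g x)%C (mk U HU f Hf, mk U HU g Hg).
Proof.
exists (fun _ _ => 0). split; [exact (pol_smooth _ (Csmooth_cst U HU 0))|]. intros e x Hx.
cbn [fst snd]. rewrite !mk_in by exact Hx. ring.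
Qed.

Lemma rep_zero F u x : rep F u -> U x -> F 0 x = sev U (fst u) x.
Proof. intros (h & _ & H) Hx. rewrite H by exact Hx. ring. Qed.

(** The two expansions differ by [e^2] times a difference of remainders, bounded at [x] for
    [|e| < 1]. This brings the conclusion back from the ring. *)
Lemma rep_lin_eq F G u x : rep F u -> rep G u -> U x -> lin_eq (fun e => F e x) (fun e => G e x).
Proof.
intros (h & P & H) (k & Q & I) Hx.
destruct (pol_bound h x P) as (B & HB & IB), (pol_bound k x Q) as (B' & HB' & IB').
exists (B + B'), 1. split; [lra|]. intros e He. rewrite H, I by exact Hx.
replace (_ - _)%C with (RtoC (e * e) * (h e x - k e x))%C by (rewrite RtoC_mult; ring).
rewrite Cmod_mult, Cmod_R, (Rabs_pos_eq (e * e)) by nra.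
assert (Cmod (h e x - k e x) <= B + B').
{ eapply Rle_trans; [apply Cmod_triangle|]. rewrite Cmod_opp. specialize (IB e He). specialize (IB' e He). lra. }
nra.
Qed.

Lemma small_affine (a b : C) B d : 0 < d ->
  (forall e, Rabs e < d -> Cmod (a + e * b) <= B * e ^ 2) -> a = 0 /\ b = 0.
Proof.
intros Hd H.
assert (A : a = 0).
{ apply Cmod_eq_0. apply Rle_antisym; [|apply Cmod_ge_0].
  assert (H0 := H 0 ltac:(rewrite Rabs_R0; lra)). replace (a + 0 * b)%C with a in H0 by ring. lra. }
split; [exact A|]. subst a.
apply Cmod_eq_0. apply Rle_antisym; [|apply Cmod_ge_0]. apply Rnot_lt_le. intros Hb.
set (m := Cmod b) in *.
assert (T : forall e, 0 < e < d -> m <= B * e).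
{ intros e He. assert (H1 := H e ltac:(rewrite Rabs_pos_eq; lra)).
  replace (0 + e * b)%C with (e * b)%C in H1 by ring.
  rewrite Cmod_mult, Cmod_R, Rabs_pos_eq in H1 by lra. fold m in H1. nra. }
assert (HB : 0 < B) by (specialize (T (d / 2) ltac:(lra)); nra).
assert (H2 : 0 < m / (2 * B)) by (apply Rdiv_lt_0_compat; lra).
(* For this [e] the bound [m <= B * e] would give [m <= m / 2], although [m] is positive. *)
set (e := Rmin (d / 2) (m / (2 * B))).
assert (0 < e) by (apply Rmin_pos; lra).
assert (e <= d / 2) by apply Rmin_l. assert (He : e <= m / (2 * B)) by apply Rmin_r.
specialize (T e ltac:(lra)).
assert (B * e <= B * (m / (2 * B))) by (apply Rmult_le_compat_l; lra).
replace (B * (m / (2 * B))) with (m / 2) in * by (field; lra). lra.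
Qed.

(** Pointwise equality modulo [e^2] determines both Taylor coefficients, so the approximate
    hypotheses become exact ring equations. The bound may depend on the point. *)
Lemma rep_eq F G u v : rep F u -> rep G v ->
  (forall x, U x -> lin_eq (fun e => F e x) (fun e => G e x)) -> u = v.
Proof.
intros (h & P & H) (k & Q & I) E.
assert (T : forall x, U x -> sev U (fst u) x = sev U (fst v) x /\ sev U (snd u) x = sev U (snd v) x).
{ intros x Hx. destruct (E x Hx) as (B0 & d & Hd & L).
  destruct (pol_bound h x P) as (B & HB & IB), (pol_bound k x Q) as (B' & HB' & IB').
  destruct (small_affine (sev U (fst u) x - sev U (fst v) x) (sev U (snd u) x - sev U (snd v) x)
    (B0 + B + B') (Rmin d 1)) as (R1 & R2).
  - apply Rmin_pos; lra.
  - intros e He. assert (Rmin d 1 <= d) by apply Rmin_l. assert (Rmin d 1 <= 1) by apply Rmin_r.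
    specialize (L e ltac:(lra)). specialize (IB e ltac:(lra)). specialize (IB' e ltac:(lra)).
    replace (_ + _)%C with ((F e x - G e x) + (RtoC (e * e) * (k e x - h e x)))%C
      by (rewrite H, I by exact Hx; rewrite RtoC_mult; ring).
    eapply Rle_trans; [apply Cmod_triangle|].
    rewrite Cmod_mult, Cmod_R, (Rabs_pos_eq (e * e)) by nra.
    assert (Cmod (k e x - h e x) <= B + B').
    { eapply Rle_trans; [apply Cmod_triangle|]. rewrite Cmod_opp. lra. }
    assert (0 <= Cmod (k e x - h e x)) by apply Cmod_ge_0. nra.
  - split; [replace (sev U (fst u) x) with ((sev U (fst u) x - sev U (fst v) x) + sev U (fst v) x)%C by ring; rewrite R1
      |replace (sev U (snd u) x) with ((sev U (snd u) x - sev U (snd v) x) + sev U (snd v) x)%C by ring; rewrite R2]; ring. }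
apply injective_projections; apply smf_ext; intros x Hx; now apply T.
Qed.
Definition rep_rel : reprel DK :=
  Reprel DK rep (fun F G u E => rep_ext F G u (fun e x _ => E e x)) rep_add rep_sub rep_mul rep_opp rep_kc rep_pd.
End Representation.
End PolynomialFamilies.

(** * Dual coframe of a perturbed frame *)

Module Coframes.
Import DifferentialRings FrameGeometry Koszul CurvatureSymmetries FieldEquations Coordinates PrincipalFrame DualNumbers Linearisation.
Open Scope dr_scope.

Section Coframe.
Context {K : dring} (T : dual K) (X : kncoord K) (S : kspacetime K).
Add Ring KringCo : (kth K) (morphism (kc_morph K), constants [kcst]).
Local Notation lam := (DualNumbers.lam T).
Local Notation eps := (DualNumbers.eps T).
Context (Hfr : forall i mu, DualNumbers.bg T (kfr S i mu) = xfr X i mu).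
(* First-order inverse: [(E0 + eps E1)^-1 = E0^-1 - eps E0^-1 E1 E0^-1]. *)
Definition pcf (mu : coord) (i : idx) : K :=
  xcf X mu i - eps * ksumc (fun nu => ksum4 (fun j => xcf X mu j * lam (kfr S j nu)) * xcf X nu i).
Lemma pcf_fr mu nu : ksum4 (fun j => pcf mu j * kfr S j nu) = kcoord_delta mu nu.
Proof.
assert (H0 := fun m n => xcf_fr X (bgS T S) Hfr m n). unfold bgS, kfr in H0. cbv beta iota in H0.
fold (kfr S) in H0.
assert (P : forall m, ksum4 (fun j => xcf X m j * xfr X j nu) = kcoord_delta m nu).
{ intros m. rewrite <- (H0 m nu). unfold ksum4. now rewrite <- !Hfr. }
assert (E := epseps _ T).
transitivity (ksum4 (fun j => xcf X mu j * xfr X j nu) + eps * (ksum4 (fun j => xcf X mu j * lam (kfr S j nu))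
  - ksumc (fun n => ksum4 (fun j => xcf X mu j * lam (kfr S j n)) * ksum4 (fun j => xcf X n j * xfr X j nu)))).
- assert (D : forall j, kfr S j nu = xfr X j nu + eps * lam (kfr S j nu))
    by (intros j; rewrite (dec _ T (kfr S j nu)) at 1; now rewrite Hfr).
  unfold pcf, ksum4.
  rewrite (D E1) at 1. rewrite (D E2) at 1. rewrite (D E3) at 1. rewrite (D E4) at 1.
  unfold ksumc, ksum4.
  repeat match goal with |- context [lam ?t] => generalize (lam t); intros ? end.
  repeat match goal with |- context [xcf X ?m ?i] => generalize (xcf X m i); intros ? end.
  repeat match goal with |- context [xfr X ?m ?i] => generalize (xfr X m i); intros ? end.
  ring [E].
- unfold ksumc. rewrite !P. unfold kcoord_delta. destruct mu, nu; unfold ksum4; ring.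
Qed.
End Coframe.
End Coframes.

(** * The exterior region and its background functions *)

Module Exterior.
Import DifferentialRings FrameGeometry Koszul CurvatureSymmetries Coordinates PrincipalFrame SmoothFunctions SmoothRing Representations PolynomialFamilies.
Open Scope R_scope.

Record dhom (K1 K2 : dring) := Dhom {
  hf :> K1 -> K2;
  hf_add : forall u v, hf (kadd u v) = kadd (hf u) (hf v);
  hf_mul : forall u v, hf (kmul u v) = kmul (hf u) (hf v);
  hf_cst : forall z, hf (cst z) = cst z;
  hf_pd : forall m u, hf (pd m u) = pd m (hf u)
}.
Arguments hf {_ _}.

Section Hom.
Context {K1 K2 : dring} (h : dhom K1 K2).
Add Ring Kring1 : (kth K1) (morphism (kc_morph K1), constants [kcst]).
Add Ring Kring2 : (kth K2) (morphism (kc_morph K2), constants [kcst]).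
Open Scope dr_scope.
Lemma hf_kc c : h (kc c) = kc c. Proof. apply hf_cst. Qed.
Lemma hf_opp u : h (- u) = - h u.
Proof. replace (- u) with (#q (-1) * u) by ring. rewrite hf_mul, hf_kc. ring. Qed.
Lemma hf_sub u v : h (u - v) = h u - h v.
Proof. replace (u - v) with (u + - v) by ring. rewrite hf_add, hf_opp. ring. Qed.

(** The background symbols live on the whole exterior, a perturbation only on [U]; they are moved
    there by a homomorphism instead of being built again. *)
Definition kncoord_map (X : kncoord K1) : kncoord K2.
Proof.
refine (Kncoord K2 (h (xr X)) (h (xc X)) (h (xs X)) (h (xis X)) (h (xim X)) (h (xDl X)) (h (xiDl X)) (h (xM X))
  (h (xa X)) (h (xQ X)) _ _ _ _ _ _ _ _ _ _ _);
  repeat rewrite <- ?hf_mul, <- ?hf_add, <- ?hf_sub, <- ?hf_pd.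
- rewrite (xcc _ X), hf_sub, hf_kc, hf_mul. reflexivity.
- rewrite (xs_xis _ X). apply hf_kc.
- rewrite (xDl_xiDl _ X). apply hf_kc.
- rewrite (xim_sq _ X). apply hf_kc.
- rewrite (xDl_def _ X). repeat rewrite ?hf_sub, ?hf_add, ?hf_mul, ?hf_kc. reflexivity.
- intros m. rewrite <- hf_pd, (pd_xr _ X). destruct m; apply hf_kc.
- intros m. rewrite <- hf_pd, (pd_xc _ X). destruct m; rewrite ?hf_opp; try apply hf_kc; reflexivity.
- intros m. rewrite <- hf_pd, (pd_xs _ X). destruct m; try apply hf_kc; reflexivity.
- intros m. rewrite <- hf_pd, (pd_xM _ X). apply hf_kc.
- intros m. rewrite <- hf_pd, (pd_xa _ X). apply hf_kc.
- intros m. rewrite <- hf_pd, (pd_xQ _ X). apply hf_kc.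
Defined.
Lemma xfr_map X i mu : xfr (kncoord_map X) i mu = h (xfr X i mu).
Proof.
unfold xfr, xcovec. destruct i, mu; cbn [xr xc xs xis xim xDl xiDl xM xa xQ kncoord_map];
repeat rewrite ?hf_sub, ?hf_add, ?hf_opp, ?hf_mul, ?hf_kc; reflexivity.
Qed.
End Hom.

Section Restriction.
Context (V U : pt -> Prop) (HV : open_pt V) (HU : open_pt U) (UV : forall x, U x -> V x).
Local Notation KV := (smooth_dring V HV).
Local Notation KU := (smooth_dring U HU).
Lemma smooth_sub f : smooth_on V f -> smooth_on U f.
Proof. intros H l x Hx. apply H, UV, Hx. Qed.
Lemma Csmooth_sub f : Csmooth_on V f -> Csmooth_on U f.
Proof. intros (A & B). split; now apply smooth_sub. Qed.
Definition restriction (u : KV) : KU := mk U HU (sev V u) (Csmooth_sub _ (sev_smooth V u)).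
Definition restriction_dual (u : KV) : dualize KU := (restriction u, cst 0).
Lemma restriction_in u x : U x -> sev U (restriction u) x = sev V u x.
Proof. intros Hx. unfold restriction. now rewrite mk_in. Qed.
(** Background functions do not depend on [e]: restriction to [U] is paired with a zero first-order
    part. *)
Definition restriction_hom : dhom KV (dualize KU).
Proof.
refine (Dhom _ _ restriction_dual _ _ _ _); intros; apply injective_projections;
  apply smf_ext; intros x Hx.
- change (fst (kadd (restriction_dual u) (restriction_dual v))) with (kadd (restriction u) (restriction v)).
  unfold restriction_dual; cbn [fst]. rewrite (sev_add U HU _ _ x Hx), !restriction_in by exact Hx. apply (sev_add V HV); auto.
- change (snd (kadd (restriction_dual u) (restriction_dual v))) with (kadd (cst 0) (cst 0) : KU).
  unfold restriction_dual; cbn [snd]. rewrite (sev_add U HU _ _ x Hx), !(sev_cst U HU _ Hx). ring.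
- change (fst (kmul (restriction_dual u) (restriction_dual v))) with (kmul (restriction u) (restriction v)).
  unfold restriction_dual; cbn [fst]. rewrite (sev_mul U HU _ _ x Hx), !restriction_in by exact Hx. apply (sev_mul V HV); auto.
- change (snd (kmul (restriction_dual u) (restriction_dual v)))
    with (kadd (kmul (restriction u) (cst 0)) (kmul (cst 0) (restriction v)) : KU).
  unfold restriction_dual; cbn [snd]. rewrite (sev_add U HU _ _ x Hx), !(sev_mul U HU _ _ x Hx), !(sev_cst U HU _ Hx). ring.
- change (fst (cst z : dualize KU)) with (cst z : KU).
  unfold restriction_dual; cbn [fst]. rewrite (sev_cst U HU _ Hx), restriction_in by exact Hx. apply (sev_cst V HV); auto.
- reflexivity.
- change (fst (pd m (restriction_dual u))) with (pd m (restriction u)).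
  unfold restriction_dual; cbn [fst]. rewrite (sev_pd U HU _ x Hx), restriction_in by exact Hx. rewrite (sev_pd V HV) by auto.
  apply (Cpartial_ext U HU); [|exact Hx]. intros y Hy. now rewrite restriction_in.
- change (snd (pd m (restriction_dual u))) with (pd m (cst 0 : KU)).
  unfold restriction_dual; cbn [snd]. rewrite pd_cst. reflexivity.
Defined.
End Restriction.

Section RealFunctions.
Context (V : pt -> Prop) (HV : open_pt V).
Local Notation KV := (smooth_dring V HV).
Definition smr (f : pt -> R) (H : smooth_on V f) : KV := mk V HV (fun x => RtoC (f x)) (Csmooth_RtoC V HV f H).
Lemma smr_in f H x : V x -> sev V (smr f H) x = RtoC (f x).
Proof. intros. unfold smr. now rewrite mk_in. Qed.
Lemma smr_pd f H g mu x : V x -> is_derive (fun s => f (shift x mu s)) 0 g -> sev V (pd mu (smr f H)) x = RtoC g.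
Proof.
intros Hx D. rewrite (sev_pd V HV _ x Hx).
rewrite (Cpartial_ext V HV _ (fun y => RtoC (f y)) mu x); [|intros; now apply smr_in|exact Hx].
rewrite Cpartial_RtoC. f_equal. now apply is_derive_unique.
Qed.
End RealFunctions.

Section Exterior.
Context (M a Q : R) (HM : subextremal M a Q).
Local Notation ext := (exterior M a Q).

Lemma sub_bounds : 0 < M /\ a ^ 2 + Q ^ 2 < M ^ 2.
Proof.
unfold subextremal in HM. assert (0 <= sqrt (a ^ 2 + Q ^ 2)) by apply sqrt_pos.
assert (E : sqrt (a ^ 2 + Q ^ 2) ^ 2 = a ^ 2 + Q ^ 2) by (apply pow2_sqrt; nra).
split; [lra|]. rewrite <- E. nra.
Qed.
(** Outside the larger root [Delta] is positive, and the poles are excluded: every denominator of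
    metric and frame is nonzero. *)
Lemma ext_bounds x : ext x -> 0 < M < rc x /\ 0 < KN_Delta M a Q x /\ 0 < sin (thc x).
Proof.
intros (H & T). destruct sub_bounds as (B1 & B2).
set (s := sqrt (M ^ 2 - a ^ 2 - Q ^ 2)) in *.
assert (0 <= s) by apply sqrt_pos.
assert (E : s ^ 2 = M ^ 2 - a ^ 2 - Q ^ 2) by (apply pow2_sqrt; lra).
split; [lra|]. split; [unfold KN_Delta; nra|]. apply sin_gt_0; lra.
Qed.
Lemma ext_open : open_pt ext.
Proof.
intros x (H & T). set (s := sqrt (M ^ 2 - a ^ 2 - Q ^ 2)) in *.
exists (Rmin (rc x - (M + s)) (Rmin (thc x) (PI - thc x))).
split; [repeat apply Rmin_pos; lra|].
intros y (_ & A & B & _).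
assert (Rmin (rc x - (M + s)) (Rmin (thc x) (PI - thc x)) <= rc x - (M + s)) by apply Rmin_l.
assert (Rmin (rc x - (M + s)) (Rmin (thc x) (PI - thc x)) <= Rmin (thc x) (PI - thc x)) by apply Rmin_r.
assert (Rmin (thc x) (PI - thc x) <= thc x) by apply Rmin_l.
assert (Rmin (thc x) (PI - thc x) <= PI - thc x) by apply Rmin_r.
apply Rabs_def2 in A, B. unfold exterior. fold s. lra.
Qed.
Lemma q2_pos x : ext x -> 0 < q2 a x.
Proof. intros H. destruct (ext_bounds x H). unfold q2. nra. Qed.
Lemma qm_sqrt x : qm a x = sqrt (q2 a x).
Proof. unfold qm, Cmod, q, q2. cbn [fst snd]. f_equal. ring. Qed.
Lemma qm_pos x : ext x -> 0 < qm a x.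
Proof. intros. rewrite qm_sqrt. now apply sqrt_lt_R0, q2_pos. Qed.
Lemma qm_sq x : ext x -> qm a x * qm a x = q2 a x.
Proof. intros H. rewrite qm_sqrt. apply sqrt_sqrt, Rlt_le, q2_pos, H. Qed.

Local Notation sm := (alg_is_smooth ext ext_open).

Lemma alg_r : alg ext rc. Proof. exact (alg_coord ext cr). Qed.
Lemma alg_c : alg ext (fun x => cos (thc x)). Proof. exact (alg_cos ext thc (alg_coord ext cth)). Qed.
Lemma alg_s : alg ext (fun x => sin (thc x)). Proof. exact (alg_sin ext thc (alg_coord ext cth)). Qed.
Lemma alg_is : alg ext (fun x => / sin (thc x)).
Proof. apply (alg_inv ext _ alg_s). intros x Hx. apply Rgt_not_eq, (ext_bounds x Hx). Qed.
Lemma alg_q2 : alg ext (fun x => rc x * rc x + a * cos (thc x) * (a * cos (thc x))).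
Proof.
assert (A := alg_mul ext _ _ (alg_cst ext a) alg_c).
exact (alg_add ext _ _ (alg_mul ext _ _ alg_r alg_r) (alg_mul ext _ _ A A)).
Qed.
Lemma q2_eq x : q2 a x = rc x * rc x + a * cos (thc x) * (a * cos (thc x)).
Proof. unfold q2. ring. Qed.
Lemma smooth_im : smooth_on ext (fun x => / qm a x).
Proof.
assert (P : forall x, ext x -> 0 < rc x * rc x + a * cos (thc x) * (a * cos (thc x)))
  by (intros x Hx; rewrite <- q2_eq; now apply q2_pos).
apply (smooth_ext ext ext_open) with (f := fun x => / sqrt (rc x * rc x + a * cos (thc x) * (a * cos (thc x)))).
- intros x Hx. now rewrite qm_sqrt, q2_eq.
- apply sm, alg_inv; [apply alg_sqrt; [exact alg_q2|exact P]|].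
  intros x Hx. apply Rgt_not_eq, sqrt_lt_R0. auto.
Qed.
Lemma alg_Dl : alg ext (fun x => rc x * rc x + (- (2 * M)) * rc x + (a ^ 2 + Q ^ 2)).
Proof.
exact (alg_add ext _ _ (alg_add ext _ _ (alg_mul ext _ _ alg_r alg_r) (alg_mul ext _ _ (alg_cst ext _) alg_r)) (alg_cst ext _)).
Qed.
Lemma Dl_eq x : rc x * rc x + (- (2 * M)) * rc x + (a ^ 2 + Q ^ 2) = KN_Delta M a Q x.
Proof. unfold KN_Delta. ring. Qed.
Lemma smooth_Dl : smooth_on ext (KN_Delta M a Q).
Proof. apply (smooth_ext ext ext_open) with (2 := sm _ alg_Dl). intros x _. apply Dl_eq. Qed.
Lemma smooth_iDl : smooth_on ext (fun x => / KN_Delta M a Q x).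
Proof.
apply sm, alg_inv; [apply alg_smooth, smooth_Dl|].
intros x Hx. apply Rgt_not_eq, (ext_bounds x Hx).
Qed.

Local Notation KE := (smooth_dring ext ext_open).
Local Notation smr := (smr ext ext_open).
Definition kn_xco (mu : coord) : KE := smr (coordf mu) (sm _ (alg_coord ext mu)).
Lemma kn_xco_pd mu nu : pd nu (kn_xco mu) = kcoord_delta mu nu.
Proof.
apply smf_ext. intros x Hx. unfold kn_xco.
rewrite (smr_pd ext ext_open _ _ (match mu, nu with ct, ct | cr, cr | cth, cth | cph, cph => 1 | _, _ => 0 end) nu x Hx).
- unfold kcoord_delta. destruct mu, nu; symmetry; rewrite (sev_kc ext ext_open _ Hx); kcs.
- destruct mu, nu; simpl; auto_derive; trivial; ring.
Qed.

Definition kn_ext : kncoord KE.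
Proof.
refine (Kncoord KE (smr rc (sm _ alg_r)) (smr _ (sm _ alg_c)) (smr _ (sm _ alg_s)) (smr _ (sm _ alg_is))
  (smr _ smooth_im) (smr _ smooth_Dl) (smr _ smooth_iDl) (cst (RtoC M)) (cst (RtoC a)) (cst (RtoC Q))
  _ _ _ _ _ _ _ _ _ _ _); try (intros m; rewrite pd_cst; apply kz_0);
  try intros m; apply smf_ext; intros x Hx;
  repeat rewrite ?(sev_add ext ext_open _ _ _ Hx), ?(sev_mul ext ext_open _ _ _ Hx), ?(sev_sub ext ext_open _ _ _ Hx),
    ?(sev_kc ext ext_open _ Hx), ?(sev_cst ext ext_open _ Hx), ?(smr_in ext ext_open _ _ _ Hx);
  destruct (ext_bounds x Hx) as (B1 & B2 & B3);
  rewrite ?(qiC_real _ 1) by (unfold Q2R; simpl; field); rewrite ?(qiC_real _ 2) by (unfold Q2R; simpl; field).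
- rewrite <- !RtoC_mult, <- RtoC_minus. f_equal. assert (T := sin2_cos2 (thc x)). unfold Rsqr in T. lra.
- rewrite <- !RtoC_mult. f_equal. field. lra.
- rewrite <- !RtoC_mult. f_equal. field. lra.
- rewrite <- !RtoC_mult, <- RtoC_plus, <- RtoC_mult. f_equal.
  assert (P := q2_pos x Hx). assert (P2 := qm_pos x Hx).
  replace (rc x * rc x + a * a * cos (thc x) * cos (thc x)) with (qm a x * qm a x)
    by (rewrite qm_sq by exact Hx; unfold q2; ring). field. lra.
- rewrite <- !RtoC_mult, <- RtoC_minus, <- !RtoC_plus. f_equal. unfold KN_Delta. ring.
- rewrite (smr_pd ext ext_open _ _ (match m with cr => 1 | _ => 0 end) m x Hx).
  + destruct m; symmetry; rewrite (sev_kc ext ext_open _ Hx); kcs.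
  + destruct m; simpl; auto_derive; trivial; ring.
- rewrite (smr_pd ext ext_open _ _ (match m with cth => - sin (thc x) | _ => 0 end) m x Hx).
  + destruct m; symmetry; rewrite ?(sev_opp ext ext_open _ _ Hx), ?(sev_kc ext ext_open _ Hx), ?(smr_in ext ext_open _ _ _ Hx),
      ?RtoC_opp; try reflexivity; kcs.
  + destruct m; simpl; auto_derive; trivial; rewrite ?Rplus_0_r; ring.
- rewrite (smr_pd ext ext_open _ _ (match m with cth => cos (thc x) | _ => 0 end) m x Hx).
  + destruct m; symmetry; rewrite ?(sev_opp ext ext_open _ _ Hx), ?(sev_kc ext ext_open _ Hx), ?(smr_in ext ext_open _ _ _ Hx),
      ?RtoC_opp; try reflexivity; kcs.
  + destruct m; simpl; auto_derive; trivial; rewrite ?Rplus_0_r; ring.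
Defined.
End Exterior.
End Exterior.

(** * Metric, frame and field of the background *)

Module KerrNewmanData.
Import SmoothFunctions SmoothRing Exterior.
Open Scope R_scope.

Section Background.
Context (M a Q : R) (HM : subextremal M a Q).
Local Notation ext := (exterior M a Q).
Local Notation Dl := (KN_Delta M a Q).

Lemma KN_inner i j x : ext x -> inner (KN M a Q) (KN_fr M a Q i) (KN_fr M a Q j) x = mink i j.
Proof.
intros Hx. destruct (ext_bounds M a Q HM x Hx) as (B1 & B2 & B3).
assert (P2 := q2_pos M a Q HM x Hx). assert (Pm := qm_pos M a Q HM x Hx).
assert (E := qm_sq M a Q HM x Hx).
assert (C2 : sin (thc x) ^ 2 = 1 - cos (thc x) ^ 2).
{ assert (T := sin2_cos2 (thc x)). unfold Rsqr in T. nra. }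
(* With this relation the trigonometric functions can be generalised, and the inner products become
   rational identities. *)
assert (Eq : rc x ^ 2 + a ^ 2 = q2 a x + a ^ 2 * sin (thc x) ^ 2) by (rewrite C2; unfold q2; ring).
unfold inner, sumc, KN; cbn [met]. unfold KN_met, KN_fr, covec; cbv zeta.
generalize dependent (q2 a x). intros p. generalize dependent (qm a x). intros m.
generalize dependent (Dl x). intros D. generalize dependent (sin (thc x)). intros s.
intros. subst p.
destruct i, j; unfold mink;
  first [ field; lra | rewrite Eq; field; lra ].
Qed.

Lemma KN_coframe_fr k i x : ext x ->
  sumc (fun mu => KN_coframe M a Q k mu x * KN_fr M a Q i mu x)
  = match k, i with E1, E1 | E2, E2 | E3, E3 | E4, E4 => 1 | _, _ => 0 end.
Proof.
intros Hx. transitivity (raise (fun j => inner (KN M a Q) (KN_fr M a Q i) (KN_fr M a Q j) x) k).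
- unfold KN_coframe, raise, sum4, inner, sumc, KN; cbn [met]. ring.
- unfold raise, sum4. rewrite !KN_inner by exact Hx. destruct k, i; unfold mink, mink_inv; field.
Qed.
(** The two-form was defined through the metric duals of the frame; those are the dual basis because
    the frame is null and orthonormal. *)
Lemma KN_Ff_value i j x : ext x -> Ff (KN M a Q) i j x = KN_Ff a Q i j x.
Proof.
intros Hx. unfold Ff, KN; cbn [em fr].
transitivity (sum4 (fun k => sum4 (fun l => KN_Ff a Q k l x
   * sumc (fun mu => KN_coframe M a Q k mu x * KN_fr M a Q i mu x)
   * sumc (fun nu => KN_coframe M a Q l nu x * KN_fr M a Q j nu x)))).
- unfold KN_em, sum4, sumc. ring.
- unfold sum4. rewrite !KN_coframe_fr by exact Hx. destruct i, j; ring.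
Qed.

Lemma KN_PF_value x : ext x ->
  KN_PF a Q x = (Q * (rc x ^ 2 - a ^ 2 * cos (thc x) ^ 2) / q2 a x ^ 2, 2 * Q * rc x * a * cos (thc x) / q2 a x ^ 2).
Proof.
intros Hx. assert (P := q2_pos M a Q HM x Hx). unfold KN_PF.
assert (Hq : (Cconj (q a x) * Cconj (q a x))%C <> 0).
{ intros E. assert (E1 := f_equal Re E). assert (E2 := f_equal Im E). unfold q2 in P. simpl in E1, E2. nra. }
assert (H : RtoC Q = Cmult (Q * (rc x ^ 2 - a ^ 2 * cos (thc x) ^ 2) / q2 a x ^ 2, 2 * Q * rc x * a * cos (thc x) / q2 a x ^ 2) (Cconj (q a x) * Cconj (q a x))%C).
{ unfold q2 in *. apply injective_projections; simpl; field; lra. }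
rewrite H. field. intros E. apply Hq. rewrite E. ring.
Qed.

Ltac sms := repeat lazymatch goal with
  | |- smooth_on _ (fun _ => ?c) => exact (smooth_cst ext (ext_open M a Q) c)
  | |- smooth_on _ (fun x => @?f x + @?g x) => apply (smooth_add ext (ext_open M a Q) f g)
  | |- smooth_on _ (fun x => @?f x - @?g x) => apply (smooth_add ext (ext_open M a Q) f (fun x => - g x))
  | |- smooth_on _ (fun x => @?f x * @?g x) => apply (smooth_mul ext (ext_open M a Q) f g)
  | |- smooth_on _ (fun x => @?f x / @?g x) => apply (smooth_mul ext (ext_open M a Q) f (fun x => / g x))
  | |- smooth_on _ (fun x => / (@?f x * @?g x)) => apply (smooth_ext ext (ext_open M a Q) (fun x => / f x * / g x)); [intros; symmetry; apply Rinv_mult|]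
  | |- smooth_on _ (fun x => - @?f x) => apply (smooth_opp ext (ext_open M a Q) f)
  | |- smooth_on _ (fun x => @?f x ^ 2) => apply (smooth_ext ext (ext_open M a Q) (fun x => f x * f x)); [intros; ring|]
  end.

Lemma smooth_rc : smooth_on ext rc. Proof. exact (alg_is_smooth ext (ext_open M a Q) _ (alg_r M a Q)). Qed.
Lemma smooth_cos : smooth_on ext (fun x => cos (thc x)). Proof. exact (alg_is_smooth ext (ext_open M a Q) _ (alg_c M a Q)). Qed.
Lemma smooth_sin : smooth_on ext (fun x => sin (thc x)). Proof. exact (alg_is_smooth ext (ext_open M a Q) _ (alg_s M a Q)). Qed.
Lemma smooth_is : smooth_on ext (fun x => / sin (thc x)). Proof. exact (alg_is_smooth ext (ext_open M a Q) _ (alg_is M a Q HM)). Qed.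
Lemma smooth_q2 : smooth_on ext (q2 a).
Proof.
apply (smooth_ext ext (ext_open M a Q)) with (2 := alg_is_smooth ext (ext_open M a Q) _ (alg_q2 M a Q)).
intros. symmetry. apply q2_eq.
Qed.
Lemma smooth_iq2 : smooth_on ext (fun x => / q2 a x).
Proof.
apply (alg_is_smooth ext (ext_open M a Q)), alg_inv; [apply alg_smooth, smooth_q2|].
intros x Hx. apply Rgt_not_eq, (q2_pos M a Q HM x Hx).
Qed.
Ltac smleaf := first [ exact smooth_rc | exact smooth_cos | exact smooth_sin | exact smooth_is | exact smooth_q2
  | exact smooth_iq2 | exact (smooth_im M a Q HM) | exact (smooth_Dl M a Q) | exact (smooth_iDl M a Q HM) ].

Lemma smooth_KN_met mu nu : smooth_on ext (KN_met M a Q mu nu).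
Proof. unfold KN_met, covec. cbv zeta. destruct mu, nu; sms; smleaf. Qed.
Lemma smooth_KN_fr i mu : smooth_on ext (KN_fr M a Q i mu).
Proof. unfold KN_fr, covec. cbv zeta. destruct i, mu; sms; smleaf. Qed.
Lemma smooth_KN_Ff i j : smooth_on ext (KN_Ff a Q i j).
Proof.
assert (R1 : smooth_on ext (fun x => Re (KN_PF a Q x))).
{ apply (smooth_ext ext (ext_open M a Q)) with (fun x => Q * (rc x ^ 2 - a ^ 2 * cos (thc x) ^ 2) * (/ q2 a x * / q2 a x)).
  - intros x Hx. rewrite KN_PF_value by exact Hx. cbn [Re fst]. assert (P := q2_pos M a Q HM x Hx). field. lra.
  - sms; smleaf. }
assert (R2 : smooth_on ext (fun x => Im (KN_PF a Q x))).
{ apply (smooth_ext ext (ext_open M a Q)) with (fun x => 2 * Q * rc x * a * cos (thc x) * (/ q2 a x * / q2 a x)).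
  - intros x Hx. rewrite KN_PF_value by exact Hx. cbn [Im snd]. assert (P := q2_pos M a Q HM x Hx). field. lra.
  - sms; smleaf. }
unfold KN_Ff. destruct i, j; sms; assumption.
Qed.
Lemma smooth_KN_em mu nu : smooth_on ext (KN_em M a Q mu nu).
Proof.
assert (A := smooth_KN_met). assert (B := smooth_KN_fr). assert (C := smooth_KN_Ff).
assert (D : forall i mu, smooth_on ext (KN_coframe M a Q i mu)).
{ intros i m. unfold KN_coframe, raise, sum4, sumc.
  sms; lazymatch goal with |- smooth_on _ (fun x => KN_met _ _ _ ?m ?n x) => exact (A m n)
  | |- smooth_on _ (fun x => KN_fr _ _ _ ?j ?n x) => exact (B j n) end. }
unfold KN_em, sum4. sms; lazymatch goal with |- smooth_on _ (fun x => KN_coframe _ _ _ ?i ?n x) => exact (D i n)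
  | |- smooth_on _ (fun x => KN_Ff _ _ ?i ?j x) => exact (C i j) end.
Qed.
Lemma KN_met_sym mu nu x : KN_met M a Q mu nu x = KN_met M a Q nu mu x.
Proof. unfold KN_met. ring. Qed.
Lemma KN_em_anti mu nu x : KN_em M a Q mu nu x = - KN_em M a Q nu mu x.
Proof. unfold KN_em, sum4, KN_Ff. ring. Qed.
End Background.
End KerrNewmanData.

(** * A linear perturbation as an exact solution over dual numbers *)

Module Perturbations.
Import DifferentialRings FrameGeometry Koszul CurvatureSymmetries FieldEquations Operators Coordinates PrincipalFrame DualNumbers Linearisation SmoothFunctions SmoothRing Representations PolynomialFamilies Coframes Exterior KerrNewmanData.
Open Scope R_scope.

Section MapCalc.
Context {K1 K2 : dring} (h : dhom K1 K2) (X : kncoord K1).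
Local Notation N1 := (kn_calc X).
Local Notation N2 := (kn_calc (kncoord_map h X)).
Ltac tac := cbn; unfold xiq, xiqb, xq, xqb; cbn; repeat rewrite ?hf_add, ?hf_sub, ?hf_mul, ?hf_kc; reflexivity.
Lemma kq_map : kq N2 = h (kq N1). Proof. tac. Qed.
Lemma kqb_map : kqb N2 = h (kqb N1). Proof. tac. Qed.
Lemma kiq_map : kiq N2 = h (kiq N1). Proof. tac. Qed.
Lemma kiqb_map : kiqb N2 = h (kiqb N1). Proof. tac. Qed.
Lemma kDl_map : kDl N2 = h (kDl N1). Proof. tac. Qed.
Lemma ktau_map : ktau N2 = h (ktau N1). Proof. tac. Qed.
Lemma kim_map : kim N2 = h (kim N1). Proof. tac. Qed.
Lemma kM_map : kM N2 = h (kM N1). Proof. tac. Qed.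
Lemma kQ_map : kQ N2 = h (kQ N1). Proof. tac. Qed.
End MapCalc.

Section Exterior.
Context (M a Q : R) (HM : subextremal M a Q).
Local Notation ext := (exterior M a Q).
Local Notation X0 := (kn_ext M a Q HM).
Local Notation N0 := (kn_calc X0).
Local Notation ev := (sev ext).

Section Values.
Context (x : pt) (Hx : ext x).
Lemma ev_r : ev (xr X0) x = RtoC (rc x). Proof. now apply smr_in. Qed.
Lemma ev_c : ev (xc X0) x = RtoC (cos (thc x)). Proof. now apply (smr_in ext _ (fun x => cos (thc x))). Qed.
Lemma ev_s : ev (xs X0) x = RtoC (sin (thc x)). Proof. now apply (smr_in ext _ (fun x => sin (thc x))). Qed.
Lemma ev_is : ev (xis X0) x = RtoC (/ sin (thc x)). Proof. now apply (smr_in ext _ (fun x => / sin (thc x))). Qed.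
Lemma ev_im : ev (xim X0) x = RtoC (/ qm a x). Proof. now apply (smr_in ext _ (fun x => / qm a x)). Qed.
Lemma ev_Dl : ev (xDl X0) x = RtoC (KN_Delta M a Q x). Proof. now apply smr_in. Qed.
Lemma ev_iDl : ev (xiDl X0) x = RtoC (/ KN_Delta M a Q x). Proof. now apply (smr_in ext _ (fun x => / KN_Delta M a Q x)). Qed.
Lemma ev_M : ev (xM X0) x = RtoC M. Proof. now apply (sev_cst ext (ext_open M a Q)). Qed.
Lemma ev_a : ev (xa X0) x = RtoC a. Proof. now apply (sev_cst ext (ext_open M a Q)). Qed.
Lemma ev_Q : ev (xQ X0) x = RtoC Q. Proof. now apply (sev_cst ext (ext_open M a Q)). Qed.
End Values.
Ltac sv Hx := repeat rewrite ?(sev_add ext (ext_open M a Q) _ _ _ Hx), ?(sev_mul ext (ext_open M a Q) _ _ _ Hx),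
  ?(sev_sub ext (ext_open M a Q) _ _ _ Hx), ?(sev_opp ext (ext_open M a Q) _ _ Hx), ?(sev_kc ext (ext_open M a Q) _ Hx),
  ?(ev_r _ Hx), ?(ev_c _ Hx), ?(ev_s _ Hx), ?(ev_is _ Hx), ?(ev_im _ Hx), ?(ev_Dl _ Hx), ?(ev_iDl _ Hx),
  ?(ev_M _ Hx), ?(ev_a _ Hx), ?(ev_Q _ Hx), ?qiC_i, ?qiC_nat0, ?qiC_nat1, ?qiC_nat2.

Lemma q_neq0 x : ext x -> q a x <> 0.
Proof.
intros Hx E. assert (P := q2_pos M a Q HM x Hx). apply (f_equal (fun z => Re z * Re z + Im z * Im z)) in E.
unfold q2 in P. simpl in E. lra.
Qed.
Lemma qc_neq0 x : ext x -> Cconj (q a x) <> 0.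
Proof.
intros Hx E. apply (q_neq0 x Hx). rewrite <- (Cconj_conj (q a x)), E. unfold Cconj, RtoC; simpl. f_equal. ring.
Qed.
Lemma q_qc x : ext x -> (q a x * Cconj (q a x))%C = RtoC (q2 a x).
Proof. intros Hx. unfold q2. apply injective_projections; simpl; ring. Qed.
Lemma im_im_value x : ext x -> (RtoC (/ qm a x) * RtoC (/ qm a x))%C = (/ (q a x * Cconj (q a x)))%C.
Proof.
intros Hx. assert (P := q2_pos M a Q HM x Hx). rewrite (q_qc x Hx), <- RtoC_inv, <- RtoC_mult by lra. f_equal.
rewrite <- (qm_sq M a Q HM x Hx). assert (Pm := qm_pos M a Q HM x Hx). field. lra.
Qed.
Lemma ev_q x : ext x -> ev (kq N0) x = q a x.
Proof. intros Hx. change (kq N0) with (xq X0). unfold xq. sv Hx. apply injective_projections; simpl; ring. Qed.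
Lemma ev_qb x : ext x -> ev (kqb N0) x = Cconj (q a x).
Proof. intros Hx. change (kqb N0) with (xqb X0). unfold xqb. sv Hx. apply injective_projections; simpl; ring. Qed.
Lemma ev_iq x : ext x -> ev (kiq N0) x = (/ q a x)%C.
Proof.
intros Hx. transitivity (ev (kmul (kqb N0) (kmul (xim X0) (xim X0))) x).
- change (kiq N0) with (xiq X0). unfold xiq. change (kqb N0) with (xqb X0). sv Hx. ring.
- sv Hx. rewrite (ev_qb x Hx), (im_im_value x Hx). field. split; first [exact (q_neq0 x Hx) | exact (qc_neq0 x Hx)].
Qed.
Lemma ev_iqb x : ext x -> ev (kiqb N0) x = (/ Cconj (q a x))%C.
Proof.
intros Hx. transitivity (ev (kmul (kq N0) (kmul (xim X0) (xim X0))) x).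
- change (kiqb N0) with (xiqb X0). unfold xiqb. change (kq N0) with (xq X0). sv Hx. ring.
- sv Hx. rewrite (ev_q x Hx), (im_im_value x Hx). field. split; first [exact (q_neq0 x Hx) | exact (qc_neq0 x Hx)].
Qed.

Lemma xfr_value i mu x : ext x -> ev (xfr X0 i mu) x = RtoC (KN_fr M a Q i mu x).
Proof.
intros Hx. assert (P := q2_pos M a Q HM x Hx). assert (Pm := qm_pos M a Q HM x Hx).
assert (E := qm_sq M a Q HM x Hx). destruct (ext_bounds M a Q HM x Hx) as (B1 & B2 & B3).
unfold xfr, xcovec, KN_fr, covec. destruct i, mu; sv Hx; try reflexivity;
  rewrite <- ?RtoC_mult, <- ?RtoC_plus, <- ?RtoC_mult, <- ?RtoC_opp; f_equal; rewrite <- ?E; field; lra.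
Qed.
End Exterior.

Section Perturbation.
Context (M a Q : R) (HM : subextremal M a Q) (U : pt -> Prop) (HU : open_pt U)
  (UE : forall x, U x -> exterior M a Q x) (v : variation).
Local Notation ext := (exterior M a Q).
Context (Smet : forall mu nu, smooth_on U (d_met v mu nu)) (Sfr : forall i mu, smooth_on U (d_fr v i mu))
  (Sem : forall mu nu, smooth_on U (d_em v mu nu)).
Local Notation SK := (smooth_dring U HU).
Local Notation DK := (dualize SK).
Local Notation T := (dual_dual SK).
Local Notation S := (perturbed M a Q v).
Local Notation Rl := (rep_rel U HU).
Definition res : dhom (smooth_dring ext (ext_open M a Q)) DK := restriction_hom ext U (ext_open M a Q) HU UE.
Definition X : kncoord DK := kncoord_map res (kn_ext M a Q HM).

Definition aff (f g : pt -> R) (Hf : smooth_on ext f) (Hg : smooth_on U g) : DK :=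
  (mk U HU (fun x => RtoC (f x)) (Csmooth_RtoC U HU f (smooth_sub ext U UE f Hf)),
   mk U HU (fun x => RtoC (g x)) (Csmooth_RtoC U HU g Hg)).
Definition KS : kspacetime DK := Kspacetime DK
  (fun mu nu => aff _ _ (smooth_KN_met M a Q HM mu nu) (Smet mu nu))
  (fun i mu => aff _ _ (smooth_KN_fr M a Q HM i mu) (Sfr i mu))
  (fun mu nu => aff _ _ (smooth_KN_em M a Q HM mu nu) (Sem mu nu)).
Lemma rep_aff f g Hf Hg : rrelR Rl (fun e x => f x + e * g x) (aff f g Hf Hg).
Proof.
apply (rep_ext U HU (fun e x => RtoC (f x) + e * RtoC (g x))%C); [|apply rep_affine].
intros. now rewrite RtoC_plus, RtoC_mult.
Qed.
Lemma Hmet mu nu : rrelR Rl (fun e x => met (S e) mu nu x) (kmet KS mu nu). Proof. apply rep_aff. Qed.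
Lemma Hfr i mu : rrelR Rl (fun e x => fr (S e) i mu x) (kfr KS i mu). Proof. apply rep_aff. Qed.
Lemma Hem mu nu : rrelR Rl (fun e x => em (S e) mu nu x) (kem KS mu nu). Proof. apply rep_aff. Qed.

Lemma perturbed_0 : S 0 = KN M a Q.
Proof.
unfold perturbed, KN. f_equal; repeat (apply functional_extensionality; intros ?); ring.
Qed.
Lemma cst_0 : (cst 0 : SK) = kc (0%Q, 0%Q).
Proof. unfold kc. now rewrite qiC_nat0. Qed.
Lemma bg_res u : bg T (res u) = res u.
Proof. apply injective_projections; [reflexivity|]. cbn. symmetry. apply cst_0. Qed.
Lemma bg_is_res (w : DK) u : (forall x, U x -> sev U (fst w) x = sev ext u x) -> bg T w = res u.
Proof.
intros H. rewrite <- bg_res. apply injective_projections; [|reflexivity].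
apply smf_ext. intros x Hx. cbn [bg dual_dual fst]. rewrite H by exact Hx. symmetry.
apply (restriction_in ext U (ext_open M a Q) HU UE u x Hx).
Qed.
(** The background part of a represented family is its value at [e = 0]. *)
Lemma bg_rep F w u : rep U HU F w -> (forall x, U x -> F 0 x = sev ext u x) -> bg T w = res u.
Proof. intros H E. apply bg_is_res. intros x Hx. rewrite <- (rep_zero U HU F w x H Hx). auto. Qed.

Lemma ext_sv_0 x : ext x -> sev ext (kc (0%Q, 0%Q) : smooth_dring ext (ext_open M a Q)) x = 0.
Proof. intros Hx. rewrite (sev_kc ext (ext_open M a Q) x Hx). apply qiC_nat0. Qed.

Lemma bg_Ff_0 i j : (forall x, U x -> KN_Ff a Q i j x = 0) -> kFf (bgS T KS) i j = kc (0%Q, 0%Q).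
Proof.
intros H. rewrite <- bg_F. rewrite <- (hf_kc res).
apply (bg_rep (fun e x => RtoC (Ff (S e) i j x))); [exact (rep_Ff DK Rl S KS Hfr Hem i j)|].
intros x Hx. rewrite perturbed_0, (KN_Ff_value M a Q HM i j x (UE x Hx)), (H x Hx), (ext_sv_0 x (UE x Hx)). reflexivity.
Qed.

Context (LP : forall x, U x ->
  (forall mu nu, d_met v mu nu x = d_met v nu mu x) /\
  (forall mu nu, d_em v mu nu x = - d_em v nu mu x) /\
  (forall i j, lin_eq (fun e => inner (S e) (fr (S e) i) (fr (S e) j) x) (fun _ => mink i j)) /\
  (forall i j, lin_eq (fun e => einstein_res (S e) i j x) (fun _ => 0)) /\
  (forall i j k, lin_eq (fun e => bianchi_res (S e) i j k x) (fun _ => 0)) /\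
  (forall k, lin_eq (fun e => maxwell_res (S e) k x) (fun _ => 0))).

Lemma kem_anti mu nu : kem KS mu nu = kopp (kem KS nu mu).
Proof.
apply injective_projections; apply smf_ext; intros x Hx.
- change (fst (kopp (kem KS nu mu))) with (kopp (fst (kem KS nu mu))). rewrite (sev_opp U HU _ x Hx).
  cbn. rewrite !restr_in by exact Hx. rewrite <- RtoC_opp. f_equal. apply KN_em_anti.
- change (snd (kopp (kem KS nu mu))) with (kopp (snd (kem KS nu mu))). rewrite (sev_opp U HU _ x Hx).
  cbn. rewrite !restr_in by exact Hx. rewrite <- RtoC_opp. f_equal. now apply LP.
Qed.
Lemma kmet_sym mu nu : kmet KS mu nu = kmet KS nu mu.
Proof.
apply injective_projections; apply smf_ext; intros x Hx; cbn; rewrite !restr_in by exact Hx; f_equal.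
- apply KN_met_sym.
- now apply LP.
Qed.
Lemma kinner_fr i j : kinner KS (kfr KS i) (kfr KS j) = kmink i j.
Proof.
eapply (rep_eq U HU).
- exact (rep_inner DK Rl S KS Hmet (fun e => fr (S e) i) (fun e => fr (S e) j) _ _ (Hfr i) (Hfr j)).
- exact (rep_mink DK Rl i j).
- intros x Hx. apply (LP x Hx).
Qed.
Lemma rep_0 : rep U HU (fun _ _ => 0) (kc (0%Q, 0%Q)).
Proof. exact (rep_kc U HU _ _ qiC_nat0). Qed.
Lemma bg_fr i mu : bg T (kfr KS i mu) = xfr X i mu.
Proof.
unfold X. rewrite xfr_map. apply (bg_rep _ _ _ (Hfr i mu)). intros x Hx.
rewrite (xfr_value M a Q HM i mu x (UE x Hx)). rewrite perturbed_0. reflexivity.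
Qed.
Lemma xco_pd mu nu : pd nu (res (kn_xco M a Q mu)) = kcoord_delta mu nu.
Proof.
rewrite <- hf_pd, kn_xco_pd. unfold kcoord_delta. destruct mu, nu; apply hf_kc.
Qed.

Lemma kFf_anti i j : kFf KS i j = kopp (kFf KS j i).
Proof.
Add Ring KringDD : (kth (dualize (smooth_dring U HU))) (morphism (kc_morph (dualize (smooth_dring U HU))), constants [kcst]).
unfold kFf, ksumc. rewrite (kem_anti ct cr), (kem_anti ct cth), (kem_anti ct cph), (kem_anti cr cth), (kem_anti cr cph), (kem_anti cth cph).
assert (Z : forall mu, kem KS mu mu = kc (0%Q, 0%Q)).
{ intros mu. assert (E := kem_anti mu mu).
  transitivity (kmul (kc (1#2, 0%Q)) (kadd (kem KS mu mu) (kem KS mu mu))); [ring|]. rewrite E at 2. ring. }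
rewrite !Z. ring.
Qed.

(** Each residual is represented by its algebraic counterpart, and [rep_eq] turns its negligibility
    into vanishing; [pcf] supplies the spanning property. *)
Lemma perturbation_em : einstein_maxwell KS.
Proof.
constructor.
- exact (framed_intro KS kmet_sym kinner_fr _ (pcf_fr T X KS bg_fr) _ xco_pd).
- intros i j. eapply (rep_eq U HU); [exact (rep_einstein DK Rl S KS Hmet Hfr Hem i j)|exact rep_0|]. intros x Hx. apply (LP x Hx).
- intros i j k. eapply (rep_eq U HU); [exact (rep_bianchi DK Rl S KS Hmet Hfr Hem i j k)|exact rep_0|]. intros x Hx. apply (LP x Hx).
- intros k. eapply (rep_eq U HU); [exact (rep_maxwell DK Rl S KS Hmet Hfr Hem k)|exact rep_0|]. intros x Hx. apply (LP x Hx).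
- exact kFf_anti.
Qed.

Lemma KN_PF_inv x : ext x -> KN_PF a Q x = (Q * (/ Cconj (q a x)) * (/ Cconj (q a x)))%C.
Proof. intros Hx. unfold KN_PF. field. apply (qc_neq0 M a Q HM x Hx). Qed.
Lemma rhoF_value x : ext x -> rhoF (KN M a Q) x = Re (KN_PF a Q x) /\ rhoF_star (KN M a Q) x = Im (KN_PF a Q x).
Proof.
intros Hx. unfold rhoF, rhoF_star. rewrite !(KN_Ff_value M a Q HM _ _ x Hx). unfold KN_Ff. split; field.
Qed.
Lemma PF_value x : ext x -> PF (KN M a Q) x = KN_PF a Q x.
Proof.
intros Hx. unfold PF. destruct (rhoF_value x Hx) as (-> & ->). apply injective_projections; simpl; ring.
Qed.

Lemma perturbation : kn_perturbation T X KS.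
Proof.
constructor.
- exact perturbation_em.
- exact kinner_fr.
- exact kmet_sym.
- exact bg_fr.
- intros b. apply bg_Ff_0. intros x Hx. now destruct b.
- intros b. apply bg_Ff_0. intros x Hx. now destruct b.
- transitivity (bg T (kPF KS)).
  { unfold kPF, krhoF, krhoF_star. rewrite bg_add, !bg_mul, bg_opp, !bg_kc, !bg_F. reflexivity. }
  unfold X. rewrite kQ_map, kiqb_map, <- !hf_mul. apply (bg_rep _ _ _ (rep_PF DK Rl S KS Hfr Hem)). intros x Hx.
  rewrite perturbed_0. assert (Hx' := UE x Hx). rewrite (PF_value x Hx'), (KN_PF_inv x Hx').
  rewrite !(sev_mul ext (ext_open M a Q) _ _ x Hx'), !(ev_iqb M a Q HM x Hx'). now rewrite <- (ev_Q M a Q HM x Hx').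
- transitivity (bg T (kPFc KS)).
  { unfold kPFc, krhoF, krhoF_star. rewrite bg_sub, !bg_mul, bg_opp, !bg_kc, !bg_F. reflexivity. }
  unfold X. rewrite kQ_map, kiq_map, <- !hf_mul. apply (bg_rep _ _ _ (rep_PFc DK Rl S KS Hfr Hem)). intros x Hx.
  rewrite perturbed_0. assert (Hx' := UE x Hx). rewrite (PF_value x Hx'), (KN_PF_inv x Hx').
  rewrite !(sev_mul ext (ext_open M a Q) _ _ x Hx'), !(ev_iq M a Q HM x Hx').
  rewrite !Cmult_conj, !Cinv_conj, !Cconj_conj by apply (qc_neq0 M a Q HM x Hx').
  replace (Cconj Q) with (RtoC Q) by (unfold Cconj, RtoC; simpl; f_equal; ring).
  now rewrite <- (ev_Q M a Q HM x Hx').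
- exists (fun mu => res (kn_xco M a Q mu)). exact xco_pd.
Qed.
End Perturbation.
End Perturbations.

(** * The lower order coefficients *)

Module CoefficientValues.
Import DifferentialRings FrameGeometry Operators Decoupling Coordinates PrincipalFrame DualNumbers AntiSelfDual Linearisation Exterior Perturbations.
Open Scope dr_scope.

Section Coefficients.
Context {K : dring} (X : kncoord K).
Add Ring KringCf : (kth K) (morphism (kc_morph K), constants [kcst]).
Local Notation N := (kn_calc X).
Local Notation half := (#q (1#2)).
Local Notation q := (kq N). Local Notation iq := (kiq N). Local Notation qb := (kqb N).
Local Notation iqb := (kiqb N). Local Notation im := (kim N). Local Notation Q := (kQ N).
Local Notation nXb := (Decoupling.nXb N). Local Notation nXbc := (Decoupling.nXbc N).
Local Notation nH := (Decoupling.nH N). Local Notation nHb := (Decoupling.nHb N).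
Local Notation nHc := (Decoupling.nHc N). Local Notation nHbc := (Decoupling.nHbc N).

Definition sd1 (f : K) (b : hor) : K := match b with h1 => f | h2 => - #i * f end.

(** Built from the background alone, so that on the exterior they can be fixed before [U] and the
    variation are given. *)
Definition kn_coeffs : kcoeffs K := {|
  c4F := half * (nXb - nXbc) * (nXb - nXbc);
  caX := #q (1#4) * (nXb - nXbc) * (nXb - nXbc);
  cZB := fun b => - Linearisation.Zone X b;
  cWZF := fun b => #q 4 * Linearisation.Zone X b;
  caB := #q (3#8) * (nXbc - nXb);
  cYF := - #q (3#2) * (nXbc - nXb);
  cY0B := #q 0;
  cZ0B := - Decoupling.nzB N;
  cY0X := #q (1#4) * (- #q 10 * nXb * nXb - #q 7 * nXbc * nXbc + #q 17 * nXb * nXbc);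
  cWZ0 := Decoupling.nwF N;
  cY0F := fun b => match b with h1 => #q 6 * nXb * nHc - #q 4 * nXbc * nHc + #q 2 * nXb * nHbc | h2 => #q 0 end;
  cW0B := sd1 (#q (1#8) * nXb * nH + #q (3#2) * nXbc * nH + #q (7#8) * nXbc * nHb);
  cW0X := sd1 (#q (1#4) * (- #q 3 * nXb * nXb * nH + #q 5 * nXbc * nXbc * nH
           - nXb * nXbc * nH + nXbc * nXbc * nHb));
  cwp := q * qb * qb * qb * qb * qb * im;
  cwq := q * qb * qb;
  ct1 := - #i * (q - qb) * iq * iqb;
  cV1 := Decoupling.nV1 N;
  cV2 := Decoupling.nV2 N;
  cr1 := #q 4 * Q * Q * qb * qb * qb * im * iq * iqb * iq * iqb;
  cr2 := - half * q * q * q * im * iq * iqb * iq * iqb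
|}.

(* Without rotation [q] is real and the horizontal structures [nH], ... vanish. *)
Section Static.
Context (Ha : xa X = #q 0).
Lemma static_atoms : qb = q /\ iqb = iq /\ ktau N = #q 0.
Proof. cbn. unfold xiq, xiqb, xq, xqb. rewrite Ha. repeat split; ring. Qed.
Ltac st := destruct static_atoms as (E1 & E2 & E3);
  unfold kn_coeffs, c4F, caX, cZB, cWZF, caB, cYF, cZ0B, cY0X, cWZ0, cY0F, cW0B, cW0X, sd1, Linearisation.Zone,
    Decoupling.nzB, Decoupling.nwF, Decoupling.nXb, Decoupling.nXbc, Decoupling.nH, Decoupling.nHb, Decoupling.nHc, Decoupling.nHbc;
  rewrite ?E2, ?E3; try ring.
Lemma static_4F : c4F kn_coeffs = #q 0. Proof. st. Qed.
Lemma static_aX : caX kn_coeffs = #q 0. Proof. st. Qed.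
Lemma static_ZB b : cZB kn_coeffs b = #q 0. Proof. destruct b; st. Qed.
Lemma static_ZF b : cWZF kn_coeffs b = #q 0. Proof. destruct b; st. Qed.
Lemma static_aB : caB kn_coeffs = #q 0. Proof. st. Qed.
Lemma static_YF : cYF kn_coeffs = #q 0. Proof. st. Qed.
Lemma static_Z0 : cZ0B kn_coeffs = #q 0. Proof. st. Qed.
Lemma static_0X : cY0X kn_coeffs = #q 0. Proof. st. Qed.
Lemma static_W0 : cWZ0 kn_coeffs = #q 0. Proof. st. Qed.
Lemma static_Y0 b : cY0F kn_coeffs b = #q 0. Proof. destruct b; st. Qed.
Lemma static_WB b : cW0B kn_coeffs b = #q 0. Proof. destruct b; st. Qed.
Lemma static_WX b : cW0X kn_coeffs b = #q 0. Proof. destruct b; st. Qed.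
End Static.

Local Notation r := (xr X). Local Notation u := (xa X * xc X). Local Notation m := (xim X).
Local Notation Dl := (xDl X). Local Notation tau := (xa X * xs X).
Ltac real_form := unfold kn_coeffs, c4F, caX, cZB, cWZF, ct1, Linearisation.Zone, cV1, cV2, Decoupling.nV1, Decoupling.nV2, Decoupling.nVnum,
   Decoupling.nXb, Decoupling.nXbc, Decoupling.nH, Decoupling.nHc; cbn; unfold xiq, xiqb, xq, xqb;
  assert (R4 := xim_rule X); ring [R4].
(** Reality is not expressible in the ring. It is made visible by polynomials with rational
    coefficients in symbols that evaluate to real functions. *)
Lemma c4F_real : c4F kn_coeffs = #q (-8) * Dl * Dl * u * u * m * m * m * m * m * m * m * m.
Proof. real_form. Qed.
Lemma caX_real : caX kn_coeffs = #q (-4) * Dl * Dl * u * u * m * m * m * m * m * m * m * m.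
Proof. real_form. Qed.
Lemma cZB_real b : cZB kn_coeffs b = match b with
  | h1 => #q (-4) * Dl * tau * r * u * m * m * m * m * m * m * m
  | h2 => #q 2 * Dl * tau * (r * r - u * u) * m * m * m * m * m * m * m end.
Proof. destruct b; real_form. Qed.
Lemma cWZF_real b : cWZF kn_coeffs b = match b with
  | h1 => #q 16 * Dl * tau * r * u * m * m * m * m * m * m * m
  | h2 => #q (-8) * Dl * tau * (r * r - u * u) * m * m * m * m * m * m * m end.
Proof. destruct b; real_form. Qed.
Lemma ct1_real : ct1 kn_coeffs = #q 2 * u * m * m.
Proof. real_form. Qed.
Let vnum : K := r * r * Dl + (tau * tau - #q 2 * u * u) * r * r - #q 2 * (tau * tau + u * u) * u * u.
Lemma cV1_real : cV1 kn_coeffs = vnum * m * m * m * m * m * m + #q 5 * xQ X * xQ X * m * m * m * m.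
Proof. unfold vnum. real_form. Qed.
Lemma cV2_real : cV2 kn_coeffs = #q 4 * vnum * m * m * m * m * m * m + #q 2 * xQ X * xQ X * m * m * m * m.
Proof. unfold vnum. real_form. Qed.
End Coefficients.

Section Map.
Context {K1 K2 : dring} (h : dhom K1 K2) (X : kncoord K1).
Local Notation X2 := (kncoord_map h X).
Ltac mp := unfold kn_coeffs, c4F, caX, cZB, cWZF, caB, cYF, cY0B, cZ0B, cY0X, cWZ0, cY0F, cW0B, cW0X, sd1,
    cwp, cwq, ct1, cV1, cV2, cr1, cr2, Linearisation.Zone,
    Decoupling.nzB, Decoupling.nwF, Decoupling.nV1, Decoupling.nV2, Decoupling.nVnum, Decoupling.dDl, Decoupling.nXb, Decoupling.nXbc, Decoupling.nH, Decoupling.nHb, Decoupling.nHc, Decoupling.nHbc;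
  rewrite ?kq_map, ?kqb_map, ?kiq_map, ?kiqb_map, ?kDl_map, ?ktau_map, ?kim_map, ?kM_map, ?kQ_map;
  repeat rewrite ?hf_add, ?hf_sub, ?hf_opp, ?hf_mul, ?hf_kc; reflexivity.
Lemma map_4F : c4F (kn_coeffs X2) = h (c4F (kn_coeffs X)). Proof. mp. Qed.
Lemma map_aX : caX (kn_coeffs X2) = h (caX (kn_coeffs X)). Proof. mp. Qed.
Lemma map_ZB b : cZB (kn_coeffs X2) b = h (cZB (kn_coeffs X) b). Proof. destruct b; mp. Qed.
Lemma map_ZF b : cWZF (kn_coeffs X2) b = h (cWZF (kn_coeffs X) b). Proof. destruct b; mp. Qed.
Lemma map_aB : caB (kn_coeffs X2) = h (caB (kn_coeffs X)). Proof. mp. Qed.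
Lemma map_YF : cYF (kn_coeffs X2) = h (cYF (kn_coeffs X)). Proof. mp. Qed.
Lemma map_0B : cY0B (kn_coeffs X2) = h (cY0B (kn_coeffs X)). Proof. mp. Qed.
Lemma map_Z0 : cZ0B (kn_coeffs X2) = h (cZ0B (kn_coeffs X)). Proof. mp. Qed.
Lemma map_0X : cY0X (kn_coeffs X2) = h (cY0X (kn_coeffs X)). Proof. mp. Qed.
Lemma map_W0 : cWZ0 (kn_coeffs X2) = h (cWZ0 (kn_coeffs X)). Proof. mp. Qed.
Lemma map_Y0 b : cY0F (kn_coeffs X2) b = h (cY0F (kn_coeffs X) b). Proof. destruct b; mp. Qed.
Lemma map_WB b : cW0B (kn_coeffs X2) b = h (cW0B (kn_coeffs X) b). Proof. destruct b; mp. Qed.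
Lemma map_WX b : cW0X (kn_coeffs X2) b = h (cW0X (kn_coeffs X) b). Proof. destruct b; mp. Qed.
Lemma map_wp : cwp (kn_coeffs X2) = h (cwp (kn_coeffs X)). Proof. mp. Qed.
Lemma map_wq : cwq (kn_coeffs X2) = h (cwq (kn_coeffs X)). Proof. mp. Qed.
Lemma map_t1 : ct1 (kn_coeffs X2) = h (ct1 (kn_coeffs X)). Proof. mp. Qed.
Lemma map_V1 : cV1 (kn_coeffs X2) = h (cV1 (kn_coeffs X)). Proof. mp. Qed.
Lemma map_V2 : cV2 (kn_coeffs X2) = h (cV2 (kn_coeffs X)). Proof. mp. Qed.
Lemma map_r1 : cr1 (kn_coeffs X2) = h (cr1 (kn_coeffs X)). Proof. mp. Qed.
Lemma map_r2 : cr2 (kn_coeffs X2) = h (cr2 (kn_coeffs X)). Proof. mp. Qed.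

(** All coefficients are images under [h], hence equal to their own background parts. *)
Lemma kn_coeff_values (T : dual K2) : (forall u, DualNumbers.bg T (h u) = h u) -> coeff_values T X2 (kn_coeffs X2).
Proof.
intros Hb.
constructor; intros; rewrite ?map_4F, ?map_aX, ?map_ZB, ?map_ZF, ?map_aB, ?map_YF, ?map_0B, ?map_Z0, ?map_0X,
  ?map_W0, ?map_Y0, ?map_WB, ?map_WX, ?map_wp, ?map_wq, ?map_t1, ?map_V1, ?map_V2, ?map_r1, ?map_r2, ?Hb.
all: try (first [symmetry; first [apply map_4F | apply map_aX | apply map_ZB | apply map_ZF | apply map_aB | apply map_YF
  | apply map_0B | apply map_Z0 | apply map_0X | apply map_W0 | apply (map_Y0 h1) | apply (map_Y0 h2)
  | apply (map_WB h1) | apply (map_WX h1) | apply map_wp | apply map_wq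
  | apply map_t1 | apply map_V1 | apply map_V2 | apply map_r1 | apply map_r2]]); unfold asd1; reflexivity.
Qed.
End Map.
End CoefficientValues.

(** * Representation of the coupled system *)

Module SystemRepresentation.
Import DifferentialRings FrameGeometry Linearisation SmoothFunctions SmoothRing Representations.
Open Scope R_scope.

Section System.
Context (K : dring) (Rl : reprel K).
Local Notation rep := (rrel Rl).
Local Notation repR := (rrelR Rl).
Context (S : R -> spacetime) (KS : kspacetime K).
Context (Hmet : forall mu nu, repR (fun e x => met (S e) mu nu x) (kmet KS mu nu))
  (Hfr : forall i mu, repR (fun e x => fr (S e) i mu x) (kfr KS i mu))
  (Hem : forall mu nu, repR (fun e x => em (S e) mu nu x) (kem KS mu nu)).
Context (M a Q : R) (k : coeffs) (kk : kcoeffs K).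

Record rep_coeffs : Prop := {
  r_4F : repR (fun _ x => W4F k x) (c4F kk);
  r_aX : repR (fun _ x => WaX k x) (caX kk);
  r_ZB : forall b, repR (fun _ x => ZaB k b x) (cZB kk b);
  r_ZF : forall b, repR (fun _ x => WZaF k b x) (cWZF kk b);
  r_aB : rep (fun _ x => WaB k x) (caB kk);
  r_YF : rep (fun _ x => YaF k x) (cYF kk);
  r_0B : rep (fun _ x => Y0B k x) (cY0B kk);
  r_Z0 : rep (fun _ x => Z0B k x) (cZ0B kk);
  r_0X : rep (fun _ x => Y0X k x) (cY0X kk);
  r_W0 : rep (fun _ x => WZ0F k x) (cWZ0 kk);
  r_Y0 : forall b, rep (fun _ x => Y0F k b x) (cY0F kk b);
  r_WB : forall b, rep (fun _ x => W0B k b x) (cW0B kk b);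
  r_WX : forall b, rep (fun _ x => W0X k b x) (cW0X kk b);
  r_wp : rep (fun _ x => wp a x) (cwp kk);
  r_wq : rep (fun _ x => wq a x) (cwq kk);
  r_t1 : repR (fun _ x => 2 * a * cos (thc x) / q2 a x) (ct1 kk);
  r_V1 : repR (fun _ x => V1 M a Q x) (cV1 kk);
  r_V2 : repR (fun _ x => V2 M a Q x) (cV2 kk);
  r_r1 : rep (fun _ x => 4 * (Q * Q) * (Cconj (q a x) * Cconj (q a x) * Cconj (q a x)) / (qm a x ^ 5)%R)%C (cr1 kk);
  r_r2 : rep (fun _ x => - / 2 * ((q a x * q a x * q a x) / (qm a x ^ 5)%R))%C (cr2 kk)
}.
Context (RC : rep_coeffs).

Let SF := rep_frF K Rl S KS Hmet Hfr Hem.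
Let SB := rep_frB K Rl S KS Hmet Hfr Hem.
Let SX := rep_frX K Rl S KS Hmet Hfr Hem.

Lemma rep_frp b : rep (fun e x => frp a (S e) b x) (kfrp KS kk b).
Proof.
assert (A := rep_cnabla1 K Rl S KS Hmet Hfr 1 qone E3 (fun e => frB (S e)) (kfrB KS) b qiC_nat1 SB).
assert (B := SB b). assert (T1 := rep_trchib K Rl S KS Hmet Hfr). assert (T2 := rep_atrchib K Rl S KS Hmet Hfr).
assert (W := r_wp RC). unfold frp, kfrp. rp.
Qed.
Lemma rep_frqF b c : rep (fun e x => frqF a (S e) b c x) (kfrqF KS kk b c).
Proof.
assert (A := rep_cnabla2 K Rl S KS Hmet Hfr 1 qone E3 (fun e => frF (S e)) (kfrF KS) b c qiC_nat1 SF).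
assert (B := SF b c). assert (T1 := rep_trchib K Rl S KS Hmet Hfr). assert (T2 := rep_atrchib K Rl S KS Hmet Hfr).
assert (W := r_wq RC). unfold frqF, kfrqF. rp.
Qed.
Lemma rep_Lp b : rep (fun e x => Lp a (S e) k b x) (kLp KS kk b).
Proof.
assert (A := fun c : hor => rep_cnabla1 K Rl S KS Hmet Hfr 1 qone c (fun e => frB (S e)) (kfrB KS) b qiC_nat1 SB).
assert (B := rep_cDbardot K Rl S KS Hmet Hfr 1 qone (fun e => frF (S e)) (kfrF KS) b qiC_nat1 SF).
assert (C := rep_dot12 K Rl (fun _ x c => Y0F k c x) (fun e x c d => frF (S e) c d x) _ _ b (r_Y0 RC) SF).
assert (D1 := SB b). assert (D2 := SX b).
assert (P1 := rep_PF K Rl S KS Hfr Hem). assert (P2 := rep_PFc K Rl S KS Hfr Hem).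
assert (W := r_wp RC). assert (R1 := r_ZB RC). assert (R2 := r_YF RC). assert (R3 := r_0B RC).
assert (R4 := r_Z0 RC). assert (R5 := r_0X RC).
unfold Lp, kLp, Csumh, ksumh. cbv zeta. rp.
Qed.
Lemma rep_LqF b c : rep (fun e x => LqF a (S e) k b c x) (kLqF KS kk b c).
Proof.
assert (A := fun i => rep_cnabla2 K Rl S KS Hmet Hfr 1 qone i (fun e => frF (S e)) (kfrF KS) b c qiC_nat1 SF).
assert (B := rep_cDotimes K Rl S KS Hmet Hfr 1 qone (fun e => frB (S e)) (kfrB KS) b c qiC_nat1 SB).
assert (C := rep_cDotimes K Rl S KS Hmet Hfr 2 qtwo (fun e => frX (S e)) (kfrX KS) b c qiC_nat2 SX).
assert (D1 := rep_otimes K Rl (fun _ x d => W0B k d x) (fun e x d => frB (S e) d x) _ _ b c (r_WB RC) SB).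
assert (D2 := rep_otimes K Rl (fun _ x d => W0X k d x) (fun e x d => frX (S e) d x) _ _ b c (r_WX RC) SX).
assert (D3 := SF b c).
assert (W := r_wq RC). assert (R1 := r_4F RC). assert (R2 := r_aX RC). assert (R3 := r_ZF RC).
assert (R4 := r_aB RC). assert (R5 := r_W0 RC).
unfold LqF, kLqF, Csumh, ksumh. rp.
Qed.
Lemma rep_dt mu : repR (fun _ x => dt mu x) (kdt mu).
Proof. unfold dt, kdt. destruct mu; rp. Qed.
Lemma rep_eq1_lhs b : rep (fun e x => eq1_lhs M a Q (S e) b x) (klhs1 KS kk b).
Proof.
assert (A := rep_box1 K Rl S KS Hmet Hfr (fun e => frp a (S e)) _ b rep_frp).
assert (B := rep_nabla1 K Rl S KS Hmet Hfr (fun _ => dt) (fun e => frp a (S e)) _ _ b rep_dt rep_frp).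
assert (P := rep_frp b). assert (R1 := r_t1 RC). assert (R2 := r_V1 RC).
apply rrel_ext with (fun e x => box1 (S e) (frp a (S e)) b x
   - Ci * RtoC (2 * a * cos (thc x) / q2 a x) * nabla1 (S e) dt (frp a (S e)) b x
   - RtoC (V1 M a Q x) * frp a (S e) b x)%C; [reflexivity|].
unfold klhs1.
apply (rrel_sub K Rl (fun e x => box1 (S e) (frp a (S e)) b x
   - Ci * RtoC (2 * a * cos (thc x) / q2 a x) * nabla1 (S e) dt (frp a (S e)) b x)%C).
- apply (rrel_sub K Rl (fun e x => box1 (S e) (frp a (S e)) b x)); [exact A|].
  apply (rrel_mul K Rl (fun e x => Ci * RtoC (2 * a * cos (thc x) / q2 a x))%C); [|exact B].
  apply (rrel_mul K Rl (fun e x => Ci)); [rp|exact R1].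
- apply (rrel_mul K Rl (fun e x => RtoC (V1 M a Q x))); [exact R2|exact P].
Qed.
Lemma rep_eq2_lhs b c : rep (fun e x => eq2_lhs M a Q (S e) b c x) (klhs2 KS kk b c).
Proof.
assert (A := rep_box2 K Rl S KS Hmet Hfr (fun e => frqF a (S e)) _ b c rep_frqF).
assert (B := rep_nabla2 K Rl S KS Hmet Hfr (fun _ => dt) (fun e => frqF a (S e)) _ _ b c rep_dt rep_frqF).
assert (P := rep_frqF b c). assert (R1 := r_t1 RC). assert (R2 := r_V2 RC).
apply rrel_ext with (fun e x => box2 (S e) (frqF a (S e)) b c x
   - Ci * (2 * RtoC (2 * a * cos (thc x) / q2 a x)) * nabla2 (S e) dt (frqF a (S e)) b c x
   - RtoC (V2 M a Q x) * frqF a (S e) b c x)%C.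
{ intros e x. unfold eq2_lhs. do 3 f_equal. f_equal. rewrite <- RtoC_mult. f_equal. unfold Rdiv. ring. }
unfold klhs2.
apply (rrel_sub K Rl (fun e x => box2 (S e) (frqF a (S e)) b c x
   - Ci * (2 * RtoC (2 * a * cos (thc x) / q2 a x)) * nabla2 (S e) dt (frqF a (S e)) b c x)%C).
- apply (rrel_sub K Rl (fun e x => box2 (S e) (frqF a (S e)) b c x)); [exact A|].
  apply (rrel_mul K Rl (fun e x => Ci * (2 * RtoC (2 * a * cos (thc x) / q2 a x)))%C); [|exact B].
  apply (rrel_mul K Rl (fun e x => Ci)); [rp|].
  apply (rrel_mul K Rl (fun e x => RtoC 2)); [rp|exact R1].
- apply (rrel_mul K Rl (fun e x => RtoC (V2 M a Q x))); [exact R2|exact P].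
Qed.
Lemma rep_eq1_rhs b : rep (fun e x => eq1_rhs a Q (S e) k b x) (krhs1 KS kk b).
Proof.
assert (A := rep_cDbardot K Rl S KS Hmet Hfr 0 qzero (fun e => frqF a (S e)) _ b qiC_nat0 rep_frqF).
unfold krhs1.
apply (rrel_add K Rl (fun e x => 4 * (Q * Q) * (Cconj (q a x) * Cconj (q a x) * Cconj (q a x)) / (qm a x ^ 5)%R
     * Dbardot (S e) (frqF a (S e)) b x)%C (fun e x => Lp a (S e) k b x)); [|apply rep_Lp].
apply (rrel_mul K Rl (fun e x => 4 * (Q * Q) * (Cconj (q a x) * Cconj (q a x) * Cconj (q a x)) / (qm a x ^ 5)%R)%C);
  [exact (r_r1 RC)|exact A].
Qed.
Lemma rep_eq2_rhs b c : rep (fun e x => eq2_rhs a (S e) k b c x) (krhs2 KS kk b c).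
Proof.
assert (A := rep_cDotimes K Rl S KS Hmet Hfr 0 qzero (fun e => frp a (S e)) _ b c qiC_nat0 rep_frp).
assert (H : forall d, rep (fun e x => Hf (S e) x d - Hbf (S e) x d)%C (ksub (kH KS d) (kHb KS d))).
{ intros d. apply (rrel_sub K Rl (fun e x => Hf (S e) x d)); [apply (rep_H K Rl S KS Hmet Hfr)|apply (rep_Hb K Rl S KS Hmet Hfr)]. }
assert (B := rep_otimes K Rl (fun e x d => Hf (S e) x d - Hbf (S e) x d)%C (fun e x d => frp a (S e) d x) _ _ b c H rep_frp).
unfold krhs2.
apply (rrel_add K Rl (fun e x => - / 2 * ((q a x * q a x * q a x) / (qm a x ^ 5)%R)
     * (Dotimes (S e) (frp a (S e)) b c x
        - 3 / 2 * otimes (fun d => Hf (S e) x d - Hbf (S e) x d) (fun d => frp a (S e) d x) b c))%C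
   (fun e x => LqF a (S e) k b c x)); [|apply rep_LqF].
apply (rrel_mul K Rl (fun e x => - / 2 * ((q a x * q a x * q a x) / (qm a x ^ 5)%R))%C); [exact (r_r2 RC)|].
apply (rrel_sub K Rl (fun e x => Dotimes (S e) (frp a (S e)) b c x)); [exact A|].
apply (rrel_mul K Rl (fun e x => 3 / 2)%C); [rp|exact B].
Qed.
End System.
End SystemRepresentation.

(** * Values of coefficients and background quantities on the exterior *)

Module ExteriorValues.
Import DifferentialRings FrameGeometry Koszul CurvatureSymmetries FieldEquations Operators Decoupling Coordinates PrincipalFrame DualNumbers BackgroundValues AntiSelfDual Linearisation SmoothFunctions SmoothRing Representations PolynomialFamilies Exterior KerrNewmanData Perturbations CoefficientValues.
Open Scope R_scope.

(* The weight [q^(1/2) qbar^(9/2)] is [|q| qbar^4]. *)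
Section Weight.
Definition cis (t : R) : C := (cos t, sin t).
Lemma cis_add s t : cis (s + t) = (cis s * cis t)%C.
Proof. unfold cis. rewrite cos_plus, sin_plus. apply injective_projections; simpl; ring. Qed.
Lemma Cpow_cis z s : Cpow z s = (Rpower (Cmod z) s * cis (s * Carg z))%C.
Proof. unfold Cpow, cis. apply injective_projections; simpl; ring. Qed.
(** Half-angle formulas: [t = y / (|z| + x)] is the tangent of half the argument, and
    [1 + t^2 = 2 |z| / (|z| + x)]. *)
Lemma Cmod_cis z : 0 < Re z -> z = (Cmod z * cis (Carg z))%C.
Proof.
intros Hr. destruct z as [x y]. cbn [Re fst] in Hr. unfold Carg. cbn [Re Im fst snd].
set (m := Cmod (x, y)).
assert (Hm : 0 < m) by (apply Cmod_gt_0; intros E; apply (f_equal fst) in E; simpl in E; lra).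
assert (E : m * m = x * x + y * y).
{ unfold m, Cmod. cbn [fst snd]. rewrite sqrt_sqrt; [ring|nra]. }
set (t := y / (m + x)).
assert (Ht : 0 < 1 + t²) by (assert (0 <= t²) by apply Rle_0_sqr; lra).
assert (Hc : cos (atan t) * cos (atan t) = / (1 + t²)).
{ rewrite cos_atan. replace (1 / sqrt (1 + t²) * (1 / sqrt (1 + t²))) with (/ (sqrt (1 + t²) * sqrt (1 + t²))).
  - rewrite sqrt_sqrt; lra.
  - field. apply Rgt_not_eq, sqrt_lt_R0, Ht. }
assert (Hs : sin (atan t) = t * cos (atan t)) by (rewrite sin_atan, cos_atan; unfold Rdiv; ring).
assert (K : 1 + t² = 2 * m / (m + x)).
{ unfold t, Rsqr. apply Rmult_eq_reg_r with ((m + x) * (m + x)); [|nra]. field_simplify; [nra|lra..]. }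
rewrite K in Hc.
unfold cis. replace (2 * atan t) with (atan t + atan t) by ring. rewrite cos_plus, sin_plus, Hs.
apply injective_projections; simpl.
- transitivity (m * (1 - t * t) * (cos (atan t) * cos (atan t)) ); [|ring]. rewrite Hc. unfold t.
  apply Rmult_eq_reg_r with ((m + x) * 2); [|lra]. field_simplify; [nra|lra..].
- transitivity (m * 2 * t * (cos (atan t) * cos (atan t)) ); [|ring]. rewrite Hc. unfold t. field; lra.
Qed.
Lemma Cmod_conj_ (z : C) : Cmod (Cconj z) = Cmod z.
Proof. unfold Cmod, Cconj. cbn [fst snd]. f_equal. ring. Qed.
Lemma weight_value z : 0 < Re z -> (Cpow z (1 / 2) * Cpow (Cconj z) (9 / 2))%C = (Cmod z * (Cconj z * Cconj z * Cconj z * Cconj z))%C.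
Proof.
intros Hr. assert (Hm : 0 < Cmod z) by (apply Cmod_gt_0; intros ->; simpl in Hr; lra).
assert (Ea : Carg (Cconj z) = - Carg z).
{ unfold Carg. rewrite Cmod_conj_. destruct z as [x y]. unfold Cconj. cbn [Re Im fst snd].
  replace (- y / (Cmod (x, y) + x)) with (- (y / (Cmod (x, y) + x))) by (unfold Rdiv; ring). rewrite atan_opp. ring. }
assert (Ec := Cmod_cis (Cconj z) Hr). rewrite Ea, Cmod_conj_ in Ec.
rewrite !Cpow_cis, Ea, Cmod_conj_. rewrite Ec at 1 2 3 4.
transitivity (RtoC (Rpower (Cmod z) (1 / 2) * Rpower (Cmod z) (9 / 2)) * (cis (1 / 2 * Carg z) * cis (9 / 2 * - Carg z)))%C.
{ rewrite RtoC_mult. ring. }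
rewrite <- Rpower_plus, <- cis_add.
(* The moduli contribute the exponent [1/2 + 9/2 = 5], the phases [1/2 - 9/2 = -4]; both are
   integers, so the choice of branch disappears. *)
replace (1 / 2 + 9 / 2) with (INR 5) by (simpl; field). rewrite Rpower_pow by exact Hm.
replace (1 / 2 * Carg z + 9 / 2 * - Carg z) with (- Carg z + - Carg z + - Carg z + - Carg z) by field.
rewrite !cis_add. simpl pow. rewrite !RtoC_mult. ring.
Qed.
End Weight.

Section KerrNewman.
Context (M a Q : R) (HM : subextremal M a Q).
Local Notation ext := (exterior M a Q).
Local Notation KE := (smooth_dring ext (ext_open M a Q)).
Local Notation X0 := (kn_ext M a Q HM).
Local Notation N0 := (kn_calc X0).
Local Notation ev := (sev ext).
Local Notation k0 := (kn_coeffs X0).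
Local Notation Dl := (KN_Delta M a Q).

Lemma qiC_Q p : qiC (p, 0%Q) = RtoC (Q2R p).
Proof. now apply qiC_real. Qed.
Ltac sv Hx := repeat rewrite ?(sev_add ext (ext_open M a Q) _ _ _ Hx), ?(sev_mul ext (ext_open M a Q) _ _ _ Hx),
  ?(sev_sub ext (ext_open M a Q) _ _ _ Hx), ?(sev_opp ext (ext_open M a Q) _ _ Hx), ?(sev_kc ext (ext_open M a Q) _ Hx),
  ?(ev_r M a Q HM _ Hx), ?(ev_c M a Q HM _ Hx), ?(ev_s M a Q HM _ Hx), ?(ev_is M a Q HM _ Hx), ?(ev_im M a Q HM _ Hx),
  ?(ev_Dl M a Q HM _ Hx), ?(ev_iDl M a Q HM _ Hx), ?(ev_q M a Q HM _ Hx), ?(ev_qb M a Q HM _ Hx), ?(ev_iq M a Q HM _ Hx), ?(ev_iqb M a Q HM _ Hx),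
  ?(ev_M M a Q HM _ Hx), ?(ev_a M a Q HM _ Hx), ?(ev_Q M a Q HM _ Hx), ?qiC_i, ?qiC_Q.
Ltac svR Hx := sv Hx; repeat rewrite <- ?RtoC_mult, <- ?RtoC_plus, <- ?RtoC_minus, <- ?RtoC_opp.
Ltac q2r := unfold Q2R; simpl.

(** In terms of the background antisymmetric trace of the underlined chi, [cf_W4F] is [-2] times its
    square and [cf_WaX] is minus its square. *)
Definition cf_W4F (x : pt) : R := -8 * Dl x ^ 2 * (a * cos (thc x)) ^ 2 / qm a x ^ 8.
Definition cf_WaX (x : pt) : R := -4 * Dl x ^ 2 * (a * cos (thc x)) ^ 2 / qm a x ^ 8.
Definition cf_Z (b : hor) (x : pt) : R :=
  match b with
  | h1 => 4 * Dl x * (a * sin (thc x)) * rc x * (a * cos (thc x)) / qm a x ^ 7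
  | h2 => -2 * Dl x * (a * sin (thc x)) * (rc x ^ 2 - (a * cos (thc x)) ^ 2) / qm a x ^ 7
  end.
Lemma ev_4F x : ext x -> ev (c4F k0) x = RtoC (cf_W4F x).
Proof.
intros Hx. assert (Pm := qm_pos M a Q HM x Hx). rewrite c4F_real. svR Hx. unfold cf_W4F. f_equal. q2r. field. lra.
Qed.
Lemma ev_aX x : ext x -> ev (caX k0) x = RtoC (cf_WaX x).
Proof.
intros Hx. assert (Pm := qm_pos M a Q HM x Hx). rewrite caX_real. svR Hx. unfold cf_WaX. f_equal. q2r. field. lra.
Qed.
Lemma ev_ZB b x : ext x -> ev (cZB k0 b) x = RtoC (- cf_Z b x).
Proof.
intros Hx. assert (Pm := qm_pos M a Q HM x Hx). rewrite cZB_real. unfold cf_Z. destruct b; svR Hx; f_equal; q2r; field; lra.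
Qed.
Lemma ev_ZF b x : ext x -> ev (cWZF k0 b) x = RtoC (4 * cf_Z b x).
Proof.
intros Hx. assert (Pm := qm_pos M a Q HM x Hx). rewrite cWZF_real. unfold cf_Z. destruct b; svR Hx; f_equal; q2r; field; lra.
Qed.
Lemma ev_t1 x : ext x -> ev (ct1 k0) x = RtoC (2 * a * cos (thc x) / q2 a x).
Proof.
intros Hx. assert (Pm := qm_pos M a Q HM x Hx). rewrite ct1_real, <- (qm_sq M a Q HM x Hx). svR Hx. f_equal. q2r. field. lra.
Qed.
Lemma Vnum_value x : Vnum M a Q x = rc x * rc x * Dl x + (a * sin (thc x) * (a * sin (thc x)) - 2 * (a * cos (thc x)) * (a * cos (thc x))) * rc x * rc x
  - 2 * (a * sin (thc x) * (a * sin (thc x)) + a * cos (thc x) * (a * cos (thc x))) * (a * cos (thc x)) * (a * cos (thc x)).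
Proof.
assert (E : sin (thc x) * sin (thc x) = 1 - cos (thc x) * cos (thc x)).
{ assert (T := sin2_cos2 (thc x)). unfold Rsqr in T. lra. }
unfold Vnum, KN_Delta. cbv zeta. ring [E].
Qed.
Lemma ev_V1 x : ext x -> ev (cV1 k0) x = RtoC (V1 M a Q x).
Proof.
intros Hx. assert (Pm := qm_pos M a Q HM x Hx). rewrite cV1_real. svR Hx. unfold V1. rewrite Vnum_value. f_equal. q2r. field. lra.
Qed.
Lemma ev_V2 x : ext x -> ev (cV2 k0) x = RtoC (V2 M a Q x).
Proof.
intros Hx. assert (Pm := qm_pos M a Q HM x Hx). rewrite cV2_real. svR Hx. unfold V2. rewrite Vnum_value. f_equal. q2r. field. lra.
Qed.
Lemma ev_kim x : ext x -> ev (kim N0) x = RtoC (/ qm a x). Proof. apply (ev_im M a Q HM). Qed.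
Lemma ev_kQ x : ext x -> ev (kQ N0) x = RtoC Q. Proof. apply (ev_Q M a Q HM). Qed.
Lemma qq_qm x : ext x -> (q a x * Cconj (q a x))%C = (RtoC (qm a x) * RtoC (qm a x))%C.
Proof. intros Hx. now rewrite (q_qc M a Q x Hx), <- (qm_sq M a Q HM x Hx), RtoC_mult. Qed.
Lemma ev_wp x : ext x -> ev (cwp k0) x = wp a x.
Proof.
intros Hx. assert (Pm := qm_pos M a Q HM x Hx). unfold wp. rewrite weight_value.
- fold (qm a x). unfold cwp, kn_coeffs. sv Hx. rewrite (ev_kim x Hx), RtoC_inv by lra.
  transitivity (q a x * Cconj (q a x) * (Cconj (q a x) * Cconj (q a x) * Cconj (q a x) * Cconj (q a x)) * / RtoC (qm a x))%C; [ring|].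
  rewrite (qq_qm x Hx). field. intros E. apply RtoC_inj in E. lra.
- destruct (ext_bounds M a Q HM x Hx). cbn. lra.
Qed.
Lemma ev_wq x : ext x -> ev (cwq k0) x = wq a x.
Proof. intros Hx. unfold wq, cwq, kn_coeffs. sv Hx. ring. Qed.
Lemma iq_iqb_qm x : ext x -> (/ q a x * / Cconj (q a x))%C = (/ RtoC (qm a x) * / RtoC (qm a x))%C.
Proof.
intros Hx. assert (Pm := qm_pos M a Q HM x Hx).
assert (RtoC (qm a x) <> 0) by (intros E; apply RtoC_inj in E; lra).
transitivity (/ (q a x * Cconj (q a x)))%C.
- field. split; first [exact (q_neq0 M a Q HM x Hx) | exact (qc_neq0 M a Q HM x Hx)].
- rewrite (qq_qm x Hx). field. assumption.
Qed.
Lemma RtoC_pow5 (r : R) : RtoC (r ^ 5) = (RtoC r * RtoC r * RtoC r * RtoC r * RtoC r)%C.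
Proof. rewrite <- !RtoC_mult. f_equal. ring. Qed.
Lemma ev_r1 x : ext x -> ev (cr1 k0) x
  = (4 * (Q * Q) * (Cconj (q a x) * Cconj (q a x) * Cconj (q a x)) / (qm a x ^ 5)%R)%C.
Proof.
intros Hx. assert (Pm := qm_pos M a Q HM x Hx).
assert (RtoC (qm a x) <> 0) by (intros E; apply RtoC_inj in E; lra).
unfold cr1, kn_coeffs. sv Hx. rewrite (ev_kim x Hx), (ev_kQ x Hx), RtoC_inv, RtoC_pow5 by lra.
replace (Q2R 4) with 4 by (q2r; field).
transitivity (4 * Q * Q * (Cconj (q a x) * Cconj (q a x) * Cconj (q a x)) * / RtoC (qm a x)
  * (/ q a x * / Cconj (q a x)) * (/ q a x * / Cconj (q a x)))%C; [ring|].
rewrite (iq_iqb_qm x Hx). field. assumption.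
Qed.
Lemma ev_r2 x : ext x -> ev (cr2 k0) x = (- / 2 * ((q a x * q a x * q a x) / (qm a x ^ 5)%R))%C.
Proof.
intros Hx. assert (Pm := qm_pos M a Q HM x Hx).
assert (RtoC (qm a x) <> 0) by (intros E; apply RtoC_inj in E; lra).
unfold cr2, kn_coeffs. sv Hx. rewrite (ev_kim x Hx), RtoC_inv, RtoC_pow5 by lra.
replace (Q2R (1#2)) with (/ 2) by (q2r; field). rewrite RtoC_half.
transitivity (- RtoC (/ 2) * (q a x * q a x * q a x) * / RtoC (qm a x)
  * (/ q a x * / Cconj (q a x)) * (/ q a x * / Cconj (q a x)))%C; [ring|].
rewrite (iq_iqb_qm x Hx). field. assumption.
Qed.

Let id_ext : forall x, ext x -> ext x := fun x H => H.
(** The zero variation makes Kerr-Newman itself the member [e = 0] of a represented family, so its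
    traces are read off from the algebraic tables. *)
Let v0 : variation := Variation (fun _ _ _ => 0) (fun _ _ _ => 0) (fun _ _ _ => 0).
Let sm0 (A B : Type) (i : A) (j : B) : smooth_on ext (fun _ => 0) := smooth_cst ext (ext_open M a Q) 0.
Local Notation T := (dual_dual KE).
Local Notation KS0 := (KS M a Q HM ext (ext_open M a Q) id_ext v0 (sm0 coord coord) (sm0 idx coord) (sm0 coord coord)).
Local Notation res0 := (res M a Q ext (ext_open M a Q) id_ext).
Local Notation XD := (X M a Q HM ext (ext_open M a Q) id_ext).
Local Notation Rl := (rep_rel ext (ext_open M a Q)).
Let Hfr0 := Hfr M a Q HM ext (ext_open M a Q) id_ext v0 (sm0 coord coord) (sm0 idx coord) (sm0 coord coord).
Let Hmet0 := Hmet M a Q HM ext (ext_open M a Q) id_ext v0 (sm0 coord coord) (sm0 idx coord) (sm0 coord coord).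

Lemma KN_in0 i j : kinner (bgS T KS0) (kfr (bgS T KS0) i) (kfr (bgS T KS0) j) = kmink i j.
Proof.
assert (E : res0 (kmink i j) = kmink i j) by (unfold kmink; destruct i, j; apply hf_kc).
rewrite <- E. transitivity (DualNumbers.bg T (kinner KS0 (kfr KS0 i) (kfr KS0 j))); [symmetry; apply bg_inner|].
eapply bg_rep; [exact (rep_inner _ Rl _ KS0 Hmet0 (fun e => fr (perturbed M a Q v0 e) i) (fun e => fr (perturbed M a Q v0 e) j) _ _ (Hfr0 i) (Hfr0 j))|].
intros x Hx. cbv beta. rewrite perturbed_0. change (fr (KN M a Q)) with (KN_fr M a Q). rewrite (KN_inner M a Q HM i j x Hx).
unfold mink, kmink. destruct i, j; symmetry; rewrite (sev_kc ext (ext_open M a Q) x Hx), qiC_Q; f_equal; q2r; field.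
Qed.
Lemma KN_fr0 i mu : kfr (bgS T KS0) i mu = xfr XD i mu.
Proof. apply bg_fr. Qed.

Lemma ev_rep F (w : dualize KE) u x : rep ext (ext_open M a Q) F w -> DualNumbers.bg T w = res0 u -> ext x -> F 0 x = ev u x.
Proof.
intros HF Hw Hx. rewrite (rep_zero ext (ext_open M a Q) F w x HF Hx).
change (fst w) with (fst (DualNumbers.bg T w)). rewrite Hw. exact (restriction_in ext ext (ext_open M a Q) (ext_open M a Q) id_ext u x Hx).
Qed.
Let xcop := xco_pd M a Q ext (ext_open M a Q) id_ext.
Add Ring KringDE : (kth (dualize KE)) (morphism (kc_morph (dualize KE)), constants [kcst]).
Add Ring KringE : (kth KE) (morphism (kc_morph KE), constants [kcst]).
Lemma bg_trchi : DualNumbers.bg T (ktrchi KS0) = res0 (kadd (kiq N0) (kiqb N0)).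
Proof.
assert (A := X_0 XD _ KN_fr0 KN_in0 _ xcop). assert (B := Xc_0 XD _ KN_fr0 KN_in0 _ xcop).
transitivity (kmul (kc (1#2, 0%Q)) (kadd (kX (bgS T KS0)) (kXc (bgS T KS0)))).
- unfold ktrchi, ktrh, kchi, ksumh, kX, kXc. rewrite bg_add, !bg_gam. unfold emb. ring.
- rewrite A, B. unfold X. rewrite kiq_map, kiqb_map, hf_add. ring.
Qed.
Lemma bg_trchib : DualNumbers.bg T (ktrchib KS0) = res0 (kmul (kc (-1, 0)%Q) (kmul (kDl N0) (kmul (kmul (kiq N0) (kiqb N0)) (kadd (kiq N0) (kiqb N0))))).
Proof.
assert (A := Xb_0 XD _ KN_fr0 KN_in0 _ xcop). assert (B := Xbc_0 XD _ KN_fr0 KN_in0 _ xcop).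
transitivity (kmul (kc (1#2, 0%Q)) (kadd (kXb (bgS T KS0)) (kXbc (bgS T KS0)))).
- unfold ktrchib, ktrh, kchib, ksumh, kXb, kXbc. rewrite bg_add, !bg_gam. unfold emb. ring.
- rewrite A, B. unfold X. rewrite kiq_map, kiqb_map, kDl_map. rewrite !hf_mul, !hf_add, hf_kc. ring.
Qed.
Lemma bg_atrchib : DualNumbers.bg T (kmul (kc (0, 1)%Q) (katrchib KS0)) = res0 (kmul (kc (1#2, 0%Q)) (ksub (Decoupling.nXbc N0) (Decoupling.nXb N0))).
Proof.
assert (A := Xb_0 XD _ KN_fr0 KN_in0 _ xcop). assert (B := Xbc_0 XD _ KN_fr0 KN_in0 _ xcop).
transitivity (kmul (kc (1#2, 0%Q)) (ksub (kXbc (bgS T KS0)) (kXb (bgS T KS0)))).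
- unfold katrchib, katrh, kchib, ksumh, keps, kXb, kXbc. rewrite bg_mul, bg_kc.
  repeat rewrite ?bg_add, ?bg_mul, ?bg_kc, ?bg_gam. unfold emb. ring.
- rewrite A, B. unfold X. rewrite kiq_map, kiqb_map, kDl_map. unfold Decoupling.nXb, Decoupling.nXbc.
  repeat rewrite ?hf_mul, ?hf_sub, ?hf_opp, ?hf_kc. ring.
Qed.

Lemma iq_sum x : ext x -> (/ q a x + / Cconj (q a x))%C = RtoC (2 * rc x / q2 a x).
Proof.
intros Hx. assert (P := q2_pos M a Q HM x Hx).
transitivity ((q a x + Cconj (q a x)) / (q a x * Cconj (q a x)))%C.
- field. split; first [exact (q_neq0 M a Q HM x Hx) | exact (qc_neq0 M a Q HM x Hx)].
- rewrite (q_qc M a Q x Hx), RtoC_div by lra. f_equal. apply injective_projections; simpl; ring.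
Qed.
Lemma iq_prod x : ext x -> (/ q a x * / Cconj (q a x))%C = RtoC (/ q2 a x).
Proof.
intros Hx. assert (P := q2_pos M a Q HM x Hx). rewrite RtoC_inv, <- (q_qc M a Q x Hx) by lra.
field. split; first [exact (q_neq0 M a Q HM x Hx) | exact (qc_neq0 M a Q HM x Hx)].
Qed.
Lemma KN_trchi x : ext x -> trchi (KN M a Q) x = 2 * rc x / q2 a x.
Proof.
intros Hx. apply RtoC_inj. rewrite <- (iq_sum x Hx).
assert (E := ev_rep _ _ _ x (rep_trchi _ Rl _ KS0 Hmet0 Hfr0) bg_trchi Hx). cbv beta in E. rewrite perturbed_0 in E.
rewrite E. sv Hx. reflexivity.
Qed.
Lemma KN_trchib x : ext x -> trchib (KN M a Q) x = - 2 * Dl x * rc x / q2 a x ^ 2.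
Proof.
intros Hx. assert (P := q2_pos M a Q HM x Hx). apply RtoC_inj.
assert (E := ev_rep _ _ _ x (rep_trchib _ Rl _ KS0 Hmet0 Hfr0) bg_trchib Hx). cbv beta in E. rewrite perturbed_0 in E.
rewrite E. sv Hx. rewrite (iq_sum x Hx), (iq_prod x Hx). change (kDl N0) with (xDl X0). svR Hx. f_equal. q2r. field. lra.
Qed.
Lemma KN_atrchib x : ext x -> (Ci * atrchib (KN M a Q) x)%C = ev (kmul (kc (1#2, 0%Q)) (ksub (Decoupling.nXbc N0) (Decoupling.nXb N0))) x.
Proof.
intros Hx.
assert (A := rep_atrchib _ Rl _ KS0 Hmet0 Hfr0).
assert (B : rrel Rl (fun e x => Ci * atrchib (perturbed M a Q v0 e) x)%C (kmul (kc (0, 1)%Q) (katrchib KS0))).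
{ apply (rrel_mul _ Rl (fun _ _ => Ci)); [apply rrel_kc, qiC_i|exact A]. }
assert (E := ev_rep _ _ _ x B bg_atrchib Hx). cbv beta in E. rewrite perturbed_0 in E. exact E.
Qed.
Lemma ev_aB x : ext x -> ev (caB k0) x = (3 / 4 * Ci * atrchib (KN M a Q) x)%C.
Proof.
intros Hx. transitivity (3 / 4 * (Ci * atrchib (KN M a Q) x))%C; [|ring].
rewrite (KN_atrchib x Hx).
transitivity (ev (kmul (kc (3#4, 0%Q)) (kmul (kc (1#2, 0%Q)) (ksub (Decoupling.nXbc N0) (Decoupling.nXb N0)))) x).
- f_equal. unfold caB, kn_coeffs. ring.
- rewrite (sev_mul ext (ext_open M a Q) _ _ x Hx), (sev_kc ext (ext_open M a Q) x Hx), qiC_Q.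
  f_equal. replace (3 / 4)%C with (RtoC (3 / 4)) by (rewrite RtoC_div by lra; reflexivity). f_equal; q2r; field.
Qed.
Lemma ev_YF x : ext x -> ev (cYF k0) x = (- (3) * Ci * atrchib (KN M a Q) x)%C.
Proof.
intros Hx. transitivity (- (3) * (Ci * atrchib (KN M a Q) x))%C; [|ring].
rewrite (KN_atrchib x Hx).
transitivity (ev (kmul (kc (-3, 0)%Q) (kmul (kc (1#2, 0%Q)) (ksub (Decoupling.nXbc N0) (Decoupling.nXb N0)))) x).
- f_equal. unfold cYF, kn_coeffs. ring.
- rewrite (sev_mul ext (ext_open M a Q) _ _ x Hx), (sev_kc ext (ext_open M a Q) x Hx), qiC_Q.
  f_equal. rewrite <- RtoC_opp. f_equal. q2r. field.
Qed.
End KerrNewman.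
End ExteriorValues.

(** * Potentials and the coupled system *)

Module Conclusion.
Import DifferentialRings FrameGeometry Operators Coordinates PrincipalFrame DualNumbers AntiSelfDual Linearisation SmoothFunctions SmoothRing Representations PolynomialFamilies Exterior KerrNewmanData Perturbations CoefficientValues SystemRepresentation ExteriorValues.
Open Scope R_scope.

Section Potentials.
Context (M a Q : R) (HM : subextremal M a Q).
Local Notation ext := (exterior M a Q).
Local Notation Dl := (KN_Delta M a Q).

Lemma V_split x : ext x ->
  V1 M a Q x = Vnum M a Q x / q2 a x ^ 3 + 5 * Q ^ 2 / q2 a x ^ 2 /\
  V2 M a Q x = 4 * (Vnum M a Q x / q2 a x ^ 3) + 2 * Q ^ 2 / q2 a x ^ 2.
Proof.
intros Hx. assert (Pm := qm_pos M a Q HM x Hx). unfold V1, V2. rewrite <- !(qm_sq M a Q HM x Hx).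
split; field; lra.
Qed.
Lemma rhoF_sq x : ext x -> rhoF (KN M a Q) x ^ 2 = Q ^ 2 * (rc x ^ 2 - a ^ 2 * cos (thc x) ^ 2) ^ 2 / q2 a x ^ 4.
Proof.
intros Hx. assert (P := q2_pos M a Q HM x Hx). destruct (rhoF_value M a Q HM x Hx) as (-> & _).
rewrite (KN_PF_value M a Q HM x Hx). cbn [Re fst]. field. lra.
Qed.

(** The single power of [|a|] comes from [a^2 <= M |a|]. As [|a|] and [|Q|] are at most [r], the
    numerators are bounded by [4 M |a| r^2] and [4 M |a| r^4], and [1 / |q|^2 <= 1 / r^2]. *)
Lemma potential_bounds x : ext x ->
  let A := (1 - 3 * cos (thc x) ^ 2) * a ^ 2 * rc x ^ 2 - 2 * a ^ 4 * cos (thc x) ^ 2 in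
  let B := 4 * Q ^ 2 * rc x ^ 2 * (a ^ 2 * cos (thc x) ^ 2) in
  Rabs (A / q2 a x ^ 3) <= 4 * M * (Rabs a / rc x ^ 4) /\ 0 <= B / q2 a x ^ 4 <= 4 * M * (Rabs a / rc x ^ 4).
Proof.
intros Hx A B. destruct (sub_bounds M a Q HM) as (B1 & B2), (ext_bounds M a Q HM x Hx) as (B3 & _).
set (r := rc x) in *. set (y := cos (thc x) ^ 2) in *.
assert (Hy : 0 <= y <= 1).
{ unfold y. assert (T := COS_bound (thc x)). split; nra. }
assert (Hq : q2 a x = r ^ 2 + a ^ 2 * y) by reflexivity.
assert (0 < r ^ 2) by nra.
assert (Hq2 : r ^ 2 <= q2 a x) by nra.
set (s := / q2 a x). set (w := / r ^ 2).
assert (Hs : 0 < s <= w).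
{ split; [apply Rinv_0_lt_compat; lra|]. apply Rinv_le_contravar; lra. }
assert (Ew : r ^ 2 * w = 1) by (unfold w; field; nra).
assert (Ha : Rabs a <= M /\ a ^ 2 = Rabs a * Rabs a).
{ rewrite <- (pow2_abs a). split; [|ring]. assert (0 <= Rabs a) by apply Rabs_pos. rewrite <- (pow2_abs a) in B2. nra. }
destruct Ha as (Ha1 & Ha2). assert (Ha0 : 0 <= Rabs a) by apply Rabs_pos.
set (b := Rabs a) in *.
assert (Hb : a ^ 2 <= M * b) by (rewrite Ha2; nra).
assert (Hb2 : a ^ 2 <= r ^ 2) by nra. assert (HQ : Q ^ 2 <= r ^ 2) by nra.
assert (0 <= a ^ 2) by nra. assert (0 <= Q ^ 2) by nra.
assert (s3 : 0 < s ^ 3 <= w ^ 3) by (split; [apply pow_lt; lra|apply pow_incr; lra]).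
assert (s4 : 0 < s ^ 4 <= w ^ 4) by (split; [apply pow_lt; lra|apply pow_incr; lra]).
assert (w2 : 0 < w ^ 2) by (apply pow_lt; lra).
assert (Er : b / r ^ 4 = b * w ^ 2) by (unfold w; field; nra).
assert (Mb : 0 <= M * b) by nra.
rewrite Er. split; [|split].
- replace (A / q2 a x ^ 3) with (A * s ^ 3) by (unfold s; field; lra).
  assert (HA : Rabs A <= 4 * (M * b) * r ^ 2).
  { unfold A. replace (a ^ 4) with (a ^ 2 * a ^ 2) by ring.
    assert (0 <= a ^ 2 * r ^ 2) by nra. assert (a ^ 2 * a ^ 2 <= a ^ 2 * r ^ 2) by nra.
    assert (0 <= a ^ 2 * a ^ 2) by nra. assert (a ^ 2 * r ^ 2 <= M * b * r ^ 2) by nra.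
    apply Rabs_le. split; nra. }
  rewrite Rabs_mult, (Rabs_pos_eq (s ^ 3)) by lra.
  apply Rle_trans with (4 * (M * b) * r ^ 2 * w ^ 3).
  + apply Rmult_le_compat; [apply Rabs_pos|lra|exact HA|lra].
  + right. replace (w ^ 3) with (w * w ^ 2) by ring.
    transitivity (4 * (M * b) * (r ^ 2 * w) * w ^ 2); [ring|]. rewrite Ew. ring.
- assert (0 <= a ^ 2 * y) by nra. apply Rmult_le_pos; [unfold B; assert (0 <= Q ^ 2 * r ^ 2) by nra; nra|].
  apply Rlt_le, Rinv_0_lt_compat, pow_lt. lra.
- replace (B / q2 a x ^ 4) with (B * s ^ 4) by (unfold s; field; lra).
  assert (HB : 0 <= B <= 4 * (M * b) * (r ^ 2 * r ^ 2)).
  { unfold B. assert (0 <= a ^ 2 * y) by nra. assert (a ^ 2 * y <= M * b) by nra.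
    assert (0 <= Q ^ 2 * r ^ 2) by nra. assert (Q ^ 2 * r ^ 2 <= r ^ 2 * r ^ 2) by nra. split; [nra|].
    apply Rle_trans with (4 * (r ^ 2 * r ^ 2) * (a ^ 2 * y)); [nra|].
    assert (0 <= r ^ 2 * r ^ 2) by nra. nra. }
  apply Rle_trans with (4 * (M * b) * (r ^ 2 * r ^ 2) * w ^ 4).
  + apply Rmult_le_compat; lra.
  + right. transitivity (4 * (M * b) * (r ^ 2 * w) * (r ^ 2 * w) * w ^ 2); [ring|]. rewrite Ew. ring.
Qed.

(** Both errors combine the two quantities of [potential_bounds], as [p + 5 z] and [4 p + 2 z];
    since each is at most [4 M |a| / r^4], the constant is [24 M] in both cases. *)
Lemma potential_expansion x : ext x ->
  Rabs (V1 M a Q x - (- (1 / 4) * trchi (KN M a Q) x * trchib (KN M a Q) x + 5 * rhoF (KN M a Q) x ^ 2))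
    <= 24 * M * (Rabs a / rc x ^ 4) /\
  Rabs (V2 M a Q x - (- trchi (KN M a Q) x * trchib (KN M a Q) x + 2 * rhoF (KN M a Q) x ^ 2))
    <= 24 * M * (Rabs a / rc x ^ 4).
Proof.
intros Hx. assert (P := q2_pos M a Q HM x Hx). destruct (V_split x Hx) as (-> & ->).
rewrite (rhoF_sq x Hx), (KN_trchi M a Q HM x Hx), (KN_trchib M a Q HM x Hx).
destruct (potential_bounds x Hx) as (HA & HB). cbv zeta in HA, HB.
set (A := (1 - 3 * cos (thc x) ^ 2) * a ^ 2 * rc x ^ 2 - 2 * a ^ 4 * cos (thc x) ^ 2) in *.
set (B := 4 * Q ^ 2 * rc x ^ 2 * (a ^ 2 * cos (thc x) ^ 2)) in *.
(* [r^2 Delta / |q|^6] is exactly the product of traces in the expansion, and [B] is the defect of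
   [rho_F^2] from [Q^2 / |q|^4]. *)
assert (E1 : Vnum M a Q x = rc x ^ 2 * Dl x + A) by (unfold A, Vnum, KN_Delta; cbv zeta; ring).
assert (E2 : Q ^ 2 * (rc x ^ 2 - a ^ 2 * cos (thc x) ^ 2) ^ 2 = Q ^ 2 * q2 a x ^ 2 - B) by (unfold B, q2; ring).
rewrite E1, E2.
set (p := A / q2 a x ^ 3) in *. set (z := B / q2 a x ^ 4) in *.
match goal with |- Rabs ?l <= _ /\ Rabs ?m <= _ =>
  replace l with (p + 5 * z) by (unfold p, z; field; lra); replace m with (4 * p + 2 * z) by (unfold p, z; field; lra) end.
apply Rabs_le_between in HA. split; apply Rabs_le; lra.
Qed.

Lemma cos_sq_lt x : ext x -> 0 <= cos (thc x) ^ 2 < 1.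
Proof.
intros Hx. destruct (ext_bounds M a Q HM x Hx) as (_ & _ & S). assert (T := sin2_cos2 (thc x)). unfold Rsqr in T. nra.
Qed.
(* The numerator is affine in [cos^2 < 1]: it suffices to test it at [0] and [1]. *)
Lemma potential_positive (c d : R) x : ext x -> 0 < c -> 0 <= d ->
  2 * a ^ 2 * (rc x ^ 2 + a ^ 2) <= rc x ^ 2 * Dl x + d * (rc x ^ 2 + a ^ 2) ->
  0 < c * (Vnum M a Q x / q2 a x ^ 3) + c * d / q2 a x ^ 2.
Proof.
intros Hx Hc Hd H. assert (P := q2_pos M a Q HM x Hx). destruct (ext_bounds M a Q HM x Hx) as (B1 & B2 & _).
assert (Hy := cos_sq_lt x Hx).
replace (c * (Vnum M a Q x / q2 a x ^ 3) + c * d / q2 a x ^ 2) with (c * (Vnum M a Q x + d * q2 a x) * (/ q2 a x) ^ 3)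
  by (field; lra).
apply Rmult_lt_0_compat; [|apply pow_lt, Rinv_0_lt_compat, P]. apply Rmult_lt_0_compat; [exact Hc|].
set (y := cos (thc x) ^ 2) in *.
replace (Vnum M a Q x + d * q2 a x) with ((1 - y) * (rc x ^ 2 * Dl x + a ^ 2 * rc x ^ 2 + d * rc x ^ 2)
  + y * (rc x ^ 2 * Dl x + d * (rc x ^ 2 + a ^ 2) - 2 * a ^ 2 * (rc x ^ 2 + a ^ 2)))
  by (unfold y, Vnum, KN_Delta, q2; cbv zeta; ring).
assert (0 < rc x ^ 2) by nra. assert (0 <= a ^ 2) by nra.
assert (0 < rc x ^ 2 * Dl x) by nra. assert (0 <= a ^ 2 * rc x ^ 2) by nra. assert (0 <= d * rc x ^ 2) by nra. nra.
Qed.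
Lemma V1_positive x : ext x ->
  2 * a ^ 2 * (rc x ^ 2 + a ^ 2) <= rc x ^ 2 * Dl x + 5 * Q ^ 2 * (rc x ^ 2 + a ^ 2) -> 0 < V1 M a Q x.
Proof.
intros Hx H. destruct (V_split x Hx) as (-> & _).
replace (Vnum M a Q x / q2 a x ^ 3 + 5 * Q ^ 2 / q2 a x ^ 2)
  with (1 * (Vnum M a Q x / q2 a x ^ 3) + 1 * (5 * Q ^ 2) / q2 a x ^ 2) by (f_equal; [ring|f_equal; ring]).
apply potential_positive; [exact Hx|lra|nra|exact H].
Qed.
Lemma V2_positive x : ext x ->
  2 * a ^ 2 * (rc x ^ 2 + a ^ 2) <= rc x ^ 2 * Dl x + Q ^ 2 / 2 * (rc x ^ 2 + a ^ 2) -> 0 < V2 M a Q x.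
Proof.
intros Hx H. destruct (V_split x Hx) as (_ & ->).
replace (2 * Q ^ 2) with (4 * (Q ^ 2 / 2)) by field.
apply potential_positive; [exact Hx|lra|nra|exact H].
Qed.
End Potentials.

Section Equations.
Context (M a Q : R) (HM : subextremal M a Q).
Local Notation ext := (exterior M a Q).
Local Notation KE := (smooth_dring ext (ext_open M a Q)).
Local Notation X0 := (kn_ext M a Q HM).
Local Notation ev := (sev ext).
Local Notation k0 := (kn_coeffs X0).

(** Coefficients required to be real are explicit real functions; the complex ones are evaluations
    of ring elements, which makes them smooth by construction. *)
Definition kerr_newman_coeffs : coeffs := {|
  W4F := cf_W4F M a Q; WaX := cf_WaX M a Q;
  ZaB := fun b x => - cf_Z M a Q b x; WZaF := fun b x => 4 * cf_Z M a Q b x;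
  WaB := ev (caB k0); YaF := ev (cYF k0); Y0B := ev (cY0B k0); Z0B := ev (cZ0B k0);
  Y0X := ev (cY0X k0); WZ0F := ev (cWZ0 k0); Y0F := fun b => ev (cY0F k0 b);
  W0B := fun b => ev (cW0B k0 b); W0X := fun b => ev (cW0X k0 b) |}.
Local Notation k := kerr_newman_coeffs.

Lemma smooth_real f (u : KE) : (forall x, ext x -> ev u x = RtoC (f x)) -> smooth_on ext f.
Proof.
intros E. apply (smooth_ext ext (ext_open M a Q)) with (2 := proj1 (sev_smooth ext u)).
intros x Hx. now rewrite E.
Qed.
Lemma kn_smooth_coeffs : smooth_coeffs M a Q k.
Proof.
unfold smooth_coeffs; cbn [W4F WaX ZaB WZaF WaB YaF Y0B Z0B Y0X WZ0F Y0F W0B W0X kerr_newman_coeffs].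
split; [exact (smooth_real _ _ (ev_4F M a Q HM))|].
split; [exact (smooth_real _ _ (ev_aX M a Q HM))|].
split; [intros b; split; [exact (smooth_real _ _ (ev_ZB M a Q HM b))|exact (smooth_real _ _ (ev_ZF M a Q HM b))]|].
do 6 (split; [exact (sev_smooth ext _)|]).
intros b. split; [exact (sev_smooth ext _)|]. split; exact (sev_smooth ext _).
Qed.
Lemma ev_0 x : ext x -> ev (kc (0%Q, 0%Q) : KE) x = 0.
Proof. intros Hx. rewrite (sev_kc ext (ext_open M a Q) x Hx). apply qiC_nat0. Qed.
Lemma kn_vanishing : a = 0 -> vanishing_coeffs M a Q k.
Proof.
intros Ea x Hx. assert (E := ev_0 x Hx).
assert (Ha : xa X0 = kc (0%Q, 0%Q)).
{ change (xa X0) with (cst (RtoC a) : KE). unfold kc. now rewrite qiC_nat0, Ea. }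
assert (Z := fun b => eq_trans (eq_sym (ev_ZB M a Q HM b x Hx)) (eq_trans (f_equal (fun u => ev u x) (static_ZB X0 Ha b)) E)).
assert (Z' := fun b => eq_trans (eq_sym (ev_ZF M a Q HM b x Hx)) (eq_trans (f_equal (fun u => ev u x) (static_ZF X0 Ha b)) E)).
cbn [W4F WaX ZaB WZaF WaB YaF Y0B Z0B Y0X WZ0F Y0F W0B W0X kerr_newman_coeffs].
rewrite (static_aB X0 Ha), (static_YF X0 Ha), (static_Z0 X0 Ha), (static_0X X0 Ha), (static_W0 X0 Ha).
change (cY0B k0) with (kc (0%Q, 0%Q) : KE).
repeat split; try exact E.
- apply RtoC_inj. rewrite <- (ev_4F M a Q HM x Hx), (static_4F X0 Ha). exact E.
- apply RtoC_inj. rewrite <- (ev_aX M a Q HM x Hx), (static_aX X0 Ha). exact E.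
- apply RtoC_inj. exact (Z b).
- apply RtoC_inj. exact (Z' b).
- rewrite (static_Y0 X0 Ha b). exact E.
- rewrite (static_WB X0 Ha b). exact E.
- rewrite (static_WX X0 Ha b). exact E.
Qed.

Context (U : pt -> Prop) (HU : open_pt U) (UE : forall x, U x -> ext x) (v : variation)
  (LP : linear_perturbation M a Q U v).
Local Notation SK := (smooth_dring U HU).
Local Notation DK := (dualize SK).
Local Notation S := (perturbed M a Q v).
Local Notation Rl := (rep_rel U HU).
Local Notation res := (res M a Q U HU UE).
Local Notation XD := (X M a Q HM U HU UE).
Local Notation kk := (kn_coeffs XD).
Let Smet := proj1 LP.
Let Sfr := proj1 (proj2 LP).
Let Sem := proj1 (proj2 (proj2 LP)).
Let LPx := proj2 (proj2 (proj2 LP)).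
Local Notation KSv := (KS M a Q HM U HU UE v Smet Sfr Sem).
Let KP : kn_perturbation (dual_dual SK) XD KSv := perturbation M a Q HM U HU UE v Smet Sfr Sem LPx.
Let V : coeff_values (dual_dual SK) XD kk := kn_coeff_values res X0 (dual_dual SK) (bg_res M a Q U HU UE).

Lemma rep_res F u w : w = res u -> (forall x, ext x -> ev u x = F x) -> rep U HU (fun _ x => F x) w.
Proof.
intros -> E. apply (rep_ext U HU (fun _ x => sev U (restriction ext U (ext_open M a Q) HU UE u) x)).
- intros _ x Hx. rewrite (restriction_in ext U (ext_open M a Q) HU UE u x Hx). auto.
- exists (fun _ _ => 0). split; [exact (pol_smooth U _ (Csmooth_cst U HU 0))|]. intros e x Hx.
  change (fst (res u)) with (restriction ext U (ext_open M a Q) HU UE u). change (snd (res u)) with (cst 0 : SK).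
  rewrite (sev_cst U HU x Hx). ring.
Qed.
Lemma kn_rep_coeffs : rep_coeffs DK Rl M a Q k kk.
Proof.
constructor.
- exact (rep_res _ _ _ (map_4F res X0) (ev_4F M a Q HM)).
- exact (rep_res _ _ _ (map_aX res X0) (ev_aX M a Q HM)).
- intros b. exact (rep_res _ _ _ (map_ZB res X0 b) (ev_ZB M a Q HM b)).
- intros b. exact (rep_res _ _ _ (map_ZF res X0 b) (ev_ZF M a Q HM b)).
- exact (rep_res _ _ _ (map_aB res X0) (fun x _ => eq_refl)).
- exact (rep_res _ _ _ (map_YF res X0) (fun x _ => eq_refl)).
- exact (rep_res _ _ _ (map_0B res X0) (fun x _ => eq_refl)).
- exact (rep_res _ _ _ (map_Z0 res X0) (fun x _ => eq_refl)).
- exact (rep_res _ _ _ (map_0X res X0) (fun x _ => eq_refl)).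
- exact (rep_res _ _ _ (map_W0 res X0) (fun x _ => eq_refl)).
- intros b. exact (rep_res _ _ _ (map_Y0 res X0 b) (fun x _ => eq_refl)).
- intros b. exact (rep_res _ _ _ (map_WB res X0 b) (fun x _ => eq_refl)).
- intros b. exact (rep_res _ _ _ (map_WX res X0 b) (fun x _ => eq_refl)).
- exact (rep_res _ _ _ (map_wp res X0) (ev_wp M a Q HM)).
- exact (rep_res _ _ _ (map_wq res X0) (ev_wq M a Q HM)).
- exact (rep_res _ _ _ (map_t1 res X0) (ev_t1 M a Q HM)).
- exact (rep_res _ _ _ (map_V1 res X0) (ev_V1 M a Q HM)).
- exact (rep_res _ _ _ (map_V2 res X0) (ev_V2 M a Q HM)).
- exact (rep_res _ _ _ (map_r1 res X0) (ev_r1 M a Q HM)).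
- exact (rep_res _ _ _ (map_r2 res X0) (ev_r2 M a Q HM)).
Qed.
Let RC := kn_rep_coeffs.
Let Hm := Hmet M a Q HM U HU UE v Smet Sfr Sem.
Let Hf := Hfr M a Q HM U HU UE v Smet Sfr Sem.
Let He := Hem M a Q HM U HU UE v Smet Sfr Sem.

(** By [system_1] both sides are represented by the same dual number. *)
Lemma equation_1 b x : U x -> lin_eq (fun e => eq1_lhs M a Q (S e) b x) (fun e => eq1_rhs a Q (S e) k b x).
Proof.
apply (rep_lin_eq U HU (fun e => eq1_lhs M a Q (S e) b) (fun e => eq1_rhs a Q (S e) k b) (klhs1 KSv kk b)).
- exact (rep_eq1_lhs DK Rl S KSv Hm Hf He M a Q k kk RC b).
- rewrite (system_1 _ _ _ KP _ V). exact (rep_eq1_rhs DK Rl S KSv Hm Hf He M a Q k kk RC b).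
Qed.
Lemma equation_2 b c x : U x -> lin_eq (fun e => eq2_lhs M a Q (S e) b c x) (fun e => eq2_rhs a (S e) k b c x).
Proof.
apply (rep_lin_eq U HU (fun e => eq2_lhs M a Q (S e) b c) (fun e => eq2_rhs a (S e) k b c) (klhs2 KSv kk b c)).
- exact (rep_eq2_lhs DK Rl S KSv Hm Hf He M a Q k kk RC b c).
- rewrite (system_2 _ _ _ KP _ V). exact (rep_eq2_rhs DK Rl S KSv Hm Hf He M a Q k kk RC b c).
Qed.

(** The transformed quantities lie in [s_1(C)] and [s_2(C)] only modulo [e^2]; their first-order
    truncations satisfy the algebraic relations for every [e] and serve as witnesses. *)
Definition affine_part (w : DK) (x : pt) (e : R) : C := (sev U (fst w) x + e * sev U (snd w) x)%C.
Lemma rep_affine_part F w x : rep U HU F w -> U x -> lin_eq (fun e => F e x) (fun e => affine_part w x e).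
Proof.
intros H Hx. apply (rep_lin_eq U HU F (fun e y => affine_part w y e) w); [exact H| |exact Hx].
exists (fun _ _ => 0). split; [exact (pol_smooth U _ (Csmooth_cst U HU 0))|]. intros e y Hy. unfold affine_part. ring.
Qed.
Lemma affine_rotation (u w : DK) x e : U x -> w = (- kc (0%Q, 1%Q) * u)%D ->
  affine_part w x e = (- Ci * affine_part u x e)%C.
Proof.
intros Hx ->. unfold affine_part.
change (fst (- kc (0%Q, 1%Q) * u)%D) with (- kc (0%Q, 1%Q) * fst u)%D.
change (snd (- kc (0%Q, 1%Q) * u)%D) with ((- kc (0%Q, 1%Q)) * snd u + (- cst 0) * fst u)%D.
rewrite (sev_add U HU _ _ x Hx), !(sev_mul U HU _ _ x Hx), !(sev_opp U HU _ x Hx), (sev_kc U HU x Hx), (sev_cst U HU x Hx), qiC_i. ring.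
Qed.
Lemma affine_opp (u w : DK) x e : U x -> w = (- u)%D -> affine_part w x e = (- affine_part u x e)%C.
Proof.
intros Hx ->. unfold affine_part.
change (fst (- u)%D) with (- fst u)%D. change (snd (- u)%D) with (- snd u)%D.
rewrite !(sev_opp U HU _ x Hx). ring.
Qed.
Lemma frp_in_s1 x : U x -> exists G : R -> hor -> C, (forall e, in_s1 (G e)) /\
  forall b, lin_eq (fun e => frp a (S e) b x) (fun e => G e b).
Proof.
intros Hx. exists (fun e b => affine_part (kfrp KSv kk b) x e). split.
(* A form [f + i *f] has [f] as its real part. *)
- intros e. exists (fun b => Re (affine_part (kfrp KSv kk b) x e)).
  assert (E := affine_rotation _ _ x e Hx (frp_asd _ _ _ KP kk)).
  intros b. unfold cplx1, dual1, sumh, eps.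
  destruct b; rewrite E; destruct (affine_part (kfrp KSv kk h1) x e) as [p q]; apply injective_projections; simpl; ring.
- intros b. apply (rep_affine_part (fun e => frp a (S e) b)); [|exact Hx].
  exact (rep_frp DK Rl S KSv Hm Hf He M a Q k kk RC b).
Qed.
Lemma frqF_in_s2 x : U x -> exists G : R -> hor -> hor -> C, (forall e, in_s2 (G e)) /\
  forall b c, lin_eq (fun e => frqF a (S e) b c x) (fun e => G e b c).
Proof.
intros Hx. exists (fun e b c => affine_part (kfrqF KSv kk b c) x e). split.
- intros e. exists (fun b c => Re (affine_part (kfrqF KSv kk b c) x e)).
  destruct (frq_asd _ _ _ KP kk) as (A1 & A2 & A3).
  assert (E1 := affine_rotation _ _ x e Hx A1). assert (E2 := affine_rotation _ _ x e Hx A2).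
  assert (E3 := affine_opp _ _ x e Hx A3).
  rewrite E1, E2, E3. split; [reflexivity|]. split.
  + destruct (affine_part (kfrqF KSv kk h1 h1) x e) as [p q]. simpl. ring.
  + intros b c. unfold cplx2, dual2, sumh, eps.
    destruct b, c; rewrite ?E1, ?E2, ?E3; destruct (affine_part (kfrqF KSv kk h1 h1) x e) as [p q];
      apply injective_projections; simpl; ring.
- intros b c. apply (rep_affine_part (fun e => frqF a (S e) b c)); [|exact Hx].
  exact (rep_frqF DK Rl S KSv Hm Hf He M a Q k kk RC b c).
Qed.
End Equations.
End Conclusion.

Import Exterior ExteriorValues Conclusion.

Theorem theorem7p3 (M : R) :
  (* (i) *)
  (exists K : R, forall (a Q : R) (x : pt),
     subextremal M a Q -> exterior M a Q x ->
     Rabs (V1 M a Q x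
           - (- (1 / 4) * trchi (KN M a Q) x * trchib (KN M a Q) x
              + 5 * rhoF (KN M a Q) x ^ 2)) <= K * (Rabs a / rc x ^ 4) /\
     Rabs (V2 M a Q x
           - (- trchi (KN M a Q) x * trchib (KN M a Q) x
              + 2 * rhoF (KN M a Q) x ^ 2)) <= K * (Rabs a / rc x ^ 4)) /\
  forall a Q : R, subextremal M a Q ->
  (* Positivity: each bound is the exact condition on [r] for the potential to be
     positive for all [theta]; it always holds if [a = 0] or [r] is large. *)
  (forall x : pt, exterior M a Q x ->
     (2 * a ^ 2 * (rc x ^ 2 + a ^ 2)
        <= rc x ^ 2 * KN_Delta M a Q x + 5 * Q ^ 2 * (rc x ^ 2 + a ^ 2) ->
      0 < V1 M a Q x) /\
     (2 * a ^ 2 * (rc x ^ 2 + a ^ 2)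
        <= rc x ^ 2 * KN_Delta M a Q x + Q ^ 2 / 2 * (rc x ^ 2 + a ^ 2) ->
      0 < V2 M a Q x)) /\
  (* (ii) *)
  exists k : coeffs,
    smooth_coeffs M a Q k /\
    (forall x : pt, exterior M a Q x ->
       WaB k x = (3 / 4 * Ci * atrchib (KN M a Q) x)%C /\
       YaF k x = (- (3) * Ci * atrchib (KN M a Q) x)%C) /\
    (a = 0 -> vanishing_coeffs M a Q k) /\
    forall (U : pt -> Prop) (v : variation),
      open_pt U -> (forall x, U x -> exterior M a Q x) ->
      linear_perturbation M a Q U v ->
      forall x : pt, U x ->
      (* the two transformed quantities lie in s_1(C) and s_2(C) *)
      (exists G : R -> hor -> C, (forall e, in_s1 (G e)) /\
         forall b, lin_eq (fun e => frp a (perturbed M a Q v e) b x)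
                          (fun e => G e b)) /\
      (exists G : R -> hor -> hor -> C, (forall e, in_s2 (G e)) /\
         forall b c, lin_eq (fun e => frqF a (perturbed M a Q v e) b c x)
                            (fun e => G e b c)) /\
      (* the coupled system *)
      (forall b, lin_eq (fun e => eq1_lhs M a Q (perturbed M a Q v e) b x)
                        (fun e => eq1_rhs a Q (perturbed M a Q v e) k b x)) /\
      (forall b c, lin_eq (fun e => eq2_lhs M a Q (perturbed M a Q v e) b c x)
                          (fun e => eq2_rhs a (perturbed M a Q v e) k b c x)).
Proof.
(* The constant depends on the mass alone, uniformly in [a] and [Q]. *)
split; [exists (24 * M); intros a Q x HM Hx; exact (potential_expansion M a Q HM x Hx)|].
intros a Q HM. split.
- intros x Hx. split; [apply V1_positive|apply V2_positive]; assumption.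
- exists (kerr_newman_coeffs M a Q HM). split; [apply kn_smooth_coeffs|]. split.
  { intros x Hx. split; [exact (ev_aB M a Q HM x Hx)|exact (ev_YF M a Q HM x Hx)]. }
  split; [apply kn_vanishing|].
  intros U v HU UE LP x Hx. repeat split.
  + exact (frp_in_s1 M a Q HM U HU UE v LP x Hx).
  + exact (frqF_in_s2 M a Q HM U HU UE v LP x Hx).
  + intros b. exact (equation_1 M a Q HM U HU UE v LP b x Hx).
  + intros b c. exact (equation_2 M a Q HM U HU UE v LP b c x Hx).
Qed.
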